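(* Let $n=2$ and let $B_r\subset\subset\Omega$. Let $x_0\in\Omega$ and $u:\Omega\to\mathbb R$, with $x_0$ a singular free boundary point of $u$ (i.e. $x_0\in\partial\{u>0\}$ and $\nabla u(x_0)=0$). Assume that either $u$ is a minimizer of $J$ with $\partial\{u>0\}$ not $\delta$-rank-2 flat at $x_0$ at any level, for some $\delta>0$, or that $u$ is a one-phase minimizer of $J$ with $u\in C^{1,1}(\Omega)$ and such that $\partial\{u>0\}$ has null Lebesgue measure. Then every blow-up limit of $u$ at $x_0$ is either a homogeneous function of degree two, or it is identically zero.
   Context: $\Omega\subset\mathbb R^n$ is a smooth bounded domain and $u_0\in W^{2,2}(\Omega)$ is given. $J[u]:=\int_\Omega\big(|\Delta u|^2+\chi_{\{u>0\}}\big)$ and $\mathcal A:=\{u\in W^{2,2}(\Omega): u-u_0\in W^{1,2}_0(\Omega)\}$. A minimizer of $J$ is $u\in\mathcal A$ with $J[u]\le J[v]$ for all $v\in\mathcal A$; a one-phase minimizer is $u\in\mathcal A$ with $u\ge0$ and $J[u]\le J[v]$ for all $v\in\mathcal A$ with $v\ge0$ in $\Omega$. Minimizers are (represented by) $C^{1,\alpha}_{\rm loc}(\Omega)$ functions for every $\alpha\in(0,1)$. A blow-up sequence of $u$ at $x_0\in\partial\{u>0\}$ is $u_k(x):=\rho_k^{-2}u(x_0+\rho_kx)$ with $\rho_k\to0^+$; a blow-up limit of $u$ at $x_0$ is a limit (locally uniform on $\mathbb R^n$) of a subsequence of such a sequence. For $A,B\subset\mathbb R^n$, ${\rm HD}(A,B):=\max\{\sup_{a\in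 A}{\rm dist}(a,B),\sup_{b\in B}{\rm dist}(b,A)\}$. $P_2$ is the set of all polynomials $p(x)=\sum_{i,j=1}^n a_{ij}x_ix_j$, with $(a_{ij})$ symmetric, such that $\|p\|_{L^\infty(B_1)}=1$. For $p\in P_2$, $S(p,x_0):=\{x\in\mathbb R^n: p(x-x_0)=0\}$. For $x_0\in\partial\{u>0\}$ and $r>0$, $h(r,x_0):=\inf_{p\in P_2}{\rm HD}\big(\partial\{u>0\}\cap B_r(x_0),\,S(p,x_0)\cap B_r(x_0)\big)$; $\partial\{u>0\}$ is $\delta$-rank-2 flat at level $r$ at $x_0$ if $h(r,x_0)<\delta r$. *)

(* Defs.v *)
From HB Require Import structures.
From mathcomp Require Import all_boot all_order all_algebra.
From mathcomp Require Import all_classical all_reals all_analysis.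

Set Implicit Arguments.
Unset Strict Implicit.
Unset Printing Implicit Defensive.

Import Order.TTheory GRing.Theory Num.Theory.
Import numFieldNormedType.Exports.

Local Open Scope classical_set_scope.
Local Open Scope ring_scope.

(* The factors are R with its Borel sigma-algebra; as a normed module this is
   R * R, whose library norm is the sup norm.  Every metric notion below uses
   the Euclidean norm [enorm] instead. *)
Notation plane R := (measurableTypeR R * measurableTypeR R)%type.

Section Plane.
Variable R : realType.
Implicit Types (x y e : plane R) (A B : set (plane R)) (f g : plane R -> R).

Definition mu2 : {measure set (plane R) -> \bar R} :=
  (@lebesgue_measure R \x @lebesgue_measure R)%E.

Definition coord2 (i : 'I_2) x : R := if i == ord0 then x.1 else x.2.

Definition basis2 (i : 'I_2) : plane R := if i == ord0 then (1, 0) else (0, 1).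

Definition dot x y : R := \sum_(i < 2) coord2 i x * coord2 i y.

Definition enorm x : R := Num.sqrt (dot x x).

Definition eball x (r : R) : set (plane R) := [set y | enorm (y - x) < r].

Definition boundary A : set (plane R) := closure A `\` interior A.

Definition dist_to x A : \bar R := ereal_inf [set (enorm (x - y))%:E | y in A].

Definition HD A B : \bar R :=
  maxe (ereal_sup [set dist_to a B | a in A]) (ereal_sup [set dist_to b A | b in B]).

(* Iterated partial derivatives are indexed by words in {0, 1}: the word
   [:: i; j] stands for d_i d_j and the empty word for the function itself. *)
Definition partials (s : seq 'I_2) f : plane R -> R :=
  foldr (fun i g => 'D_(basis2 i) g) f s.

Definition smooth2 f : Prop := forall s : seq 'I_2,
  continuous (partials s f : plane R -> R) /\
  forall (i : 'I_2) x, derivable (partials s f) x (basis2 i).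

Definition grad f x : plane R := ('D_(basis2 ord0) f x, 'D_(basis2 ord_max) f x).

Definition smooth1 (g : R -> R) : Prop :=
  forall (k : nat) (t : R), derivable (derive1n k g) t 1.

End Plane.

Section Sobolev.
Variable R : realType.
Variable Omega : set (plane R).
Implicit Types (f g u v phi : plane R -> R) (s : seq 'I_2).

(* Near each boundary point, in orthonormal coordinates with second axis e,
   Omega is the strict epigraph of a smooth function. *)
Definition smooth_bounded_domain : Prop :=
  [/\ open Omega, connected Omega, Omega !=set0, bounded_set Omega &
   forall x, boundary Omega x ->
     exists r : R, exists e : plane R, exists g : R -> R,
       [/\ 0 < r, enorm e = 1, smooth1 g &
        forall y, eball x r y ->
          (Omega y <-> g (dot (y - x) (e.2, - e.1)) < dot (y - x) e)]].

Definition test_function phi : Prop :=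
  [/\ smooth2 phi, compact (closure [set x | phi x != 0]) &
   closure [set x | phi x != 0] `<=` Omega].

Definition L2 f : Prop :=
  measurable_fun Omega f /\
  (mu2 R).-integrable Omega (EFin \o (fun x => f x ^+ 2)).

Definition weak_deriv s f g : Prop := forall phi, test_function phi ->
  \int[mu2 R]_(x in Omega) (f x * partials s phi x) =
  (-1) ^+ size s * \int[mu2 R]_(x in Omega) (g x * phi x).

(* f belongs to W^{k,2}(Omega). *)
Definition sobolev (k : nat) f : Prop :=
  L2 f /\
  forall s, (size s <= k)%N -> exists g, L2 g /\ weak_deriv s f g.

(* Some representative of the L^2 weak derivative of f along s, which is
   determined almost everywhere in Omega; the zero function if there is none. *)
Definition wderiv s f : plane R -> R :=
  xget (fun=> 0) [set g | L2 g /\ weak_deriv s f g].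

(* f belongs to W^{k,2}_0(Omega), the closure of the test functions in
   W^{k,2}(Omega). *)
Definition sobolev0 (k : nat) f : Prop :=
  sobolev k f /\
  forall eps : R, 0 < eps -> exists phi, test_function phi /\
    forall s, (size s <= k)%N ->
      (\int[mu2 R]_(x in Omega) ((wderiv s f x - partials s phi x) ^+ 2)%:E
         < eps%:E)%E.

Definition laplacian u : plane R -> R :=
  fun x => \sum_(i < 2) wderiv [:: i; i] u x.

Definition J u : \bar R :=
  (\int[mu2 R]_(x in Omega) (`|laplacian u x| ^+ 2 + \1_[set y | 0 < u y] x)%R%:E)%E.

Definition admissible (u0 u : plane R -> R) : Prop :=
  sobolev 2 u /\ sobolev0 1 (fun x => u x - u0 x).

Definition minimizer (u0 u : plane R -> R) : Prop :=
  admissible u0 u /\ forall v, admissible u0 v -> (J u <= J v)%E.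

Definition one_phase_minimizer (u0 u : plane R -> R) : Prop :=
  [/\ admissible u0 u, forall x, Omega x -> 0 <= u x &
   forall v, admissible u0 v -> (forall x, Omega x -> 0 <= v x) ->
     (J u <= J v)%E].

Definition holder_grad (alpha : R) (K : set (plane R)) u : Prop :=
  exists C : R, forall x y, K x -> K y ->
    enorm (grad u x - grad u y) <= C * enorm (x - y) `^ alpha.

Definition C1alpha_loc (alpha : R) u : Prop :=
  (forall x, Omega x -> differentiable u x) /\
  forall K, compact K -> K `<=` Omega -> holder_grad alpha K u.

(* On a smooth bounded domain, boundedness of u and of its gradient follows. *)
Definition C11 u : Prop :=
  (forall x, Omega x -> differentiable u x) /\ holder_grad 1 Omega u.

(* u is only meaningful on Omega, so {u > 0} is a subset of Omega; its boundary
   is the one in the whole plane. *)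
Definition free_boundary u : set (plane R) :=
  boundary (Omega `&` [set x | 0 < u x]).

Definition quad_form (A : 'M[R]_2) : plane R -> R :=
  fun x => \sum_(i < 2) \sum_(j < 2) A i j * coord2 i x * coord2 j x.

Definition P2 : set (plane R -> R) :=
  [set p | (exists A : 'M[R]_2, A^T = A /\ p = quad_form A) /\
           'N[mu2 R]_+oo [EFin \o (p \_ (eball (0 : plane R) 1))%R]%E = 1%E].

Definition zero_set (p : plane R -> R) (x0 : plane R) : set (plane R) :=
  [set x | p (x - x0) = 0].

Definition flatness u (r : R) (x0 : plane R) : \bar R :=
  ereal_inf [set HD (free_boundary u `&` eball x0 r)
                    (zero_set p x0 `&` eball x0 r) | p in P2].

Definition rank2_flat u (delta r : R) (x0 : plane R) : Prop :=
  (flatness u r x0 < (delta * r)%:E)%E.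

End Sobolev.

Section BlowUp.
Variable R : realType.

Definition blowup (u : plane R -> R) (x0 : plane R) (rho : R) : plane R -> R :=
  fun x => rho ^- 2 * u (x0 + rho *: x).

(* The values of u outside its domain are immaterial: for x0 in an open domain
   and a compact K, [x0 + rho *: K] eventually lies in the domain. *)
Definition blowup_limit (u : plane R -> R) (x0 : plane R) (v : plane R -> R) :
    Prop :=
  exists (rho : nat -> R) (sigma : nat -> nat),
    [/\ forall k, 0 < rho k, rho k @[k --> \oo] --> 0,
        {homo sigma : m n / (m < n)%N} &
        {family compact, (fun k => blowup u x0 (rho (sigma k))) @ \oo --> v}].

Definition homogeneous2 (v : plane R -> R) : Prop :=
  forall (t : R) (x : plane R), 0 < t -> v (t *: x) = t ^+ 2 * v x.

End BlowUp.

(* Main.v *)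
(* In both cases every blow-up limit is homogeneous.

Two phases: competitors u - t phi with phi >= 0 make mu = - Laplacian^2 u a
positive measure. Testing it with a truncated logarithm shows that mu has no
atom at x0, otherwise averages of u / r^2 would diverge. Representing u by the
kernel |x|^2 ln |x|^2, third-order differences of u along lines through x0
at scale r are o(r^2), which identifies the even and odd parts
of blow-ups.

One phase: inner variations along dilations and outer variations combine, by a
Weiss identity, into a scale-invariant bound for the integral of
(T T u)^2 / |x - x0|^6, where T = (x - x0).grad - 2. Its decay on annuli makes T T
annihilate blow-ups away from 0; as these grow quadratically, T does too. *)

Require Import Defs.
From HB Require Import structures.
From mathcomp Require Import all_boot all_order all_algebra.
From mathcomp Require Import all_classical all_reals all_analysis.
From mathcomp Require Import measurable_realfun ring lra.

Set Implicit Arguments.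
Unset Strict Implicit.
Unset Printing Implicit Defensive.

Import Order.TTheory GRing.Theory Num.Theory.
Import numFieldNormedType.Exports.

Local Open Scope classical_set_scope.
Local Open Scope ring_scope.

(** A minimizer is not known to grow at most quadratically at [x0]. The given blow-up limit makes up
    for this: it controls [u / rho^2] on discs of arbitrarily small radii, and that is enough for a
    quantity monotone under halving of the radius. Three vanishing moments remove the factor [ln r]
    which the kernel produces at scale r. They leave [r^3 / d] at distance d, so the far mass
    contributes o(r^2), and the near mass is small because there is no atom.

    In the one-phase problem competitors must stay nonnegative. The variations are therefore
    [u * (1 + t psi)] and compositions of u with [x + t a(x) e_i]. First variations are linear in
    the field, hence the dilation field is treated one coordinate at a time and substitution on
    lines suffices. The exponent 6 is forced: among the weights |x - x0|^-m it is the one for which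
    moving T by parts leaves no term of order zero. Truncating the weight leaves errors near two
    radii only, and the quadratic growth coming from C^{1,1} makes their size independent of the
    radius. *)

Section Plane.
Variable R : realType.
Local Notation pl := (plane R).
Local Notation e_ := (@basis2 R).
Local Notation o_0 := (@ord0 1).
Local Notation o_1 := (@ord_max 1).

(** * Calculus of directional derivatives *)

Section DirectionalDerivative.
Variables (V : normedModType R).
Implicit Types (f g : V -> R) (x v : V).

Lemma der_add f g x v df dg : is_derive x v f df -> is_derive x v g dg ->
 is_derive x v (fun y => f y + g y) (df + dg).
by move=> ? ?; exact: is_deriveD. Qed.

Lemma der_opp f x v df : is_derive x v f df ->
 is_derive x v (fun y => - f y) (- df).
by move=> ?; exact: is_deriveN. Qed.

Lemma der_mul f g x v df dg : is_derive x v f df -> is_derive x v g dg ->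
 is_derive x v (fun y => f y * g y) (df * g x + f x * dg).
move=> Hf Hg; have := is_deriveM Hf Hg.
by rewrite /GRing.scale /= addrC (mulrC (g x)).
Qed.

Lemma der_inv f x v df : f x != 0 -> is_derive x v f df ->
 is_derive x v (fun y => (f y)^-1) (- (df / f x ^+ 2)).
move=> f0 [Hf <-]; apply: DeriveDef; first exact: derivableV.
by rewrite deriveV // /GRing.scale /= mulNr mulrC.
Qed.

(** A directional derivative is an ordinary derivative on a line. This transfers the one-variable
    chain rule to [der_comp] and, later, mean value theorems to the plane. *)
Lemma der_line f x v df : is_derive x v f df <->
 is_derive (0 : R) 1 (fun h : R => f (h *: v + x)) df.
have E : 'D_1 (fun h : R => f (h *: v + x)) 0 = 'D_v f x.
 rewrite /derive; set g1 := (X in lim (X @ _)); set g2 := (X in _ = lim (X @ _)).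
 suff -> : g1 = g2 by [].
 by rewrite funeqE /g1 /g2 => h /=; rewrite addr0 scale0r add0r [_%:A]mulr1.
split=> -[H1 H2]; (apply: DeriveDef; last by rewrite -H2 E).
- exact: (proj1 (@derivable1P _ _ _ f x v) H1).
- exact: (proj2 (@derivable1P _ _ _ f x v) H1).
Qed.

Lemma der_comp (h : R -> R) f x v df dh :
 is_derive x v f df -> is_derive (f x) 1 h dh ->
 is_derive x v (fun y => h (f y)) (dh * df).
move=> /der_line Hf Hh; apply/der_line.
have [d1 e1] := Hf; have [d2 e2] := Hh.
have d2' : derivable h (f (0 *: v + x)) 1 by rewrite scale0r add0r.
apply: DeriveDef.
 apply/derivable1_diffP; apply: (@differentiable_comp _ _ _ _ (fun t : R => f (t *: v + x)) h).
  exact: (derivable1_diffP _ _).1 d1.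
 exact: (derivable1_diffP _ _).1 d2'.
have := derive1_comp d1 d2'; rewrite !derive1E /= e1 scale0r add0r e2 => <-.
by [].
Qed.

End DirectionalDerivative.

(** * Smooth functions along a family of directions *)

Section Smooth.
Variables (V : normedModType R) (I : Type) (e : I -> V).
Implicit Types (f g : V -> R).

(** The directions are a parameter [e], so that functions on the line, with the single direction 1,
    and functions on the plane, with the two basis vectors, share one theory. *)
Fixpoint Cn n f : Prop := match n with
 | 0 => continuous f
 | n'.+1 => continuous f /\
   forall i, (forall x, derivable f x (e i)) /\ Cn n' (fun x => 'D_(e i) f x)
 end.

Definition smooth f := forall n, Cn n f.

Lemma Cn_pred n f : Cn n.+1 f -> Cn n f.
elim: n f => [f []//|n IH f [cf H]]; split=> // i; split; first by case: (H i).
by apply: IH; case: (H i).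
Qed.

Lemma smooth_cont f : smooth f -> continuous f.
by move=> /(_ 0). Qed.

Lemma smooth_derivable f i x : smooth f -> derivable f x (e i).
by move=> /(_ 1) [_ /(_ i) []]. Qed.

Lemma smooth_der f i x : smooth f -> is_derive x (e i) f ('D_(e i) f x).
by move=> sf; apply: derivableP; exact: smooth_derivable. Qed.

Lemma smooth_D f i : smooth f -> smooth (fun x => 'D_(e i) f x).
by move=> sf n; have [_ /(_ i) []] := sf n.+1. Qed.

Lemma smoothI f : continuous f ->
 (forall i, exists2 df, smooth df & forall x, is_derive x (e i) f (df x)) ->
 smooth f.
move=> cf H [//|n]; split=> // i; have [df sdf Hdf] := H i.
split; first by move=> x; have [] := Hdf x.
suff -> : (fun x => 'D_(e i) f x) = df by [].
by apply/funext => x; have [_ ->] := Hdf x.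
Qed.

Lemma Cn_cst n (c : R) : Cn n (fun _ => c).
elim: n c => [c|n IH c]; first by move=> x; exact: cvg_cst.
split; first by move=> x; exact: cvg_cst.
move=> i; split; first by move=> x; exact: derivable_cst.
rewrite (_ : 'D__ _ = fun _ => 0) //; apply/funext => x.
exact: derive_cst.
Qed.

Lemma smooth_cst (c : R) : smooth (fun _ => c).
by move=> n; exact: Cn_cst. Qed.

Lemma Cn_add n f g : Cn n f -> Cn n g -> Cn n (fun x => f x + g x).
elim: n f g => [f g cf cg x|n IH f g [cf Hf] [cg Hg]].
 by apply: cvgD; [exact: cf|exact: cg].
split; first by move=> x; apply: cvgD; [exact: cf|exact: cg].
move=> i; have [df Hf'] := Hf i; have [dg Hg'] := Hg i; split.
 by move=> x; apply: derivableD.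
rewrite (_ : (fun x => _) = fun x => 'D_(e i) f x + 'D_(e i) g x).
 exact: IH.
by apply/funext => x; rewrite -deriveD.
Qed.

Lemma Cn_mul n f g : Cn n f -> Cn n g -> Cn n (fun x => f x * g x).
elim: n f g => [f g cf cg x|n IH f g Hf0 Hg0].
 by apply: cvgM; [exact: cf|exact: cg].
have [cf Hf] := Hf0; have [cg Hg] := Hg0.
split; first by move=> x; apply: cvgM; [exact: cf|exact: cg].
move=> i; have [df Hf'] := Hf i; have [dg Hg'] := Hg i; split.
 by move=> x; apply: derivableM.
rewrite (_ : (fun x => _) = fun x => 'D_(e i) f x * g x + f x * 'D_(e i) g x).
 by apply: Cn_add; apply: IH => //; exact: Cn_pred.
apply/funext => x; have [_ ->//] :=
 der_mul (derivableP (df x)) (derivableP (dg x)).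
Qed.

Lemma smooth_add f g : smooth f -> smooth g -> smooth (fun x => f x + g x).
by move=> sf sg n; exact: Cn_add. Qed.

Lemma smooth_mul f g : smooth f -> smooth g -> smooth (fun x => f x * g x).
by move=> sf sg n; exact: Cn_mul. Qed.

Lemma smooth_opp f : smooth f -> smooth (fun x => - f x).
move=> sf; rewrite (_ : (fun _ => _) = fun x => -1 * f x).
 exact: smooth_mul (smooth_cst _) sf.
by apply/funext => x; rewrite mulN1r.
Qed.

Lemma smooth_sub f g : smooth f -> smooth g -> smooth (fun x => f x - g x).
by move=> sf sg; exact: smooth_add sf (smooth_opp sg). Qed.

Lemma smooth_exp f n : smooth f -> smooth (fun x => f x ^+ n).
move=> sf; elim: n => [|n IH].
 by rewrite (_ : (fun x => _) = fun _ => 1) //; exact: smooth_cst.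
rewrite (_ : (fun x => _) = fun x => f x * f x ^+ n); first exact: smooth_mul.
by apply/funext => x; rewrite exprS.
Qed.

Lemma smooth_sum (J : Type) (s : seq J) (P : pred J) (F : J -> V -> R) :
 (forall j, smooth (F j)) -> smooth (fun x => \sum_(j <- s | P j) F j x).
move=> sF; elim: s => [|j s IH].
 rewrite (_ : (fun x => _) = fun _ => 0); first exact: smooth_cst.
 by apply/funext => x; rewrite big_nil.
rewrite (_ : (fun x => _) =
 fun x => (if P j then F j x else 0) + \sum_(j <- s | P j) F j x).
 by apply: smooth_add => //; case: (P j) => //; exact: smooth_cst.
by apply/funext => x; rewrite big_cons; case: (P j) => //; rewrite add0r.
Qed.

Lemma smooth_inv f : smooth f -> (forall x, f x != 0) ->
 smooth (fun x => (f x)^-1).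
move=> sf f0; have cV : continuous (fun x => (f x)^-1).
 by move=> x; apply: cvgV => //; exact: smooth_cont.
(* All powers at once: differentiating the m-th power of [1 / f] gives a smooth factor times the
   (m+1)-st power, so the induction on the order of smoothness closes. *)
move=> n; suff : forall m, Cn n (fun x => (f x)^-1 ^+ m) /\ True.
 by move=> /(_ 1) [].
have cX m : continuous (fun x => (f x)^-1 ^+ m).
 elim: m => [x|m IH x].
  by rewrite (_ : (fun x => _) = fun _ => 1) //; exact: cvg_cst.
 rewrite (_ : (fun x => _) = fun x => (f x)^-1 * (f x)^-1 ^+ m).
  by apply: cvgM; [exact: cV|exact: IH].
 by apply/funext => y; rewrite exprS.
elim: n => [m|n IH m]; first by split.
split=> //; split=> // i.
have D x : is_derive x (e i) (fun x => (f x)^-1 ^+ m)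
  (- (m%:R * 'D_(e i) f x) * (f x)^-1 ^+ m.+1).
 have Hi := der_inv (f0 x) (smooth_der i x sf).
 have := is_deriveX m Hi; rewrite (_ : (_ ^+ m)%R = fun x => (f x)^-1 ^+ m).
  move=> H; apply: (is_derive_eq H) => {H}; rewrite /GRing.scale /=.
  case: m => [|k]; first by rewrite !mul0r oppr0 mul0r.
  by rewrite /= -exprVn !exprS; ring.
 by apply/funext => y; rewrite exprfctE.
split; first by move=> x; have [] := D x.
rewrite (_ : (fun x => 'D__ _ _) =
  fun x => - (m%:R * 'D_(e i) f x) * (f x)^-1 ^+ m.+1); last first.
 by apply/funext => x; have [_ ->] := D x.
apply: Cn_mul; last by case: (IH m.+1).
by apply: smooth_opp; apply: smooth_mul; [exact: smooth_cst|exact: smooth_D].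
Qed.

End Smooth.

Definition smoothR (h : R -> R) : Prop :=
 @smooth R unit (fun _ : unit => 1 : R) h.

Definition sm2 (f : pl -> R) : Prop := smooth e_ f.

Section SmoothComp.
Variables (V : normedModType R) (I : Type) (e : I -> V).

Lemma smooth_comp (h : R -> R) (f : V -> R) :
 smoothR h -> smooth e f -> smooth e (fun x => h (f x)).
move=> sh sf n; elim: n h sh => [h sh x|n IH h sh].
 apply: (@continuous_comp _ _ _ f h); first exact: smooth_cont sf x.
 exact: smooth_cont sh _.
split.
 move=> x; apply: (@continuous_comp _ _ _ f h); first exact: smooth_cont sf x.
 exact: smooth_cont sh _.
move=> i; have D x : is_derive x (e i) (fun x => h (f x)) ('D_1 h (f x) * 'D_(e i) f x).
 apply: der_comp; first exact: smooth_der.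
 exact: (@smooth_der _ unit (fun _ : unit => 1 : R) _ tt).
split; first by move=> x; have [] := D x.
rewrite (_ : (fun x => 'D__ _ _) = fun x => 'D_1 h (f x) * 'D_(e i) f x).
 apply: Cn_mul; last exact: smooth_D.
 by apply: (IH (fun y => 'D_1 h y)); exact: (@smooth_D _ unit (fun _ : unit => 1 : R) _ tt).
by apply/funext => x; have [_ ->] := D x.
Qed.

End SmoothComp.

Section SmoothReal.
Implicit Types (f : R -> R).

Lemma smoothR_id : smoothR (fun x : R => x).
apply: smoothI => [x|_]; first exact: cvg_id.
exists (fun=> 1); first exact: smooth_cst.
by move=> x; exact: is_derive_id.
Qed.

Lemma smoothR_D f : smoothR f -> smoothR (fun x => 'D_1 f x).
exact: (@smooth_D _ unit (fun _ : unit => 1 : R) _ tt). Qed.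

Lemma smoothR_der f (x : R) : smoothR f -> is_derive x 1 f ('D_1 f x).
exact: (@smooth_der _ unit (fun _ : unit => 1 : R) _ tt). Qed.

Lemma smooth_ln_comp (V : normedModType R) (I : Type) (e : I -> V) (p : V -> R) :
 smooth e p -> (forall x, 0 < p x) -> smooth e (fun x => ln (p x)).
move=> sp p0; apply: smoothI => [x|i].
 apply: (@continuous_comp _ _ _ p (@ln R)); first exact: smooth_cont sp x.
 exact: continuous_ln.
exists (fun x => (p x)^-1 * 'D_(e i) p x).
 apply: smooth_mul; last exact: smooth_D.
 by apply: smooth_inv => // x; rewrite gt_eqF.
move=> x; apply: der_comp; first exact: smooth_der.
exact: is_derive1_ln.
Qed.

End SmoothReal.

#[local] Create HintDb plane.
#[local] Hint Resolve smoothR_id smoothR_D smooth_D : plane.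

(* Side goals: regularity, support, integrability and sign conditions. *)
Ltac smt :=
 first [done | lazymatch goal with
 | |- sm2 (fun x => _) => unfold sm2; smt
 | |- smoothR (fun x => _) => unfold smoothR; smt
 | |- smooth _ (fun _ => ?c) => solve [apply: smooth_cst]
 | |- smooth _ (fun x => @?f x + @?g x) => apply: (@smooth_add _ _ _ f g); smt
 | |- smooth _ (fun x => @?f x * @?g x) => apply: (@smooth_mul _ _ _ f g); smt
 | |- smooth _ (fun x => - @?f x) => apply: (@smooth_opp _ _ _ f); smt
 | |- smooth _ (fun x => @?f x ^+ ?n) => apply: (@smooth_exp _ _ _ f n); smt
 | |- @smooth _ unit _ (fun x => derive ?f x _) => apply: (@smoothR_D f); smt
 | |- smooth _ (fun x => derive ?f x (_ ?i)) => apply: (@smooth_D _ _ _ f i); smt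
 | |- @smooth _ unit _ ?f => change (smoothR f); smt_leaf
 | |- smooth e_ ?f => change (sm2 f); smt_leaf
 | |- continuous _ => first [solve [auto 4 with plane nocore] | apply: smooth_cont; smt]
 | |- is_true (0 <= _ + _) => apply: addr_ge0; smt
 | |- is_true (0 <= _ * _) => apply: mulr_ge0; smt
 | |- is_true (0 <= _ ^+ _) => first [solve [apply: sqr_ge0] | apply: exprn_ge0; smt]
 | |- is_true (0 <= _^-1) => rewrite invr_ge0; smt
 | |- is_true (0 <= _) => apply: ltW; smt
 | |- is_true (0 < _ * _) => apply: mulr_gt0; smt
 | |- is_true (0 < _ ^+ _) => apply: exprn_gt0; smt
 | |- is_true (0 < _^-1) => rewrite invr_gt0; smt
 | |- is_true (0 < _ + _) => first [solve [apply: addr_gt0; smt] | solve [apply: ltr_pwDr; smt] | apply: ltr_pwDl; smt]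
 | |- is_true _ => fail
 | |- _ => smt_leaf
 end]
with smt_leaf := solve [auto 6 with plane nocore].

(** * Weighted push-forward of a measure *)

Section WeightedPushforward.
Local Open Scope ereal_scope.
Context d d' (T : measurableType d) (S : measurableType d').
Variables (m : {measure set T -> \bar R}) (phi : T -> S) (w : T -> R).
Hypotheses (mphi : measurable_fun setT phi) (mw : measurable_fun setT w) (w0 : forall x, (0 <= w x)%R).

Definition wpush (A : set S) : \bar R := \int[m]_(x in phi @^-1` A) (w x)%:E.

Let mpre A : measurable A -> measurable (phi @^-1` A).
by move=> mA; rewrite -[X in measurable X]setTI; exact: mphi. Qed.

Let mwE A : measurable_fun A (EFin \o w).
by apply: measurable_funTS; exact/measurable_EFinP. Qed.

Let wpush0 : wpush set0 = 0.
by rewrite /wpush preimage_set0 integral_set0. Qed.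

Let wpush_ge0 A : 0 <= wpush A.
by apply: integral_ge0 => x _; rewrite lee_fin. Qed.

Let wpush_additive : semi_sigma_additive wpush.
move=> F mF tF mUF; rewrite /wpush preimage_bigcup ge0_integral_bigcup //.
- apply: is_cvg_ereal_nneg_natsum_cond => n _ _.
 by apply: integral_ge0 => x _; rewrite lee_fin.
- by move=> k; exact: mpre.
- by move=> *; rewrite lee_fin.
- move=> i j _ _ [x [Fi Fj]]; apply: (tF i j) => //.
 by exists (phi x).
Qed.

Definition wpush_measure : {measure set S -> \bar R} :=
 HB.pack wpush (isMeasure.Build _ _ _ wpush wpush0 wpush_ge0 wpush_additive).

Import HBNNSimple.

(** [n] is any measure agreeing with the weighted push-forward, so that Lebesgue measure itself can
    be inserted. Both sides are monotone limits over simple functions, where the identity is checked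
    level set by level set. *)
Lemma ge0_integral_wpush (n : {measure set S -> \bar R}) (G : S -> \bar R) :
 (forall A, measurable A -> n A = wpush A) ->
 measurable_fun setT G -> (forall y, 0 <= G y) ->
 \int[n]_y G y = \int[m]_x ((w x)%:E * G (phi x)).
move=> nE mG G0.
pose h := nnsfun_approx measurableT mG.
have -> : \int[n]_y G y = lim (\int[n]_y (EFin \o h k) y @[k --> \oo]).
 have hE x : G x = lim ((EFin \o h k) x @[k --> \oo]).
  by apply/esym/cvg_lim => //; apply: cvg_nnsfun_approx.
 under eq_integral => x _ do rewrite hE.
 apply: monotone_convergence => //.
 - by move=> k; apply/measurable_EFinP; smt.
 - by move=> k x _; rewrite lee_fin.
 - by move=> x _ a b ab; rewrite lee_fin; exact/lefP/nd_nnsfun_approx.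
have -> : \int[m]_x ((w x)%:E * G (phi x)) =
  lim (\int[m]_x ((w x)%:E * (h k (phi x))%:E) @[k --> \oo]).
 have hE x : (w x)%:E * G (phi x) = lim ((w x)%:E * (h k (phi x))%:E @[k --> \oo]).
  apply/esym/cvg_lim => //; apply: cvgeZl => //.
  by have := @cvg_nnsfun_approx _ _ _ setT measurableT _ mG (fun y _ => G0 y) (phi x) I.
 under eq_integral => x _ do rewrite hE.
 apply: monotone_convergence => //.
 - move=> k; apply: emeasurable_funM; first exact/measurable_EFinP.
  by apply/measurable_EFinP; apply: measurableT_comp.
 - by move=> k x _; rewrite mule_ge0 ?lee_fin.
 - move=> x _ a b ab; apply: lee_wpmul2l; first by rewrite lee_fin.
  by rewrite lee_fin; exact/lefP/nd_nnsfun_approx.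
suff suf k : \int[m]_x ((w x)%:E * (h k (phi x))%:E) = \int[n]_y (EFin \o h k) y.
 by congr (limn _); apply/funext => k; rewrite suf.
transitivity (\int[n]_y
  (\sum_(r \in range (h k)) (r * \1_(h k @^-1` [set r]) y)%:E)); last first.
 by apply: eq_integral => t tE; rewrite /= fimfunE -fsumEFin.
rewrite ge0_integral_fsum//; last 2 first.
- move=> r; apply/measurable_EFinP; apply: measurable_funM => //.
- by move=> r y _; exact: nnfun_muleindic_ge0.
transitivity (\int[m]_x (\sum_(r \in range (h k))
  (r * \1_(h k @^-1` [set r]) (phi x))%:E * (w x)%:E)).
 apply: eq_integral => x _.
 rewrite -ge0_mule_fsuml => [|r]; last exact: nnfun_muleindic_ge0.
 by rewrite fsumEFin // -(fimfunE _ (phi x)) muleC.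
have mi r : measurable_fun setT (fun x => \1_(h k @^-1` [set r]) (phi x) : R).
 have mr : measurable_fun setT (\1_(h k @^-1` [set r]) : S -> R) by [].
 exact: (measurableT_comp mr mphi).
rewrite ge0_integral_fsum//; last 2 first.
- move=> r; apply: emeasurable_funM; apply/measurable_EFinP => //.
 by apply: measurable_funM.
- by move=> r x _; rewrite mule_ge0 ?lee_fin// -lee_fin nnfun_muleindic_ge0.
apply: eq_fsbigr => r rh.
have r0 : 0 <= r%:E by move: rh; rewrite inE => -[t _ <-]; rewrite lee_fin.
under eq_integral do rewrite EFinM -muleA.
rewrite ge0_integralZl//; last 2 first.
- by apply: emeasurable_funM; apply/measurable_EFinP.
- by move=> x _; rewrite mule_ge0 ?lee_fin.
under [RHS]eq_integral do rewrite EFinM.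
rewrite [RHS]ge0_integralZl//; last by apply/measurable_EFinP.
congr (_ * _).
rewrite integral_indic// setIT nE// /wpush [RHS]integral_mkcond.
apply: eq_integral => x _; rewrite patchE.
have -> : \1_(h k @^-1` [set r]) (phi x) = \1_(phi @^-1` (h k @^-1` [set r])) x :> R.
 smt.
by rewrite indicE; case: ifP => _ /=; rewrite ?mul1e ?mul0e.
Qed.

End WeightedPushforward.

(** * Change of variables on the line *)

Section LineSubstitution.
Local Notation lam := (@lebesgue_measure R).
Variables (phi w : R -> R).
Hypotheses (Dphi : forall x : R, is_derive x 1 phi (w x)) (cw : continuous w) (w0 : forall x, 0 < w x).
Hypothesis sphi : forall y, exists x, phi x = y.

Let cphi : continuous phi.
by move=> x; apply/differentiable_continuous/derivable1_diffP; smt.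
Qed.

Lemma increasing_of_derive x y : x < y -> phi x < phi y.
move=> xy; have [|c _ E] := @MVT R phi w x y xy.
 by apply: continuous_subspaceT.
by rewrite -subr_gt0 E mulr_gt0 // subr_gt0.
Qed.

Let mono x y : (phi x < phi y) = (x < y).
by have /leW_mono -> := le_mono increasing_of_derive. Qed.

Let monole x y : (phi x <= phi y) = (x <= y).
exact: (le_mono increasing_of_derive). Qed.

(** Lebesgue measure is determined by its values on half-open intervals. Their preimages are again
    half-open intervals, by monotonicity and surjectivity, and the fundamental theorem of calculus
    gives the length. *)
Lemma lebesgue_wpush (A : set R) : measurable A ->
 lam A = wpush lam phi w A.
have mphi : measurable_fun setT (phi : measurableTypeR R -> measurableTypeR R).
 exact: continuous_measurable_fun.
have mw : measurable_fun setT (w : measurableTypeR R -> measurableTypeR R).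
 exact: continuous_measurable_fun.
have w0' x : 0 <= w x by exact: ltW.
have := @lebesgue_measure_unique R (wpush_measure lam mphi mw w0').
apply=> X [[a b] _ <-] /=.
rewrite /wpush; have [al E1] := sphi a; have [be E2] := sphi b.
have -> : phi @^-1` `]a, b]%classic = `]al, be]%classic.
 by apply/seteqP; split=> x /=; rewrite !in_itv /= -E1 -E2 mono monole.
rewrite lebesgue_measure_itv /= lte_fin -E1 -E2 mono.
case: ltP => ab; last first.
 by rewrite set_itv_ge ?integral_set0 // bnd_simp -leNgt.
rewrite integral_itv_obnd_cbnd; last first.
 by apply: measurable_funTS; exact/measurable_EFinP.
rewrite (@continuous_FTC2 R w phi) //.
- by apply: continuous_subspaceT.
- split.
 + by move=> x _; smt.
 + by apply: cvg_at_right_filter; exact: cphi.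
 + by apply: cvg_at_left_filter; exact: cphi.
- by move=> x _; rewrite derive1E; have [_ ->] := Dphi x.
Qed.

Lemma ge0_line_substitution (G : measurableTypeR R -> \bar R) :
 measurable_fun setT G -> (forall y, 0 <= G y)%E ->
 (\int[lam]_y G y = \int[lam]_x ((w x)%:E * G (phi x)))%E.
move=> mG G0; apply: ge0_integral_wpush => //.
- exact: (continuous_measurable_fun cphi).
- exact: (continuous_measurable_fun cw).
- by move=> x; exact: ltW.
- by move=> A mA; exact: lebesgue_wpush.
Qed.

End LineSubstitution.

(** * Borel measurability in the plane *)

Section PlaneMeasurability.

Let near_lt (q x k : R) : x - k < q -> q < x + k -> `|q - x| < k.
by move=> ? ?; rewrite ltr_norml; lra. Qed.

Let near_lt2 (q x y k e : R) : `|q - x| < k -> `|q - y| < k -> k < e / 2 ->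
 `|x - y| < e.
rewrite !ltr_norml => /andP[? ?] /andP[? ?] ?.
lra.
Qed.

(** The sigma-algebra is the product one, so an open set has to be exhausted by countably many
    products: boxes with rational centres and radii [1 / (n+1)]. *)
Lemma open_measurable_plane (A : set pl) : open A -> measurable A.
move=> oA.
pose box (q : rat * rat * nat) : set pl :=
 ball (ratr q.1.1 : R) (q.2.+1%:R^-1) `*` ball (ratr q.1.2 : R) (q.2.+1%:R^-1).
pose F q := if `[< box q `<=` A >] then box q else set0.
have -> : A = \bigcup_(q in setT) F q.
 apply/seteqP; split; last first.
  by move=> x [q _]; rewrite /F; case: asboolP => // H /H.
 move=> x Ax; have /nbhs_ballP[e /= e0 Be] := oA x Ax.
 have [n ne] : exists n : nat, n.+1%:R^-1 < e / 2.
  have e2 : 0 < e / 2 by smt.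
  exists (Num.truncn ((e / 2)^-1)).
  rewrite invf_plt ?posrE //.
  by apply: truncnS_gt.
 have n0 : 0 < n.+1%:R^-1 :> R by smt.
 have [q1 /[!in_itv]/= /andP[H1 H2]] := @rat_in_itvoo R (x.1 - n.+1%:R^-1) (x.1 + n.+1%:R^-1)
  ltac:(by rewrite ltrD2l gtrN).
 have [q2 /[!in_itv]/= /andP[H3 H4]] := @rat_in_itvoo R (x.2 - n.+1%:R^-1) (x.2 + n.+1%:R^-1)
  ltac:(by rewrite ltrD2l gtrN).
 have bx : box (q1, q2, n) x.
  by split; rewrite /ball /=; apply: near_lt.
 exists (q1, q2, n) => //; rewrite /F; case: asboolP => // -[].
 move=> y [/=]; rewrite /ball /= => y1 y2.
 by apply: Be; split; rewrite /ball /=;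
  [apply: (near_lt2 (near_lt H1 H2) y1)|apply: (near_lt2 (near_lt H3 H4) y2)].
apply: countable_bigcupT_measurable => // q.
rewrite /F; case: ifP => // _; rewrite /box.
by apply: measurableX; apply: open_measurable; exact: ball_open.
Qed.

Lemma cont_measurable (f : pl -> R) :
 continuous f -> measurable_fun setT f.
move=> /continuousP cf; apply: (measurability _ (RGenOpens.measurableE R)).
move=> _ [_ [a [b ->] <-]]; rewrite setTI; apply: open_measurable_plane.
exact/cf/interval_open.
Qed.

End PlaneMeasurability.

(** * Integration over the plane and substitutions *)

Section PlaneIntegral.
Local Notation lam := (@lebesgue_measure R).
Local Notation mu := (mu2 R).
Implicit Types (f g : pl -> R) (x y : pl).

Definition ig f : Prop := mu.-integrable setT (EFin \o f).
Definition I f : R := \int[mu]_x f x.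

Lemma ig_measurable f : ig f -> measurable_fun setT f.
by move=> /measurable_int /measurable_EFinP. Qed.

Lemma igD f g : ig f -> ig g -> ig (fun x => f x + g x).
by move=> If Ig; exact: (integrableD measurableT If Ig). Qed.

Lemma igZ (c : R) f : ig f -> ig (fun x => c * f x).
by move=> If; exact: (integrableZl measurableT c If). Qed.

Lemma igN f : ig f -> ig (fun x => - f x).
by move=> If; exact: (integrableN If). Qed.

Lemma igB f g : ig f -> ig g -> ig (fun x => f x - g x).
by move=> If Ig; apply: igD => //; exact: igN. Qed.

Lemma ig_le f g : measurable_fun setT f -> ig g ->
 (forall x, `|f x| <= g x) -> ig f.
move=> mf Ig fg; apply: (le_integrable measurableT _ _ Ig).
 exact/measurable_EFinP.
by move=> x _ /=; rewrite lee_fin (le_trans (fg x)) // ler_norm.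
Qed.

Lemma ig_abs f : ig f -> ig (fun x => `|f x|).
move=> If; apply: (le_integrable measurableT _ _ If).
 apply/measurable_EFinP; apply: measurableT_comp => //; exact: ig_measurable.
by move=> x _ /=; rewrite normr_id.
Qed.

Lemma ID f g : ig f -> ig g -> I (fun x => f x + g x) = I f + I g.
by move=> If Ig; exact: RintegralD. Qed.

Lemma IB f g : ig f -> ig g -> I (fun x => f x - g x) = I f - I g.
by move=> If Ig; exact: RintegralB. Qed.

Lemma IZ (c : R) f : ig f -> I (fun x => c * f x) = c * I f.
by move=> If; exact: RintegralZl. Qed.

Lemma IN f : ig f -> I (fun x => - f x) = - I f.
move=> If; rewrite -mulN1r -IZ //; congr (I _).
by apply/funext => x; lra.
Qed.

Lemma I_le f g : ig f -> ig g -> (forall x, f x <= g x) -> I f <= I g.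
by move=> If Ig fg; apply: le_Rintegral. Qed.

Lemma I_ge0 f : (forall x, 0 <= f x) -> 0 <= I f.
by move=> f0; apply: Rintegral_ge0. Qed.

Lemma I_abs f : ig f -> `|I f| <= I (fun x => `|f x|).
by move=> If; exact: le_normr_Rintegral. Qed.

Lemma I0 : I (fun=> 0) = 0.
by rewrite /I /Rintegral integral0. Qed.

Lemma ig0 : ig (fun=> 0).
exact: integrable0. Qed.

Lemma I_EFin f : ig f -> (\int[mu]_x (f x)%:E = (I f)%:E)%E.
by move=> If; rewrite /I /Rintegral fineK //; exact: integrable_fin_num. Qed.

Lemma ig_ge0 f : measurable_fun setT f -> (forall x, 0 <= f x) ->
 (\int[mu]_x (f x)%:E < +oo)%E -> ig f.
move=> mf f0 H; apply/integrableP; split; first exact/measurable_EFinP.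
by under eq_integral do rewrite /= ger0_norm //.
Qed.

Lemma ge0_tonelli_snd (f : pl -> \bar R) :
 measurable_fun setT f -> (forall x, 0 <= f x)%E ->
 (\int[mu]_x f x = \int[lam]_t \int[lam]_s f (s, t))%E.
by move=> mf f0; exact: fubini_tonelli2. Qed.

Lemma ge0_tonelli_fst (f : pl -> \bar R) :
 measurable_fun setT f -> (forall x, 0 <= f x)%E ->
 (\int[mu]_x f x = \int[lam]_s \int[lam]_t f (s, t))%E.
by move=> mf f0; exact: fubini_tonelli1. Qed.

(** The change of variables formula for nonnegative functions is itself taken as the definition of a
    substitution. It is stable under composition, so translations and dilations are assembled from
    maps moving one coordinate. *)
Definition subst_ok (Phi : pl -> pl) (w : pl -> R) : Prop :=
 [/\ measurable_fun setT Phi, measurable_fun setT w, forall x, 0 <= w x &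
 forall G : pl -> \bar R, measurable_fun setT G -> (forall y, 0 <= G y)%E ->
 (\int[mu]_y G y = \int[mu]_x ((w x)%:E * G (Phi x)))%E].

(** Tonelli reduces a map moving only the first coordinate to a substitution on each horizontal
    line. *)
Lemma subst_ok_fst (phi w : pl -> R) :
 (forall x, is_derive x (e_ o_0) phi (w x)) ->
 continuous phi -> continuous w -> (forall x, 0 < w x) ->
 (forall x c, exists t, phi (t, x.2) = c) ->
 subst_ok (fun x => (phi x, x.2)) w.
move=> Dphi cphi cw w0 sphi; split.
- apply/measurable_fun_pairP; split; first exact: cont_measurable.
 exact: measurable_snd.
- exact: cont_measurable.
- by move=> x; exact: ltW.
move=> G mG G0.
have mw : measurable_fun setT (fun x : pl => ((w x)%:E * G (phi x, x.2))%E).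
 apply: emeasurable_funM; first by apply/measurable_EFinP; exact: cont_measurable.
 apply: (measurableT_comp mG); apply/measurable_fun_pairP; split.
  exact: cont_measurable.
 exact: measurable_snd.
rewrite ge0_tonelli_snd // ge0_tonelli_snd //; last first.
 by move=> x; rewrite mule_ge0 // lee_fin ltW.
apply: eq_integral => t _.
have line (x : R) : continuous_at x (fun x : R => (x, t) : pl).
 by apply: (@cvg_pair _ _ _ _ (nbhs x) (nbhs t) _ _ _ id (cst t));
  [exact: cvg_id|exact: cvg_cst].
have D (x : R) : is_derive x 1 (fun s : R => phi (s, t)) (w (x, t)).
 have /der_line H := Dphi (x, t); apply/der_line.
 rewrite [X in is_derive _ _ X _](_ : _ = (fun h : R => phi (h *: e_ o_0 + (x, t)))) //.
 apply/funext => h; congr phi; rewrite /basis2 /=.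
 by congr (_, _); rewrite /= ?scaler0 ?add0r // [h *: 1]mulr1.
apply: (ge0_line_substitution D).
- by move=> x; apply: (@continuous_comp _ _ _ (fun x : R => (x, t) : pl) w); [exact: line|exact: cw].
- by move=> x; exact: w0.
- by move=> y; exact: (sphi (0, t)).
- apply: (measurableT_comp mG); apply/measurable_fun_pairP; split => /=.
  exact: measurable_id.
 exact: measurable_cst.
- by move=> y; exact: G0.
Qed.

Lemma subst_ok_snd (phi w : pl -> R) :
 (forall x, is_derive x (e_ o_1) phi (w x)) ->
 continuous phi -> continuous w -> (forall x, 0 < w x) ->
 (forall x c, exists t, phi (x.1, t) = c) ->
 subst_ok (fun x => (x.1, phi x)) w.
move=> Dphi cphi cw w0 sphi; split.
- apply/measurable_fun_pairP; split; last exact: cont_measurable.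
 exact: measurable_fst.
- exact: cont_measurable.
- by move=> x; exact: ltW.
move=> G mG G0.
have mw : measurable_fun setT (fun x : pl => ((w x)%:E * G (x.1, phi x))%E).
 apply: emeasurable_funM; first by apply/measurable_EFinP; exact: cont_measurable.
 apply: (measurableT_comp mG); apply/measurable_fun_pairP; split.
  exact: measurable_fst.
 exact: cont_measurable.
rewrite ge0_tonelli_fst // ge0_tonelli_fst //; last first.
 by move=> x; rewrite mule_ge0 // lee_fin ltW.
apply: eq_integral => t _.
have line (x : R) : continuous_at x (fun x : R => (t, x) : pl).
 by apply: (@cvg_pair _ _ _ _ (nbhs t) (nbhs x) _ _ _ (cst t) id);
  [exact: cvg_cst|exact: cvg_id].
have D (x : R) : is_derive x 1 (fun s : R => phi (t, s)) (w (t, x)).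
 have /der_line H := Dphi (t, x); apply/der_line.
 rewrite [X in is_derive _ _ X _](_ : _ = (fun h : R => phi (h *: e_ o_1 + (t, x)))) //.
 apply/funext => h; congr phi; rewrite /basis2 /=.
 by congr (_, _); rewrite /= ?scaler0 ?add0r // [h *: 1]mulr1.
apply: (ge0_line_substitution D).
- by move=> x; apply: (@continuous_comp _ _ _ (fun x : R => (t, x) : pl) w); [exact: line|exact: cw].
- by move=> x; exact: w0.
- by move=> y; exact: (sphi (t, 0)).
- apply: (measurableT_comp mG); apply/measurable_fun_pairP; split => /=.
  exact: measurable_cst.
 exact: measurable_id.
- by move=> y; exact: G0.
Qed.

Lemma subst_ok_comp Phi w Psi v : subst_ok Phi w -> subst_ok Psi v ->
 subst_ok (fun x => Psi (Phi x)) (fun x => w x * v (Phi x)).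
move=> [mP mw w0 H1] [mQ mv v0 H2]; split.
- exact: measurableT_comp mQ mP.
- by apply: measurable_funM => //; exact: measurableT_comp mv mP.
- by move=> x; smt.
move=> G mG G0; rewrite H2 // H1.
- by apply: eq_integral => x _; rewrite EFinM muleA.
- apply: emeasurable_funM; first exact/measurable_EFinP.
 exact: measurableT_comp mG mQ.
- by move=> y; rewrite mule_ge0 // lee_fin.
Qed.

Lemma subst_ig Phi w f : subst_ok Phi w -> ig f ->
 ig (fun x => w x * f (Phi x)).
move=> [mP mw w0 H] If; have mf := ig_measurable If.
apply/integrableP; split.
 apply/measurable_EFinP; apply: measurable_funM => //.
 exact: measurableT_comp mf mP.
have := H (fun x => `|f x|%:E).
have m1 : measurable_fun setT (fun x => `|f x|%:E).
 by apply/measurable_EFinP; apply: measurableT_comp.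
move=> /(_ m1) -/(_ (fun y => normr_ge0 _)).
rewrite [X in X = _]I_EFin; last exact: ig_abs.
move=> E.
rewrite (_ : (\int[_]_(_ in _) _)%E = (I (fun x => `|f x|))%:E) ?ltey //.
rewrite E; apply: eq_integral => x _ /=.
by rewrite normrM (ger0_norm (w0 x)).
Qed.

(** The signed case follows by positive and negative parts; the weight, being nonnegative, commutes
    with both. *)
Lemma subst_I Phi w f : subst_ok Phi w -> ig f ->
 I (fun x => w x * f (Phi x)) = I f.
move=> ok If; have Iw := subst_ig ok If; have [mP mw w0 H] := ok.
have mf := ig_measurable If.
rewrite /I /Rintegral; congr fine.
rewrite [LHS]integralE [RHS]integralE.
have mE : measurable_fun setT (EFin \o f) by exact/measurable_EFinP.
congr (_ - _)%E; rewrite [RHS]H.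
- apply: eq_integral => x _; rewrite !funeposE /=.
 rewrite -!EFin_max -EFinM; congr (_%:E).
 by rewrite maxr_pMr ?w0 // mulr0.
- exact: measurable_funepos.
- by move=> y; smt.
- apply: eq_integral => x _; rewrite !funenegE /= -!EFin_max -EFinM; congr (_%:E).
 by rewrite maxr_pMr ?w0 // mulr0 mulrN.
- exact: measurable_funeneg.
- by move=> y; smt.
Qed.

End PlaneIntegral.

#[local] Hint Resolve igD igZ igN igB ig_abs ig0 : plane.

(** * Euclidean and sup norms, smooth functions on the plane *)

Section PlaneGeometry.
Implicit Types (x y z : pl) (f g : pl -> R).

(** Squared Euclidean norm. Being polynomial it is smooth at 0 as well, so radial functions are
    written in terms of it rather than of [enorm]. *)
Definition nsq x : R := x.1 ^+ 2 + x.2 ^+ 2.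

Lemma dot_nsq x : dot x x = nsq x.
by rewrite /dot big_ord_recl big_ord1 /coord2 /nsq /= !expr2.
Qed.

Lemma nsq_ge0 x : 0 <= nsq x.
by rewrite addr_ge0 ?sqr_ge0. Qed.

Lemma enormE x : enorm x = Num.sqrt (nsq x).
by rewrite /enorm dot_nsq. Qed.

Lemma enorm_ge0 x : 0 <= enorm x.
by rewrite enormE sqrtr_ge0. Qed.

Lemma sqr_enorm x : enorm x ^+ 2 = nsq x.
by rewrite enormE sqr_sqrtr // nsq_ge0. Qed.

Lemma nsqZ (c : R) x : nsq (c *: x) = c ^+ 2 * nsq x.
by rewrite /nsq /= /GRing.scale /= !exprMn mulrDr. Qed.

Lemma nsq0 : nsq 0 = 0.
by rewrite /nsq /= expr0n /= addr0. Qed.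

Lemma nsqN x : nsq (- x) = nsq x.
by rewrite /nsq /= !sqrrN. Qed.

Lemma norm_planeE x : `|x| = Num.max `|x.1| `|x.2|.
exact: prod_normE. Qed.

Lemma norm1_le x : `|x.1| <= `|x|.
by rewrite norm_planeE le_max lexx. Qed.

Lemma norm2_le x : `|x.2| <= `|x|.
by rewrite norm_planeE le_max lexx orbT. Qed.

Lemma nsq_le_norm x : nsq x <= 2 * `|x| ^+ 2.
have h1 : x.1 ^+ 2 <= `|x| ^+ 2.
 by rewrite -(real_normK (num_real x.1)) lerXn2r ?nnegrE ?norm1_le.
have h2 : x.2 ^+ 2 <= `|x| ^+ 2.
 by rewrite -(real_normK (num_real x.2)) lerXn2r ?nnegrE ?norm2_le.
rewrite /nsq; lra.
Qed.

Lemma norm_le_nsq x : `|x| ^+ 2 <= nsq x.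
rewrite norm_planeE /nsq.
have [_|_] := leP `|x.1| `|x.2|; rewrite real_normK ?num_real //.
 by rewrite lerDr sqr_ge0.
by rewrite lerDl sqr_ge0.
Qed.

Lemma norm_lt_nsq x (N : R) : 0 <= N -> nsq x < N ^+ 2 -> `|x| < N.
move=> N0 H; rewrite -(@ltr_pXn2r _ 2) ?nnegrE //.
exact: le_lt_trans (norm_le_nsq x) H.
Qed.

Lemma cont_fst_plane : continuous (fun x : pl => x.1).
by move=> x; exact: cvg_fst. Qed.

Lemma cont_snd_plane : continuous (fun x : pl => x.2).
by move=> x; exact: cvg_snd. Qed.

Lemma der_fst x (v : pl) : is_derive x v (fun x : pl => x.1) v.1.
apply/der_line.
have : is_derive (0 : R) 1 (fun h : R => h * v.1 + x.1) (1 * v.1 + id 0 * 0 + 0).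
 by apply: der_add; apply: der_mul.
rewrite mulr0 !addr0 mul1r => H.
exact: H.
Qed.

Lemma der_snd x (v : pl) : is_derive x v (fun x : pl => x.2) v.2.
apply/der_line.
have : is_derive (0 : R) 1 (fun h : R => h * v.2 + x.2) (1 * v.2 + id 0 * 0 + 0).
 by apply: der_add; apply: der_mul.
rewrite mulr0 !addr0 mul1r => H.
exact: H.
Qed.

Lemma sm2_fst : sm2 (fun x => x.1).
apply: smoothI => [|i]; first exact: cont_fst_plane.
exists (fun=> (e_ i).1); first smt.
by move=> x; exact: der_fst.
Qed.

Lemma sm2_snd : sm2 (fun x => x.2).
apply: smoothI => [|i]; first exact: cont_snd_plane.
exists (fun=> (e_ i).2); first smt.
by move=> x; exact: der_snd.
Qed.

Lemma sm2_partials f s : sm2 f -> sm2 (partials s f).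
by move=> sf; elim: s => //= i s IH; smt. Qed.

Lemma partials_rcons f s i : partials (rcons s i) f = partials s ('D_(e_ i) f).
by rewrite /partials foldr_rcons. Qed.

(** [partials] applies the head of a word last, whereas [Cn] peels off the derivative applied first;
    [partials_rcons] reconciles the two orders. *)
Lemma smooth2P f : smooth2 f <-> sm2 f.
split=> [H n|sf s]; last first.
 split; first exact/smooth_cont/sm2_partials.
 by move=> i x; exact/smooth_derivable/sm2_partials.
elim: n f H => [f H|n IH f H]; first by have [] := H [::].
split; first by have [] := H [::].
move=> i; split; first by have [_] := H [::].
by apply: IH => s; rewrite -partials_rcons; exact: H.
Qed.

Lemma sm2_nsq : sm2 nsq.
by apply: smooth_add; apply: smooth_exp; [exact: sm2_fst|exact: sm2_snd]. Qed.

Lemma cont_nsq : continuous nsq.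
exact: smooth_cont sm2_nsq. Qed.

Lemma der_nsq x (v : pl) :
 is_derive x v nsq (2 * (x.1 * v.1 + x.2 * v.2)).
have H : is_derive x v (fun x => x.1 * x.1 + x.2 * x.2)
 ((v.1 * x.1 + x.1 * v.1) + (v.2 * x.2 + x.2 * v.2)).
 by apply: der_add; apply: der_mul;
  (exact: der_fst || exact: der_snd).
rewrite (_ : nsq = fun x : pl => x.1 * x.1 + x.2 * x.2); last first.
 smt.
by apply: is_derive_eq H _; ring.
Qed.

Lemma der_shift_plane f (z x v : pl) df :
 is_derive (x + z) v f df -> is_derive x v (fun y => f (y + z)) df.
move=> /der_line H; apply/der_line.
rewrite (_ : (fun h => _) = (fun h : R => f (h *: v + (x + z)))) //.
by apply/funext => h; rewrite addrA.
Qed.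

Lemma cont_shift_plane f z : continuous f -> continuous (fun y => f (y + z)).
move=> cf x; apply: (@continuous_comp _ _ _ (fun y : pl => y + z) f); last exact: cf.
by apply: cvgD; [exact: cvg_id|exact: cvg_cst].
Qed.

Lemma sm2_shift f z : sm2 f -> sm2 (fun y => f (y + z)).
move=> sf n; elim: n f sf => [|n IH] f sf.
 exact/cont_shift_plane/smooth_cont.
split; first exact/cont_shift_plane/smooth_cont.
move=> i; have D x := der_shift_plane (smooth_der i (x + z) sf).
split; first by smt.
rewrite (_ : (fun x => 'D_(e_ i) (fun y => f (y + z)) x) =
 fun x => 'D_(e_ i) f (x + z)).
 by apply: (IH (fun x => 'D_(e_ i) f x)); smt.
by apply/funext => x; case: (D x).
Qed.

End PlaneGeometry.

(** * Functions of bounded support *)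

Section BoundedSupport.
Local Notation lam := (@lebesgue_measure R).
Local Notation mu := (mu2 R).
Implicit Types (f g : pl -> R) (x y h : pl).

Definition bsupp f : Prop := exists N : R, forall x, N < `|x| -> f x = 0.

Lemma bsuppW f g : bsupp f -> (forall x, f x = 0 -> g x = 0) -> bsupp g.
by move=> [N H] fg; exists N => x /H /fg. Qed.

Lemma bsupp_add f g : bsupp f -> bsupp g -> bsupp (fun x => f x + g x).
move=> [N H] [M K]; exists (Num.max N M) => x; rewrite gt_max => /andP[a b].
by rewrite H // K // addr0.
Qed.

Lemma bsuppMl f g : bsupp f -> bsupp (fun x => f x * g x).
by move=> bf; apply: bsuppW bf _ => x ->; lra. Qed.

Lemma bsuppMr f g : bsupp g -> bsupp (fun x => f x * g x).
by move=> bf; apply: bsuppW bf _ => x ->; lra. Qed.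

Lemma bsupp_shift f h : bsupp f -> bsupp (fun x => f (x + h)).
move=> [N H]; exists (N + `|h|) => x Hx; apply: H.
rewrite -ltrBrDr in Hx; apply: lt_le_trans Hx _.
by rewrite lerBlDr -{1}(addrK h x) ler_normB.
Qed.

Lemma cball_compact (N : R) : compact [set x : pl | `|x| <= N].
have -> : [set x : pl | `|x| <= N] = (`[- N, N] `*` `[- N, N])%classic.
 apply/seteqP; split=> x /=; rewrite !in_itv /= norm_planeE ge_max !ler_norml.
  lra.
 lra.
exact: compact_setX (@segment_compact _ _ _) (@segment_compact _ _ _).
Qed.

Lemma closed_bounded_compact (A : set pl) (N : R) : closed A ->
 (forall x, A x -> `|x| <= N) -> compact A.
by move=> cA H; exact: subclosed_compact cA (@cball_compact N) H. Qed.

Lemma cont_bounded_on f (K : set pl) : continuous f -> compact K ->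
 exists M : R, forall x, K x -> `|f x| <= M.
move=> cf cK.
have /compact_bounded[M [_ H]] : compact (f @` K).
 by apply: continuous_compact => //; exact: continuous_subspaceT.
exists (M + 1) => x Kx; apply: (H (M + 1)); first by lra.
by exists x.
Qed.

Lemma bsupp_bounded f : continuous f -> bsupp f ->
 exists2 M : R, 0 < M & forall x, `|f x| <= M.
move=> cf [N H]; have [M K] := cont_bounded_on cf (@cball_compact N).
exists (`|M| + 1); first by smt.
move=> x; have [le|/H ->] := leP `|x| N; last by rewrite normr0 addr_ge0.
by rewrite (le_trans (K x le)) // (le_trans (ler_norm M)) // lerDl.
Qed.

Lemma mu_cball_lty (N : R) : (mu [set x : pl | (`|x| <= N)%R] < +oo)%E.
have -> : [set x : pl | `|x| <= N] = (`[- N, N] `*` `[- N, N])%classic.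
 apply/seteqP; split=> x /=; rewrite !in_itv /= norm_planeE ge_max !ler_norml.
  lra.
 lra.
rewrite (_ : mu _ = (lam `[(- N)%R, N]%classic * lam `[(- N)%R, N]%classic)%E); last first.
 exact: (@product_measure1E _ _ _ _ _ lam lam).
rewrite lebesgue_measure_itv /=.
by case: ifP => _; rewrite ?mule0 ?ltry // -EFinB -EFinM ltry.
Qed.

Lemma cball_measurable (N : R) : measurable [set x : pl | `|x| <= N].
have -> : [set x : pl | `|x| <= N] = (`[- N, N] `*` `[- N, N])%classic.
 apply/seteqP; split=> x /=; rewrite !in_itv /= norm_planeE ge_max !ler_norml.
  lra.
 lra.
exact: measurableX.
Qed.

Lemma ig_bounded f (M : R) : measurable_fun setT f -> bsupp f ->
 (forall x, `|f x| <= M) -> ig f.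
move=> mf [N H] fM; set K := [set x : pl | `|x| <= N].
have KI : mu.-integrable K (EFin \o f).
 apply: measurable_bounded_integrable; first exact: cball_measurable.
 - exact: mu_cball_lty.
 - exact: measurable_funTS.
 - by exists M; split; [exact: num_real|move=> z Mz x _; exact: le_trans (fM x) (ltW Mz)].
move/(integrable_mkcond _ (cball_measurable N)) : KI.
rewrite /ig (_ : (EFin \o f) \_ K = EFin \o f) //.
apply/funext => x; rewrite patchE /=; case: ifPn => // /negP; rewrite inE /K /= => /negP.
by rewrite -ltNge => /H ->.
Qed.

Lemma ig_continuous f : continuous f -> bsupp f -> ig f.
move=> cf bf; have [M _ H] := bsupp_bounded cf bf.
apply: ig_bounded bf H; exact: cont_measurable.
Qed.

Lemma ig_mul_bounded f g (M : R) : measurable_fun setT f ->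
 (forall x, `|f x| <= M) -> ig g -> ig (fun x => f x * g x).
move=> mf H Ig; apply: (@ig_le _ (fun x => M * `|g x|)).
- by apply: measurable_funM => //; exact: ig_measurable.
- by apply: igZ; exact: ig_abs.
- by move=> x; rewrite normrM ler_wpM2r.
Qed.

Lemma ig_mul_continuous f g : continuous f -> bsupp f -> ig g ->
 ig (fun x => f x * g x).
move=> cf bf Ig; have [M _ H] := bsupp_bounded cf bf.
by apply: ig_mul_bounded H Ig; exact: cont_measurable.
Qed.

Lemma subst_translate h : subst_ok (fun x : pl => x + h) (fun=> 1).
have H1 : subst_ok (fun x : pl => (x.1 + h.1, x.2)) (fun=> 1).
 apply: subst_ok_fst => //.
 - by move=> x; have := der_add (der_fst x (e_ o_0)) (is_derive_cst h.1 x (e_ o_0)); rewrite addr0.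
 - by move=> x; apply: cvgD; [exact: cvg_fst|exact: cvg_cst].
 - by move=> x; exact: cvg_cst.
 - by move=> x c; exists (c - h.1); rewrite /= subrK.
have H2 : subst_ok (fun x : pl => (x.1, x.2 + h.2)) (fun=> 1).
 apply: subst_ok_snd => //.
 - by move=> x; have := der_add (der_snd x (e_ o_1)) (is_derive_cst h.2 x (e_ o_1)); rewrite addr0.
 - by move=> x; apply: cvgD; [exact: cvg_snd|exact: cvg_cst].
 - by move=> x; exact: cvg_cst.
 - by move=> x c; exists (c - h.2); rewrite /= subrK.
have := subst_ok_comp H1 H2; rewrite /= mulr1.
smt.
Qed.

Lemma subst_scale (c : R) : 0 < c -> subst_ok (fun x : pl => c *: x) (fun=> c ^+ 2).
move=> c0.
have H1 : subst_ok (fun x : pl => (c * x.1, x.2)) (fun=> c).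
 apply: subst_ok_fst => //.
 - by move=> x; have := der_mul (is_derive_cst c x (e_ o_0)) (der_fst x (e_ o_0)); rewrite /= mul0r add0r mulr1.
 - by move=> x; apply: cvgM; [exact: cvg_cst|exact: cvg_fst].
 - by move=> x; exact: cvg_cst.
 - by move=> x d; exists (c^-1 * d); rewrite /= mulVKf // gt_eqF.
have H2 : subst_ok (fun x : pl => (x.1, c * x.2)) (fun=> c).
 apply: subst_ok_snd => //.
 - by move=> x; have := der_mul (is_derive_cst c x (e_ o_1)) (der_snd x (e_ o_1)); rewrite /= mul0r add0r mulr1.
 - by move=> x; apply: cvgM; [exact: cvg_cst|exact: cvg_snd].
 - by move=> x; exact: cvg_cst.
 - by move=> x d; exists (c^-1 * d); rewrite /= mulVKf // gt_eqF.
have := subst_ok_comp H1 H2; rewrite /= -expr2.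
smt.
Qed.

Lemma ig_translate f h : ig f -> ig (fun x => f (x + h)).
move=> /(subst_ig (subst_translate h)).
by rewrite (_ : (fun x => _) = fun x => f (x + h)) //; apply/funext => x; lra.
Qed.

Lemma I_translate f h : ig f -> I (fun x => f (x + h)) = I f.
move=> If; rewrite -(subst_I (subst_translate h) If); congr (I _).
by apply/funext => x; lra.
Qed.

Lemma ig_scale f (c : R) : 0 < c -> ig f -> ig (fun x => f (c *: x)).
move=> c0 /(subst_ig (subst_scale c0)) /(igZ (c ^+ 2)^-1).
rewrite (_ : (fun x => _) = fun x => f (c *: x)) //; apply/funext => x.
by rewrite mulKf // expf_neq0 // gt_eqF.
Qed.

Lemma I_scale f (c : R) : 0 < c -> ig f -> I (fun x => f (c *: x)) = (c ^+ 2)^-1 * I f.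
move=> c0 If; rewrite -(subst_I (subst_scale c0) If) IZ; last exact: ig_scale.
by rewrite mulKf // expf_neq0 // gt_eqF.
Qed.

Lemma line_integral_derive0 (p w : R -> R) (N : R) :
 (forall x : R, is_derive x 1 p (w x)) -> continuous w ->
 (forall x : R, N < `|x| -> p x = 0) -> (forall x : R, N < `|x| -> w x = 0) ->
 (\int[lam]_x (w x)%:E = 0)%E.
move=> Dp cw p0 w0; set M := `|N| + 1.
have M0 : 0 < M by rewrite /M ltr_wpDl.
have NM : N < M by rewrite /M (le_lt_trans (ler_norm N)) // ltrDl.
have cp : continuous p.
 by move=> x; apply/differentiable_continuous/derivable1_diffP; smt.
have := @continuous_FTC2 R w p (- M) M.
rewrite (p0 M) ?(p0 (- M)) ?normrN ?gtr0_norm // subee // => H.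
rewrite -H //.
- rewrite [RHS]integral_mkcond; apply: eq_integral => x _; rewrite patchE.
 case: ifPn => // /negP; rewrite inE /= in_itv /= -ler_norml => /negP.
 by rewrite -ltNge => Mx; rewrite w0 // (lt_trans NM).
- lra.
- exact: continuous_subspaceT.
- split.
 + by move=> x _; smt.
 + by apply: cvg_at_right_filter; exact: cp.
 + by apply: cvg_at_left_filter; exact: cp.
- by move=> x _; rewrite derive1E; have [_ ->] := Dp x.
Qed.

Lemma derive_bsupp f (v : pl) (N : R) : (forall x, N < `|x| -> f x = 0) ->
 forall x, N < `|x| -> 'D_v f x = 0.
move=> H x Nx; rewrite (@near_eq_derive _ _ _ _ (fun=> 0)) ?derive_cst //.
have : (fun y : pl => `|y|) y @[y --> x] --> `|x|.
 exact: (@norm_continuous _ _ x).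
move=> /(_ [set z | N < z]) => Hn.
have : \forall y \near x, N < `|y|.
 by apply: Hn; exact: lt_nbhsr.
by apply: filterS => y; exact: H.
Qed.

(** By Fubini the integral is an iterated one, and the inner integral on each line vanishes by the
    fundamental theorem of calculus. *)
Lemma I_derive0 f (i : 'I_2) : (forall x, derivable f x (e_ i)) ->
 continuous ('D_(e_ i) f) -> bsupp f -> I ('D_(e_ i) f) = 0.
move=> df cdf [N fN]; have dN := fun x => derive_bsupp (e_ i) fN (x := x).
have Ig : ig ('D_(e_ i) f).
 by apply: ig_continuous => //; exists N.
rewrite /I /Rintegral.
have nE s t : N < `|s| -> N < `|((s, t) : pl)|.
 by move=> H; rewrite norm_planeE lt_max H.
have nE' s t : N < `|t| -> N < `|((s, t) : pl)|.
 by move=> H; rewrite norm_planeE lt_max H orbT.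
have [i0|i1] : i = o_0 \/ i = o_1.
 by case: i {df cdf dN Ig} => [[|[|//]]] Hi; [left|right]; exact: val_inj.
- subst i; rewrite -(@integral21_prod_meas1 _ _ _ _ _ lam lam) // /fubini_G.
 rewrite (eq_integral (fun=> 0)%E) ?integral0 // => t _ /=.
 apply: (@line_integral_derive0 (fun s => f (s, t)) (fun s => 'D_(e_ o_0) f (s, t)) N).
 + move=> x; have /der_line H := derivableP (df (x, t)).
  apply/der_line.
  rewrite [X in is_derive _ _ X _](_ : _ = (fun h : R => f (h *: e_ o_0 + (x, t)))) //.
  apply/funext => h; congr f; rewrite /basis2 /=.
  by congr (_, _); rewrite /= ?scaler0 ?add0r // [h *: 1]mulr1.
 + move=> x; apply: (@continuous_comp _ _ _ (fun x : R => (x, t) : pl) ('D_(e_ o_0) f)); last exact: cdf.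
  by apply: (@cvg_pair _ _ _ _ (nbhs x) (nbhs t) _ _ _ id (cst t));
   [exact: cvg_id|exact: cvg_cst].
 + by move=> x /nE H; exact: fN.
 + by move=> x /nE H; exact: dN.
- subst i; rewrite -(@integral12_prod_meas1 _ _ _ _ _ lam lam) // /fubini_F.
 rewrite (eq_integral (fun=> 0)%E) ?integral0 // => t _ /=.
 apply: (@line_integral_derive0 (fun s => f (t, s)) (fun s => 'D_(e_ o_1) f (t, s)) N).
 + move=> x; have /der_line H := derivableP (df (t, x)).
  apply/der_line.
  rewrite [X in is_derive _ _ X _](_ : _ = (fun h : R => f (h *: e_ o_1 + (t, x)))) //.
  apply/funext => h; congr f; rewrite /basis2 /=.
  by congr (_, _); rewrite /= ?scaler0 ?add0r // [h *: 1]mulr1.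
 + move=> x; apply: (@continuous_comp _ _ _ (fun x : R => (t, x) : pl) ('D_(e_ o_1) f)); last exact: cdf.
  by apply: (@cvg_pair _ _ _ _ (nbhs t) (nbhs x) _ _ _ (cst t) id);
   [exact: cvg_cst|exact: cvg_id].
 + by move=> x /nE' H; exact: fN.
 + by move=> x /nE' H; exact: dN.
Qed.

End BoundedSupport.

#[local] Hint Resolve cont_fst_plane cont_snd_plane sm2_fst sm2_snd sm2_partials sm2_nsq cont_nsq cont_shift_plane sm2_shift bsupp_add bsuppMl bsuppMr bsupp_shift ig_continuous ig_mul_continuous ig_translate ig_scale : plane.

(** * Smooth functions that are flat at 0 *)

Section FlatFunction.
Implicit Types (P Q : {poly R}) (t x : R).

(** Induction over the polynomial: each factor x costs half of the exponential rate, because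
    [x <= (2 / a) exp (a x / 2)]. *)
Lemma poly_le_expR Q (a : R) : 0 < a ->
 exists C : R, forall x, 0 <= x -> `|Q.[x]| <= C * expR (a * x).
elim/poly_ind: Q a => [a a0|Q c IH a a0].
 by exists 0 => x _; rewrite horner0 normr0 mul0r.
have a20 : 0 < a / 2 by smt.
have [C HC] := IH _ a20; exists (C * (2 / a) + `|c|) => x x0.
rewrite hornerMXaddC (le_trans (ler_normD _ _)) // mulrDl lerD //; last first.
 by rewrite ler_peMr // -expR0 ler_expR mulr_ge0 // ltW.
rewrite normrM (ger0_norm x0).
have h1 : x <= 2 / a * expR (a / 2 * x).
 rewrite mulrC -ler_pdivrMr ?divr_gt0 // invf_div mulrC.
 by apply: le_trans (expR_ge1Dx _); lra.
apply: (@le_trans _ _ ((C * expR (a / 2 * x)) * (2 / a * expR (a / 2 * x)))).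
 by apply: ler_pM => //; exact: HC.
rewrite le_eqVlt; apply/orP; left; apply/eqP.
have -> : expR (a * x) = expR (a / 2 * x) * expR (a / 2 * x).
 by rewrite -expRD; congr expR; field.
by ring.
Qed.

(** The classical [exp (- 1/t)] extended by 0, with a polynomial prefactor in [1/t]: the enlarged
    family is closed under differentiation, which turns smoothness into an induction. *)
Definition flat P t : R := if 0 < t then P.[t^-1] * expR (- t^-1) else 0.

Lemma der_horner Q x : is_derive x 1 (horner Q) (Q^`().[x]).
apply: DeriveDef; first smt.
by rewrite -derive1E -derivE.
Qed.

Lemma der_flat P t :
 is_derive t 1 (flat P) (flat ('X^2 * (P - P^`())) t).
have [t0|t0|<-] := ltgtP 0 t.
- have H : is_derive t 1 (fun s => P.[s^-1] * expR (- s^-1))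
   ((P^`().[t^-1] * - (1 / t ^+ 2)) * expR (- t^-1)
    + P.[t^-1] * (expR (- t^-1) * - (- (1 / t ^+ 2)))).
  have Hi : is_derive t 1 (fun s : R => s^-1) (- (1 / t ^+ 2)).
   by apply: (@der_inv _ (fun s : R => s)); lra.
  exact: (der_mul
   (@der_comp _ (horner P) _ _ _ _ _ Hi (der_horner _ _))
   (@der_comp _ (@expR R) _ _ _ _ _ (der_opp Hi) (is_derive_expR _))).
 have N : \forall s \near t, P.[s^-1] * expR (- s^-1) = flat P s.
  near=> s; rewrite /flat ifT //; near: s; exact: lt_nbhsr.
 have := near_eq_is_derive N H; move/is_derive_eq; apply.
 rewrite /flat t0 hornerM hornerXn hornerD hornerN exprVn.
 by field; rewrite gt_eqF.
- have N : \forall s \near t, (fun=> 0) s = flat P s.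
  near=> s; rewrite /flat ifF //; apply/negbTE; rewrite -leNgt ltW //.
  by near: s; exact: lt_nbhsl.
 have := near_eq_is_derive N (is_derive_cst 0 t 1); move/is_derive_eq; apply.
 by rewrite /flat ltNge (ltW t0).
(* At 0 the difference quotient is h times [h^-2 P(h^-1) exp (- h^-1)], and the second factor is
   bounded because the exponential dominates polynomials. *)
- have [C HC] := @poly_le_expR ('X^2 * P) 1 ltr01.
 have Cb h : h != 0 -> `|h^-1 *: (flat P (h *: 1 + 0) - flat P 0)| <= `|C| * `|h|.
  move=> h0; rewrite /flat ltxx subr0 addr0 [h *: 1]mulr1.
  case: ltP => hp; last by rewrite scaler0 normr0 mulr_ge0.
  have ih : 0 <= h^-1 by smt.
  have := HC _ ih; rewrite mul1r hornerM hornerXn => H.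
  rewrite /GRing.scale /= !normrM !(gtr0_norm (expR_gt0 _)) (ger0_norm ih) (gtr0_norm hp).
  have {H} : `|h^-1 ^+ 2 * P.[h^-1]| * expR (- h^-1) <= `|C|.
   rewrite expRN ler_pdivrMr ?expR_gt0 // (le_trans H) // ler_wpM2r ?expR_ge0 //.
   exact: ler_norm.
  rewrite normrM (ger0_norm (exprn_ge0 2 ih)) => H.
  have -> : h^-1 * (`|P.[h^-1]| * expR (- h^-1)) =
    h * (h^-1 ^+ 2 * `|P.[h^-1]| * expR (- h^-1)).
   by field; rewrite gt_eqF.
  by rewrite mulrC ler_wpM2r // ltW.
 have L : (fun h => h^-1 *: (flat P (h *: 1 + 0) - flat P 0)) @ 0^' --> (0 : R).
  apply/cvgrPdist_le => e e0; near=> h; rewrite sub0r normrN.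
  have hn0 : h != 0 by near: h; exact: nbhs_dnbhs_neq.
  rewrite (le_trans (Cb h hn0)) //.
  have C1 : 0 < `|C| + 1 by smt.
  have he : `|h| <= e / (`|C| + 1).
   near: h; apply: dnbhs0_le; exact: divr_gt0.
  rewrite (@le_trans _ _ ((`|C| + 1) * `|h|)) ?ler_wpM2r ?lerDl //.
  by rewrite mulrC -ler_pdivlMr.
 apply: DeriveDef; first by apply/cvg_ex; exists 0.
 rewrite [RHS]/flat ltxx /derive; apply: cvg_lim => //; exact: L.
Unshelve. all: by end_near. Qed.

Lemma smoothR_flat P : smoothR (flat P).
move=> n; elim: n P => [|n IH] P.
 by move=> t; apply/differentiable_continuous/derivable1_diffP; case: (der_flat P t).
split; first by move=> t; apply/differentiable_continuous/derivable1_diffP; case: (der_flat P t).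
move=> _; split; first by move=> t; case: (der_flat P t).
rewrite (_ : (fun x => 'D_1 (flat P) x) = flat ('X^2 * (P - P^`()))) //.
by apply/funext => t; case: (der_flat P t).
Qed.

Definition theta := flat 1.

Lemma thetaE t : theta t = if 0 < t then expR (- t^-1) else 0.
by rewrite /theta /flat hornerC mul1r. Qed.

Lemma theta_ge0 t : 0 <= theta t.
by rewrite thetaE; case: ifP => // _; smt. Qed.

Lemma theta_gt0 t : 0 < t -> 0 < theta t.
by rewrite thetaE => ->; exact: expR_gt0. Qed.

Lemma theta_le0 t : t <= 0 -> theta t = 0.
by rewrite thetaE ltNge => ->. Qed.

Lemma theta_nd s t : s <= t -> theta s <= theta t.
move=> st; have [s0|s0] := leP s 0; first by rewrite (theta_le0 s0) theta_ge0.
have t0 := lt_le_trans s0 st.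
by rewrite !thetaE s0 t0 ler_expR lerN2 lef_pV2 ?posrE.
Qed.

End FlatFunction.

(** * A smooth cutoff *)

Section Cutoff.
Implicit Types t : R.
Local Notation th := (@theta).

(** Equal to 1 up to 1/2 and to 0 from 1 on, and nonincreasing. The quotient is smooth because the
    two summands of the denominator never vanish together. It is mostly applied to squared
    distances. *)
Definition cut t : R := th (1 - t) / (th (1 - t) + th (t - 2^-1)).

Lemma cut_den t : 0 < th (1 - t) + th (t - 2^-1).
have [H|H] := ltP t 1; first by rewrite ltr_wpDr ?theta_ge0 // theta_gt0 // subr_gt0.
by rewrite ltr_wpDl ?theta_ge0 // theta_gt0 // subr_gt0 (lt_le_trans _ H) //; lra.
Qed.

Lemma cut_ge0 t : 0 <= cut t.
by rewrite divr_ge0 ?theta_ge0 // ltW // cut_den. Qed.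

Lemma cut_le1 t : cut t <= 1.
by rewrite ler_pdivrMr ?cut_den // mul1r lerDl theta_ge0. Qed.

Lemma cut1 t : t <= 2^-1 -> cut t = 1.
move=> H; rewrite /cut (@theta_le0 (t - _)) ?subr_le0 // addr0 divff //.
by rewrite gt_eqF // theta_gt0 //; lra.
Qed.

Lemma cut0 t : 1 <= t -> cut t = 0.
by move=> H; rewrite /cut (@theta_le0 (1 - t)) ?subr_le0 // mul0r. Qed.

Lemma cut_ni s t : s <= t -> cut t <= cut s.
move=> st; rewrite /cut ler_pdivrMr ?cut_den // mulrAC ler_pdivlMr ?cut_den //.
have a : th (1 - t) <= th (1 - s) by apply: theta_nd; lra.
have b : th (s - 2^-1) <= th (t - 2^-1) by apply: theta_nd; lra.
rewrite !mulrDr (mulrC (th (1 - t)) (th (1 - s))) lerD2l.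
by apply: ler_pM => //; exact: theta_ge0.
Qed.

Lemma smoothR_affine (a b : R) : smoothR (fun t : R => a * t + b).
apply: smooth_add; last smt.
by apply: smooth_mul; smt.
Qed.

Lemma smoothR_cut : smoothR cut.
have h1 : smoothR (fun t => th (1 - t)).
 rewrite (_ : (fun t => _) = fun t => th (-1 * t + 1)); last first.
  by apply/funext => t; rewrite mulN1r addrC.
 by apply: smooth_comp; [exact: smoothR_flat|exact: smoothR_affine].
have h2 : smoothR (fun t => th (t - 2^-1)).
 rewrite (_ : (fun t => _) = fun t => th (1 * t + - 2^-1)); last first.
  by apply/funext => t; rewrite mul1r.
 by apply: smooth_comp; [exact: smoothR_flat|exact: smoothR_affine].
apply: smooth_mul => //; apply: smooth_inv; first smt.
by move=> t; rewrite gt_eqF // cut_den.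
Qed.

Lemma derive_near_cst (f : R -> R) (c t : R) : (\forall s \near t, f s = c) -> 'D_1 f t = 0.
move=> H; rewrite (@near_eq_derive _ _ _ _ (fun=> c)) ?derive_cst //.
Qed.

Lemma dcut_lo t : t < 2^-1 -> 'D_1 cut t = 0.
move=> H; apply: (@derive_near_cst _ 1); near=> s; apply: cut1; apply: ltW.
by near: s; exact: lt_nbhsl.
Unshelve. all: by end_near. Qed.

Lemma dcut_hi t : 1 < t -> 'D_1 cut t = 0.
move=> H; apply: (@derive_near_cst _ 0); near=> s; apply: cut0; apply: ltW.
by near: s; exact: lt_nbhsr.
Unshelve. all: by end_near. Qed.

(** A positive derivative would contradict monotonicity. The sign enters the positivity of [kc]. *)
Lemma dcut_le0 t : 'D_1 cut t <= 0.
rewrite leNgt; apply/negP => H.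
have [dc] := smoothR_der t smoothR_cut.
move=> _.
have L : (fun h => h^-1 *: (cut (h *: 1 + t) - cut t)) @ 0^' --> 'D_1 cut t by exact: dc.
have : \forall h \near 0^', 0 < h^-1 *: (cut (h *: 1 + t) - cut t).
 exact: (cvgr_gt _ L).
move=> Hn; have [h [h0 hp]] : exists h, h != 0 /\ 0 < h^-1 *: (cut (h *: 1 + t) - cut t).
 have : \forall h \near 0^', h != 0 /\ 0 < h^-1 *: (cut (h *: 1 + t) - cut t).
  near=> h; split; first by near: h; exact: nbhs_dnbhs_neq.
  by near: h.
 by move=> /filter_ex[h Hh]; exists h.
move: hp; rewrite [h *: 1]mulr1 /GRing.scale /=.
have [hp|hn|E] := ltgtP h 0; last by lra.
- rewrite nmulr_rgt0 ?invr_lt0 // subr_lt0 ltNge cut_ni //.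
 by rewrite gerDr ltW.
- rewrite pmulr_rgt0 ?invr_gt0 // subr_gt0 ltNge cut_ni //.
 by rewrite lerDr ltW.
Unshelve. all: by end_near. Qed.

End Cutoff.

(** * Test functions *)

Section TestFunctions.
Implicit Types (x y : pl) (f g phi : pl -> R) (Omega K : set pl).
Local Notation mu := (mu2 R).

(** Vanishing outside a compact subset, in place of a condition on the closure of the support: this
    form passes directly to sums, products and derivatives. *)
Definition csupp Omega f : Prop :=
 exists K, [/\ compact K, K `<=` Omega & forall x, ~ K x -> f x = 0].

Lemma csupp_bsupp Omega f : csupp Omega f -> bsupp f.
move=> [K [cK _ H]]; have [M [_ HM]] := compact_bounded cK.
exists (M + 1) => x Hx; apply: H => Kx.
have := HM (M + 1); rewrite ltrDl ltr01 => /(_ isT x Kx) /=.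
lra.
Qed.

Lemma testP Omega phi : test_function Omega phi <->
 sm2 phi /\ csupp Omega phi.
split=> [[/smooth2P sp cp pO]|[sp [K [cK KO pK]]]].
 split=> //; exists (closure [set x | phi x != 0]); split=> // x nx.
 apply/eqP/negPn/negP => px; apply: nx; exact: subset_closure.
have cl : closure [set x | phi x != 0] `<=` K.
 have clK : closed K by apply: compact_closed => //; smt.
 rewrite (closure_id K).1 //; apply: closure_subset => x /= px.
 by apply: contrapT => /pK E; lra.
split; first exact/smooth2P.
- apply: (subclosed_compact _ cK cl); exact: closed_closure.
- by move=> x /cl /KO.
Qed.

Lemma csupp_partials Omega f s : csupp Omega f -> csupp Omega (partials s f).
move=> [K [cK KO H]]; exists K; split=> //.
elim: s => [|i s IH] //= x nKx.
have oK : open (~` K).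
 by apply: closed_openC; apply: compact_closed => //; smt.
rewrite (@near_eq_derive _ _ _ _ (fun=> 0)) ?derive_cst //.
by apply: filterS (oK _ nKx) => y; exact: IH.
Qed.

Lemma csuppMr Omega f g : csupp Omega g -> csupp Omega (fun x => f x * g x).
by move=> [K [? ? H]]; exists K; split=> // x /H ->; lra. Qed.

Lemma csuppD Omega f g : csupp Omega f -> csupp Omega g ->
 csupp Omega (fun x => f x + g x).
move=> [K [cK KO H]] [L [cL LO H']]; exists (K `|` L); split=> //.
- exact: compactU.
- by move=> x [/KO|/LO].
- by move=> x nx; rewrite H ?H' ?addr0 // => ?; apply: nx; [right|left].
Qed.

Lemma test_partials Omega phi s : test_function Omega phi ->
 test_function Omega (partials s phi).
move=> /testP[sp cp]; apply/testP; split; first smt.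
exact: csupp_partials.
Qed.

Lemma testM Omega phi f : test_function Omega phi -> sm2 f ->
 test_function Omega (fun x => f x * phi x).
move=> /testP[sp cp] sf; apply/testP; split; first smt.
exact: csuppMr.
Qed.

Lemma testD Omega phi psi : test_function Omega phi -> test_function Omega psi ->
 test_function Omega (fun x => phi x + psi x).
move=> /testP[sp cp] /testP[sq cq]; apply/testP.
by split; [exact: smooth_add|exact: csuppD].
Qed.

Lemma testZ Omega phi (c : R) : test_function Omega phi ->
 test_function Omega (fun x => c * phi x).
by move=> tp; apply: testM => //; smt. Qed.

Lemma sm2_radial (h : R -> R) (x0 : pl) : smoothR h -> sm2 (fun x => h (nsq (x - x0))).
move=> sh; apply: (@smooth_comp _ _ _ h (fun x => nsq (x - x0))) => //.
smt.
Qed.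

Lemma cdisk_compact (x0 : pl) (N : R) : compact [set x | nsq (x - x0) <= N].
apply: (@closed_bounded_compact _ (`|x0| + (`|N| + 1))).
 have c : continuous (fun x : pl => nsq (x - x0)).
  smt.
 have -> : [set x | nsq (x - x0) <= N] = (fun x => nsq (x - x0)) @^-1` [set t | t <= N] by [].
 by apply: closed_comp => [x _|]; smt.
move=> x /= H.
rewrite -[x in `|x|](subrK x0) addrC (le_trans (ler_normD _ _)) // lerD2l ltW //.
apply: norm_lt_nsq; first by smt.
rewrite (le_lt_trans H) // (le_lt_trans (ler_norm N)) // sqrrD1.
by rewrite -addrA ltr_wpDl ?sqr_ge0 //; have := normr_ge0 N; lra.
Qed.

Lemma test_radial Omega (h : R -> R) (x0 : pl) (N : R) : smoothR h ->
 (forall t, N < t -> h t = 0) -> [set x | nsq (x - x0) <= N] `<=` Omega ->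
 test_function Omega (fun x => h (nsq (x - x0))).
move=> sh h0 S; apply/testP; split; first exact: sm2_radial.
exists [set x | nsq (x - x0) <= N]; split=> //; first exact: cdisk_compact.
by move=> x /= /negP; rewrite -ltNge; exact: h0.
Qed.

Lemma I_gt0 f (x0 : pl) : continuous f -> bsupp f -> (forall x, 0 <= f x) ->
 0 < f x0 -> 0 < I f.
move=> cf bf f0 fx.
have If := ig_continuous cf bf.
have : \forall y \near x0, f x0 / 2 < f y.
 by have := cf x0; move/cvgr_gt; apply; lra.
move=> /nbhs_ballP[e /= e0 He].
pose B := ((ball x0.1 e : set R) `*` (ball x0.2 e : set R)).
have mB : measurable B.
 by apply: measurableX; apply: open_measurable; exact: ball_open.
have muB : (mu B = (e *+ 2 * (e *+ 2))%:E)%E.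
 transitivity ((@lebesgue_measure R) (ball x0.1 e) * (@lebesgue_measure R) (ball x0.2 e))%E.
  by apply: (@product_measure1E _ _ _ _ _ (@lebesgue_measure R) (@lebesgue_measure R));
   apply: open_measurable; exact: ball_open.
 by rewrite !lebesgue_measure_ball // ltW.
have H1 : (\int[mu]_(x in B) (f x0 / 2)%:E <= \int[mu]_x (f x)%:E)%E.
 rewrite integral_mkcond; apply: ge0_le_integral => //.
 - move=> x _; rewrite patchE; case: ifP => // _.
  by rewrite lee_fin divr_ge0 // ltW.
 - apply/(measurable_restrictT _ mB); smt.
 - by apply/measurable_EFinP; exact: cont_measurable.
 - move=> x _; rewrite patchE; case: ifPn => [|_]; last by rewrite lee_fin.
  rewrite inE => -[x1 x2]; rewrite lee_fin ltW //; exact: He.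
rewrite integral_cst // muB -EFinM I_EFin // lee_fin in H1.
apply: lt_le_trans H1; rewrite mulr_gt0 ?divr_gt0 // mulr_gt0 // pmulrn_lgt0 //.
Qed.

End TestFunctions.

#[local] Hint Resolve smoothR_flat smoothR_affine smoothR_cut csupp_bsupp testP test_partials testM testD testZ sm2_radial : plane.

(** * Density of Lipschitz functions in L^1 *)

Section Density.
Local Notation mu := (mu2 R).
Implicit Types (x y : pl) (f g G : pl -> R) (E F : set pl).

Lemma ball_planeE x y (e : R) : ball x e y = (`|x - y| < e) :> Prop.
by rewrite ball_prod_normE. Qed.

Lemma near_plane x (P : set pl) (e : R) : 0 < e ->
 (forall y, `|x - y| < e -> P y) -> nbhs x P.
move=> e0 H; apply/nbhs_ballP; exists e => //= y.
by rewrite ball_planeE; exact: H.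
Qed.

Lemma I_dominated (f_ : nat -> pl -> R) f g :
 (forall n, measurable_fun setT (f_ n)) -> ig g ->
 (forall n x, `|f_ n x| <= g x) ->
 (forall x, f_ n x @[n --> \oo] --> f x) ->
 ig f /\ I (fun x => `|f_ n x - f x|) @[n --> \oo] --> (0 : R).
move=> mf Ig fg cv.
have mlim : measurable_fun setT f.
 exact: (measurable_fun_cvg mf (fun x _ => cv x)).
have := @dominated_convergence _ (pl) R mu setT measurableT
 (fun n x => (f_ n x)%:E) (EFin \o f) (EFin \o g).
case.
- by move=> n; apply/measurable_EFinP.
- exact/measurable_EFinP.
- by apply: aeW => x _; apply/fine_cvgP; split; [exact: nearW|exact: cv].
- exact: Ig.
- by apply: aeW => x n _; rewrite lee_fin.
by move=> If /fine_cvgP[_ H] _; split.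
Qed.

Lemma I_cvg_dominated (f_ : nat -> pl -> R) f g :
 (forall n, measurable_fun setT (f_ n)) -> ig g ->
 (forall n x, `|f_ n x| <= g x) ->
 (forall x, f_ n x @[n --> \oo] --> f x) ->
 ig f /\ I (f_ n) @[n --> \oo] --> I f.
move=> mf Ig fg cv; have [If H] := I_dominated mf Ig fg cv; split=> //.
have Ifn n : ig (f_ n) by exact: ig_le (mf n) Ig (fg n).
apply/cvgrPdist_le => e e0.
move/cvgrPdist_le : H => /(_ e e0); apply: filterS => n.
rewrite sub0r normrN => H; rewrite distrC -IB //.
rewrite (le_trans (I_abs _)) //; first exact: igB.
by rewrite (le_trans _ H) // ler_norm.
Qed.

Definition lipb f : Prop :=
 bsupp f /\ exists2 L : R, 0 <= L & forall x y, `|f x - f y| <= L * `|x - y|.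

Lemma lipb_continuous f : lipb f -> continuous f.
move=> [_ [L L0 H]] x; apply/cvgrPdist_le => e e0.
have L1 : 0 < L + 1 by smt.
apply: (@near_plane x _ (e / (L + 1))); first exact: divr_gt0.
move=> y; rewrite ltr_pdivlMr // => Hy.
rewrite (le_trans (H x y)) // (le_trans _ (ltW Hy)) // mulrC.
by rewrite ler_wpM2l // lerDl.
Qed.

Lemma lipb_ig f : lipb f -> ig f.
by move=> lf; apply: ig_continuous; [exact: lipb_continuous|case: lf]. Qed.

Lemma lipbD f g : lipb f -> lipb g -> lipb (fun x => f x + g x).
move=> [bf [L L0 HL]] [bg [M M0 HM]]; split; first smt.
exists (L + M); first smt.
move=> x y; rewrite mulrDl opprD addrACA (le_trans (ler_normD _ _)) //.
by rewrite lerD.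
Qed.

Lemma lipbZ (c : R) f : lipb f -> lipb (fun x => c * f x).
move=> [bf [L L0 HL]]; split; first smt.
exists (`|c| * L); first smt.
by move=> x y; rewrite -mulrBr normrM -mulrA ler_wpM2l.
Qed.

Lemma lipb0 : lipb (fun=> 0).
by split; [exists 0|exists 0 => // x y; rewrite subrr normr0 mul0r]. Qed.

(** The approximants are Lipschitz with bounded support, which is what the convergence of
    mollifications and the continuity under small shears rest on. *)
Definition near1 G : Prop := ig G /\
 forall e : R, 0 < e -> exists f, lipb f /\ I (fun x => `|G x - f x|) <= e.

Lemma near1D f g : near1 f -> near1 g -> near1 (fun x => f x + g x).
move=> [If Hf] [Ig Hg]; split; first exact: igD.
move=> e e0; have e20 : 0 < e / 2 by smt.
have [a [la Ha]] := Hf _ e20; have [b [lb Hb]] := Hg _ e20.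
exists (fun x => a x + b x); split; first exact: lipbD.
have Ia := lipb_ig la; have Ib := lipb_ig lb.
apply: (@le_trans _ _ (I (fun x => `|f x - a x| + `|g x - b x|))).
 apply: I_le.
 - by apply: ig_abs; apply: igB; apply: igD.
 - by apply: igD; apply: ig_abs; apply: igB.
 - by move=> x; rewrite opprD addrACA ler_normD.
rewrite ID; [|by apply: ig_abs; apply: igB..].
lra.
Qed.

Lemma near1Z (c : R) f : near1 f -> near1 (fun x => c * f x).
move=> [If Hf]; split; first exact: igZ.
move=> e e0; have c1 : 0 < `|c| + 1 by smt.
have [a [la Ha]] := Hf _ (divr_gt0 e0 c1).
exists (fun x => c * a x); split; first exact: lipbZ.
rewrite (_ : (fun x => _) = fun x => `|c| * `|f x - a x|); last first.
 by apply/funext => x; rewrite -mulrBr normrM.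
rewrite IZ; last by apply: ig_abs; apply: igB => //; exact: lipb_ig.
apply: (@le_trans _ _ ((`|c| + 1) * I (fun x => `|f x - a x|))).
 by rewrite ler_wpM2r ?I_ge0 // lerDl.
by rewrite mulrC -ler_pdivlMr.
Qed.

Lemma near1B f g : near1 f -> near1 g -> near1 (fun x => f x - g x).
move=> nf ng; rewrite (_ : (fun x => _) = fun x => f x + -1 * g x).
 by apply: near1D => //; exact: near1Z.
by apply/funext => x; lra.
Qed.

Lemma near1_0 : near1 (fun=> 0).
split; first exact: ig0.
move=> e e0; exists (fun=> 0); split; first exact: lipb0.
by rewrite subrr normr0 I0 ltW.
Qed.

Lemma near1_sum (J : Type) (s : seq J) (h : J -> pl -> R) :
 (forall j, near1 (h j)) -> near1 (fun x => \sum_(j <- s) h j x).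
move=> H; elim: s => [|j s IH].
 by rewrite (_ : (fun x => _) = fun=> 0); [exact: near1_0|apply/funext => x; rewrite big_nil].
rewrite (_ : (fun x => _) = fun x => h j x + \sum_(j <- s) h j x); first exact: near1D.
by apply/funext => x; rewrite big_cons.
Qed.

Lemma near1_lim G : ig G ->
 (forall e : R, 0 < e -> exists g, near1 g /\ I (fun x => `|G x - g x|) <= e) -> near1 G.
move=> IG H; split=> // e e0; have e20 : 0 < e / 2 by smt.
have [g [[Ig Hg] Hgg]] := H _ e20; have [f [lf Hf]] := Hg _ e20.
exists f; split=> //; have If := lipb_ig lf.
apply: (@le_trans _ _ (I (fun x => `|G x - g x| + `|g x - f x|))).
 apply: I_le.
 - by apply: ig_abs; apply: igB.
 - by apply: igD; apply: ig_abs; apply: igB.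
 - by move=> x; rewrite (le_trans _ (ler_normD _ _)) // addrA subrK.
rewrite ID; [|by apply: ig_abs; apply: igB..].
lra.
Qed.

Definition clamp (t : R) : R := Num.max 0 (Num.min 1 t).

Lemma clamp_ge0 t : 0 <= clamp t.
by rewrite le_max lexx. Qed.

Lemma clamp_le1 t : clamp t <= 1.
by rewrite ge_max ler01 ge_min lexx. Qed.

Lemma clamp_le0 t : t <= 0 -> clamp t = 0.
move=> t0; apply/max_idPl; rewrite ge_min t0 orbT //.
Qed.

Lemma clamp_ge1 t : 1 <= t -> clamp t = 1.
by move=> t1; rewrite /clamp (min_idPl t1); apply/max_idPr. Qed.

Lemma clamp_lip s t : `|clamp s - clamp t| <= `|s - t|.
rewrite /clamp; case: (ltP 1 s) => a; case: (ltP 1 t) => b;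
 rewrite ?(min_idPl (ltW a)) ?(min_idPr a) ?(min_idPl (ltW b)) ?(min_idPr b);
 rewrite ?(max_idPr ler01) ?subrr ?normr0 //;
 do ?(case: (ltP 0 s) => c); do ?(case: (ltP 0 t) => d);
 rewrite ?subrr ?normr0 //; rewrite ?ler_normr ?ler_norml; lra.
Qed.

(** A trapezoid rising on [[a, a + 1/(n+1)]] and falling on [[b, b + 1/(n+1)]]. It tends pointwise
    to the indicator of the half-open interval from a to b, and such intervals generate the Borel
    sets. *)
Definition trap (a b : R) (n : nat) (t : R) : R :=
 clamp (n.+1%:R * (t - a)) * clamp (1 - n.+1%:R * (t - b)).

Lemma trap_ge0 a b n t : 0 <= trap a b n t.
by rewrite mulr_ge0 ?clamp_ge0. Qed.

Lemma trap_le1 a b n t : trap a b n t <= 1.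
by rewrite mulr_ile1 ?clamp_ge0 ?clamp_le1. Qed.

Lemma prod_lip (p q r s : R) : `|p| <= 1 -> `|s| <= 1 ->
 `|p * q - r * s| <= `|q - s| + `|p - r|.
move=> p1 s1; have -> : p * q - r * s = p * (q - s) + (p - r) * s by ring.
rewrite (le_trans (ler_normD _ _)) // !normrM lerD //.
 by rewrite ler_piMl.
by rewrite ler_piMr.
Qed.

Lemma trap_lip a b n s t : `|trap a b n s - trap a b n t| <= 2 * n.+1%:R * `|s - t|.
have c1 u : `|clamp u| <= 1 by rewrite ger0_norm ?clamp_ge0 ?clamp_le1.
rewrite (le_trans (prod_lip _ _ (c1 _) (c1 _))) //.
rewrite -mulrA (_ : 2 * _ = n.+1%:R * `|s - t| + n.+1%:R * `|s - t|); last by ring.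
rewrite lerD // (le_trans (clamp_lip _ _)) //.
- rewrite (_ : _ - _ = n.+1%:R * (t - s)); last by ring.
 by rewrite normrM distrC ger0_norm.
- rewrite (_ : _ - _ = n.+1%:R * (s - t)); last by ring.
 by rewrite normrM ger0_norm.
Qed.

Lemma trap_supp a b n t : trap a b n t != 0 -> a <= t <= b + 1.
move=> H; apply/andP; split; rewrite leNgt; apply/negP => K; move: H.
 rewrite /trap clamp_le0 ?mul0r ?eqxx // mulr_ge0_le0 // subr_le0 ltW //.
rewrite /trap [X in _ * X]clamp_le0 ?mulr0 ?eqxx // subr_le0.
have n1 : 1 <= n.+1%:R :> R by rewrite ler1n.
have : 1 <= t - b by lra.
by move=> tb; rewrite (le_trans tb) // ler_peMl //; lra.
Qed.

Lemma trap_cvg a b t : trap a b n t @[n --> \oo] --> (\1_(`]a, b]%classic) t : R).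
have big (d : R) : 0 < d -> \forall n \near \oo, 1 <= n.+1%:R * d.
 move=> d0; near=> n.
 rewrite -ler_pdivrMr // mul1r.
 have : d^-1 <= n%:R by near: n; exact: nbhs_infty_ger.
 by move=> /le_trans; apply; rewrite ler_nat.
have [ta|ta] := leP t a.
 rewrite indicE memNset /=; last by rewrite in_itv /= ltNge ta.
 rewrite (_ : (fun n => _) = fun=> 0); first exact: cvg_cst.
 by apply/funext => n; rewrite /trap clamp_le0 ?mul0r // mulr_ge0_le0 // subr_le0.
have [tb|tb] := leP t b.
 rewrite indicE mem_set /=; last by rewrite in_itv /= ta.
 apply: cvg_near_cst.
 near=> n; rewrite /trap clamp_ge1; last first.
  by near: n; apply: big; rewrite subr_gt0.
 rewrite clamp_ge1 ?mul1r // lerDl oppr_ge0 mulr_ge0_le0 // subr_le0 //.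
rewrite indicE memNset /=; last by rewrite in_itv /= (leNgt t) tb andbF.
apply: cvg_near_cst.
near=> n; rewrite /trap [X in _ * X]clamp_le0 ?mulr0 // subr_le0.
by near: n; apply: big; rewrite subr_gt0.
Unshelve. all: by end_near. Qed.

Lemma ig_cball (N : R) : ig (fun x => \1_[set x : pl | `|x| <= N] x : R).
apply: (@ig_bounded _ 1).
- by apply: measurable_indic; exact: cball_measurable.
- exists N => x Nx; rewrite indicE memNset //= => H.
 lra.
- by move=> x; rewrite indicE; case: (_ \in _); rewrite ?normr1 ?normr0.
Qed.

Lemma near1_rect (a b c d : R) :
 near1 (\1_(`]a, b] `*` `]c, d])%classic : pl -> R).
pose f n x := trap a b n x.1 * trap c d n x.2.
pose N := Num.max (Num.max `|a| `|b + 1|) (Num.max `|c| `|d + 1|).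
have supp n x : N < `|x| -> f n x = 0.
 rewrite /N norm_planeE gt_max !gt_max => /andP[/andP[h1 h2] /andP[h3 h4]].
 rewrite /f; have [le|lt] := leP `|x.1| `|x.2|.
  rewrite (max_idPr le) in h3 h4; rewrite mulrC.
  have [->|/trap_supp/andP[u v]] := eqVneq (trap c d n x.2) 0; first by lra.
  exfalso; move: h3 h4; have [p|p] := leP 0 x.2.
   rewrite (ger0_norm p) => _; rewrite ltNge (le_trans v) // ler_norm //.
  rewrite (ltr0_norm p) => h; rewrite ltNge (le_trans _ (ler_norm _)) //.
  by move: h; rewrite ltNge -normrN (le_trans _ (ler_norm _)) // lerN2.
 rewrite (max_idPl (ltW lt)) in h1 h2.
 have [->|/trap_supp/andP[u v]] := eqVneq (trap a b n x.1) 0; first by lra.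
 exfalso; move: h1 h2; have [p|p] := leP 0 x.1.
  rewrite (ger0_norm p) => _; rewrite ltNge (le_trans v) // ler_norm //.
 rewrite (ltr0_norm p) => h; rewrite ltNge (le_trans _ (ler_norm _)) //.
 by move: h; rewrite ltNge -normrN (le_trans _ (ler_norm _)) // lerN2.
have t1 a' b' n t : `|trap a' b' n t| <= 1.
 by rewrite ger0_norm ?trap_ge0 ?trap_le1.
have lf n : lipb (f n).
 split; first by exists N => x; exact: supp.
 exists (2 * n.+1%:R + 2 * n.+1%:R); first by smt.
 move=> x y; rewrite (le_trans (prod_lip _ _ (t1 _ _ _ _) (t1 _ _ _ _))) //.
 rewrite mulrDl lerD // (le_trans (trap_lip _ _ _ _ _)) // ler_wpM2l ?mulr_ge0 //.
  exact: (norm2_le (x - y)).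
 exact: (norm1_le (x - y)).
have cv x : f n x @[n --> \oo] --> (\1_(`]a, b] `*` `]c, d])%classic x : R).
 have -> : (\1_(`]a, b] `*` `]c, d])%classic x : R) =
   \1_(`]a, b]%classic) x.1 * \1_(`]c, d]%classic) x.2.
  rewrite !indicE -natrM; congr (_%:R).
  rewrite mulnb; congr nat_of_bool; apply/idP/andP.
   by rewrite !inE /= => -[].
  by rewrite !inE /= => -[].
 by apply: cvgM; exact: trap_cvg.
have K1 : ig (fun x => \1_[set x : pl | `|x| <= N] x : R).
 exact: ig_cball.
have [|If H] := @I_dominated f _ _ (fun n => cont_measurable (lipb_continuous (lf n))) K1 _ cv.
 move=> n x; rewrite indicE; have [le|lt] := leP `|x| N.
  by rewrite mem_set //= normrM mulr_ile1.
 by rewrite supp // normr0.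
split=> // e e0; move/cvgrPdist_le : H => /(_ e e0) /filter_ex[n Hn].
exists (f n); split=> //; move: Hn; rewrite sub0r normrN => /(le_trans (ler_norm _)).
by rewrite (_ : (fun x => `|f n x - _|) = fun x => `|\1_(`]a, b] `*` `]c, d])%classic x - f n x|) //;
 apply/funext => x; rewrite distrC.
Qed.

Lemma near1_bigcup (F : nat -> set pl) (N : R) :
 (forall n, measurable (F n)) -> trivIset setT F ->
 (forall n, F n `<=` [set x | `|x| <= N]) ->
 (forall n, near1 (\1_(F n) : pl -> R)) ->
 near1 (\1_(\bigcup_k F k) : pl -> R).
move=> mF tF FK nF.
pose s n x : R := \sum_(k < n) \1_(F k) x.
have s0 x n : (~ exists k, F k x) -> s n x = 0.
 move=> H; apply: big1 => k _; rewrite indicE memNset // => Fk.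
 by apply: H; exists k.
have s1 x k : F k x -> forall n, s n x = (k < n)%:R.
 move=> Fk n; rewrite /s; have [kn|nk] := ltnP k n.
  rewrite (bigD1 (Ordinal kn)) //= indicE mem_set // big1 ?addr0 // => j jk.
  rewrite indicE memNset // => Fj; move/eqP : jk; apply; apply: val_inj => /=.
  by apply: (tF j k) => //; exists x.
 rewrite big1 // => j _; rewrite indicE memNset // => Fj.
 have jk : nat_of_ord j = k by apply: (tF j k) => //; exists x.
 by have := ltn_ord j; rewrite jk ltnNge nk.
have cv x : s n x @[n --> \oo] --> (\1_(\bigcup_k F k) x : R).
 have [[k Fk]|H] := pselect (exists k, F k x).
  rewrite indicE mem_set; last by exists k.
  apply: cvg_near_cst.
  near=> n; rewrite (s1 _ _ Fk) (_ : (k < n)%N = true) //.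
  by near: n; exact: nbhs_infty_gt.
 rewrite indicE memNset; last by move=> [k _ Fk]; apply: H; exists k.
 by rewrite (_ : (fun n => _) = fun=> 0); [exact: cvg_cst|apply/funext => n; rewrite s0].
have K1 : ig (fun x => \1_[set x : pl | `|x| <= N] x : R).
 exact: ig_cball.
have ns n : near1 (s n) by exact: near1_sum.
have [|If H] := @I_dominated s _ _ (fun n => ig_measurable (proj1 (ns n))) K1 _ cv.
 move=> n x; have [[k Fk]|H] := pselect (exists k, F k x).
  rewrite (s1 _ _ Fk) indicE mem_set /=; last exact: (FK k).
  by case: (k < n)%N; rewrite ?normr1 ?normr0.
 by rewrite s0 // normr0 indicE.
apply: near1_lim => // e e0; move/cvgrPdist_le : H => /(_ e e0) /filter_ex[n Hn].
exists (s n); split=> //; move: Hn; rewrite sub0r normrN => /(le_trans (ler_norm _)).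
by rewrite (_ : (fun x => `|s n x - _|) = fun x => `|\1_(\bigcup_k F k) x - s n x|) //;
 apply/funext => x; rewrite distrC.
Unshelve. all: by end_near. Qed.

Definition cube (N : R) : set pl := (`]- N, N] `*` `]- N, N])%classic.

Lemma cube_le N x : cube N x -> `|x| <= N.
move=> [/=]; rewrite !in_itv /= => /andP[a b] /andP[c d].
rewrite norm_planeE ge_max !ler_norml; lra.
Qed.

Lemma near1_setC (E K : set pl) : near1 (\1_K : pl -> R) ->
 near1 (\1_(E `&` K) : pl -> R) -> near1 (\1_(~` E `&` K) : pl -> R).
move=> nK nE; rewrite (_ : (\1_(~` E `&` K) : pl -> R) = fun x => \1_K x - \1_(E `&` K) x).
 exact: near1B.
apply/funext => x; rewrite !indicE !in_setI in_setC.
by case: (x \in E); case: (x \in K); rewrite ?subrr ?subr0.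
Qed.

Let cupI (S : (set pl)^nat) K N : (forall n, measurable (S n)) -> measurable K ->
 (forall x, K x -> `|x| <= N) -> trivIset setT S ->
 (forall n, near1 (\1_(S n `&` K) : pl -> R)) ->
 near1 (\1_((\bigcup_k S k) `&` K) : pl -> R).
move=> mS mK KN tS nS; rewrite setI_bigcupl; apply: (@near1_bigcup _ N) => //.
- by move=> n; exact: measurableI.
- move=> i j _ _ [x [[Si _] [Sj _]]]; apply: (tS i j) => //; by exists x.
- by move=> n x [_ /KN].
Qed.

(** Dynkin's argument three times: in the first factor and in the second one, starting from
    half-open intervals, then over measurable rectangles, which generate the product sigma-algebra.
    Intersecting with a cube keeps every indicator integrable. *)
Lemma near1_indic (E : set pl) N : measurable E ->
 near1 (\1_(E `&` cube N) : pl -> R).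
have mcube : measurable (cube N) by exact: measurableX.
have oc (X Y : set R) : ocitv X -> ocitv Y -> near1 (\1_((X `*` Y) `&` cube N) : pl -> R).
 move=> oX oY; rewrite /cube -setXI.
 have [[a b] _ <-] := ocitvI oX (is_ocitv (- N) N).
 have [[c d] _ <-] := ocitvI oY (is_ocitv (- N) N).
 exact: near1_rect.
have gen : @measurable _ (measurableTypeR R) = <<s (@ocitv R) >> by [].
have st1 (X Y : set R) : measurable X -> ocitv Y -> near1 (\1_((X `*` Y) `&` cube N) : pl -> R).
 move=> mX oY; move: X mX.
 have nT : near1 (\1_((setT `*` Y) `&` cube N) : pl -> R).
  by rewrite /cube -setXI setTI; have [[c d] _ <-] := ocitvI oY (is_ocitv (- N) N);
   exact: near1_rect.
 have mY : measurable (Y : set (measurableTypeR R)) by rewrite gen; exact: sub_sigma_algebra.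
 apply: (@dynkin_induction _ (measurableTypeR R) (@ocitv R)
  (fun X => near1 (\1_((X `*` Y) `&` cube N) : pl -> R))) => //.
 - exact: ocitvI.
 - by move=> X oX; exact: oc.
 - move=> X mX nX.
  have := @near1_setC (X `*` Y) ((setT `*` Y) `&` cube N) nT.
  have -> : (X `*` Y) `&` ((setT `*` Y) `&` cube N) = (X `*` Y) `&` cube N.
   by apply/seteqP; split=> x /=; tauto.
  move=> /(_ nX); congr (near1 (\1_ _)).
  by apply/seteqP; split=> x /=; tauto.
 - move=> S mS tS nS.
  have := @cupI (fun n => S n `*` Y) (cube N) N.
  have -> : \bigcup_k (S k `*` Y) = (\bigcup_k S k) `*` Y.
   apply/seteqP; split=> x /=; first by move=> [k _ [? ?]]; split=> //; exists k.
   by move=> [[k _ ?] ?]; exists k.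
  apply=> //.
  + by move=> n; exact: measurableX.
  + by move=> x; exact: cube_le.
  + move=> i j _ _ [x [[Si _] [Sj _]]]; apply: (tS i j) => //; by exists x.1.
have st2 (X Y : set R) : measurable X -> measurable Y -> near1 (\1_((X `*` Y) `&` cube N) : pl -> R).
 move=> mX mY; move: Y mY.
 have nT : near1 (\1_((X `*` setT) `&` cube N) : pl -> R).
  have := st1 _ _ mX (is_ocitv (- N) N); congr (near1 (\1_ _)).
  by apply/seteqP; split=> x; rewrite /cube /=; tauto.
 apply: (@dynkin_induction _ (measurableTypeR R) (@ocitv R)
  (fun Y => near1 (\1_((X `*` Y) `&` cube N) : pl -> R))) => //.
 - exact: ocitvI.
 - by move=> Y oY; exact: st1.
 - move=> Y mY nY.
  have := @near1_setC (X `*` Y) ((X `*` setT) `&` cube N) nT.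
  have -> : (X `*` Y) `&` ((X `*` setT) `&` cube N) = (X `*` Y) `&` cube N.
   by apply/seteqP; split=> x /=; tauto.
  move=> /(_ nY); congr (near1 (\1_ _)).
  by apply/seteqP; split=> x /=; tauto.
 - move=> S mS tS nS.
  have := @cupI (fun n => X `*` S n) (cube N) N.
  have -> : \bigcup_k (X `*` S k) = X `*` (\bigcup_k S k).
   apply/seteqP; split=> x /=; first by move=> [k _ [? ?]]; split=> //; exists k.
   by move=> [? [k _ ?]]; exists k.
  apply=> //.
  + by move=> n; exact: measurableX.
  + by move=> x; exact: cube_le.
  + move=> i j _ _ [x [[_ Si] [_ Sj]]]; apply: (tS i j) => //; by exists x.2.
have nT : near1 (\1_(cube N) : pl -> R).
 by exact: near1_rect.
have genP := @measurable_prod_measurableType _ _ (measurableTypeR R) (measurableTypeR R).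
move=> mE; have : <<s [set A `*` B | A in @measurable _ (measurableTypeR R) & B in @measurable _ (measurableTypeR R)] >> E.
 by rewrite -genP.
move: E {mE}.
apply: (@dynkin_induction _ (pl) [set A `*` B | A in measurable & B in measurable]
 (fun E => near1 (\1_(E `&` cube N) : pl -> R))).
- exact: genP.
- move=> _ _ [A mA [B mB <-]] [C mC [D mD <-]]; rewrite -setXI.
 by exists (A `&` C); [exact: measurableI|exists (B `&` D) => //; exact: measurableI].
- by rewrite setTI.
- by move=> _ [A mA [B mB <-]]; exact: st2.
- by move=> E mE nE; exact: near1_setC.
- move=> S mS tS nS; apply: (@cupI _ _ N) => //.
 by move=> x; exact: cube_le.
Qed.

End Density.

#[local] Hint Resolve lipb0 ig_cball : plane.

(** * Density of Lipschitz functions in L^2 *)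

Section Density2.
Local Notation mu := (mu2 R).
Implicit Types (x y z : pl) (f g G : pl -> R) (psi : pl -> R).

Lemma bsupp_cube G : bsupp G -> exists N, forall x, ~ cube N x -> G x = 0.
move=> [N H]; exists (`|N| + 1) => x nx; apply: H; rewrite ltNge; apply/negP => le.
apply: nx; have N1 : `|x| < `|N| + 1.
 by rewrite (le_lt_trans le) // (le_lt_trans (ler_norm N)) // ltrDl.
have h1 := le_lt_trans (norm1_le x) N1; have h2 := le_lt_trans (norm2_le x) N1.
move: h1 h2; rewrite !ltr_norml => /andP[a b] /andP[c d].
by split; rewrite /= in_itv /=; lra.
Qed.

Import HBSimple.

Lemma near1_ig G : ig G -> bsupp G -> near1 G.
move=> IG /bsupp_cube[N GN].
have mc : measurable (cube N) by exact: measurableX.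
have IGc : mu.-integrable (cube N) (EFin \o G) by exact: integrableS IG.
have [g [Ig _ cvg0]] := approximation_sfun_integrable mc IGc.
apply: near1_lim => // e e0.
have /fine_cvgP[/= fin] := cvg0.
move=> /cvgrPdist_le /(_ e e0) H.
have /filter_ex[n [Hfin Hn]] : \forall n \near \oo,
  (\int[mu]_(z in cube N) `|(G z)%:E - (g n z)%:E|)%E \is a fin_num /\
  `|0 - fine (\int[mu]_(z in cube N) `|(G z)%:E - (g n z)%:E|)%E| <= e.
 by near=> n; split; near: n.
exists (fun x => g n x * \1_(cube N) x); split.
 have -> : (fun x => g n x * \1_(cube N) x) =
   (fun x => \sum_(r <- finmap.enum_fset (fset_set (range (g n)))) r * \1_(g n @^-1` [set r] `&` cube N) x).
  apply/funext => x; rewrite {1}(fimfunE (g n) x) fsbig_finite //= mulr_suml.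
  by apply: eq_bigr => r _; rewrite -mulrA indicI.
 apply: near1_sum => r; apply: near1Z; apply: near1_indic.
 have mgn : measurable_fun setT (g n : pl -> R) by smt.
 by have := mgn measurableT [set r] (measurable_set1 r); smt.
move: Hn; rewrite sub0r normrN => /(le_trans (ler_norm _)); congr (_ <= _).
rewrite /I /Rintegral; congr fine.
rewrite [LHS]integral_mkcond; apply: eq_integral => x _; rewrite patchE.
case: ifPn => [|/negP]; rewrite inE => Hx.
 by rewrite indicE mem_set // mulr1.
by rewrite GN // indicE memNset // mulr0 subrr normr0.
Unshelve. all: by end_near. Qed.

Definition clip (M t : R) : R := Num.max (- M) (Num.min M t).

Lemma clip_abs (M t : R) : 0 <= M -> `|clip M t| <= M.
move=> M0; rewrite /clip ler_norml le_max lexx /= ge_max ge_min lexx /= andbT.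
lra.
Qed.

Lemma clip_id (M t : R) : `|t| <= M -> clip M t = t.
by rewrite ler_norml => /andP[a b]; rewrite /clip (min_idPr b) (max_idPr a). Qed.

Lemma clip_lip (M s t : R) : 0 <= M -> `|clip M s - clip M t| <= `|s - t|.
move=> M0; rewrite /clip; case: (ltP M s) => a; case: (ltP M t) => b;
 rewrite ?(min_idPl (ltW a)) ?(min_idPr a) ?(min_idPl (ltW b)) ?(min_idPr b);
 have MM : - M <= M by [lra|lra|lra|lra];
 rewrite ?(max_idPr MM) ?subrr ?normr0 //;
 do ?(case: (ltP (- M) s) => c); do ?(case: (ltP (- M) t) => d);
 rewrite ?subrr ?normr0 //; rewrite ?ler_normr ?ler_norml; apply/orP;
 by [left; apply/andP; split; lra|right; apply/andP; split; lra].
Qed.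

Lemma clip_le (M t : R) : 0 <= M -> `|clip M t| <= `|t|.
by move=> M0; have := clip_lip t 0 M0; rewrite [clip M 0]clip_id ?normr0 // !subr0.
Qed.

Lemma measurable_clip M f : measurable_fun setT f -> measurable_fun setT (fun x => clip M (f x)).
move=> mf; apply: measurable_maxr; first smt.
by apply: measurable_minr => //; smt.
Qed.

Lemma lipb_clip M f : 0 <= M -> lipb f -> lipb (fun x => clip M (f x)).
move=> M0 [bf [L L0 HL]]; split.
 by apply: bsuppW bf _ => x ->; rewrite clip_id ?normr0.
by exists L => // x y; rewrite (le_trans (clip_lip _ _ M0)).
Qed.

Lemma measurable_sqr f : measurable_fun setT f -> measurable_fun setT (fun x => f x ^+ 2).
exact: measurable_funX. Qed.

Definition l2 G : Prop := measurable_fun setT G /\ ig (fun x => G x ^+ 2).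

Lemma sqrD_le (a b : R) : (a + b) ^+ 2 <= 2 * a ^+ 2 + 2 * b ^+ 2.
by rewrite -subr_ge0 (_ : _ - _ = (a - b) ^+ 2) ?sqr_ge0 //; ring. Qed.

Lemma sqrB_le (a b : R) : (a - b) ^+ 2 <= 2 * a ^+ 2 + 2 * b ^+ 2.
by have := sqrD_le a (- b); lra. Qed.

Lemma l2D f g : l2 f -> l2 g -> l2 (fun x => f x + g x).
move=> [mf If] [mg Ig]; have m := measurable_funD mf mg; split=> //.
apply: (@ig_le _ (fun x => 2 * f x ^+ 2 + 2 * g x ^+ 2)).
- exact: measurable_sqr.
- by apply: igD; exact: igZ.
- by move=> x; rewrite ger0_norm ?sqr_ge0 // sqrD_le.
Qed.

Lemma l2Z (c : R) f : l2 f -> l2 (fun x => c * f x).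
move=> [mf If]; split; first by apply: measurable_funM => //; smt.
rewrite (_ : (fun x => _) = fun x => c ^+ 2 * f x ^+ 2); first exact: igZ.
by apply/funext => x; lra.
Qed.

Lemma l2N f : l2 f -> l2 (fun x => - f x).
move=> /(l2Z (-1)); rewrite (_ : (fun x => _) = fun x => - f x) //.
by apply/funext => x; lra.
Qed.

Lemma l2B f g : l2 f -> l2 g -> l2 (fun x => f x - g x).
by move=> lf lg; apply: l2D => //; exact: l2N. Qed.

Lemma l2_mul_bounded f g (M : R) : measurable_fun setT f -> (forall x, `|f x| <= M) ->
 l2 g -> l2 (fun x => f x * g x).
move=> mf H [mg Ig]; split; first exact: measurable_funM.
rewrite (_ : (fun x => _) = fun x => f x ^+ 2 * g x ^+ 2); last first.
 by apply/funext => x; lra.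
apply: (@ig_mul_bounded _ _ (M ^+ 2)) => //; first exact: measurable_sqr.
by move=> x; rewrite normrX lerXn2r ?nnegrE // (le_trans _ (H x)).
Qed.

Lemma l2_ig_mul f g : l2 f -> l2 g -> ig (fun x => f x * g x).
move=> [mf If] [mg Ig]; apply: (@ig_le _ (fun x => f x ^+ 2 + g x ^+ 2)).
- exact: measurable_funM.
- exact: igD.
- move=> x; have h1 := sqr_ge0 (f x + g x); have h2 := sqr_ge0 (f x - g x).
 have h3 := sqr_ge0 (f x); have h4 := sqr_ge0 (g x).
 by rewrite ler_norml; lra.
Qed.

Lemma l2_ig f : l2 f -> bsupp f -> ig f.
move=> [mf If] [N H]; apply: (@ig_le _ (fun x => f x ^+ 2 + \1_[set x : pl | `|x| <= N] x)) => //.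
 by apply: igD => //; smt.
move=> x; have [le|lt] := leP `|x| N.
 rewrite indicE mem_set //= -(real_normK (num_real (f x))).
 have := normr_ge0 (f x); set a := `|f x| => a0.
 by rewrite -subr_ge0 (_ : _ - _ = (a - 2^-1) ^+ 2 + 3 / 4);
  [rewrite addr_ge0 ?sqr_ge0|field].
by rewrite H // normr0 addr_ge0 ?sqr_ge0.
Qed.

Lemma l2_continuous f : continuous f -> bsupp f -> l2 f.
move=> cf bf; split; first exact: cont_measurable.
apply: ig_continuous.
 by move=> x; apply: (@continuous_comp _ _ _ f (fun t => t ^+ 2)); [exact: cf|exact: exprn_continuous].
by apply: bsuppW bf _ => x ->; lra.
Qed.

(** Truncate G at height n, approximate the truncation in L^1 and clip the approximant at height n
    as well: the squared error of the second step is then at most [2 n] times its L^1 error. *)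
Lemma near2 G : l2 G -> bsupp G -> forall e : R, 0 < e ->
 exists f, lipb f /\ I (fun x => (G x - f x) ^+ 2) <= e.
move=> lG bG e e0; have [mG IG2] := lG.
pose T n x := clip n%:R (G x).
have cv x : (G x - T n x) ^+ 2 @[n --> \oo] --> (0 : R).
 apply: cvg_near_cst; near=> n.
 rewrite /T clip_id ?subrr ?expr0n //.
 by near: n; exact: nbhs_infty_ger.
have mT n : measurable_fun setT (T n) by exact: measurable_clip.
have [|_ H] := @I_cvg_dominated (fun n x => (G x - T n x) ^+ 2) (fun=> 0)
  (fun x => G x ^+ 2) (fun n => measurable_sqr (measurable_funB mG (mT n))) IG2 _ cv.
 move=> n x; rewrite normrX -[leRHS]real_normK ?num_real //.
 rewrite lerXn2r ?nnegrE // /T.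
 have [le|lt] := leP `|G x| n%:R; first by rewrite clip_id // subrr normr0.
 rewrite /clip; have n0 : (0 : R) <= n%:R by [].
 move: lt; have [p|p] := leP 0 (G x).
  rewrite (ger0_norm p) => h; rewrite (min_idPl (ltW h)) (max_idPr _) ?ger0_norm; lra.
 rewrite (ltr0_norm p) => h.
 have h' : G x <= n%:R by lra.
 rewrite (min_idPr h') (max_idPl _) ?ler0_norm; lra.
rewrite I0 in H; move/cvgrPdist_le : H => /(_ (e / 4)).
rewrite divr_gt0 // => /(_ isT) /filter_ex[n].
rewrite sub0r normrN => /(le_trans (ler_norm _)) Hn.
have bT : bsupp (T n) by apply: bsuppW bG _ => x gx; rewrite /T gx clip_id ?normr0.
have IT : ig (T n).
 by apply: (ig_bounded (M := n%:R)) => // x; exact: clip_abs.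
(* The [+ 1] keeps the divisor positive when n = 0. *)
have n4 : 0 < (n%:R *+ 2 + 1) * 4 :> R by smt.
have [_ /(_ _ (divr_gt0 e0 n4))[f [lf Hf]]] := near1_ig IT bT.
have lc := lipb_clip (ler0n R n) lf.
exists (fun x => clip n%:R (f x)); split=> //.
have cb : bsupp (fun x => T n x - clip n%:R (f x)).
 by apply: bsupp_add => //; apply: bsuppW (proj1 lc) _ => x ->; lra.
have l2c : l2 (fun x => clip n%:R (f x)).
 by apply: l2_continuous; [exact: lipb_continuous|case: lc].
have l2T : l2 (T n).
 split=> //; apply: (ig_le (measurable_sqr (mT n)) IG2) => x.
 rewrite normrX -[leRHS]real_normK ?num_real // lerXn2r ?nnegrE //.
 exact: clip_le.
have l1 := l2B lG l2T; have l3 := l2B l2T l2c; have l4 := l2B lG l2c.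
apply: (@le_trans _ _ (I (fun x => 2 * (G x - T n x) ^+ 2 +
  2 * (T n x - clip n%:R (f x)) ^+ 2))).
 apply: I_le; [by case: l4|by apply: igD; apply: igZ; [case: l1|case: l3]|].
 by move=> x; rewrite (le_trans _ (sqrD_le _ _)) // addrA subrK.
rewrite ID; [|by apply: igZ; case: l1|by apply: igZ; case: l3].
rewrite !IZ; [|by case: l3|by case: l1].
have H2 : I (fun x => (T n x - clip n%:R (f x)) ^+ 2) <= e / 4.
 apply: (@le_trans _ _ (I (fun x => (n%:R *+ 2) * `|T n x - f x|))).
  apply: I_le; [by case: l3|apply: igZ; apply: ig_abs; apply: igB => //; exact: lipb_ig|].
  move=> x; rewrite -(real_normK (num_real _)) expr2; apply: ler_pM => //.
   rewrite (le_trans (ler_normB _ _)) // mulr2n lerD // clip_abs //.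
  have E : T n x = clip n%:R (T n x) by rewrite clip_id // clip_abs.
  by rewrite {1}E; exact: clip_lip.
 rewrite IZ; last by apply: ig_abs; apply: igB => //; exact: lipb_ig.
 apply: (@le_trans _ _ ((n%:R *+ 2 + 1) * I (fun x => `|T n x - f x|))).
  by rewrite ler_wpM2r ?I_ge0 // lerDl.
 move: Hf; rewrite ler_pdivlMr // => Hf; lra.
lra.
Unshelve. all: by end_near. Qed.

End Density2.

(** * Lipschitz bounds from partial derivatives *)

Section Lipschitz.
Implicit Types (x y z : pl) (f g psi : pl -> R).

Lemma mvt_bound (p w : R -> R) (M a b : R) : (forall x : R, is_derive x 1 p (w x)) ->
 (forall x : R, `|w x| <= M) -> `|p a - p b| <= M * `|a - b|.
move=> Dp wM; have cp : continuous p.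
 by move=> x; apply/differentiable_continuous/derivable1_diffP; smt.
wlog ab : a b / a <= b.
 move=> H; have [/H //|/ltW/H] := leP a b.
 by rewrite distrC (distrC b).
have [c _ E] := @MVT_segment R p w a b ab (fun (t : R) _ => Dp t) (continuous_subspaceT cp).
by rewrite distrC E normrM (distrC a b) ler_wpM2r.
Qed.

Lemma der_restr0 f x (t : R) df : is_derive (t, x.2) (e_ o_0) f df ->
 is_derive t 1 (fun s : R => f (s, x.2)) df.
move=> /der_line H; apply/der_line.
rewrite [X in is_derive _ _ X _](_ : _ = (fun h : R => f (h *: e_ o_0 + (t, x.2)))) //.
apply/funext => h; congr f; rewrite /basis2 /=.
by congr (_, _); rewrite /= ?scaler0 ?add0r // [h *: 1]mulr1.
Qed.

Lemma der_restr1 f x (t : R) df : is_derive (x.1, t) (e_ o_1) f df ->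
 is_derive t 1 (fun s : R => f (x.1, s)) df.
move=> /der_line H; apply/der_line.
rewrite [X in is_derive _ _ X _](_ : _ = (fun h : R => f (h *: e_ o_1 + (x.1, t)))) //.
apply/funext => h; congr f; rewrite /basis2 /=.
by congr (_, _); rewrite /= ?scaler0 ?add0r // [h *: 1]mulr1.
Qed.

Lemma lip_of_partials f (M : R) : sm2 f -> (forall i x, `|'D_(e_ i) f x| <= M) ->
 forall x y, `|f x - f y| <= M * (`|x.1 - y.1| + `|x.2 - y.2|).
move=> sf H x y.
have -> : f x - f y = (f (x.1, x.2) - f (y.1, x.2)) + (f (y.1, x.2) - f (y.1, y.2)).
 by rewrite addrA subrK; case: x => ? ?; case: y.
rewrite (le_trans (ler_normD _ _)) // mulrDr lerD //.
 apply: (@mvt_bound (fun t => f (t, x.2)) (fun t => 'D_(e_ o_0) f (t, x.2))) => // t.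
 by apply: (@der_restr0 f x); exact: smooth_der.
apply: (@mvt_bound (fun t => f (y.1, t)) (fun t => 'D_(e_ o_1) f (y.1, t))) => // t.
by apply: (@der_restr1 f y); exact: smooth_der.
Qed.

Lemma bsupp_partials psi s : sm2 psi -> bsupp psi -> bsupp (partials s psi).
move=> sp [N H]; exists N; elim: s => [|i s IH] //= x Nx.
exact: (derive_bsupp (e_ i) IH Nx).
Qed.

Lemma sm2_lipb psi : sm2 psi -> bsupp psi -> lipb psi.
move=> sp bp; split=> //.
have B i : exists2 M, 0 < M & forall x, `|'D_(e_ i) psi x| <= M.
 apply: bsupp_bounded; first exact/smooth_cont/smooth_D.
 exact: (@bsupp_partials psi [:: i]).
have [M0 M00 H0] := B o_0; have [M1 M10 H1] := B o_1.
exists ((M0 + M1) * 2); first by smt.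
move=> x y; rewrite -mulrA.
have Hi i z : `|'D_(e_ i) psi z| <= M0 + M1.
 have [->|->] : i = o_0 \/ i = o_1.
  by case: i => [[|[|//]]] Hi; [left|right]; exact: val_inj.
 - by rewrite (le_trans (H0 z)) // lerDl ltW.
 - by rewrite (le_trans (H1 z)) // lerDr ltW.
rewrite (le_trans (lip_of_partials sp Hi x y)) // ler_wpM2l //.
 smt.
rewrite mulr_natl mulr2n lerD //; [exact: (norm1_le (x - y))|exact: (norm2_le (x - y))].
Qed.

End Lipschitz.

#[local] Hint Resolve l2D l2Z l2N l2B l2_ig_mul l2_ig l2_continuous bsupp_partials sm2_lipb : plane.

(** * Convolution and mollifiers *)

Section Convolution.
Local Notation mu := (mu2 R).
Local Notation lam := (@lebesgue_measure R).
Implicit Types (x y z : pl) (U f g psi : pl -> R).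

Definition conv U psi x : R := I (fun y => U y * psi (x - y)).

Lemma der_along f (df : pl -> R) x (v : pl) (t : R) :
 (forall z, is_derive z v f (df z)) ->
 is_derive t 1 (fun s : R => f (s *: v + x)) (df (t *: v + x)).
move=> /(_ (t *: v + x)) /der_line H; apply/der_line.
rewrite [X in is_derive _ _ X _](_ : _ = (fun h : R => f (h *: v + (t *: v + x)))) //.
by apply/funext => h; rewrite addrA -scalerDl [h *: 1]mulr1.
Qed.

Lemma cont_flip psi x : continuous psi -> continuous (fun y => psi (x - y)).
move=> cp y; apply: (@continuous_comp _ _ _ (fun y : pl => x - y) psi); last exact: cp.
by apply: cvgB; [exact: cvg_cst|exact: cvg_id].
Qed.

Lemma conv_ig U psi x : ig U -> continuous psi -> bsupp psi ->
 ig (fun y => U y * psi (x - y)).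
move=> IU cp bp; have [M _ HM] := bsupp_bounded cp bp.
rewrite (_ : (fun y => _) = fun y => psi (x - y) * U y); last first.
 by apply/funext => y; lra.
apply: (@ig_mul_bounded _ _ M) => //.
by apply: cont_measurable; exact: cont_flip.
Qed.

Lemma conv_is_derive U psi i x : ig U -> sm2 psi -> bsupp psi ->
 is_derive x (e_ i) (conv U psi) (conv U ('D_(e_ i) psi) x).
move=> IU sp bp; pose e := e_ i.
have cD : continuous ('D_e psi) by exact/smooth_cont/smooth_D.
have bD : bsupp ('D_e psi) by exact: (@bsupp_partials psi [:: i]).
have cp := smooth_cont sp.
have [M M0 HM] := bsupp_bounded cD bD.
pose f (t : R) y := U y * psi (t *: e + x - y).
have Df (t : R) y : is_derive t 1 (f ^~ y) (U y * 'D_e psi (t *: e + x - y)).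
 have H := @der_along psi ('D_e psi) (x - y) e t (fun z => smooth_der i z sp).
 have := der_mul (is_derive_cst (U y) t 1) H.
 rewrite mul0r add0r addrA; congr (is_derive _ _ _ _).
 by apply/funext => s; rewrite /f /cst addrA.
have I0 : `]-1, 1[%classic (0 : R) by rewrite /= in_itv /=; lra.
have intf (t : R) : `]-1, 1[%classic t -> mu.-integrable setT (EFin \o f t).
 by move=> _; apply: conv_ig.
have derf (t : R) y : `]-1, 1[%classic t -> setT y -> derivable (f ^~ y) t 1.
 smt.
have G0 y : 0 <= M * `|U y| by smt.
have IG : mu.-integrable setT (EFin \o (fun y => M * `|U y|)).
 by apply: igZ; exact: ig_abs.
have Gub (t : R) y : `]-1, 1[%classic t -> setT y -> `|partial1of2 f t y| <= M * `|U y|.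
 move=> _ _; rewrite partial1of2E; have [_ ->] := Df t y.
 by rewrite normrM mulrC ler_wpM2r.
have H1 := derivable_under_integral measurableT I0 intf derf G0 IG Gub.
have H2 := differentiation_under_integral measurableT I0 intf derf G0 IG Gub.
apply/der_line; apply: DeriveDef.
 exact: H1.
rewrite -derive1E (_ : (fun h : R => conv U psi (h *: e_ i + x)) =
  fun t => \int[mu]_(y in setT) f t y) // H2.
congr (Rintegral _ _ _); apply/funext => y; rewrite partial1of2E; have [_ ->] := Df 0 y.
by rewrite scale0r add0r.
Qed.

Lemma conv_lip U psi (L : R) : ig U -> continuous psi -> bsupp psi ->
 (forall x y, `|psi x - psi y| <= L * `|x - y|) ->
 forall x y, `|conv U psi x - conv U psi y| <= L * I (fun z => `|U z|) * `|x - y|.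
move=> IU cp bp HL x y; rewrite /conv -IB; [|exact: conv_ig..].
rewrite (le_trans (I_abs _)) //; first by apply: igB; exact: conv_ig.
rewrite mulrAC -IZ; last exact: ig_abs.
apply: I_le.
- by apply: ig_abs; apply: igB; exact: conv_ig.
- by apply: igZ; exact: ig_abs.
- move=> z; rewrite -mulrBr normrM mulrC ler_wpM2r // (le_trans (HL _ _)) //.
 by rewrite opprB addrA subrK.
Qed.

Lemma lip_continuous f (L : R) : (forall x y, `|f x - f y| <= L * `|x - y|) -> continuous f.
move=> H x; apply/cvgrPdist_le => e e0.
have L1 : 0 < `|L| + 1 by smt.
apply: (@near_plane x _ (e / (`|L| + 1))); first exact: divr_gt0.
move=> y; rewrite ltr_pdivlMr // => Hy.
rewrite (le_trans (H x y)) // (le_trans _ (ltW Hy)) // mulrC.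
by rewrite ler_wpM2l // (le_trans (ler_norm L)) // lerDl.
Qed.

Lemma conv_continuous U psi : ig U -> lipb psi -> continuous (conv U psi).
move=> IU lp; have [bp [L _ HL]] := lp.
exact: lip_continuous (conv_lip IU (lipb_continuous lp) bp HL).
Qed.

Lemma conv_sm2 U psi : ig U -> sm2 psi -> bsupp psi -> sm2 (conv U psi).
move=> IU sp bp n; elim: n psi sp bp => [|n IH] psi sp bp.
 exact: conv_continuous IU (sm2_lipb sp bp).
split; first exact: conv_continuous IU (sm2_lipb sp bp).
move=> i; have D x := conv_is_derive i x IU sp bp.
split; first by smt.
rewrite (_ : (fun x => 'D_(e_ i) (conv U psi) x) = conv U ('D_(e_ i) psi)).
 apply: IH; first smt.
 exact: (@bsupp_partials psi [:: i]).
by apply/funext => x; case: (D x).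
Qed.

Lemma partials_conv U psi s : ig U -> sm2 psi -> bsupp psi ->
 partials s (conv U psi) = conv U (partials s psi).
move=> IU sp bp; elim: s => //= i s ->; apply/funext => x.
have D := @conv_is_derive U (partials s psi) i x IU (sm2_partials s sp)
 (bsupp_partials s sp bp).
by case: D.
Qed.

Definition mollc : R := I (fun x => cut (nsq x)).

Lemma cut_nsq_sm2 : sm2 (fun x : pl => cut (nsq x)).
by apply: (@smooth_comp _ _ _ (@cut)); smt. Qed.

Lemma cut_nsq_bsupp : bsupp (fun x : pl => cut (nsq x)).
exists 1 => x x1; apply: cut0; apply: le_trans (norm_le_nsq x).
by rewrite -[1](expr1n _ 2) lerXn2r ?nnegrE // ltW.
Qed.

Lemma cut_nsq_ig : ig (fun x : pl => cut (nsq x)).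
by apply: ig_continuous cut_nsq_bsupp; exact: smooth_cont cut_nsq_sm2. Qed.

Lemma mollc_gt0 : 0 < mollc.
apply: (@I_gt0 _ 0).
- exact: smooth_cont cut_nsq_sm2.
- exact: cut_nsq_bsupp.
- by move=> x; exact: cut_ge0.
- by rewrite nsq0 cut1 ?invr_ge0.
Qed.

(** Scale [1/(n+1)] and unit mass. The mollifier is radial, hence even, which lets [conv_evenE]
    write the convolution as an average of translates; radiality is used again for the symmetry of
    second derivatives. *)
Definition moll (n : nat) x : R := mollc^-1 * n.+1%:R ^+ 2 * cut (nsq (n.+1%:R *: x)).

Lemma moll_ge0 n x : 0 <= moll n x.
by rewrite mulr_ge0 ?cut_ge0 // mulr_ge0 ?sqr_ge0 // invr_ge0 ltW // mollc_gt0. Qed.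

Lemma moll_even n x : moll n (- x) = moll n x.
by rewrite /moll scalerN nsqN. Qed.

Lemma moll_sm2 n : sm2 (moll n).
apply: smooth_mul; first smt.
rewrite (_ : (fun x => _) = fun x => cut (n.+1%:R ^+ 2 * nsq x)); last first.
 by apply/funext => x; rewrite nsqZ.
apply: (@smooth_comp _ _ _ (@cut)); first smt.
smt.
Qed.

Lemma moll_supp n x : n.+1%:R^-1 < `|x| -> moll n x = 0.
move=> H; rewrite /moll cut0 ?mulr0 // nsqZ.
have n0 : 0 < n.+1%:R :> R by [].
rewrite -ler_pdivrMl ?exprn_gt0 // mulr1 -exprVn.
apply: le_trans (norm_le_nsq x).
by rewrite lerXn2r ?nnegrE ?invr_ge0 // ltW.
Qed.

Lemma moll_bsupp n : bsupp (moll n).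
by exists n.+1%:R^-1 => x; exact: moll_supp. Qed.

Lemma moll_ig n : ig (moll n).
by apply: ig_continuous (moll_bsupp n); exact: smooth_cont (moll_sm2 n). Qed.

Lemma I_moll n : I (moll n) = 1.
rewrite /moll IZ; last exact: ig_scale cut_nsq_ig.
rewrite (@I_scale (fun x => cut (nsq x))) //; last exact: cut_nsq_ig.
rewrite -/mollc mulrA mulfK ?mulVf ?gt_eqF ?mollc_gt0 ?exprn_gt0 //.
Qed.

#[local] Opaque moll.

Lemma conv_evenE U psi x : ig U -> continuous psi -> bsupp psi ->
 (forall z, psi (- z) = psi z) ->
 ig (fun z => U (z + x) * psi z) /\ conv U psi x = I (fun z => U (z + x) * psi z).
move=> IU cp bp ep; have H := conv_ig x IU cp bp.
have E : (fun z => U (z + x) * psi (x - (z + x))) = fun z => U (z + x) * psi z.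
 by apply/funext => z; rewrite opprD addrCA subrr addr0 ep.
split; first by have := ig_translate x H; rewrite E.
by rewrite /conv -(I_translate x H) E.
Qed.

(** The variance of the translates of U under the probability density [moll n] is nonnegative. *)
Lemma conv_jensen U n x : l2 U -> bsupp U ->
 conv U (moll n) x ^+ 2 <= I (fun z => U (z + x) ^+ 2 * moll n z).
move=> lU bU; have IU := l2_ig lU bU.
have cm := smooth_cont (@moll_sm2 n).
have [I1 E] := @conv_evenE U (moll n) x IU cm (moll_bsupp n) (moll_even n).
set a := conv _ _ x in E *.
have I2 : ig (fun z => U (z + x) ^+ 2 * moll n z).
 by have [] := @conv_evenE (fun y => U y ^+ 2) (moll n) x (proj2 lU) cm (moll_bsupp n) (moll_even n).
have : 0 <= I (fun z => (U (z + x) - a) ^+ 2 * moll n z).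
 by apply: I_ge0 => z; rewrite mulr_ge0 ?sqr_ge0 ?moll_ge0.
rewrite (_ : (fun z => (_ - a) ^+ 2 * _) = fun z => (U (z + x) ^+ 2 * moll n z) +
  ((- 2 * a) * (U (z + x) * moll n z) + a ^+ 2 * moll n z)); last first.
 by apply/funext => z; ring.
have mg := moll_ig n.
rewrite (ID I2 (igD (igZ _ I1) (igZ _ mg))) (ID (igZ _ I1) (igZ _ mg)).
rewrite (IZ _ I1) (IZ _ mg) I_moll -E; lra.
Qed.

Lemma mu2_sigma_finite : sigma_finite setT (mu2 R).
exists (fun n => [set x : pl | `|x| <= n%:R]).
 apply/seteqP; split=> // x _; exists (Num.truncn `|x|).+1 => //=.
 by rewrite ltW // truncnS_gt.
by move=> n; split; [exact: cball_measurable|exact: mu_cball_lty].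
Qed.

(** Tonelli on the product of two planes asks for a sigma-finite measure structure, which is
    attached to [mu2] here. *)
Definition muS : {sigma_finite_measure set pl -> \bar R} :=
 HB.pack_for {sigma_finite_measure set pl -> \bar R}
  (mu2 R : set pl -> \bar R) (Measure.class (mu2 R))
  (Measure_isSigmaFinite.Build _ _ _ (mu2 R) mu2_sigma_finite).

Lemma measurable_add_plane : measurable_fun setT (fun p : pl * pl => p.1 + p.2).
have m1 := @measurable_fst _ _ (pl) (pl).
have m2 := @measurable_snd _ _ (pl) (pl).
have f1 := @measurable_fst _ _ (measurableTypeR R) (measurableTypeR R).
have f2 := @measurable_snd _ _ (measurableTypeR R) (measurableTypeR R).
apply/measurable_fun_pairP; split.
 apply: (measurable_funD (f := fun p : pl * pl => p.1.1) (g := fun p => p.2.1)).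
  exact: measurableT_comp f1 m1.
 exact: measurableT_comp f1 m2.
apply: (measurable_funD (f := fun p : pl * pl => p.1.2) (g := fun p => p.2.2)).
 exact: measurableT_comp f2 m1.
exact: measurableT_comp f2 m2.
Qed.

Lemma conv_young U n : l2 U -> bsupp U ->
 l2 (conv U (moll n)) /\ I (fun x => conv U (moll n) x ^+ 2) <= I (fun x => U x ^+ 2).
move=> lU bU; have IU := l2_ig lU bU; have [mU IU2] := lU.
have cm := smooth_cont (@moll_sm2 n).
have cc : continuous (conv U (moll n)).
 by apply: conv_continuous IU (sm2_lipb (@moll_sm2 n) (moll_bsupp n)).
have mc := cont_measurable cc.
have I2 x : ig (fun z => U (z + x) ^+ 2 * moll n z).
 by have [] := @conv_evenE (fun y => U y ^+ 2) (moll n) x (proj2 lU) cm (moll_bsupp n) (moll_even n).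
have mm : measurable_fun setT (fun p : pl * pl => (U (p.2 + p.1) ^+ 2 * moll n p.2)%:E).
 apply/measurable_EFinP; apply: measurable_funM.
  apply: measurable_funX.
  apply: (measurableT_comp mU).
  rewrite (_ : (fun p : pl * pl => _) = fun p : pl * pl => p.1 + p.2) ; last by apply/funext => p; rewrite addrC.
  exact: measurable_add_plane.
 apply: (measurableT_comp (cont_measurable cm)).
 smt.
have p0 p : (0 <= ((U (p.2 + p.1) ^+ 2 * moll n p.2)%:E : \bar R))%E.
 by rewrite lee_fin mulr_ge0 ?sqr_ge0 ?moll_ge0.
have B : (\int[mu]_x (conv U (moll n) x ^+ 2)%:E <= (I (fun x => U x ^+ 2))%:E)%E.
 apply: (@le_trans _ _ (\int[mu]_x \int[mu]_z (U (z + x) ^+ 2 * moll n z)%:E)%E).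
  apply: ge0_le_integral => //.
  - by move=> x _; rewrite lee_fin sqr_ge0.
  - by apply/measurable_EFinP; exact: measurable_sqr.
  - have H := @measurable_fun_fubini_tonelli_F _ _ (pl) (pl) R muS _ mm p0.
   smt.
  - move=> x _; rewrite I_EFin // lee_fin; exact: conv_jensen.
 have := @fubini_tonelli _ _ (pl) (pl) R muS muS _ mm p0.
 rewrite /= => ->.
 rewrite (eq_integral (fun z => (I (fun x => U x ^+ 2) * moll n z)%:E)); last first.
  move=> z _; transitivity (\int[mu]_x (U (x + z) ^+ 2 * moll n z)%:E)%E.
   by apply: eq_integral => x _; rewrite addrC.
  have It := ig_translate z IU2.
  rewrite I_EFin; last first.
   rewrite (_ : (fun x => _) = fun x => moll n z * U (x + z) ^+ 2); first exact: igZ.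
   by apply/funext => x; lra.
  congr (_%:E); rewrite (_ : (fun x => U (x + z) ^+ 2 * moll n z) = fun x => moll n z * U (x + z) ^+ 2).
   by rewrite IZ // (I_translate z IU2) mulrC.
  by apply/funext => x; lra.
 rewrite [X in (X <= _)%E](_ : _ = (\int[mu]_z (I (fun x => U x ^+ 2) * moll n z)%:E)%E) //.
 rewrite I_EFin; last by apply: igZ; exact: moll_ig.
 by rewrite IZ ?I_moll ?mulr1 //; exact: moll_ig.
have lc : l2 (conv U (moll n)).
 split=> //; apply: ig_ge0; first exact: measurable_sqr.
  by move=> x; smt.
 by apply: le_lt_trans B _; rewrite ltry.
split=> //; rewrite -lee_fin -I_EFin //; by case: lc.
Qed.

Lemma conv_lin U f n x : ig U -> ig f ->
 conv (fun y => U y - f y) (moll n) x = conv U (moll n) x - conv f (moll n) x.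
move=> IU If; have cm := smooth_cont (@moll_sm2 n); have bm := moll_bsupp n.
rewrite /conv -IB; [|exact: conv_ig..].
by congr (I _); apply/funext => y; lra.
Qed.

Lemma conv_approx f n x (L : R) : ig f -> (forall z, `|z| <= n.+1%:R^-1 -> `|f (z + x) - f x| <= L) ->
 `|conv f (moll n) x - f x| <= L.
move=> If H; have cm := smooth_cont (@moll_sm2 n).
have [I1 ->] := @conv_evenE f (moll n) x If cm (moll_bsupp n) (moll_even n).
have I3 : ig (fun z => f x * moll n z) by apply: igZ; exact: moll_ig.
have -> : f x = I (fun z => f x * moll n z) by rewrite IZ ?I_moll ?mulr1 //; exact: moll_ig.
rewrite -IB // (le_trans (I_abs _)) //; first exact: igB.
have -> : L = I (fun z => L * moll n z) by rewrite IZ ?I_moll ?mulr1 //; exact: moll_ig.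
apply: I_le.
- by apply: ig_abs; exact: igB.
- by apply: igZ; exact: moll_ig.
- move=> z; rewrite -mulrBl normrM (ger0_norm (moll_ge0 n z)).
 have [le|lt] := leP `|z| n.+1%:R^-1; last by rewrite moll_supp // !mulr0.
 by rewrite ler_wpM2r ?moll_ge0 ?H.
Qed.

Lemma invn_cvg0 : (fun n => n.+1%:R^-1 : R) @ \oo --> (0 : R).
exact: cvg_harmonic. Qed.

(** For a Lipschitz approximant of G the mollifications are uniformly close on a bounded set; by
    [conv_young] mollifying does not enlarge the error of the approximation. *)
Lemma moll_cvg G : l2 G -> bsupp G ->
 I (fun x => (conv G (moll n) x - G x) ^+ 2) @[n --> \oo] --> (0 : R).
move=> lG bG; apply/cvgrPdist_le => e e0.
(* The three terms below get the coefficients 4, 4 and 2, hence a total of at most 10/12 of e. *)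
have e6 : 0 < e / 12 by smt.
have [f [lf Hf]] := near2 lG bG e6.
have l2f : l2 f by apply: l2_continuous; [exact: lipb_continuous|case: lf].
have [[N HN] [L L0 HL]] := lf.
pose V := I (fun x => \1_[set x : pl | `|x| <= N + 1] x : R).
have V0 : 0 <= V by apply: I_ge0 => x; smt.
have Kc : (fun n => (L * n.+1%:R^-1) ^+ 2 * V) @ \oo --> (0 : R).
 have : (fun n => (L * n.+1%:R^-1) * (L * n.+1%:R^-1) * V) @ \oo --> (L * 0) * (L * 0) * V.
  by do 2 (apply: cvgM; last exact: cvg_cst || (by apply: cvgM; [exact: cvg_cst|exact: invn_cvg0]));
    apply: cvgM; [exact: cvg_cst|exact: invn_cvg0].
 by rewrite mulr0 !mul0r; smt.
move/cvgrPdist_le : Kc => /(_ _ e6).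
apply: filterS => n; rewrite !sub0r !normrN => HV.
rewrite ger0_norm; last by apply: I_ge0 => x; smt.
have IG := l2_ig lG bG; have If := lipb_ig lf.
have lD := l2B lG l2f.
have bD : bsupp (fun x => G x - f x).
 by apply: bsupp_add => //; apply: bsuppW (proj1 lf) _ => x ->; lra.
have [lcD HcD] := @conv_young (fun x => G x - f x) n lD bD.
have [lcG _] := @conv_young G n lG bG.
have [lcf _] := @conv_young f n l2f (proj1 lf).
have lcff := l2B lcf l2f.
have Hff : I (fun x => (conv f (moll n) x - f x) ^+ 2) <= e / 12.
 apply: le_trans (le_trans (ler_norm _) HV); rewrite -IZ; last smt.
 apply: I_le; [by case: lcff|by apply: igZ; exact: ig_cball|].
 move=> x; have [le|lt] := leP `|x| (N + 1).
  rewrite indicE mem_set //= mulr1 -(real_normK (num_real (_ - _))).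
  rewrite lerXn2r ?nnegrE ?mulr_ge0 //.
  apply: conv_approx => // z z1; rewrite (le_trans (HL _ _)) // addrK.
  by rewrite ler_wpM2l.
 rewrite indicE memNset /=; last by move=> H; lra.
 rewrite mulr0 (_ : conv f (moll n) x - f x = 0) ?expr0n //.
 apply/eqP; rewrite -normr_le0; apply: conv_approx => // z z1.
 have n1 : n.+1%:R^-1 <= 1 :> R by rewrite invf_le1 // ler1n.
 rewrite !HN ?subrr ?normr0 //.
  lra.
 have : `|x| <= `|z + x| + `|z|.
  by rewrite -{1}(addKr z x) addrC (le_trans (ler_normB _ _)).
 have z2 := le_trans z1 n1; lra.
apply: (@le_trans _ _ (I (fun x => 4 * conv (fun y => G y - f y) (moll n) x ^+ 2 +
  (4 * (conv f (moll n) x - f x) ^+ 2 + 2 * (G x - f x) ^+ 2)))).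
 apply: I_le.
 - by case: (l2B lcG lG).
 - apply: igD; first by apply: igZ; case: lcD.
  by apply: igD; apply: igZ; [case: lcff|case: lD].
 - move=> x; rewrite conv_lin //.
  set a := conv G _ x; set b := conv f _ x; set p := G x; set q := f x.
  rewrite (_ : a - p = ((a - b) + (b - q)) - (p - q)); last by ring.
  rewrite (le_trans (sqrB_le _ _)) // [leRHS]addrA lerD //.
  by have := sqrD_le (a - b) (b - q); lra.
rewrite ID; [|by apply: igZ; case: lcD|by apply: igD; apply: igZ; [case: lcff|case: lD]].
rewrite ID; [|by apply: igZ; case: lcff|by apply: igZ; case: lD].
rewrite !IZ; [|by case: lD|by case: lcff|by case: lcD].
lra.
Qed.

End Convolution.

#[local] Hint Resolve cont_flip conv_ig lip_continuous conv_sm2 cut_nsq_sm2 cut_nsq_bsupp cut_nsq_ig moll_sm2 moll_bsupp moll_ig conv_young : plane.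

(** * Difference quotients *)

Section DifferenceQuotients.

Lemma derive_le (V : normedModType R) (f : V -> R) (x v : V) (d M h0 : R) : is_derive x v f d -> 0 < h0 ->
 (forall h : R, `|h| < h0 -> `|f (h *: v + x) - f x| <= M * `|h|) -> `|d| <= M.
move=> [df <-] h00 H.
have C : (fun h : R => h^-1 *: ((f \o shift x) (h *: v) - f x)) @ 0^' --> 'D_v f x by exact: df.
apply: (cvgr_to_le (cvg_norm C)); near=> h.
have hn : h != 0 by near: h; exact: nbhs_dnbhs_neq.
rewrite normrZ normfV ler_pdivrMl ?normr_gt0 // mulrC; apply: H.
by near: h; apply: dnbhs0_lt.
Unshelve. all: by end_near. Qed.

Lemma seg_bound_loc (p w : R -> R) (M h : R) : (forall t : R, `|t| <= `|h| -> is_derive t 1 p (w t)) ->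
 (forall t : R, `|t| <= `|h| -> `|w t| <= M) -> `|p h - p 0| <= M * `|h|.
move=> Dp wM.
have cp (A : set R) : (forall t, A t -> `|t| <= `|h|) -> {within A, continuous p}.
 move=> HA; apply: continuous_in_subspaceT => t /set_mem /HA th.
 by have [+ _] := Dp t th; move=> /derivable1_diffP /differentiable_continuous.
have [t0|t0] := leP 0 h.
 have ih t : t \in `[0, h] -> `|t| <= `|h|.
  by rewrite in_itv /= => /andP[? ?]; rewrite !ger0_norm.
 have [||c] := @MVT_segment R p w 0 h t0.
 - by move=> t; rewrite in_itv /= => /andP[? ?]; apply: Dp; rewrite !ger0_norm // ltW.
 - exact: cp.
 by move=> /ih ch ->; rewrite subr0 normrM ler_wpM2r // wM.
have ih t : t \in `[h, 0] -> `|t| <= `|h|.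
 by rewrite in_itv /= => /andP[? ?]; rewrite !ler0_norm // ?lerN2 // ltW.
have [||c] := @MVT_segment R p w h 0 (ltW t0).
- by move=> t; rewrite in_itv /= => /andP[? ?]; apply: Dp; rewrite !ltr0_norm // ?lerN2 // ltW.
- exact: cp.
by move=> /ih ch E; rewrite distrC E sub0r normrM normrN ler_wpM2r // wM.
Qed.

Lemma der_along_at (V : normedModType R) (f : V -> R) (x v : V) (t d : R) :
 is_derive (t *: v + x) v f d -> is_derive t 1 (fun s : R => f (s *: v + x)) d.
move=> /der_line H; apply/der_line.
rewrite (_ : (fun h : R => _) = fun h : R => f (h *: v + (t *: v + x))) //.
by apply/funext => h; rewrite [h *: 1]mulr1 scalerDl addrA.
Qed.

End DifferenceQuotients.

(** * Blow-up sequences *)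

Section BlowupSequences.
Implicit Types (x y z : pl) (u v : pl -> R).

Lemma ball_realE (a b e : R) : ball a e b = (`|a - b| < e) :> Prop.
by rewrite -ball_normE. Qed.

(** The radii and the extraction are merged into one sequence, which still tends to 0 because
    [sigma k >= k]. *)
Lemma blowup_uniform u x0 v : blowup_limit u x0 v -> exists r_ : nat -> R,
 [/\ forall k, 0 < r_ k, r_ k @[k --> \oo] --> (0 : R) &
  forall N e : R, 0 < e -> \forall k \near \oo, forall y, `|y| <= N ->
   `|v y - (r_ k) ^- 2 * u (x0 + r_ k *: y)| < e].
move=> [rho [sigma [r0 rc hs cv]]]; exists (fun k => rho (sigma k)); split.
- by move=> k; exact: r0.
- have sk k : (k <= sigma k)%N by elim: k => // k IH; rewrite (leq_ltn_trans IH) // hs.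
 move/cvgr0Pnorm_le: rc => rc; apply/cvgr0Pnorm_le => e /rc [N _ HN].
 by exists N => // k /= Nk; apply: HN; rewrite /= (leq_trans Nk) // sk.
move=> N e e0.
have cK := @cball_compact N.
have /fam_cvgP/(_ _ cK) cu := cv.
have := cu [set h | forall y, [set x : pl | `|x| <= N] y -> ball (v y) e (h y)].
move=> H; have : \forall k \near \oo, forall y, `|y| <= N -> ball (v y) e (blowup u x0 (rho (sigma k)) y).
 apply: H; apply/uniform_nbhs; exists [set xy | ball xy.1 e xy.2]; split=> //.
 exact: (entourage_ball _ (PosNum e0)).
smt.
Qed.

Lemma blowup_pointwise u x0 v (r_ : nat -> R) :
 (forall N e : R, 0 < e -> \forall k \near \oo, forall y, `|y| <= N ->
   `|v y - (r_ k) ^- 2 * u (x0 + r_ k *: y)| < e) ->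
 forall y, (r_ k) ^- 2 * u (x0 + r_ k *: y) @[k --> \oo] --> v y.
move=> H y; apply/cvgrPdist_lt => e e0; have := H `|y| e e0.
by apply: filterS => k /(_ y (lexx _)).
Qed.

Lemma near_scaled (Omega : set pl) x0 (r_ : nat -> R) y : open Omega -> Omega x0 ->
 r_ k @[k --> \oo] --> (0 : R) -> \forall k \near \oo, Omega (x0 + r_ k *: y).
move=> oO Ox rc; have C : x0 + r_ k *: y @[k --> \oo] --> x0 + (0 : R) *: y.
 by apply: cvgD; [exact: cvg_cst|apply: cvgZ => //; exact: cvg_cst].
by rewrite scale0r addr0 in C; apply: C; exact: oO.
Qed.

(** A nonzero value keeps its sign near [x0]: a negative one contradicts the closure, a positive one
    puts [x0] into the interior. *)
Lemma free_boundary_zero (Omega : set pl) u x0 : open Omega -> Omega x0 ->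
 {for x0, continuous u} -> free_boundary Omega u x0 -> u x0 = 0.
move=> oO Ox cu [cl nint]; have nO : nbhs x0 Omega by exact: oO.
apply/eqP; case: (ltgtP (u x0) 0) => // u0.
- have /cl [z [[_ /= z0] z1]] : nbhs x0 [set x | u x < 0] by exact: (cvgr_lt _ cu _ u0).
 lra.
- case: nint; apply: filterI => //; exact: (cvgr_gt _ cu _ u0).
Qed.

Lemma derive_all_zero u x0 : differentiable u x0 -> grad u x0 = 0 ->
 forall y, is_derive x0 y u 0.
move=> du [g1 g2] y; apply: DeriveDef; first exact: diff_derivable.
have e1 : 'd u x0 (1, 0) = 0 by rewrite -(deriveE _ du).
have e2 : 'd u x0 (0, 1) = 0 by rewrite -(deriveE _ du).
rewrite (deriveE _ du) (_ : y = y.1 *: ((1, 0) : pl) + y.2 *: ((0, 1) : pl)).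
 by rewrite linearD !linearZ /= e1 e2 !scaler0 addr0.
rewrite [LHS]surjective_pairing; congr (_, _) => /=.
 by rewrite [_ *: 1]mulr1 [_ *: 0]mulr0 addr0.
by rewrite [_ *: 1]mulr1 [_ *: 0]mulr0 add0r.
Qed.

Lemma small_increment u x0 y (e : R) : is_derive x0 y u 0 -> u x0 = 0 -> 0 < e ->
 exists2 d : R, 0 < d & forall rho : R, `|rho| < d -> `|u (x0 + rho *: y)| <= e * `|rho|.
move=> du u0 e0; have [du1 du2] := der_line u x0 y 0.
have D := du1 du; set p := fun h : R => u (h *: y + x0) in D.
have p0 : p 0 = 0 by rewrite /p scale0r add0r.
have [dp dp0] := D.
have C : (fun h : R => h^-1 *: ((p \o shift 0) (h *: 1) - p 0)) @ 0^' --> (0 : R).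
 by rewrite -[X in _ --> X]dp0; exact: dp.
move/cvgr0Pnorm_le: C => /(_ _ e0); rewrite near_withinE => /nbhs_ballP[d /= d0 Hd].
exists d => // rho rd; have [->|rn] := eqVneq rho 0.
 by rewrite scale0r addr0 u0 !normr0 mulr0.
have := Hd rho _ rn; rewrite ball_realE sub0r normrN => /(_ rd).
rewrite /= p0 subr0 addr0 [rho *: 1]mulr1 normrZ normfV ler_pdivrMl ?normr_gt0 // mulrC.
by rewrite /p addrC.
Qed.

Lemma disc_in_open (Omega : set pl) x0 : open Omega -> Omega x0 ->
 exists2 a : R, 0 < a & [set x | nsq (x - x0) <= a] `<=` Omega.
move=> oO Ox; have /nbhs_ballP[e /= e0 He] : nbhs x0 Omega by exact: oO.
exists (e ^+ 2 / 2); first by smt.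
move=> x /= xe; apply: He; rewrite ball_planeE distrC; apply: norm_lt_nsq; first smt.
by rewrite (le_lt_trans xe) // ltr_pdivrMr // ltr_pMr ?ltr1n // exprn_gt0.
Qed.

End BlowupSequences.

(** * The L^2 seminorm *)

Section L2norm.
Implicit Types (x y z : pl) (f g h : pl -> R).

(** The squared seminorm. A zero value at [f - g] stands for equality almost everywhere, which is as
    much as [wderiv] determines. *)
Definition n2 f : R := I (fun x => f x ^+ 2).

Lemma n2_ge0 f : 0 <= n2 f.
by apply: I_ge0 => x; smt. Qed.

Lemma n2N f : n2 (fun x => - f x) = n2 f.
by congr (I _); apply/funext => x; lra. Qed.

Lemma n2BC f g : n2 (fun x => f x - g x) = n2 (fun x => g x - f x).
by congr (I _); apply/funext => x; lra. Qed.

Lemma cauchy_schwarz f g : l2 f -> l2 g -> I (fun x => f x * g x) ^+ 2 <= n2 f * n2 g.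
move=> lf lg; have [_ If] := lf; have [_ Ig] := lg; have Ifg := l2_ig_mul lf lg.
set b := I _; have key (t : R) : 0 <= n2 f + (2 * t) * b + t ^+ 2 * n2 g.
 have -> : n2 f + (2 * t) * b + t ^+ 2 * n2 g = n2 (fun x => f x + t * g x).
  rewrite /n2 (_ : (fun x => (f x + t * g x) ^+ 2) =
   fun x => f x ^+ 2 + (2 * t) * (f x * g x) + t ^+ 2 * g x ^+ 2); last first.
   by apply/funext => x; ring.
  rewrite ID; [|by apply: igD => //; exact: igZ|exact: igZ].
  by rewrite ID //; [rewrite !IZ|exact: igZ].
 exact: n2_ge0.
(* When g is null the quadratic degenerates to an affine function of t, which is nonnegative only if
   its slope vanishes. *)
have [g0|g0] := eqVneq (n2 g) 0.
 rewrite g0 mulr0; have [->|b0] := eqVneq b 0; first by lra.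
 have := key (- (n2 f + 1) / (2 * b)); rewrite g0 mulr0 addr0.
 rewrite (_ : 2 * _ * b = - (n2 f + 1)); last by field.
 lra.
have gp : 0 < n2 g by rewrite lt_def g0 n2_ge0.
have := key (- b / n2 g).
rewrite (_ : _ + _ = n2 f - b ^+ 2 / n2 g); last by field.
by rewrite subr_ge0 ler_pdivrMr.
Qed.

Lemma I_mul_le f g : l2 f -> l2 g ->
 `|I (fun x => f x * g x)| <= Num.sqrt (n2 f) * Num.sqrt (n2 g).
move=> lf lg; rewrite -sqrtrM ?n2_ge0 // -sqrtr_sqr ler_wsqrtr //.
exact: cauchy_schwarz.
Qed.

Lemma n2D_le f g : l2 f -> l2 g -> n2 (fun x => f x + g x) <= 2 * n2 f + 2 * n2 g.
move=> lf lg; have [_ If] := lf; have [_ Ig] := lg.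
rewrite /n2 -!IZ // -ID; [|exact: igZ..].
apply: I_le; [by case: (l2D lf lg)|by apply: igD; exact: igZ|].
by move=> x; exact: sqrD_le.
Qed.

Lemma n2_trans f g h : l2 f -> l2 g -> l2 h ->
 n2 (fun x => f x - h x) <= 2 * n2 (fun x => f x - g x) + 2 * n2 (fun x => g x - h x).
move=> lf lg lh; have := n2D_le (l2B lf lg) (l2B lg lh).
by rewrite (_ : (fun x => _ + _) = fun x => f x - h x) //; apply/funext => x; lra.
Qed.

Lemma n20_I f g h : l2 f -> l2 g -> l2 h -> n2 (fun x => f x - g x) = 0 ->
 I (fun x => f x * h x) = I (fun x => g x * h x).
move=> lf lg lh E; apply/eqP; rewrite -subr_eq0 -IB; [|exact: l2_ig_mul..].
rewrite (_ : (fun x => _ - _) = fun x => (f x - g x) * h x); last first.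
 by apply/funext => x; lra.
have := I_mul_le (l2B lf lg) lh; rewrite E sqrtr0 mul0r.
by rewrite normr_le0.
Qed.

Lemma n20_n2 f g : l2 f -> l2 g -> n2 (fun x => f x - g x) = 0 -> n2 f = n2 g.
have sq k : n2 k = I (fun x => k x * k x).
 smt.
move=> lf lg E; rewrite !sq (n20_I lf lg lf E) -(n20_I lf lg lg E); congr (I _).
by apply/funext => x; lra.
Qed.

Definition cvg2 (F : nat -> pl -> R) f : Prop :=
 n2 (fun x => F n x - f x) @[n --> \oo] --> (0 : R).

Lemma cvg2_I (F : nat -> pl -> R) f g : (forall n, l2 (F n)) -> l2 f -> l2 g ->
 cvg2 F f -> I (fun x => F n x * g x) @[n --> \oo] --> I (fun x => f x * g x).
move=> lF lf lg H; apply/cvgrPdist_le => e e0.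
have c0 : 0 < Num.sqrt (n2 g) + 1 by smt.
have d0 : 0 < (e / (Num.sqrt (n2 g) + 1)) ^+ 2 by smt.
move/cvgrPdist_le : H => /(_ _ d0); apply: filterS => n.
rewrite sub0r normrN => /(le_trans (ler_norm _)) Hn.
rewrite distrC -IB; [|exact: l2_ig_mul..].
rewrite (_ : (fun x => _ - _) = fun x => (F n x - f x) * g x); last first.
 by apply/funext => x; lra.
rewrite (le_trans (I_mul_le (l2B (lF n) lf) lg)) //.
have s1 : Num.sqrt (n2 (fun x => F n x - f x)) <= e / (Num.sqrt (n2 g) + 1).
 by rewrite (le_trans (ler_wsqrtr Hn)) // sqrtr_sqr ger0_norm // ltW // divr_gt0.
rewrite (le_trans (ler_wpM2r (sqrtr_ge0 _) s1)) //.
by rewrite mulrAC ler_pdivrMr // ler_wpM2l ?ltW // ltrDl.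
Qed.

Lemma cvg2D (F G : nat -> pl -> R) f g :
 (forall n, l2 (F n)) -> l2 f -> (forall n, l2 (G n)) -> l2 g ->
 cvg2 F f -> cvg2 G g -> cvg2 (fun n x => F n x + G n x) (fun x => f x + g x).
move=> lF lf lG lg HF HG; apply/cvgrPdist_le => e e0.
have e4 : 0 < e / 4 by smt.
move/cvgrPdist_le : HF => /(_ _ e4) HF; move/cvgrPdist_le : HG => /(_ _ e4) HG.
near=> n; rewrite sub0r normrN ger0_norm ?n2_ge0 //.
have h1 : n2 (fun x => F n x - f x) <= e / 4.
 by rewrite -[leLHS]ger0_norm ?n2_ge0 // -normrN -sub0r; near: n.
have h2 : n2 (fun x => G n x - g x) <= e / 4.
 by rewrite -[leLHS]ger0_norm ?n2_ge0 // -normrN -sub0r; near: n.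
have := n2D_le (l2B (lF n) lf) (l2B (lG n) lg).
rewrite (_ : (fun x => _ + _) = fun x => F n x + G n x - (f x + g x)); last first.
 by apply/funext => x; rewrite opprD addrACA.
by move=> /le_trans; apply; lra.
Unshelve. all: by end_near. Qed.

Lemma cvg2M (F : nat -> pl -> R) f (c : pl -> R) (M : R) : measurable_fun setT c ->
 (forall x, `|c x| <= M) -> (forall n, l2 (F n)) -> l2 f ->
 cvg2 F f -> cvg2 (fun n x => c x * F n x) (fun x => c x * f x).
move=> mc cM lF lf H; apply/cvgrPdist_le => e e0.
have M1 : 0 < M ^+ 2 + 1 by smt.
move/cvgrPdist_le : H => /(_ _ (divr_gt0 e0 M1)); apply: filterS => n.
rewrite !sub0r !normrN !ger0_norm ?n2_ge0 // => Hn.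
have lB := l2B (lF n) lf; have [_ IBn] := lB.
apply: (@le_trans _ _ ((M ^+ 2 + 1) * n2 (fun x => F n x - f x))); last first.
 by rewrite mulrC -ler_pdivlMr.
rewrite /n2 -IZ //; apply: I_le; last 1 first.
- move=> x; rewrite -mulrBr exprMn ler_wpM2r ?sqr_ge0 // (@le_trans _ _ (M ^+ 2)) ?lerDl //.
 by rewrite -(real_normK (num_real (c x))) lerXn2r ?nnegrE // (le_trans _ (cM x)).
- have [_] := l2_mul_bounded mc cM lB.
 rewrite (_ : (fun x => (c x * (F n x - f x)) ^+ 2) = fun x => (c x * F n x - c x * f x) ^+ 2) //.
 by apply/funext => x; lra.
- exact: igZ.
Qed.

Lemma cvg2_cst f : cvg2 (fun _ => f) f.
rewrite /cvg2 (_ : n2 _ = 0); first exact: cvg_cst.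
rewrite /n2 -[RHS](@I0); congr (I _); apply/funext => x.
lra.
Qed.

End L2norm.

Section Domain.
Variable Omega : set pl.
Hypotheses (oO : open Omega) (bO : bounded_set Omega).

(** * Weak derivatives on a bounded open set *)

Section Sobolev.
Local Notation mu := (mu2 R).
Implicit Types (x y z : pl) (f g h u v w phi : pl -> R) (s : seq 'I_2).

(** Extension by zero turns integrals over [Omega] into integrals over the plane, so that the
    calculus of [I] applies. *)
Definition rs f : pl -> R := f \_ Omega.

Lemma rs_in f x : Omega x -> rs f x = f x.
by move=> Ox; rewrite /rs patchE mem_set. Qed.

Lemma rs_out f x : ~ Omega x -> rs f x = 0.
by move=> Ox; rewrite /rs patchE memNset. Qed.

Lemma mO : measurable Omega.
exact: open_measurable_plane. Qed.

Lemma bOmega : exists N : R, forall x, Omega x -> `|x| <= N.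
have [M [_ H]] := bO; exists (M + 1) => x Ox.
by apply: (H (M + 1)) => //; lra.
Qed.

Lemma bsupp_O f : (forall x, ~ Omega x -> f x = 0) -> bsupp f.
move=> H; have [N HN] := bOmega; exists N => x Nx; apply: H => /HN.
lra.
Qed.

Lemma bsupp_rs f : bsupp (rs f).
by apply: bsupp_O => x; exact: rs_out. Qed.

Let rs_sqr f : (EFin \o (fun x => f x ^+ 2)) \_ Omega = EFin \o (fun x => rs f x ^+ 2).
apply/funext => x; rewrite /= patchE; case: ifPn => /=.
 by rewrite inE => Ox; rewrite rs_in.
by move=> /negP; rewrite inE => Ox; rewrite rs_out // expr0n.
Qed.

Lemma L2P f : L2 Omega f <-> l2 (rs f).
rewrite /L2 /l2 /ig -rs_sqr; split=> -[mf If]; split.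
- exact: (measurable_restrictT f mO).1.
- exact: (integrable_mkcond _ mO).1.
- exact: (measurable_restrictT f mO).2.
- exact: (integrable_mkcond _ mO).2.
Qed.

Lemma rsI f phi : \int[mu]_(x in Omega) (f x * phi x) = I (fun x => rs f x * phi x).
rewrite Rintegral_mkcond; congr (I _); apply/funext => x.
by rewrite /rs !patchE; case: ifP => // _; rewrite mul0r.
Qed.

Lemma weak_derivP s f g : weak_deriv Omega s f g <->
 forall phi, test_function Omega phi ->
 I (fun x => rs f x * partials s phi x) = (-1) ^+ size s * I (fun x => rs g x * phi x).
by split=> H phi tp; have := H phi tp; rewrite !rsI. Qed.

Lemma test_l2 phi : test_function Omega phi -> l2 phi.
move=> /testP[sp cp]; apply: l2_continuous; first smt.
exact: csupp_bsupp cp.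
Qed.

Lemma test_out phi x : test_function Omega phi -> ~ Omega x -> phi x = 0.
by move=> /testP[_ [K [_ KO H]]] nx; apply: H => /KO. Qed.

Lemma der_flip f x y (e : pl) df : is_derive (x - y) e f df ->
 is_derive y e (fun y => f (x - y)) (- df).
move=> /der_line H; apply/der_line.
have ho : is_derive (0 : R) (1 : R) (fun h : R => - h) (- 1).
 exact: der_opp (is_derive_id _ _).
have H' : is_derive (- (0 : R)) (1 : R) (fun h : R => f (h *: e + (x - y))) df.
 by rewrite oppr0.
have := @der_comp R (fun h : R => f (h *: e + (x - y))) (fun h : R => - h) 0 1 _ _ ho H'.
rewrite mulrN1; congr (is_derive _ _ _ _).
apply/funext => h; congr f; rewrite scaleNr opprD addrCA.
by [].
Qed.

Lemma sm2_flip psi x : sm2 psi -> sm2 (fun y => psi (x - y)).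
move=> sp n; elim: n psi sp => [|n IH] psi sp.
 exact/cont_flip/smooth_cont.
have D i y := @der_flip psi x y _ _ (smooth_der i (x - y) sp).
split; first exact/cont_flip/smooth_cont.
move=> i; split; first by move=> y; smt.
rewrite (_ : (fun y => 'D_(e_ i) (fun y => psi (x - y)) y) =
  fun y => (-1) * 'D_(e_ i) psi (x - y)).
 apply: Cn_mul; first exact: smooth_cst.
 by apply: (IH ('D_(e_ i) psi)); smt.
by apply/funext => y; rewrite mulN1r; case: (D i y).
Qed.

Lemma partials_flip psi s x y : sm2 psi ->
 partials s (fun y => psi (x - y)) y = (-1) ^+ size s * partials s psi (x - y).
move=> sp; elim: s y => [|i s IH] y /=; first by lra.
rewrite (_ : partials s _ = fun y => (-1) ^+ size s * partials s psi (x - y)); last first.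
 by apply/funext => z; rewrite IH.
have H := der_flip (smooth_der i (x - y) (sm2_partials s sp)).
have := der_mul (is_derive_cst ((-1) ^+ size s : R) y (e_ i)) H.
rewrite mul0r add0r => -[_ ->].
by rewrite /cst exprS; ring.
Qed.

(** Points at sup-distance at least [1/(n+1)] from the complement: there a mollification at a finer
    scale sees only [Omega]. *)
Definition inner (n : nat) : set pl :=
 [set x | forall y, `|y - x| < n.+1%:R^-1 -> Omega y].

Lemma inner_mono m n : (m <= n)%N -> inner m `<=` inner n.
move=> mn x H y Hy; apply: H; apply: lt_le_trans Hy _.
by rewrite lef_pV2 ?posrE // ler_nat ltnS.
Qed.

Lemma inner_ex x : Omega x -> exists n, inner n x.
move=> Ox; have /nbhs_ballP[e /= e0 He] := oO Ox.
exists (Num.truncn e^-1) => y Hy; apply: He; rewrite ball_planeE distrC.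
apply: lt_trans Hy _; rewrite invf_plt ?posrE //.
by apply: truncnS_gt.
Qed.

Lemma inner_closed n : closed (inner n).
move=> x Hx y Hy.
have d0 : 0 < n.+1%:R^-1 - `|y - x| by rewrite subr_gt0.
have [z [Hz xz]] := Hx _ (@near_plane x _ _ d0 (fun y => id)).
apply: Hz; rewrite (_ : y - z = (y - x) + (x - z)); last by ring.
by rewrite (le_lt_trans (ler_normD _ _)) // -ltrBrDl.
Qed.

Lemma inner_measurable n : measurable (inner n).
rewrite -(setCK (inner n)); apply: measurableC; apply: open_measurable_plane.
exact/closed_openC/inner_closed.
Qed.

(** The mollifier reflected and centred at x is a test function of [Omega], and the sign of the
    reflection cancels the sign of the integration by parts. *)
Lemma conv_weak s u g n m x : l2 (rs u) -> weak_deriv Omega s u g -> inner m x -> (m < n)%N ->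
 conv (rs u) (partials s (moll n)) x = conv (rs g) (moll n) x.
move=> lu /weak_derivP wd ix mn.
have sm := @moll_sm2 n.
have tp : test_function Omega (fun y => moll n (x - y)).
 apply/testP; split; first exact: sm2_flip.
 exists [set y | `|x - y| <= n.+1%:R^-1]; split.
 - apply: (@closed_bounded_compact _ (`|x| + n.+1%:R^-1)).
   rewrite (_ : [set _ | _] = (fun y : pl => `|x - y|) @^-1` [set t | t <= n.+1%:R^-1]) //.
   apply: closed_comp => [y _|]; last smt.
   apply: (@continuous_comp _ _ _ (fun y : pl => x - y) (fun z : pl => `|z|)).
    by apply: cvgB; [exact: cvg_cst|exact: cvg_id].
   exact: norm_continuous.
  move=> y /= Hy; rewrite -[y](subrK x) addrC (le_trans (ler_normD _ _)) // lerD2l.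
  by rewrite distrC.
 - move=> y /= Hy; apply: ix; rewrite distrC; apply: le_lt_trans Hy _.
  by rewrite ltf_pV2 ?posrE // ltr_nat ltnS.
 - by move=> y /= /negP; rewrite -ltNge; exact: moll_supp.
have := wd _ tp.
rewrite (_ : (fun y => rs u y * _) = fun y => (-1) ^+ size s * (rs u y * partials s (moll n) (x - y))).
 rewrite IZ; last first.
  apply: conv_ig; first exact: l2_ig lu (bsupp_rs u).
   exact/smooth_cont/sm2_partials.
  smt.
 by move=> H; apply: (mulfI (x := (-1) ^+ size s)) => //; rewrite signr_eq0.
by apply/funext => y; rewrite partials_flip //; ring.
Qed.

(** The fundamental lemma of the calculus of variations: mollifications of U vanish on each
    [inner m] once their scale is fine enough, they converge to U in L^2, and the sets [inner m]
    exhaust [Omega]. *)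
Lemma null_of_test U : l2 U -> (forall x, ~ Omega x -> U x = 0) ->
 (forall phi, test_function Omega phi -> I (fun x => U x * phi x) = 0) -> n2 U = 0.
move=> lU U0 HU; have bU := bsupp_O U0; have [mU IU2] := lU.
have ErU : rs U = U.
 apply/funext => x; have [Ox|Ox] := pselect (Omega x); first by rewrite rs_in.
 by rewrite rs_out // U0.
have wd : weak_deriv Omega [::] U (fun=> 0).
 apply/weak_derivP => phi tp /=; rewrite ErU HU // mul1r.
 rewrite (_ : (fun x => rs _ x * _) = fun=> 0) ?I0 //.
 by apply/funext => x; rewrite /rs patchE; case: ifP => _; rewrite mul0r.
have c0 m n x : inner m x -> (m < n)%N -> conv U (moll n) x = 0.
 move=> ix mn; have := @conv_weak [::] U (fun=> 0) n m x.
 rewrite ErU => /(_ lU wd ix mn) /= ->.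
 rewrite /conv (_ : (fun y => rs _ y * _) = fun=> 0) ?I0 //.
 by apply/funext => y; rewrite /rs patchE; case: ifP => _; rewrite mul0r.
have H m : I (fun x => \1_(inner m) x * U x ^+ 2) = 0.
 have mi : measurable_fun setT (\1_(inner m) : pl -> R).
  by apply: measurable_indic; exact: inner_measurable.
 have i1 x : `|\1_(inner m) x : R| <= 1.
  by rewrite indicE; case: (_ \in _); rewrite ?normr1 ?normr0.
 apply/eqP; rewrite eq_le I_ge0 ?andbT; last by move=> x; smt.
 apply/ler_addgt0Pr => e e0; rewrite add0r.
 have /cvgrPdist_le /(_ e e0) Hc := moll_cvg lU bU.
 have /filter_ex[n [mn Hn]] : \forall n \near \oo, (m < n)%N /\
   `|0 - I (fun x => (conv U (moll n) x - U x) ^+ 2)| <= e.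
  by near=> n; split; near: n => //; exact: nbhs_infty_gt.
 move: Hn; rewrite sub0r normrN => /(le_trans (ler_norm _)); apply: le_trans.
 have [lc _] := conv_young n lU bU.
 apply: I_le; [exact: (ig_mul_bounded mi i1)|by case: (l2B lc lU)|].
 move=> x; rewrite indicE; case: (boolP (x \in inner m)) => /=.
  by rewrite inE => ix; rewrite (c0 m) // sub0r sqrrN mul1r.
 by rewrite mul0r sqr_ge0.
have mm m : measurable_fun setT (fun x => \1_(inner m) x * U x ^+ 2).
 apply: measurable_funM; last exact: measurable_sqr.
 by apply: measurable_indic; exact: inner_measurable.
have [||_ L] := @I_cvg_dominated (fun m x => \1_(inner m) x * U x ^+ 2) (fun x => U x ^+ 2) (fun x => U x ^+ 2) mm IU2.
- move=> m x; rewrite indicE normrM (ger0_norm (sqr_ge0 _)).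
 by case: (_ \in _); rewrite ?normr1 ?normr0 ?mul1r // mul0r sqr_ge0.
- move=> x; apply: cvg_near_cst; have [Ox|Ox] := pselect (Omega x).
  have [k ik] := inner_ex Ox; near=> m.
  rewrite indicE mem_set ?mul1r //; apply: inner_mono ik.
  by near: m; exact: nbhs_infty_ge.
 by near=> m; rewrite U0 // expr0n mulr0.
- move: L; under eq_fun do rewrite H.
 by move=> /(cvg_lim (@Rhausdorff R)); rewrite /n2 => <-; rewrite lim_cst.
Unshelve. all: by end_near. Qed.

End Sobolev.

#[local] Hint Resolve bsupp_rs test_l2 sm2_flip : plane.

(** * Admissible perturbations and the energy *)

Section Admissible.
Implicit Types (x y z : pl) (f g u v w phi : pl -> R) (s : seq 'I_2)
 (h : seq 'I_2 -> pl -> R).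

Lemma I_parts f g (i : 'I_2) : sm2 f -> sm2 g -> bsupp g ->
 I (fun x => f x * 'D_(e_ i) g x) = - I (fun x => 'D_(e_ i) f x * g x).
move=> sf sg bg.
have sD k : sm2 k -> continuous (fun x => 'D_(e_ i) k x).
 by move=> sk; smt.
have Hm x := der_mul (smooth_der i x sf) (smooth_der i x sg).
have Hd : I (fun x => 'D_(e_ i) (fun x => f x * g x) x) = 0.
 apply: I_derive0.
 - by move=> x; smt.
 - by apply/smooth_cont/smooth_D/smooth_mul.
 - exact: bsuppMr.
have E : (fun x => 'D_(e_ i) (fun x => f x * g x) x) =
  fun x => f x * 'D_(e_ i) g x + 'D_(e_ i) f x * g x.
 by apply/funext => x; case: (Hm x) => _ ->; lra.
move: Hd; rewrite E ID; first by move/eqP; lra.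
 apply: ig_continuous; first by move=> x; apply: cvgM; [exact: smooth_cont|exact: sD].
 by apply: bsuppMr; exact: (@bsupp_partials _ [:: i]).
apply: ig_continuous; first by move=> x; apply: cvgM; [exact: sD|exact: smooth_cont].
smt.
Qed.

Lemma I_partials f g s : sm2 f -> sm2 g -> bsupp g ->
 I (fun x => f x * partials s g x) = (-1) ^+ size s * I (fun x => partials (rev s) f x * g x).
move=> sf sg bg; elim: s f sf => [|i s IH] f sf; first by lra.
rewrite (@I_parts f (partials s g) i) //; [|exact: sm2_partials|exact: bsupp_partials].
rewrite IH; last smt.
by rewrite rev_cons partials_rcons exprS mulN1r mulNr.
Qed.

Lemma partialsD f g s : sm2 f -> sm2 g ->
 partials s (fun x => f x + g x) = fun x => partials s f x + partials s g x.
move=> sf sg; elim: s => [//|i s IH] /=; rewrite IH; apply/funext => x.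
have [_ ->] // := der_add (smooth_der i x (sm2_partials s sf))
 (smooth_der i x (sm2_partials s sg)).
Qed.

Lemma partialsZ (c : R) f s : sm2 f ->
 partials s (fun x => c * f x) = fun x => c * partials s f x.
move=> sf; elim: s => [//|i s IH] /=; rewrite IH; apply/funext => x.
have := der_mul (is_derive_cst c x (e_ i)) (smooth_der i x (sm2_partials s sf)).
by rewrite mul0r add0r => -[_ ->].
Qed.

Local Notation mu := (mu2 R).

Lemma rsD f g : rs (fun x => f x + g x) = fun x => rs f x + rs g x.
apply/funext => x; have [Ox|Ox] := pselect (Omega x); first by rewrite !rs_in.
by rewrite !rs_out // addr0.
Qed.

Lemma rs_id f : (forall x, ~ Omega x -> f x = 0) -> rs f = f.
move=> H; apply/funext => x; have [Ox|Ox] := pselect (Omega x); first by rewrite rs_in.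
by rewrite rs_out // H.
Qed.

Lemma weak_deriv_unique s f g1 g2 : L2 Omega g1 -> L2 Omega g2 ->
 weak_deriv Omega s f g1 -> weak_deriv Omega s f g2 ->
 n2 (fun x => rs g1 x - rs g2 x) = 0.
move=> /(L2P) l1 /(L2P) lb /weak_derivP w1 /weak_derivP w2.
apply: null_of_test.
- exact: l2B.
- by move=> x Ox; rewrite !rs_out // subrr.
move=> phi tp; have lp := test_l2 tp.
rewrite (_ : (fun x => _ * _) = fun x => rs g1 x * phi x - rs g2 x * phi x); last first.
 by apply/funext => x; lra.
rewrite IB; [|exact: l2_ig_mul..]; apply/eqP; rewrite subr_eq0; apply/eqP.
by apply: (mulfI (x := (-1) ^+ size s)); rewrite ?signr_eq0 // -w1 // -w2.
Qed.

Lemma wderivP s f : (exists g, L2 Omega g /\ weak_deriv Omega s f g) ->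
 L2 Omega (wderiv Omega s f) /\ weak_deriv Omega s f (wderiv Omega s f).
by move=> H; exact: (xgetPex (fun=> 0) H). Qed.

Lemma weak_derivD s f g f' g' : L2 Omega f -> L2 Omega g -> L2 Omega f' -> L2 Omega g' ->
 weak_deriv Omega s f f' -> weak_deriv Omega s g g' ->
 weak_deriv Omega s (fun x => f x + g x) (fun x => f' x + g' x).
move=> /(L2P) lf /(L2P) lg /(L2P) lf' /(L2P) lg' /weak_derivP Hf /weak_derivP Hg.
apply/weak_derivP => phi tp; have lp := test_l2 tp.
have ls := test_l2 (test_partials s tp).
rewrite !rsD.
rewrite (_ : (fun x => _ * partials s phi x) =
 fun x => rs f x * partials s phi x + rs g x * partials s phi x); last first.
 by apply/funext => x; lra.
rewrite (_ : (fun x => _ * phi x) = fun x => rs f' x * phi x + rs g' x * phi x); last first.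
 by apply/funext => x; lra.
by rewrite !ID; [rewrite Hf // Hg // mulrDr|exact: l2_ig_mul..].
Qed.

(* [h s] is the L^2 limit of the derivatives of test functions along [rev s];
  the reversal matches iterated integration by parts and spares the symmetry
  of second derivatives. *)
Definition test_lim w h : Prop :=
 [/\ h [::] = w,
   forall s, (size s <= 2)%N -> l2 (h s) /\ forall x, ~ Omega x -> h s x = 0 &
   exists phi : nat -> pl -> R, (forall n, test_function Omega (phi n)) /\
    forall s, (size s <= 2)%N -> cvg2 (fun n => partials (rev s) (phi n)) (h s)].

Lemma test_lim_L2 w h s : test_lim w h -> (size s <= 2)%N -> L2 Omega (h s).
by case=> _ H _ /H [lh h0]; apply/(L2P); rewrite rs_id. Qed.

(** Integration by parts for the approximating test functions passes to the limit. The support of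
    [chi] may reach outside [Omega], which is what allows such limits to be mollified on the whole
    plane. *)
Lemma test_lim_parts w h s chi : test_lim w h -> (size s <= 2)%N -> sm2 chi -> bsupp chi ->
 I (fun x => w x * partials s chi x) = (-1) ^+ size s * I (fun x => h s x * chi x).
move=> [h0 H [phi [tp cv]]] s2 sc bc.
have [l0 z0] := H [::] isT; have [ls zs] := H s s2.
have lp n t : l2 (partials t (phi n)) := test_l2 (test_partials t (tp n)).
have lc : l2 chi := l2_continuous (smooth_cont sc) bc.
have lcs : l2 (partials s chi).
 exact: l2_continuous (smooth_cont (sm2_partials s sc)) (bsupp_partials s sc bc).
have L1 := cvg2_I (fun n => lp n [::]) l0 lcs (cv [::] isT).
have L2 := cvg2_I (fun n => lp n (rev s)) ls lc (cv s s2).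
have L3 := cvgM (cvg_cst ((-1) ^+ size s : R)) L2.
move: L1; rewrite h0 /= => L1.
apply: (cvg_unique (@Rhausdorff R) L1); apply: cvg_trans (L3 _ _).
rewrite (_ : (fun n => I _) = fun n => (-1) ^+ size s * I (fun x => partials (rev s) (phi n) x * chi x)).
 smt.
apply/funext => n; apply: I_partials => //.
by have /testP[] := tp n.
Qed.

Lemma test_lim_weak w h s : test_lim w h -> (size s <= 2)%N -> weak_deriv Omega s w (h s).
move=> tw s2; have [h0 H _] := tw; apply/weak_derivP => chi tc.
have [l0 z0] := H [::] isT; have [ls zs] := H s s2.
rewrite !rs_id //; last by rewrite -h0.
have /testP[sc cc] := tc.
exact: test_lim_parts tw s2 sc (csupp_bsupp cc).
Qed.

Lemma sobolev_test_lim k u w h : (k <= 2)%N -> sobolev Omega k u -> test_lim w h ->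
 sobolev Omega k (fun x => u x + w x).
move=> k2 [lu H] tw; have lw := test_lim_L2 tw (isT : (size [::] <= 2)%N).
have {}lw : L2 Omega w by case: tw lw => ->.
split; first by apply/(L2P); rewrite rsD; apply: l2D; exact/(L2P).
move=> s sk; have [g [lg wg]] := H s sk; have s2 := leq_trans sk k2.
have lh := test_lim_L2 tw s2.
exists (fun x => g x + h s x); split.
 by apply/(L2P); rewrite rsD; apply: l2D; exact/(L2P).
by apply: weak_derivD => //; exact: test_lim_weak tw s2.
Qed.

(** [wderiv] picks an arbitrary representative, so the sum rule can be expected only up to a null
    function. *)
Lemma wderiv_test_lim k u w h s : (k <= 2)%N -> sobolev Omega k u -> test_lim w h ->
 (size s <= k)%N ->
 n2 (fun x => rs (wderiv Omega s (fun x => u x + w x)) x -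
   (rs (wderiv Omega s u) x + h s x)) = 0.
move=> k2 su tw sk; have [_ H] := sobolev_test_lim k2 su tw.
have [l1 w1] := wderivP (H s sk); have [lu Hu] := su; have [lb w2] := wderivP (Hu s sk).
have s2 := leq_trans sk k2; have lh := test_lim_L2 tw s2.
have lw : L2 Omega w by have := test_lim_L2 tw (isT : (size [::] <= 2)%N); case: tw => ->.
have hE : rs (h s) = h s by apply: rs_id; case: tw => _ /(_ s s2) [].
rewrite -hE.
have := @weak_deriv_unique s (fun x => u x + w x) _ (fun x => wderiv Omega s u x + h s x) l1 _ w1.
rewrite rsD; apply.
 by apply/(L2P); rewrite rsD; apply: l2D; exact/(L2P).
by apply: weak_derivD => //; exact: test_lim_weak.
Qed.

Lemma integral_sqr_n2 f : l2 (rs f) ->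
 (\int[mu]_(x in Omega) (f x ^+ 2)%:E = (n2 (rs f))%:E)%E.
move=> [_ lf]; rewrite integral_mkcond /n2 -I_EFin //; apply: eq_integral => x _ /=.
rewrite patchE /rs patchE; case: ifP => //; by rewrite expr0n.
Qed.

Lemma admissible_test_lim u0 u w h : admissible Omega u0 u -> test_lim w h ->
 admissible Omega u0 (fun x => u x + w x).
move=> [s2 [s1 H]] tw; split; first exact: sobolev_test_lim (leqnn 2) s2 tw.
have E : (fun x => u x + w x - u0 x) = fun x => (u x - u0 x) + w x.
 by apply/funext => x; lra.
rewrite E; split; first exact: sobolev_test_lim (isT : (1 <= 2)%N) s1 tw.
move=> eps eps0; have e8 : 0 < eps / 8 by smt.
have [phi [tp Hp]] := H _ e8.
have [h0 Hh [psi [tq Hq]]] := tw.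
have [n Hn] : exists n, forall s, (size s <= 1)%N -> n2 (fun x => partials (rev s) (psi n) x - h s x) < eps / 8.
 have C s : (size s <= 1)%N -> \forall n \near \oo, n2 (fun x => partials (rev s) (psi n) x - h s x) < eps / 8.
  move=> s1'; have /cvgrPdist_lt /(_ _ e8) := Hq s (leq_trans s1' (isT : (1 <= 2)%N)).
  apply: filterS => n; rewrite sub0r normrN; exact: le_lt_trans (ler_norm _).
 have [n [Hn [Hn0 Hn1]]] := filter_ex (filterI (C [::] isT) (filterI (C [:: o_0] isT) (C [:: o_1] isT))).
 exists n => -[//|i [|//]] _; case: (i =P o_0) => [->//|/eqP i0].
 rewrite (_ : i = o_1) //; apply/val_inj; case: i i0 => -[|[|//]] //= p.
have /testP[sp _] := tp; have /testP[sq _] := tq n.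
exists (fun x => phi x + psi n x); split; first smt.
move=> s s1'; have ss2 := leq_trans s1' (isT : (1 <= 2)%N).
(* Words of length at most 1 are palindromes, so the reversal in [test_lim] is harmless at first
   order. *)
have Es : rev s = s by case: s s1' {ss2} => [|? []].
set V := fun x => u x - u0 x.
have [_ Hv] := s1; have [lv _] := wderivP (Hv s s1').
have [_ Hvw] := sobolev_test_lim (isT : (1 <= 2)%N) s1 tw; have [lvw _] := wderivP (Hvw s s1').
have lh := (Hh s ss2).1.
have lphi := test_l2 (test_partials s tp); have lpsi := test_l2 (test_partials s (tq n)).
have ErP f k : (forall x, ~ Omega x -> k x = 0) -> rs (fun x => f x - k x) = fun x => rs f x - k x.
 move=> k0; apply/funext => x; have [Ox|Ox] := pselect (Omega x); first by rewrite !rs_in.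
 by rewrite !rs_out // k0 // subrr.
have z1 x : ~ Omega x -> partials s phi x = 0 by exact: (test_out (test_partials s tp)).
have z2 x : ~ Omega x -> partials s (psi n) x = 0 by exact: (test_out (test_partials s (tq n))).
rewrite integral_sqr_n2; last first.
 rewrite ErP; first by apply: l2B; [exact/(L2P)|rewrite partialsD //; exact: l2D].
 by move=> x Ox; rewrite partialsD // z1 // z2 // addr0.
rewrite lte_fin ErP; last by move=> x Ox; rewrite partialsD // z1 // z2 // addr0.
have a1 : n2 (fun x => rs (wderiv Omega s V) x - partials s phi x) < eps / 8.
 have := Hp s s1'; rewrite integral_sqr_n2 ?ErP ?lte_fin //.
 by apply: l2B => //; exact/(L2P).
have a2 := Hn s s1'; rewrite Es n2BC in a2.
have lg := l2D ((L2P _).1 lv) lh.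
have lpp : l2 (partials s (fun x => phi x + psi n x)) by rewrite partialsD //; exact: l2D.
have := n2_trans ((L2P _).1 lvw) lg lpp.
rewrite (wderiv_test_lim (isT : (1 <= 2)%N) s1 tw s1') mulr0 add0r.
move=> /le_lt_trans; apply.
have := n2D_le (l2B ((L2P _).1 lv) lphi) (l2B lh lpsi).
rewrite (_ : (fun x => _ + _) = fun x => rs (wderiv Omega s V) x + h s x -
  partials s (fun x => phi x + psi n x) x); last first.
 by apply/funext => x; rewrite partialsD // opprD addrACA.
by move: a1 a2; rewrite /V; clear; lra.
Qed.

Definition lap u : pl -> R := rs (laplacian Omega u).

Lemma ord2_max : lift ord0 ord0 = o_1 :> 'I_2.
exact/val_inj. Qed.

Lemma lapE u : lap u = fun x => rs (wderiv Omega [:: o_0; o_0] u) x +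
 rs (wderiv Omega [:: o_1; o_1] u) x.
rewrite /lap -rsD; congr (rs _); apply/funext => x.
by rewrite /laplacian big_ord_recl big_ord1 ord2_max.
Qed.

Lemma lap_l2 u : sobolev Omega 2 u -> l2 (lap u).
move=> [_ H]; rewrite lapE; apply: l2D; apply/(L2P).
- exact: (wderivP (H [:: o_0; o_0] isT)).1.
- exact: (wderivP (H [:: o_1; o_1] isT)).1.
Qed.

Definition lapl phi x : R := partials [:: o_0; o_0] phi x + partials [:: o_1; o_1] phi x.

Lemma I_lap u phi : sobolev Omega 2 u -> test_function Omega phi ->
 I (fun x => lap u x * phi x) = I (fun x => rs u x * lapl phi x).
move=> [lu H] tp.
have [l0 /weak_derivP w0] := wderivP (H [:: o_0; o_0] isT).
have [l1 /weak_derivP w1] := wderivP (H [:: o_1; o_1] isT).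
have lp := test_l2 tp.
have ls s := test_l2 (test_partials s tp).
have e2 : (-1) ^+ 2 = 1 :> R by lra.
have E0 := w0 phi tp; have E1 := w1 phi tp.
rewrite (_ : size _ = 2%N) // e2 mul1r in E0; rewrite (_ : size _ = 2%N) // e2 mul1r in E1.
have lu' := (L2P u).1 lu.
have gen (U A B P Q : pl -> R) : l2 U -> l2 A -> l2 B -> l2 P -> l2 Q ->
  I (fun x => U x * P x) = I (fun x => A x * phi x) ->
  I (fun x => U x * Q x) = I (fun x => B x * phi x) ->
  I (fun x => (A x + B x) * phi x) = I (fun x => U x * (P x + Q x)).
 move=> lU lA lB lP lQ EA EB.
 rewrite (_ : (fun x => (A x + B x) * phi x) = fun x => A x * phi x + B x * phi x); last first.
  by apply/funext => x; rewrite mulrDl.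
 rewrite (_ : (fun x => U x * (P x + Q x)) = fun x => U x * P x + U x * Q x); last first.
  by apply/funext => x; rewrite mulrDr.
 by rewrite !ID; [rewrite EA EB|exact: l2_ig_mul..].
rewrite lapE; apply: gen => //; exact/(L2P).
Qed.

Lemma lap_test_lim u w h : sobolev Omega 2 u -> test_lim w h ->
 n2 (fun x => lap (fun x => u x + w x) x -
  (lap u x + (h [:: o_0; o_0] x + h [:: o_1; o_1] x))) = 0.
move=> su tw; have s2 := sobolev_test_lim (leqnn 2) su tw.
have [_ Hh _] := tw.
have [_ H] := su; have [_ H'] := s2.
have L s (p : (size s <= 2)%N) := (L2P _).1 (wderivP (H s p)).1.
have L' s (p : (size s <= 2)%N) := (L2P _).1 (wderivP (H' s p)).1.
pose a : seq 'I_2 := [:: o_0; o_0]; pose b : seq 'I_2 := [:: o_1; o_1].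
have za := wderiv_test_lim (leqnn 2) su tw (isT : (size a <= 2)%N).
have zb := wderiv_test_lim (leqnn 2) su tw (isT : (size b <= 2)%N).
have := n2D_le (l2B (L' a isT) (l2D (L a isT) (Hh a isT).1)) (l2B (L' b isT) (l2D (L b isT) (Hh b isT).1)).
rewrite za zb mulr0 addr0 !lapE (_ : (fun x => _ + _) = fun x =>
  rs (wderiv Omega [:: o_0; o_0] (fun x0 => u x0 + w x0)) x +
  rs (wderiv Omega [:: o_1; o_1] (fun x0 => u x0 + w x0)) x -
  (rs (wderiv Omega [:: o_0; o_0] u) x + rs (wderiv Omega [:: o_1; o_1] u) x +
  (h [:: o_0; o_0] x + h [:: o_1; o_1] x))); last first.
 have gen (A B C D E F : R) : A - (C + E) + (B - (D + F)) = A + B - (C + D + (E + F)) by ring.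
 by apply/funext => x; exact: gen.
by move=> E; apply/eqP; rewrite eq_le E n2_ge0.
Qed.

Definition pos u : set pl := Omega `&` [set x | 0 < u x].
Definition energy u : R := n2 (lap u) + I (\1_(pos u)).

Lemma pos_measurable u : L2 Omega u -> measurable (pos u).
move=> [mu_ _]; rewrite /pos.
have := mu_ mO `]0, +oo[%classic (measurable_itv _); congr (measurable _).
by apply/seteqP; split=> x /= [Ox]; rewrite ?in_itv /= ?andbT.
Qed.

Lemma pos_ig u : L2 Omega u -> ig (\1_(pos u) : pl -> R).
move=> lu; apply: (@ig_bounded _ 1).
- by apply: measurable_indic; exact: pos_measurable.
- by apply: bsupp_O => x Ox; rewrite indicE memNset // => -[].
- by move=> x; rewrite indicE; case: (_ \in _); rewrite ?normr1 ?normr0.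
Qed.

Lemma J_energy u : sobolev Omega 2 u -> J Omega u = (energy u)%:E.
move=> su; have [lu _] := su; have [_ ll] := lap_l2 su.
rewrite /J integral_mkcond /energy /n2 -ID //; last exact: pos_ig.
rewrite -I_EFin; last by apply: igD => //; exact: pos_ig.
apply: eq_integral => x _; rewrite patchE /lap /rs patchE /=.
case: ifP => [|/negbT]; rewrite ?notin_setE ?inE => Ox.
 rewrite real_normK ?num_real // !indicE; congr ((_ + _%:R)%:E).
 by congr nat_of_bool; apply/idP/idP; rewrite !inE => // -[].
by rewrite expr0n add0r indicE memNset // => -[].
Qed.

End Admissible.

(** * The Laplacian of radial functions *)

Section RadialLaplacian.
Implicit Types (f g h df ddf : R -> R) (A : set R).

(* The Laplacian of [h (|y|^2)] in the plane is [Lam h (|y|^2)]. *)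
Definition Lam h (t : R) : R := 4 * (t * 'D_1 ('D_1 h) t + 'D_1 h t).

Lemma smoothR_Lam h : smoothR h -> smoothR (Lam h).
move=> sh; apply: smooth_mul; first smt.
smt.
Qed.

Lemma open_gtR (a : R) : open [set s : R | a < s].
exact: open_gt. Qed.

Lemma open_ltR (a : R) : open [set s : R | s < a].
exact: open_lt. Qed.

Lemma derive_eq_open f g A : open A -> (forall t : R, A t -> f t = g t) ->
 forall t : R, A t -> 'D_1 f t = 'D_1 g t.
move=> oA E t At; apply: near_eq_derive; have := oA _ At.
by apply: filterS => s; exact: E.
Qed.

Lemma Lam_eq_open f g A : open A -> (forall t : R, A t -> f t = g t) ->
 forall t : R, A t -> Lam f t = Lam g t.
move=> oA E t At; rewrite /Lam (derive_eq_open oA E At).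
by rewrite (derive_eq_open oA (derive_eq_open oA E) At).
Qed.

Lemma derive_open f df ddf A : open A -> (forall t : R, A t -> is_derive t 1 f (df t)) ->
 (forall t : R, A t -> is_derive t 1 df (ddf t)) ->
 forall t : R, A t -> 'D_1 f t = df t /\ 'D_1 ('D_1 f) t = ddf t.
move=> oA D1 D2; have E (t : R) : A t -> 'D_1 f t = df t by move=> /D1 [].
by move=> t At; split; [exact: E|rewrite (derive_eq_open oA E At); case: (D2 t At)].
Qed.

Lemma Lam_open f df ddf A : open A -> (forall t : R, A t -> is_derive t 1 f (df t)) ->
 (forall t : R, A t -> is_derive t 1 df (ddf t)) ->
 forall t : R, A t -> Lam f t = 4 * (t * ddf t + df t).
by move=> oA D1 D2 t At; have [e1 e2] := derive_open oA D1 D2 At; rewrite /Lam e1 e2. Qed.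

Lemma der_id (t : R) : is_derive t 1 (fun s : R => s) 1.
exact: is_derive_id. Qed.

Lemma der_cst (c t : R) : is_derive t 1 (fun _ : R => c) 0.
exact: is_derive_cst. Qed.

Lemma der_scale f (c t df : R) : is_derive t 1 f df ->
 is_derive t 1 (fun s : R => c * f s) (c * df).
by move=> H; have := der_mul (der_cst c t) H; rewrite mul0r add0r. Qed.

Lemma der_lnR (t : R) : 0 < t -> is_derive t 1 (fun s : R => ln s) t^-1.
exact: is_derive1_ln. Qed.

Lemma der_invR (t : R) : 0 < t -> is_derive t 1 (fun s : R => s^-1) (- (1 / t ^+ 2)).
by move=> t0; apply: der_inv (der_id t); lra. Qed.

Lemma LamD f g : smoothR f -> smoothR g ->
 Lam (fun t => f t + g t) = fun t => Lam f t + Lam g t.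
move=> sf sg; apply/funext => t.
have D1 (s : R) := der_add (smoothR_der s sf) (smoothR_der s sg).
have D2 (s : R) := der_add (smoothR_der s (smoothR_D sf)) (smoothR_der s (smoothR_D sg)).
rewrite (Lam_open openT (fun s _ => D1 s) (fun s _ => D2 s)) // /Lam.
by move: ('D_1 ('D_1 f) t) ('D_1 ('D_1 g) t) ('D_1 f t) ('D_1 g t) => a b c d; ring.
Qed.

Lemma LamZ f (c : R) : smoothR f -> Lam (fun t => c * f t) = fun t => c * Lam f t.
move=> sf; apply/funext => t.
have D1 (s : R) := der_scale c (smoothR_der s sf).
have D2 (s : R) := der_scale c (smoothR_der s (smoothR_D sf)).
rewrite (Lam_open openT (fun s _ => D1 s) (fun s _ => D2 s)) // /Lam; ring.
Qed.

Lemma der_dilate f (c t df : R) : is_derive (c * t) 1 f df ->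
 is_derive t 1 (fun s : R => f (c * s)) (c * df).
move=> H; rewrite mulrC; apply: (@der_comp _ f (fun s : R => c * s)) => //.
by rewrite -[X in is_derive _ _ _ X]mulr1; apply: der_scale; smt.
Qed.

Lemma Lam_dilate f (c : R) : smoothR f ->
 Lam (fun t => f (c * t)) = fun t => c * Lam f (c * t).
move=> sf; apply/funext => t.
have D1 (s : R) := der_dilate (smoothR_der (c * s) sf).
have D2 (s : R) := der_scale c (der_dilate (smoothR_der (c * s) (smoothR_D sf))).
rewrite (Lam_open openT (fun s _ => D1 s) (fun s _ => D2 s)) // /Lam; ring.
Qed.

Lemma Lam_cst (c : R) : Lam (fun _ => c) = fun _ => 0.
apply/funext => t; rewrite (@Lam_open _ (fun _ => 0) (fun _ => 0) setT openT) //; by ring.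
Qed.

Lemma Lam_id : Lam (fun t => t) = fun _ => 4.
apply/funext => t; rewrite (@Lam_open _ (fun _ => 1) (fun _ => 0) setT openT) //; by ring.
Qed.

Lemma Lam_ln (t : R) : 0 < t -> Lam (fun s => ln s) t = 0.
move=> t0; rewrite (@Lam_open _ _ _ [set s | 0 < s] (@open_gtR 0) (@der_lnR) (@der_invR)) //.
by field; rewrite gt_eqF.
Qed.

Lemma der_xlnx (t : R) : 0 < t -> is_derive t 1 (fun s : R => s * ln s) (ln t + 1).
move=> t0; have := der_mul (der_id t) (der_lnR t0).
by rewrite mul1r mulfV ?gt_eqF.
Qed.

Lemma der_lnD1 (t : R) : 0 < t -> is_derive t 1 (fun s : R => ln s + 1) t^-1.
by move=> t0; have := der_add (der_lnR t0) (der_cst 1 t); rewrite addr0.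
Qed.

Lemma Lam_xlnx (t : R) : 0 < t -> Lam (fun s => s * ln s) t = 8 + 4 * ln t.
move=> t0; rewrite (@Lam_open _ _ _ [set s | 0 < s] (@open_gtR 0) (@der_xlnx) (@der_lnD1)) //.
by field; rewrite gt_eqF.
Qed.

Lemma Lam2_xlnx (t : R) : 0 < t -> Lam (Lam (fun s => s * ln s)) t = 0.
move=> t0; rewrite (@Lam_eq_open _ (fun s => 8 + 4 * ln s) [set s | 0 < s] (@open_gtR 0)) //; last first.
 by move=> s; exact: Lam_xlnx.
have D1 (s : R) : 0 < s -> is_derive s 1 (fun s : R => 8 + 4 * ln s) (4 * s^-1).
 move=> s0; have := der_add (der_cst 8 s) (der_scale 4 (der_lnR s0)).
 by rewrite add0r.
have D2 (s : R) : 0 < s -> is_derive s 1 (fun s : R => 4 * s^-1) (4 * - (1 / s ^+ 2)).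
 by move=> s0; apply: der_scale; exact: der_invR.
rewrite (@Lam_open _ _ _ [set s | 0 < s] (@open_gtR 0) D1 D2) //.
by field; rewrite gt_eqF.
Qed.

Lemma der_nsq_shift (z y : pl) i :
 is_derive y (e_ i) (fun x => nsq (x - z)) (2 * coord2 i (y - z)).
apply: (der_shift_plane (z := - z)); apply: is_derive_eq (der_nsq _ _) _.
rewrite /basis2 /coord2; case: ifP => _ /=; ring.
Qed.

Lemma der_coord (z y : pl) i :
 is_derive y (e_ i) (fun x => coord2 i (x - z)) 1.
have H : is_derive (y - z) (e_ i) (fun x => coord2 i x) 1.
 rewrite /basis2 /coord2; case: ifP => _; first exact: der_fst.
 exact: der_snd.
exact: der_shift_plane H.
Qed.

Lemma derive_radial h (z y : pl) i : smoothR h ->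
 'D_(e_ i) (fun x => h (nsq (x - z))) y = 'D_1 h (nsq (y - z)) * (2 * coord2 i (y - z)).
move=> sh.
have [_ ->] // := der_comp (der_nsq_shift z y i) (smoothR_der (nsq (y - z)) sh).
Qed.

Lemma lapl_radial h (z : pl) : smoothR h ->
 lapl (fun x => h (nsq (x - z))) = fun y => Lam h (nsq (y - z)).
move=> sh; apply/funext => y.
have D2 i : partials [:: i; i] (fun x => h (nsq (x - z))) y =
  'D_1 ('D_1 h) (nsq (y - z)) * (2 * coord2 i (y - z)) ^+ 2 + 'D_1 h (nsq (y - z)) * 2.
 rewrite [partials _ _ _]/=.
 rewrite (_ : 'D_(e_ i) (fun x => h (nsq (x - z))) =
  fun y => 'D_1 h (nsq (y - z)) * (2 * coord2 i (y - z))); last first.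
  by apply/funext => x; exact: derive_radial.
 have H1 := der_comp (der_nsq_shift z y i) (smoothR_der (nsq (y - z)) (smoothR_D sh)).
 have H2 : is_derive y (e_ i) (fun x => 2 * coord2 i (x - z)) 2.
  have := der_mul (is_derive_cst (2 : R) y (e_ i)) (der_coord z y i).
  by rewrite mul0r add0r mulr1.
 have [_ ->] := der_mul H1 H2.
 by ring.
rewrite /lapl !D2 /Lam {5}/nsq; lra.
Qed.

End RadialLaplacian.

(** * The regularized biharmonic kernel *)

Section LogKernels.
Implicit Types (a e t : R).

(** A positive smooth modification of the identity, changed only for [t < 1/16], so that its
    logarithm is a logarithm smoothed at the origin. *)
Definition pp t := t * (1 - cut (16 * t)) + cut (16 * t).

Lemma smoothR_cutZ (c : R) : smoothR (fun t => cut (c * t)).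
apply: smooth_comp; first smt.
by apply: smooth_mul; smt.
Qed.

Lemma smoothR_pp : smoothR pp.
apply: smooth_add; last exact: smoothR_cutZ.
apply: smooth_mul; first smt.
by apply: smooth_sub; [exact: smooth_cst|exact: smoothR_cutZ].
Qed.

Lemma pp_id t : 16^-1 <= t -> pp t = t.
move=> H; rewrite /pp cut0 ?subr0 ?mulr1 ?addr0 //.
lra.
Qed.

Lemma pp_bnd t : t <= 16^-1 -> 32^-1 <= pp t <= 1.
move=> H; rewrite /pp; have c0 := cut_ge0 (16 * t); have c1 := cut_le1 (16 * t).
have [h|h] := leP (16 * t) 2^-1; first by rewrite cut1 //; lra.
have a1 : 0 <= (t - 32^-1) * (1 - cut (16 * t)) by apply: mulr_ge0; lra.
have a2 : 0 <= (1 - t) * (1 - cut (16 * t)) by apply: mulr_ge0; lra.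
lra.
Qed.

Lemma pp_gt0 t : 0 < pp t.
have [h|h] := leP t 16^-1; first by have /andP[] := pp_bnd h; lra.
by rewrite pp_id ?ltW //; lra.
Qed.

Definition Lg t := ln (pp t).

Lemma smoothR_Lg : smoothR Lg.
by apply: smooth_ln_comp; [exact: smoothR_pp|exact: pp_gt0]. Qed.

Lemma Lg_ln t : 16^-1 <= t -> Lg t = ln t.
by move=> H; rewrite /Lg pp_id. Qed.

Lemma Lg_bnd t : t <= 16^-1 -> `|Lg t| <= ln 32.
move=> H; have /andP[h1 h2] := pp_bnd H; rewrite /Lg ler_norml; apply/andP; split.
 by rewrite -lnV ?posrE // ler_ln ?posrE ?invr_gt0 // pp_gt0.
by rewrite (le_trans (ln_le0 h2)) // ln_ge0 //; lra.
Qed.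

(** At [t = |y|^2] this is, up to a factor, the fundamental solution [|y|^2 ln |y|^2] of the
    bilaplacian, smoothed near 0. [Kf] is its bilaplacian, supported in [t <= 1/16]. *)
Definition xL t := t * Lg t.

Lemma smoothR_xL : smoothR xL.
by apply: smooth_mul; [exact: smoothR_id|exact: smoothR_Lg]. Qed.

Definition Kf := Lam (Lam xL).

Lemma smoothR_Kf : smoothR Kf.
exact/smoothR_Lam/smoothR_Lam/smoothR_xL. Qed.

Lemma LamxL t : 16^-1 < t -> Lam xL t = 8 + 4 * ln t.
move=> H; rewrite (@Lam_eq_open _ (fun s => s * ln s) [set s | 16^-1 < s] (@open_gtR _)) //.
 by rewrite Lam_xlnx //; lra.
by move=> s /= hs; rewrite /xL Lg_ln // ltW.
Qed.

Lemma Kf0 t : 16^-1 < t -> Kf t = 0.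
move=> H; rewrite /Kf (@Lam_eq_open _ (Lam (fun s => s * ln s)) [set s | 16^-1 < s] (@open_gtR _)) //.
 by rewrite Lam2_xlnx //; lra.
by move=> s /= hs; rewrite LamxL // Lam_xlnx //; lra.
Qed.

Definition kc : R := I (fun y : pl => Kf (nsq y)).

Lemma Kf_nsq_continuous : continuous (fun y : pl => Kf (nsq y)).
by apply: smooth_cont (smooth_comp smoothR_Kf (@sm2_nsq)). Qed.

Lemma bsupp_nsq (h : R -> R) (N : R) : (forall t, N < t -> h t = 0) -> bsupp (fun y : pl => h (nsq y)).
move=> H; exists (`|N| + 1) => x Hx; apply: H.
apply: lt_le_trans (norm_le_nsq x).
have := ler_norm N; have := normr_ge0 N => h0 h1.
have : (`|N| + 1) ^+ 2 <= `|x| ^+ 2.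
 by rewrite lerXn2r ?nnegrE; lra.
by rewrite sqrrD1; have := sqr_ge0 `|N|; lra.
Qed.

(** One integration by parts against a cutoff equal to 1 on the support of [Kf]: where the cutoff
    varies, [Lam xL] is [8 + 4 ln t], and the integrand becomes [- 16 cut']. *)
Lemma kc_gt0 : 0 < kc.
pose G := Lam xL; have sG : smoothR G by exact/smoothR_Lam/smoothR_xL.
pose g := fun y : pl => G (nsq y); pose c := fun y : pl => cut (nsq y).
have sg : sm2 g by exact: smooth_comp sG (@sm2_nsq).
have sc : sm2 c := @cut_nsq_sm2.
have bc : bsupp c := @cut_nsq_bsupp.
have n0 (h : R -> R) : (fun y : pl => h (nsq y)) = fun y => h (nsq (y - 0)).
 by apply/funext => y; rewrite subr0.
have Ek : kc = I (fun y => lapl g y * c y).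
 congr (I _); apply/funext => y; rewrite /g (n0 G) lapl_radial // subr0 -/Kf.
 have [h|h] := leP (nsq y) 16^-1; first by rewrite /c cut1 ?mulr1 //; lra.
 by rewrite Kf0 // mul0r.
have ip i : I (fun y => partials [:: i; i] g y * c y) =
  - I (fun y => 'D_(e_ i) g y * 'D_(e_ i) c y).
 by rewrite (@I_parts ('D_(e_ i) g) c i) ?opprK //; smt.
have Igc i : ig (fun y => partials [:: i; i] g y * c y).
 apply: ig_continuous; last smt.
 move=> y; apply: cvgM; last exact: (smooth_cont sc).
 exact: (smooth_cont (sm2_partials [:: i; i] sg)).
have Igd i : ig (fun y => 'D_(e_ i) g y * 'D_(e_ i) c y).
 apply: ig_continuous; last by apply: bsuppMr; exact: (@bsupp_partials _ [:: i]).
 smt.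
have E : kc = I (fun y => 16 * - 'D_1 cut (nsq y)).
 rewrite Ek (_ : (fun y => lapl g y * c y) = fun y => partials [:: o_0; o_0] g y * c y +
   partials [:: o_1; o_1] g y * c y); last by apply/funext => y; rewrite /lapl mulrDl.
 have gen (p1 p2 q1 q2 : pl -> R) : ig p1 -> ig p2 -> ig q1 -> ig q2 ->
   I p1 = - I q1 -> I p2 = - I q2 -> I (fun y => p1 y + p2 y) = I (fun y => - (q1 y + q2 y)).
  by move=> i1 i2 j1 j2 e1 e2; rewrite ID // e1 e2 -opprD -ID // -IN //; exact: igD.
 rewrite (gen _ _ _ _ (Igc o_0) (Igc o_1) (Igd o_0) (Igd o_1) (ip o_0) (ip o_1)).
 congr (I _); apply/funext => y.
 rewrite /g /c (n0 G) (n0 cut) !derive_radial //; [|exact: smoothR_cut..].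
 rewrite !subr0 /coord2 /=.
 have [h|h] := ltP (nsq y) 2^-1; first by rewrite dcut_lo //; ring.
 have y0 : 16^-1 < nsq y by lra.
 have : 'D_1 G (nsq y) = 4 * (nsq y)^-1.
  rewrite (@derive_eq_open _ (fun s => 8 + 4 * ln s) [set s | 16^-1 < s] (@open_gtR _)) //; last first.
   by move=> s /=; exact: LamxL.
  have ny : 0 < nsq y by lra.
  have := der_add (der_cst 8 (nsq y)) (der_scale 4 (der_lnR ny)).
  by rewrite add0r => -[].
 move=> ->; transitivity (- (16 * (nsq y)^-1 * 'D_1 cut (nsq y) * nsq y)); first by rewrite {7}/nsq; ring.
 by field; lra.
rewrite E.
(* On [[1/2, 1]] the cutoff drops from 1 to 0, so it has slope -2 somewhere; the integrand is
   positive at that squared radius. *)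
have [t [_ ct]] : exists t : R, 2^-1 < t < 1 /\ 'D_1 cut t = - 2.
 have [t tI] := @MVT R cut (fun t => 'D_1 cut t) 2^-1 1 ltac:(lra) (fun t _ => smoothR_der t (@smoothR_cut))
  (continuous_subspaceT (smooth_cont (@smoothR_cut))).
 rewrite cut0 // cut1 // => H; exists t; split; first by smt.
 lra.
have t0 : 0 <= t.
 rewrite leNgt; apply/negP => h; have : 'D_1 cut t = 0 by apply: dcut_lo; lra.
 lra.
have cD : continuous (fun y : pl => 16 * - 'D_1 cut (nsq y)).
 apply: smooth_cont (_ : sm2 _); apply: smooth_mul; first smt.
 by apply: smooth_opp; exact: (smooth_comp (smoothR_D (@smoothR_cut)) (@sm2_nsq)).
apply: (@I_gt0 _ (Num.sqrt t, 0)) => //.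
- by apply: (@bsupp_nsq (fun s => 16 * - 'D_1 cut s) 1) => s s1; rewrite dcut_hi // oppr0 mulr0.
- by move=> y; rewrite mulr_ge0 // oppr_ge0 dcut_le0.
- by rewrite /nsq /= expr0n addr0 sqr_sqrtr // ct; lra.
Qed.

End LogKernels.

#[local] Hint Resolve smoothR_Lam smoothR_cutZ smoothR_pp smoothR_Lg smoothR_xL smoothR_Kf Kf_nsq_continuous : plane.

(** * Truncated logarithms and localized kernels *)

Section LogCutoff.
Implicit Types (a e : R).

(** Truncated logarithms at two scales, [cut(t) ln t - cut(4t) ln(4t)]: the singularities cancel and
    leave the constant [- ln 4] near 0. A factor 4 on squared distances is a halving of the
    radius. *)
Definition Gf (t : R) := cut t * Lg t - cut (4 * t) * (Lg t + ln 4).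

Lemma smoothR_Gf : smoothR Gf.
apply: smooth_sub; apply: smooth_mul; [exact: smoothR_cut|exact: smoothR_Lg|exact: smoothR_cutZ|].
smt.
Qed.

Lemma Gf_lo (t : R) : t <= 8^-1 -> Gf t = - ln 4.
by move=> H; rewrite /Gf !cut1 ?mul1r; lra. Qed.

Lemma Gf_hi (t : R) : 1 <= t -> Gf t = 0.
by move=> H; rewrite /Gf !cut0 ?mul0r ?subr0 //; lra. Qed.

Lemma Gf_mid (t : R) : 16^-1 < t -> t < 2^-1 -> Gf t = Lg t - Gf (4 * t).
move=> h1 h2; rewrite /Gf (cut1 (t := t)); last lra.
rewrite (cut0 (t := 4 * (4 * t))) ?mul0r ?subr0 ?mul1r; last lra.
rewrite (Lg_ln (t := 4 * t)); last lra.
rewrite lnM ?posrE //; last lra.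
by rewrite Lg_ln ?(addrC (ln t)) // ltW.
Qed.

Lemma Gf_log (t : R) : 4^-1 < t -> t < 2^-1 -> Gf t = Lg t.
by move=> h1 h2; rewrite /Gf cut1 ?cut0 ?mul1r ?mul0r ?subr0 //; lra. Qed.

(** The cutoff at half the radius lies below a multiple of [- Gf]; this is what converts mass in a
    disc into a decrease of [HH]. *)
Lemma Gf_ge (t : R) : ln 4 * cut (4 * t) <= - Gf t.
have l4 : 0 <= ln 4 :> R by apply: ln_ge0; lra.
have [h|h] := leP t 8^-1.
 by rewrite Gf_lo // opprK ler_piMr // cut_le1.
have [h1|h1] := leP 1 t; first by rewrite Gf_hi // cut0 ?mulr0 ?oppr0 //; lra.
have H : cut (4 * t) <= cut t by apply: cut_ni; lra.
have L : ln t <= 0 by apply: ln_le0; lra.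
rewrite /Gf Lg_ln; last lra.
have : 0 <= (cut t - cut (4 * t)) * - ln t by apply: mulr_ge0; lra.
lra.
Qed.

(** The part of the bilaplacian of [Gf] on [1/2 <= t <= 1]. Since [Gf] is a difference of one
    profile at two scales, its bilaplacian is a difference of two copies of [Th], and these
    telescope under halving of the radius. *)
Definition Th (t : R) := Lam (Lam Gf) t * (1 - cut (2 * t)).

Lemma smoothR_Th : smoothR Th.
apply: smooth_mul; first exact/smoothR_Lam/smoothR_Lam/smoothR_Gf.
smt.
Qed.

Lemma Lam2_Lg (t : R) : 16^-1 < t -> Lam (Lam (@Lg)) t = 0.
move=> H; rewrite (@Lam_eq_open _ (fun _ => 0) _ (@open_gtR 16^-1)) ?Lam_cst //.
move=> s /= hs; rewrite (@Lam_eq_open _ (fun s => ln s) _ (@open_gtR 16^-1)) //.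
 by rewrite Lam_ln //; lra.
by move=> r /= hr; rewrite Lg_ln // ltW.
Qed.

Lemma Lam2_Gf_hi (t : R) : 1 < t -> Lam (Lam Gf) t = 0.
move=> H; rewrite (@Lam_eq_open _ (fun _ => 0) _ (@open_gtR 1)) ?Lam_cst //.
move=> s /= hs; rewrite (@Lam_eq_open _ (fun _ => 0) _ (@open_gtR 1)) ?Lam_cst //.
by move=> r /= hr; rewrite Gf_hi // ltW.
Qed.

Lemma Lam2_Gf_lo (t : R) : t < 8^-1 -> Lam (Lam Gf) t = 0.
move=> H; rewrite (@Lam_eq_open _ (fun _ => 0) _ (@open_ltR 8^-1)) ?Lam_cst //.
move=> s /= hs; rewrite (@Lam_eq_open _ (fun _ => - ln 4) _ (@open_ltR 8^-1)) ?Lam_cst //.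
by move=> r /= hr; rewrite Gf_lo // ltW.
Qed.

Lemma open_oo (p q : R) : open [set s | p < s < q].
rewrite (_ : [set s | _] = [set s | p < s] `&` [set s | s < q]).
 by apply: openI; smt.
by apply/seteqP; split=> s /=; lra.
Qed.

Lemma Lam2_Gf_log (t : R) : 4^-1 < t -> t < 2^-1 -> Lam (Lam Gf) t = 0.
move=> h1 h2; have oA := @open_oo 4^-1 2^-1.
rewrite (@Lam_eq_open _ (Lam (@Lg)) _ oA) //=; last by rewrite h1.
 by rewrite Lam2_Lg //; lra.
apply: Lam_eq_open => // s /andP[]; exact: Gf_log.
Qed.

Lemma Lam2_Gf_mid (t : R) : 16^-1 < t -> t < 2^-1 -> Lam (Lam Gf) t = - 16 * Lam (Lam Gf) (4 * t).
move=> h1 h2; have oA := @open_oo 16^-1 2^-1.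
have s4 : smoothR (fun s : R => Gf (4 * s)).
 apply: smooth_comp smoothR_Gf _.
 by apply: smooth_mul; smt.
have sL4 : smoothR (fun s : R => Lam Gf (4 * s)).
 apply: smooth_comp (smoothR_Lam smoothR_Gf) _.
 by apply: smooth_mul; smt.
rewrite (@Lam_eq_open _ (Lam (fun s => Lg s + (- 1) * Gf (4 * s))) _ oA) //=; last by rewrite h1.
 rewrite LamD; [|exact: smoothR_Lg|exact: smooth_mul (smooth_cst _ _) s4].
 rewrite LamZ // (Lam_dilate _ smoothR_Gf).
 rewrite LamD; [|exact/smoothR_Lam/smoothR_Lg|]; last first.
  smt.
 rewrite LamZ; last by apply: smooth_mul => //; smt.
 rewrite -[RHS]add0r; congr (_ + _); first exact: Lam2_Lg.
 have E : Lam (fun s : R => 4 * Lam Gf (4 * s)) t = 4 * (4 * Lam (Lam Gf) (4 * t)).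
  rewrite (congr1 (fun h => h t) (LamZ 4 sL4)); congr (4 * _).
  exact: (congr1 (fun h => h t) (Lam_dilate 4 (smoothR_Lam smoothR_Gf))).
 lra.
apply: Lam_eq_open => // s /andP[k1 k2]; rewrite Gf_mid //; ring.
Qed.

Lemma Th_lo (t : R) : t < 2^-1 -> Th t = 0.
move=> H; have [h|h] := leP t 4^-1; rewrite /Th.
 by rewrite cut1 ?subrr ?mulr0 //; lra.
by rewrite Lam2_Gf_log // mul0r.
Qed.

Lemma Th_hi (t : R) : 1 < t -> Th t = 0.
by move=> H; rewrite /Th Lam2_Gf_hi // mul0r. Qed.

Lemma Lam2_Gf (t : R) : Lam (Lam Gf) t = Th t - 16 * Th (4 * t).
have [h|h] := ltP t 8^-1.
 by rewrite Lam2_Gf_lo // !Th_lo ?mulr0 ?subr0 //; lra.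
have [k|k] := ltP t 2^-1.
 rewrite Lam2_Gf_mid //; last lra.
 rewrite Th_lo // {1}/Th cut0; last lra.
 by ring.
rewrite (@Th_hi (4 * t)); last lra.
by rewrite /Th cut0; [ring|lra].
Qed.

(** [t ln t] smoothed at scale e and unchanged from [e / 16] on. [Psi] localizes it to [t <= a]. *)
Definition Ff e (t : R) := t * (Lg (t / e) + ln e).
Definition Psi a e (t : R) := cut (t / a) * Ff e t.

Lemma smoothR_div (h : R -> R) e : smoothR h -> smoothR (fun t => h (t / e)).
move=> sh; apply: (@smooth_comp _ _ _ h (fun t : R => t / e)) => //.
smt.
Qed.

Lemma smoothR_Ff e : smoothR (Ff e).
apply: smooth_mul; first smt.
apply: smooth_add; last smt.
exact/smoothR_div/smoothR_Lg.
Qed.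

Lemma smoothR_Psi a e : smoothR (Psi a e).
by apply: smooth_mul; [exact/smoothR_div/smoothR_cut|exact: smoothR_Ff]. Qed.

Lemma Psi_supp a e (t : R) : 0 < a -> a <= t -> Psi a e t = 0.
by move=> a0 at_; rewrite /Psi cut0 ?mul0r // ler_pdivlMr // mul1r. Qed.

Lemma Ff_xlnx e (t : R) : 0 < e -> e / 16 <= t -> Ff e t = t * ln t.
move=> e0 H; have t0 : 0 < t by lra.
have te : 16^-1 <= t / e by rewrite ler_pdivlMr //; lra.
by rewrite /Ff Lg_ln // ln_div ?posrE // subrK.
Qed.

Lemma Lam2_Ff e (t : R) : 0 < e -> Lam (Lam (Ff e)) t = e^-1 * Kf (t / e).
move=> e0; have -> : Ff e = fun t => e * xL (e^-1 * t) + ln e * t.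
 by apply/funext => s; rewrite /Ff /xL [e^-1 * s]mulrC; field; lra.
have sx : smoothR (fun t : R => xL (e^-1 * t)).
 apply: smooth_comp (@smoothR_xL) _.
 by apply: smooth_mul; smt.
have sx' : smoothR (fun t : R => Lam (@xL) (e^-1 * t)).
 apply: smooth_comp (smoothR_Lam (@smoothR_xL)) _.
 by apply: smooth_mul; smt.
rewrite LamD; [|exact: smooth_mul (smooth_cst _ _) sx|exact: smooth_mul (smooth_cst _ _) (@smoothR_id)].
rewrite LamZ // LamZ; last smt.
rewrite Lam_id Lam_dilate; last exact: smoothR_xL.
rewrite LamD; [|exact: smooth_mul (smooth_cst _ _) (smooth_mul (smooth_cst _ _) sx')|exact: smooth_cst].
rewrite Lam_cst LamZ; last smt.
rewrite LamZ // Lam_dilate; last exact/smoothR_Lam/smoothR_xL.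
by rewrite /Kf addr0 [t / e]mulrC; field; lra.
Qed.

(** What localization adds to the concentrating kernel. It lives on [a / 2 <= t <= a], where [Psi]
    has forgotten e; hence it is the same for all [e <= 4 * a]. *)
Definition Rr a e (t : R) := Lam (Lam (Psi a e)) t - e^-1 * Kf (t / e).

Lemma smoothR_Rr a e : smoothR (Rr a e).
apply: smooth_sub; first exact/smoothR_Lam/smoothR_Lam/smoothR_Psi.
by apply: smooth_mul; [exact: smooth_cst|exact/smoothR_div/smoothR_Kf].
Qed.

Lemma Psi_lo a e (t : R) : 0 < a -> t < a / 2 -> Psi a e t = Ff e t.
by move=> a0 H; rewrite /Psi cut1 ?mul1r // ler_pdivrMr //; lra. Qed.

Lemma Rr_lo a e (t : R) : 0 < a -> 0 < e -> t < a / 2 -> Rr a e t = 0.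
move=> a0 e0 H; rewrite /Rr (@Lam_eq_open _ (Lam (Ff e)) _ (@open_ltR (a / 2))) //.
 by rewrite Lam2_Ff // subrr.
by apply: Lam_eq_open; [exact: open_ltR|move=> s; exact: Psi_lo].
Qed.

Lemma Psi_indep a e e' (t : R) : 0 < e -> 0 < e' -> e / 16 <= t -> e' / 16 <= t ->
 Psi a e t = Psi a e' t.
by move=> e0 e0' h h'; rewrite /Psi !Ff_xlnx. Qed.

Lemma Rr_indep a e e' : 0 < a -> 0 < e <= 4 * a -> 0 < e' <= 4 * a -> Rr a e = Rr a e'.
move=> a0 /andP[e0 ea] /andP[e0' ea']; apply/funext => t.
have [h|h] := ltP t (a / 2); first by rewrite !Rr_lo.
rewrite /Rr !Kf0; [|rewrite ltr_pdivlMr //; lra..].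
rewrite (@Lam_eq_open _ (Lam (Psi a e')) _ (@open_gtR (a / 4))) //=; first by lra.
 apply: Lam_eq_open; first smt.
 by move=> s /= hs; apply: Psi_indep => //; lra.
by lra.
Qed.

Lemma Rr_hi a e (t : R) : 0 < a -> 0 < e <= 4 * a -> a < t -> Rr a e t = 0.
move=> a0 /andP[e0 ea] at_; rewrite /Rr Kf0; last by rewrite ltr_pdivlMr //; lra.
rewrite mulr0 subr0 (@Lam_eq_open _ (fun _ => 0) _ (@open_gtR a)) ?Lam_cst //.
move=> r /= hr; rewrite (@Lam_eq_open _ (fun _ => 0) _ (@open_gtR a)) ?Lam_cst //.
by move=> s /= hs; rewrite Psi_supp // ltW.
Qed.

Lemma cont_bounded_seg (f : R -> R) (p q : R) : continuous f -> exists2 M : R, 0 <= M &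
 forall t : R, p <= t <= q -> `|f t| <= M.
move=> cf; have cc : compact (f @` `[p, q]%classic).
 apply: continuous_compact; last exact: segment_compact.
 exact: continuous_subspaceT.
have [M [_ HM]] := compact_bounded cc; exists (`|M| + 1); first by smt.
move=> t tpq; apply: (HM (`|M| + 1)); last by exists t => //=; smt.
by rewrite (le_lt_trans (ler_norm _)) // ltrDl.
Qed.

(** The constant is uniform in e: below [a / 2] the kernel is exactly [s ln s], with explicit
    derivatives, and above [a / 4] it coincides with the single function [Psi a (4 * a)], controlled
    by compactness. *)
Lemma Psi_bound a : 0 < a -> exists2 C : R, 0 <= C & forall e, 0 < e <= 4 * a ->
 forall s : R, e / 16 < s -> `|'D_1 ('D_1 (Psi a e)) s| * s <= C /\
  `|'D_1 ('D_1 ('D_1 (Psi a e))) s| * s ^+ 2 <= C.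
move=> a0; pose P := Psi a (4 * a); have sP : smoothR P := smoothR_Psi _ _.
have [M2 M20 H2] := @cont_bounded_seg ('D_1 ('D_1 P)) (a / 2) a (smooth_cont (smoothR_D (smoothR_D sP))).
have [M3 M30 H3] := @cont_bounded_seg ('D_1 ('D_1 ('D_1 P))) (a / 2) a
 (smooth_cont (smoothR_D (smoothR_D (smoothR_D sP)))).
exists (1 + M2 * a + M3 * a ^+ 2).
 smt.
move=> e /andP[e0 ea] s hs; have s0 : 0 < s by lra.
have M2a : 0 <= M2 * a by smt.
have M3a : 0 <= M3 * a ^+ 2 by apply: mulr_ge0 => //; smt.
have [h|h] := ltP s (a / 2).
 have oA := @open_oo (e / 16) (a / 2).
 have As : e / 16 < s < a / 2 by lra.
 have E (t : R) : e / 16 < t < a / 2 -> Psi a e t = t * ln t.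
  by move=> /andP[h1 h2]; rewrite Psi_lo // Ff_xlnx // ltW.
 have E1 (t : R) : e / 16 < t < a / 2 -> 'D_1 (Psi a e) t = ln t + 1.
  move=> At; rewrite (derive_eq_open oA E At); have t0 : 0 < t by lra.
  by case: (der_xlnx t0).
 have E2 (t : R) : e / 16 < t < a / 2 -> 'D_1 ('D_1 (Psi a e)) t = t^-1.
  move=> At; rewrite (derive_eq_open oA E1 At); have t0 : 0 < t by lra.
  by case: (der_lnD1 t0).
 have -> : 'D_1 ('D_1 ('D_1 (Psi a e))) s = - (1 / s ^+ 2).
  by rewrite (derive_eq_open oA E2 As); case: (der_invR s0).
 have e2 : `|s^-1| * s = 1 by rewrite gtr0_norm ?invr_gt0 // mulVf // gt_eqF.
 have e3 : `|- (1 / s ^+ 2)| * s ^+ 2 = 1.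
  rewrite normrN ger0_norm; last by smt.
  by rewrite divfK // expf_neq0 // gt_eqF.
 by rewrite E2 // e2 e3; split; lra.
have oA := @open_gtR (a / 4).
have As : a / 4 < s by lra.
have E (t : R) : a / 4 < t -> Psi a e t = P t.
 by move=> At; apply: Psi_indep => //; lra.
have E1 := derive_eq_open oA E; have E2 := derive_eq_open oA E1; have E3 := derive_eq_open oA E2.
rewrite (E2 s As) (E3 s As).
have [k|k] := leP s a.
 have b2 : `|'D_1 ('D_1 P) s| <= M2 by apply: H2; rewrite h k.
 have b3 : `|'D_1 ('D_1 ('D_1 P)) s| <= M3 by apply: H3; rewrite h k.
 have c2 : `|'D_1 ('D_1 P) s| * s <= M2 * a by apply: ler_pM => //; exact: ltW.
 have c3 : `|'D_1 ('D_1 ('D_1 P)) s| * s ^+ 2 <= M3 * a ^+ 2.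
  by apply: ler_pM => //; [exact: sqr_ge0|rewrite lerXn2r ?nnegrE ?(ltW s0) ?(ltW a0)].
 by split; [apply: le_trans c2 _|apply: le_trans c3 _]; move: (M2 * a) (M3 * a ^+ 2) M2a M3a => A B h1 h2; clear - h1 h2; lra.
have Z (t : R) : a < t -> P t = 0 by move=> At; apply: Psi_supp => //; exact: ltW.
have oB := @open_gtR a.
have z1 (t : R) : a < t -> 'D_1 P t = 0.
 by move=> At; rewrite (@derive_eq_open _ (fun _ => 0) _ oB Z t At); case: (der_cst 0 t).
have z2 (t : R) : a < t -> 'D_1 ('D_1 P) t = 0.
 by move=> At; rewrite (@derive_eq_open _ (fun _ => 0) _ oB z1 t At); case: (der_cst 0 t).
have z3 (t : R) : a < t -> 'D_1 ('D_1 ('D_1 P)) t = 0.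
 by move=> At; rewrite (@derive_eq_open _ (fun _ => 0) _ oB z2 t At); case: (der_cst 0 t).
by rewrite z2 // z3 // normr0 !mul0r; split; lra.
Qed.

Lemma ln_le_id (x : R) : 0 < x -> ln x <= x.
move=> x0; have := @le_ln1Dx R (x - 1); rewrite (_ : 1 + (x - 1) = x); last by ring.
lra.
Qed.

(* The logarithmic singularity at scale [A]: subtracting [s ln A] from
  [s ln s] leaves a quantity bounded by the scale. *)
Lemma Ff_near e (A s : R) : 0 < e <= A -> 0 <= s <= A ->
 `|Ff e s - s * ln A| <= (1 + ln 32) * A.
move=> /andP[e0 eA] /andP[s0 sA].
have A0 : 0 < A by lra.
have l32 : 0 <= ln 32 :> R by apply: ln_ge0; lra.
have key (x : R) : 0 < x <= A -> `|x * (ln x - ln A)| <= A.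
 move=> /andP[x0 xA]; rewrite normrM gtr0_norm // distrC -ln_div ?posrE //.
 rewrite ger0_norm; last by apply: ln_ge0; rewrite ler_pdivlMr // mul1r.
 rewrite (le_trans (ler_wpM2l (ltW x0) (ln_le_id _))) ?divr_gt0 //.
 by rewrite mulrC divfK // gt_eqF.
have lA : 0 <= ln 32 * A by smt.
have [h|h] := leP (e / 16) s.
 rewrite Ff_xlnx // -mulrBr (le_trans (key s _)); [by []| |by lra].
 lra.
have se : s / e <= 16^-1 by rewrite ler_pdivrMr //; lra.
rewrite (_ : Ff e s - s * ln A = s * Lg (s / e) + s / e * (e * (ln e - ln A))); last first.
 by rewrite /Ff; field; lra.
rewrite (le_trans (ler_normD _ _)) //.
have b1 : `|s * Lg (s / e)| <= A * ln 32.
 by rewrite normrM ger0_norm // ler_pM // Lg_bnd.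
have b2 : `|s / e * (e * (ln e - ln A))| <= A.
 rewrite normrM ger0_norm; last by smt.
 have k1 : `|e * (ln e - ln A)| <= A by apply: key; rewrite e0.
 rewrite -[leRHS]mul1r ler_pM //; first by smt.
 by lra.
lra.
Qed.

End LogCutoff.

(** * Third-order finite differences *)

Section ThirdDifference.

Lemma seg_bound (p w : R -> R) (M a : R) : (forall x : R, is_derive x 1 p (w x)) ->
 (forall x : R, `|x| <= a -> `|w x| <= M) ->
 forall t : R, `|t| <= a -> `|p t - p 0| <= M * `|t|.
move=> Dp wM t ta; have cp : continuous p.
 by move=> x; apply/differentiable_continuous/derivable1_diffP; smt.
have [t0|t0] := leP 0 t.
 have [c] := @MVT_segment R p w 0 t t0 (fun (t : R) _ => Dp t) (continuous_subspaceT cp).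
 rewrite in_itv /= => /andP[c0 ct] ->; rewrite subr0 normrM ler_wpM2r // wM //.
 by rewrite (le_trans _ ta) // ger0_norm // ger0_norm.
have [c] := @MVT_segment R p w t 0 (ltW t0) (fun (t : R) _ => Dp t) (continuous_subspaceT cp).
rewrite in_itv /= => /andP[c0 ct]; rewrite distrC => ->; rewrite sub0r normrM normrN ler_wpM2r // wM //.
by rewrite (le_trans _ ta) // ler0_norm // ltr0_norm // lerN2.
Qed.

Lemma taylor3 (g : R -> R) (M a : R) : smoothR g -> 0 <= M ->
 (forall t : R, `|t| <= a -> `|'D_1 ('D_1 ('D_1 g)) t| <= M) ->
 forall t : R, `|t| <= a ->
 `|g t - (g 0 + 'D_1 g 0 * t + 'D_1 ('D_1 g) 0 / 2 * t ^+ 2)| <= M * a ^+ 3.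
move=> sg M0 HM t ta; have a0 : 0 <= a := le_trans (normr_ge0 t) ta.
set g1 := 'D_1 g 0; set g2 := 'D_1 ('D_1 g) 0.
have B2 (s : R) : `|s| <= a -> `|'D_1 ('D_1 g) s - g2| <= M * a.
 move=> sa; rewrite (le_trans (seg_bound (fun x => smoothR_der x (smoothR_D (smoothR_D sg))) HM sa)) //.
 by rewrite ler_wpM2l.
have D1 (s : R) : is_derive s 1 (fun s : R => 'D_1 g s - (g2 * s)) ('D_1 ('D_1 g) s - g2).
 apply: der_add; first exact: smoothR_der (smoothR_D sg).
 apply: der_opp; rewrite -[X in is_derive _ _ _ X]mulr1.
 by apply: der_scale; smt.
have B1 (s : R) : `|s| <= a -> `|'D_1 g s - g2 * s - g1| <= M * a ^+ 2.
 move=> sa; have := seg_bound D1 B2 sa; rewrite mulr0 subr0 => /le_trans; apply.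
 by rewrite expr2 mulrA ler_wpM2l // mulr_ge0.
have D0 (s : R) : is_derive s 1 (fun s : R => g s - (g1 * s + g2 / 2 * (s * s))) ('D_1 g s - g2 * s - g1).
 have H : is_derive s 1 (fun s : R => g s - (g1 * s + g2 / 2 * (s * s)))
   ('D_1 g s - (g1 * 1 + g2 / 2 * (1 * s + s * 1))).
  exact: der_add (smoothR_der s sg) (der_opp (der_add
   (der_scale g1 (der_id s))
   (der_scale (g2 / 2) (der_mul (der_id s) (der_id s))))).
 by apply: is_derive_eq H _; lra.
have := seg_bound D0 B1 ta; rewrite !mulr0 addr0 subr0.
rewrite (_ : g t - _ - g 0 = g t - (g 0 + g1 * t + g2 / 2 * t ^+ 2)); last by lra.
move=> /le_trans; apply; rewrite (_ : M * a ^+ 3 = M * a ^+ 2 * a); last by ring.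
by rewrite ler_wpM2l // mulr_ge0 // sqr_ge0.
Qed.

(** Three vanishing moments annihilate the second-order Taylor polynomial, so only the remainder of
    [taylor3] is left. *)
Lemma third_diff n (c t : 'I_n -> R) (g : R -> R) (M a : R) : smoothR g -> 0 <= M ->
 \sum_j c j = 0 -> \sum_j c j * t j = 0 -> \sum_j c j * t j ^+ 2 = 0 ->
 (forall j, `|t j| <= a) ->
 (forall s : R, `|s| <= a -> `|'D_1 ('D_1 ('D_1 g)) s| <= M) ->
 `|\sum_j c j * g (t j)| <= (\sum_j `|c j|) * (M * a ^+ 3).
move=> sg M0 c0 c1 c2 ta HM.
have -> : \sum_j c j * g (t j) = \sum_j c j * (g (t j) -
  (g 0 + 'D_1 g 0 * t j + 'D_1 ('D_1 g) 0 / 2 * t j ^+ 2)).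
 transitivity (\sum_j c j * g (t j) - (g 0 * (\sum_j c j) + 'D_1 g 0 * (\sum_j c j * t j) +
  'D_1 ('D_1 g) 0 / 2 * (\sum_j c j * t j ^+ 2))).
  by rewrite c0 c1 c2 !mulr0 !addr0 subr0.
 rewrite !mulr_sumr -!big_split /= -sumrB; apply: eq_bigr => j _.
 lra.
rewrite (le_trans (ler_norm_sum _ _ _)) // mulr_suml ler_sum // => j _.
by rewrite normrM ler_wpM2l // taylor3.
Qed.

(** Along the line, [s(r) = |y - r x|^2] is a quadratic polynomial with [s'^2 <= 4 |x|^2 s]. The
    decay of the second and third derivatives of P then bounds the third derivative in r by
    [20 C |x|^3 / m], where 20 = 8 + 12 adds the two terms of the chain rule. *)
Lemma third_diff_line n (c t : 'I_n -> R) (P : R -> R) (C m a : R) (y x : pl) :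
 smoothR P -> 0 <= C -> 0 < m ->
 \sum_j c j = 0 -> \sum_j c j * t j = 0 -> \sum_j c j * t j ^+ 2 = 0 ->
 (forall j, `|t j| <= a) ->
 (forall s : R, m ^+ 2 <= s -> `|'D_1 ('D_1 P) s| * s <= C /\
   `|'D_1 ('D_1 ('D_1 P)) s| * s ^+ 2 <= C) ->
 (forall s : R, `|s| <= a -> m ^+ 2 <= nsq (y - s *: x)) ->
 `|\sum_j c j * P (nsq (y - t j *: x))| <=
  (\sum_j `|c j|) * (20 * C * enorm x ^+ 3 / m * a ^+ 3).
move=> sP C0 m0 c0 c1 c2 ta HP Hm.
set q := nsq x; set N := enorm x; have N2 : N ^+ 2 = q by rewrite /N sqr_enorm.
have N0 : 0 <= N by exact: enorm_ge0.
pose b := y.1 * x.1 + y.2 * x.2.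
pose s (r : R) := nsq y - 2 * b * r + q * (r * r).
have sE r : nsq (y - r *: x) = s r.
 rewrite /s /q /b /nsq (_ : (y - r *: x).1 = y.1 - r * x.1) // (_ : (y - r *: x).2 = y.2 - r * x.2) //.
 by ring.
have ssm : smoothR s.
 apply: smooth_add; first apply: smooth_sub; try exact: smooth_cst.
  by apply: smooth_mul; smt.
 smt.
pose s' (r : R) := 2 * q * r - 2 * b.
have Ds (r : R) : is_derive r 1 s (s' r).
 have H : is_derive r 1 s (0 - 2 * b * 1 + q * (1 * r + r * 1)).
  exact: der_add (der_add (der_cst (nsq y) r)
   (der_opp (der_scale (2 * b) (der_id r))))
   (der_scale q (der_mul (der_id r) (der_id r))).
 by apply: is_derive_eq H _; rewrite /s'; ring.
have Ds' (r : R) : is_derive r 1 s' (2 * q).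
 have H : is_derive r 1 s' (2 * q * 1 - 0).
  exact: der_add (der_scale (2 * q) (der_id r))
   (der_opp (der_cst (2 * b) r)).
 by apply: is_derive_eq H _; ring.
pose g (r : R) := P (s r).
have sg : smoothR g by exact: smooth_comp sP ssm.
have comp (h : R -> R) (r : R) : smoothR h -> is_derive r 1 (fun r => h (s r)) ('D_1 h (s r) * s' r).
 by move=> sh; apply: der_comp (Ds r) (smoothR_der _ sh).
pose g1 (r : R) := 'D_1 P (s r) * s' r.
pose g2 (r : R) := 'D_1 ('D_1 P) (s r) * s' r * s' r + 'D_1 P (s r) * (2 * q).
have G1 : 'D_1 g = g1 by apply/funext => r; case: (comp P r sP).
have G2 : 'D_1 ('D_1 g) = g2.
 rewrite G1; apply/funext => r.
 by case: (der_mul (comp _ r (smoothR_D sP)) (Ds' r)).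
have G3 r : 'D_1 ('D_1 ('D_1 g)) r = 'D_1 ('D_1 ('D_1 P)) (s r) * s' r ^+ 3 +
  6 * q * ('D_1 ('D_1 P) (s r) * s' r).
 apply: etrans (congr1 (fun h : R -> R => 'D_1 h r) G2) _.
 have [_ E3] := der_add (der_mul (der_mul (comp _ r (smoothR_D (smoothR_D sP))) (Ds' r)) (Ds' r))
  (der_mul (comp _ r (smoothR_D sP)) (der_cst (2 * q) r)).
 apply: etrans E3 _.
 by move: ('D_1 ('D_1 ('D_1 P)) (s r)) ('D_1 ('D_1 P) (s r)) ('D_1 P (s r)) => A B D; ring.
rewrite (eq_bigr (fun j => c j * g (t j))); last by move=> j _; rewrite sE.
apply: third_diff => //.
 smt.
move=> r ra; rewrite G3.
have := Hm r ra; rewrite sE => ms.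
have m2 : 0 < m ^+ 2 by smt.
have sr0 : 0 < s r by lra.
pose w := Num.sqrt (s r).
have w2 : w ^+ 2 = s r by rewrite /w sqr_sqrtr // ltW.
have w0 : 0 < w by rewrite sqrtr_gt0.
have mw : m <= w by rewrite -(ler_pXn2r (isT : (0 < 2)%N)) ?nnegrE ?(ltW m0) ?(ltW w0) // w2.
have [P2 P3] := HP (s r) ms.
have disc : `|s' r| <= 2 * N * w.
 rewrite -(ler_pXn2r (isT : (0 < 2)%N)) ?nnegrE ?mulr_ge0 // ?(ltW w0) //.
 rewrite real_normK ?num_real // !exprMn N2 w2 /s' /s /q /b /nsq.
 by have := sqr_ge0 (y.1 * x.2 - y.2 * x.1); move: y.1 y.2 x.1 x.2 => y1 y2 x1 x2; clear; nra.
have Nw : 0 <= 2 * N * w by smt.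
have a2 : `|'D_1 ('D_1 P) (s r)| <= C / w ^+ 2 by rewrite ler_pdivlMr ?exprn_gt0 // w2.
have a3 : `|'D_1 ('D_1 ('D_1 P)) (s r)| <= C / w ^+ 4.
 by rewrite ler_pdivlMr ?exprn_gt0 // (exprM w 2 2) w2.
have b3 : `|'D_1 ('D_1 ('D_1 P)) (s r) * s' r ^+ 3| <= C / w ^+ 4 * (2 * N * w) ^+ 3.
 by rewrite normrM normrX ler_pM // lerXn2r ?nnegrE.
have b2 : `|6 * q * ('D_1 ('D_1 P) (s r) * s' r)| <= 6 * N ^+ 2 * (C / w ^+ 2 * (2 * N * w)).
 rewrite normrM (@ger0_norm _ (6 * q)) ?normrM; last by rewrite mulr_ge0 // nsq_ge0.
 by rewrite N2 ler_wpM2l ?mulr_ge0 ?nsq_ge0 // ler_pM.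
rewrite (le_trans (ler_normD _ _)) // (le_trans (lerD b3 b2)) //.
rewrite (_ : _ + _ = 20 * C * N ^+ 3 / w); last by field; rewrite gt_eqF.
rewrite ler_wpM2l ?lef_pV2 ?posrE // !mulr_ge0 // exprn_ge0 //.
Qed.

End ThirdDifference.

#[local] Hint Resolve smoothR_Gf smoothR_Th smoothR_div smoothR_Ff smoothR_Psi smoothR_Rr : plane.

Local Opaque derive wderiv.

Section Lam2.

Lemma Lam2_dilate (f : R -> R) (k c t : R) : smoothR f ->
 Lam (Lam (fun s => k * f (c * s))) t = k * c ^+ 2 * Lam (Lam f) (c * t).
move=> sf.
have sd (g : R -> R) : smoothR g -> smoothR (fun s : R => g (c * s)).
 by move=> sg; apply: smooth_comp sg _; apply: smooth_mul; smt.
have sl := smoothR_Lam sf.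
rewrite (LamZ k (sd _ sf)) (Lam_dilate c sf) (LamZ k (smooth_mul (smooth_cst _ c) (sd _ sl))).
by rewrite (LamZ c (sd _ sl)) (Lam_dilate c sl); lra.
Qed.

Lemma Th4_hi (t : R) : 1 < t -> Th (4 * t) = 0.
by move=> t1; rewrite Th_hi //; lra. Qed.

End Lam2.

(** * Linear inequalities, with the analysis abstracted away *)

Section Arithmetic.
Implicit Types A B C p d : R.

Lemma half_le_of A B : A < 2 * B -> A / 2 <= B.
lra. Qed.

Lemma step_arith A B C p d : A <= B - p -> B <= C - d -> A <= C - (p + d).
lra. Qed.

Lemma no_atom_arith A B C p d P : A <= B - P -> - p <= A -> C + p < d -> B <= C -> d <= P -> False.
lra. Qed.

End Arithmetic.

Section Arithmetic.
Implicit Types p q r : R.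

Lemma nine_le p q : 0 <= q -> p <= q / 3 ^+ 2 -> 8 * p <= q.
lra. Qed.

Lemma double_le p q : 2 * p <= q -> p <= 2^-1 * q.
lra. Qed.

Lemma quad_le p q : p <= 4 * q -> p <= 2^-1 * (8 * q).
lra. Qed.

Lemma halves_le p q r : p <= r / 2 -> q <= r / 2 -> p + q <= r.
lra. Qed.

End Arithmetic.

(** * Dyadic telescoping *)

Section OddPart.

(* Telescoping over the radii rho 2^-j: the first-order part of b is pinned
  down by its limit at 0. *)
Lemma dyadic_bound (b : R -> R) (eta r1 : R) : 0 <= eta ->
 (forall rho : R, 0 < rho < r1 -> `|b rho - 2 * b (rho / 2)| <= eta * rho ^+ 2) ->
 (forall e : R, 0 < e -> exists2 r : R, 0 < r & forall rho : R, 0 < rho < r -> `|b rho| <= e * rho) ->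
 forall rho : R, 0 < rho < r1 -> `|b rho| <= 2 * eta * rho ^+ 2.
move=> eta0 Hb H0 rho /andP[r0 rr].
have p2 k : 0 < (2 : R) ^+ k by smt.
have step j : `|b rho - 2 ^+ j * b (rho / 2 ^+ j)| <= 2 * eta * rho ^+ 2 * (1 - (2 ^+ j)^-1).
 elim: j => [|j IH]; first by rewrite expr0 mul1r divr1 subrr normr0 invr1 subrr mulr0.
 have rj0 : 0 < rho / 2 ^+ j by smt.
 have rj1 : rho / 2 ^+ j < r1.
  apply: le_lt_trans rr; rewrite ler_pdivrMr // ler_peMr ?(ltW r0) //.
  by apply: exprn_ege1; lra.
 have /Hb H : 0 < rho / 2 ^+ j < r1 by lra.
 rewrite (_ : b rho - _ = (b rho - 2 ^+ j * b (rho / 2 ^+ j)) +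
   2 ^+ j * (b (rho / 2 ^+ j) - 2 * b (rho / 2 ^+ j / 2))); last first.
  have -> : rho / 2 ^+ j.+1 = rho / 2 ^+ j / 2 by rewrite exprSr invfM mulrA.
  by rewrite exprS; ring.
 apply: le_trans (ler_normD _ _) _; rewrite normrM (gtr0_norm (p2 j)).
 apply: le_trans (lerD IH (ler_wpM2l (ltW (p2 j)) H)) _.
 rewrite le_eqVlt; apply/orP; left; apply/eqP; rewrite (exprS 2 j).
 by move: (2 ^+ j) (p2 j) => A pj; field; lra.
apply/ler_addgt0Pr => e e0.
have [r rp Hr] := H0 (e / rho) (divr_gt0 e0 r0).
pose j := Num.truncn (rho / r).
have jr : rho / 2 ^+ j.+1 < r.
 rewrite ltr_pdivrMr // mulrC -ltr_pdivrMr //; apply: lt_le_trans (truncnS_gt _) _.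
 by rewrite -natrX ler_nat ltnW // ltn_expl.
have rj0 : 0 < rho / 2 ^+ j.+1 by smt.
have /Hr H : 0 < rho / 2 ^+ j.+1 < r by lra.
have S := step j.+1.
have -> : b rho = (b rho - 2 ^+ j.+1 * b (rho / 2 ^+ j.+1)) + 2 ^+ j.+1 * b (rho / 2 ^+ j.+1).
 lra.
apply: le_trans (ler_normD _ _) _; apply: lerD.
 have A0 : 0 <= 2 * eta * rho ^+ 2 by smt.
 have i0 : 0 <= (2 ^+ j.+1)^-1 :> R by smt.
 by apply: le_trans S _; apply: ler_piMr => //; smt.
rewrite normrM (gtr0_norm (p2 _)) mulrC -ler_pdivlMr //; apply: le_trans H _.
by rewrite mulrA divfK // gt_eqF.
Qed.

End OddPart.

Section Arithmetic.

(** The balance of an inner variation at order t, with T in the place of [t^2]: everything beyond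
    first order is collected into one multiple of T. *)
Lemma variation_arith (t T c0 c1 c2 : R) : 0 <= c0 -> 0 <= c1 -> 0 <= c2 ->
 forall N P X e1 e2 J K' K G XE : R,
 X + K' - (G + K) = - t * J -> 0 <= N - G + (K' - K) ->
 N <= P + T * (P + (1 + T) * e2) -> P <= 2 * X + 2 * (T * e1) -> P = X + 2 * (t * XE) + T * e1 ->
 X <= c0 -> e1 <= c1 -> e2 <= c2 -> T <= 1 -> 0 <= T -> 0 <= X -> 0 <= e2 -> 0 <= e1 ->
 0 <= t * (-1 * J + 2 * XE) + T * (2 * c0 + 3 * c1 + 2 * c2).
move=> h0 h1 h2 N P X e1 e2 J K' K G XE E1 E2 E3 E4 E5 b0 b1 b2 T1 T0 X0 p2 p1.
have q1 : T * e1 <= c1 by rewrite -[leRHS]mul1r ler_pM.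
have q2 : P <= 2 * c0 + 2 * c1 by lra.
have q3 : (1 + T) * e2 <= 2 * c2 by rewrite ler_pM //; lra.
have q4 : T * (P + (1 + T) * e2) <= T * (2 * c0 + 2 * c1 + 2 * c2) by rewrite ler_wpM2l //; lra.
have q5 : T * e1 <= T * c1 by rewrite ler_wpM2l.
lra.
Qed.

End Arithmetic.

(** * Pointwise bounds for the remainder of the variations *)

Section PointwiseBounds.
Implicit Types (p q s E : R).

Lemma sqD4 (a b c d : R) : (a + b + (c + d)) ^+ 2 <= 4 * (a ^+ 2 + b ^+ 2 + (c ^+ 2 + d ^+ 2)).
rewrite -subr_ge0 (_ : _ - _ = (a - b) ^+ 2 + (a - c) ^+ 2 + (a - d) ^+ 2 + (b - c) ^+ 2 + (b - d) ^+ 2 + (c - d) ^+ 2); last by ring.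
smt.
Qed.

Lemma sqD2 (a b : R) : (a + b) ^+ 2 <= 2 * (a ^+ 2 + b ^+ 2).
by rewrite -subr_ge0 (_ : _ - _ = (a - b) ^+ 2); [exact: sqr_ge0|ring]. Qed.

Lemma mul2_le (a b : R) : 2 * `|a * b| <= a ^+ 2 + b ^+ 2.
have := sqr_ge0 (`|a| - `|b|); rewrite normrM sqrrB !real_normK ?num_real //.
lra.
Qed.

Lemma weight_le (K Y C E : R) : `|Y| <= C * E -> K * Y <= `|K| * E * C.
move=> H; rewrite (le_trans (ler_norm _)) // normrM -mulrA ler_wpM2l //.
lra.
Qed.

(** Values at one point: p and q are the coordinates of [x - x0], f with indices a function and its
    derivatives, c the phase indicator. [A] and [A'] stand for T f and T T f, and E is a
    scale-invariant density that dominates their squares. *)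
Variables (p q f f0 f1 f00 f01 f10 f11 c s E T1 T2 A A' L Q1 Q2 : R).
Hypotheses (sE : s = p ^+ 2 + q ^+ 2) (T2E : T2 = s ^+ 2 * (f00 ^+ 2 + f01 ^+ 2 + (f10 ^+ 2 + f11 ^+ 2))).
Hypotheses (T1E : T1 = s * (f0 ^+ 2 + f1 ^+ 2)) (EE : E = T2 + T1 + f ^+ 2 + s ^+ 2 * c) (c0 : 0 <= c).
Hypothesis AE : A = p * f0 + q * f1 - 2 * f.
Hypothesis A'E : A' = p * p * f00 + p * q * (f01 + f10) + q * q * f11 - 3 * (p * f0 + q * f1) + 4 * f.
Hypotheses (LE : L = f00 + f11) (Q1E : Q1 = p * f0 + q * f1).
Hypothesis Q2E : Q2 = (p * p * f00 + p * q * f01) + (p * q * f10 + q * q * f11).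

Let s0 : 0 <= s. Proof. by rewrite sE addr_ge0 ?sqr_ge0. Qed.
Let p2 : p ^+ 2 <= s. Proof. by rewrite sE lerDl sqr_ge0. Qed.
Let q2 : q ^+ 2 <= s. Proof. by rewrite sE lerDr sqr_ge0. Qed.

Let lin_le (x y : R) : x ^+ 2 <= s -> (x * y) ^+ 2 <= s * y ^+ 2.
by move=> H; rewrite exprMn ler_wpM2r ?sqr_ge0. Qed.

Let quad_le (x x' y : R) : x ^+ 2 <= s -> x' ^+ 2 <= s -> (x * x' * y) ^+ 2 <= s ^+ 2 * y ^+ 2.
move=> H H'; rewrite exprMn ler_wpM2r ?sqr_ge0 // exprMn [leRHS]expr2.
by rewrite ler_pM ?sqr_ge0.
Qed.

Let T2_ge0 : 0 <= T2.
by rewrite T2E mulr_ge0 ?sqr_ge0 // !addr_ge0 ?sqr_ge0. Qed.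

Let T1_ge0 : 0 <= T1.
by rewrite T1E mulr_ge0 // addr_ge0 ?sqr_ge0. Qed.

Let cs0 : 0 <= s ^+ 2 * c. Proof. by rewrite mulr_ge0 ?sqr_ge0. Qed.

Let E_ge (x y z : R) : x <= T2 -> y <= T1 -> z <= f ^+ 2 -> x + y + z <= E.
by move=> h1 h2 h3; rewrite EE -[leLHS]addr0 lerD // lerD // lerD. Qed.

Let T1_le : T1 <= E. Proof. by have := E_ge T2_ge0 (lexx T1) (sqr_ge0 f); lra. Qed.
Let T2_le : T2 <= E. Proof. by have := E_ge (lexx T2) T1_ge0 (sqr_ge0 f); lra. Qed.

Lemma f_le : f ^+ 2 <= E.
by have := E_ge T2_ge0 T1_ge0 (lexx _); lra. Qed.

Lemma c_le : s ^+ 2 * c <= E.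
by rewrite EE lerDr !addr_ge0 // sqr_ge0. Qed.

Let lin2 : Q1 ^+ 2 <= 2 * E.
rewrite Q1E (le_trans (sqD2 _ _)) // ler_wpM2l // (le_trans _ T1_le) // T1E mulrDr lerD //; exact: lin_le.
Qed.

Lemma A_le : A ^+ 2 <= 12 * E.
have := sqD2 Q1 (- (2 * f)); have H2 := lin2; have f20 := f_le.
have -> : (- (2 * f)) ^+ 2 = 4 * f ^+ 2 by ring.
rewrite (_ : Q1 - 2 * f = A); last by rewrite AE Q1E.
lra.
Qed.

Lemma A'_le : A' ^+ 2 <= 120 * E.
have HQ : Q2 ^+ 2 <= 4 * E.
 rewrite Q2E (le_trans (sqD4 _ _ _ _)) // ler_wpM2l // (le_trans _ T2_le) // T2E !mulrDr !lerD //; exact: quad_le.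
have -> : A' = Q2 + - 3 * Q1 + (2 * f + 2 * f) by rewrite A'E Q1E Q2E; ring.
have e2 : (2 * f) ^+ 2 = 4 * f ^+ 2 by ring.
have e3 : (- 3 * Q1) ^+ 2 = 9 * Q1 ^+ 2 by ring.
rewrite (le_trans (sqD4 _ _ _ _)) // e2 e3.
have hf := ler_wpM2l (ler0n R 4) f_le.
have h := lerD (lerD HQ (ler_wpM2l (ler0n R 9) lin2)) (lerD hf hf).
lra.
Qed.

Lemma L_le : (s * L) ^+ 2 <= 2 * E.
rewrite LE exprMn (le_trans (ler_wpM2l (sqr_ge0 s) (sqD2 f00 f11))) //.
rewrite mulrCA ler_wpM2l // (le_trans _ T2_le) // T2E ler_wpM2l ?sqr_ge0 //.
by rewrite lerD // ?lerDl ?lerDr sqr_ge0.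
Qed.

Lemma Ro_le : (p * f1 - q * f0) ^+ 2 <= 2 * E.
rewrite (le_trans (sqD2 _ _)) // sqrrN ler_wpM2l // (le_trans _ T1_le) //.
by rewrite T1E mulrDr addrC lerD //; exact: lin_le.
Qed.

(** K1 and K2 stand for [ks k] and [ks (ks k)]. Every term left when eight times the Weiss identity
    is combined with the radial variation carries one of them, and its other factor is at most a
    multiple of E. *)
Lemma variation_remainder_le (K1 K2 : R) :
 - 8 * (- (5 / 2) * (K1 * A ^+ 2) + 2 * (K2 * f ^+ 2) - 2 * (K1 * f ^+ 2)
  - 2^-1 * (K2 * (p * f1 - q * f0) ^+ 2) + 2^-1 * (K1 * (p * f1 - q * f0) ^+ 2)) -
 K1 * s ^+ 2 * (L ^+ 2 + c) + 2 * (s * L * (2 * K1 * A' + K2 * A)) <= 800 * ((`|K1| + `|K2|) * E).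
have E0 : 0 <= E by apply: le_trans (sqr_ge0 f) f_le.
have n2 (x : R) C : x ^+ 2 <= C * E -> `|x ^+ 2| <= C * E by rewrite ger0_norm ?sqr_ge0.
have nn (x : R) C : x ^+ 2 <= C * E -> `|- x ^+ 2| <= C * E by rewrite normrN; exact: n2.
have f1E : f ^+ 2 <= 1 * E by rewrite mul1r f_le.
have W1 := weight_le K1 (n2 _ _ A_le).
have W2 := weight_le K2 (nn _ _ f1E).
have W3 := weight_le K1 (n2 _ _ f1E).
have W4 := weight_le K2 (n2 _ _ Ro_le).
have W5 := weight_le K1 (nn _ _ Ro_le).
have W6 : K1 * - (s ^+ 2 * (L ^+ 2 + c)) <= `|K1| * E * 3.
 apply: weight_le; rewrite normrN mulrDr -exprMn ger0_norm.
  by have := lerD L_le c_le; lra.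
 smt.
have mm (x y : R) C C' : x ^+ 2 <= C * E -> y ^+ 2 <= C' * E -> `|x * y| <= (C + C') * E.
 move=> h1 h2; rewrite mulrDl (le_trans _ (lerD h1 h2)) // (le_trans _ (mul2_le x y)) //.
 by rewrite ler_peMl // ler1n.
have W7 := weight_le K1 (mm _ _ _ _ L_le A'_le).
have W8 := weight_le K2 (mm _ _ _ _ L_le A_le).
have k1 : 0 <= `|K1| * E by smt.
have k2 : 0 <= `|K2| * E by smt.
lra.
Qed.

End PointwiseBounds.

Implicit Types (x y z : pl) (f g phi psi : pl -> R).

(** * Superbiharmonicity of minimizers *)

Section Variation.
Implicit Types (u v w : pl -> R) (h : seq 'I_2 -> pl -> R).

Lemma n2D f g : l2 f -> l2 g ->
 n2 (fun x => f x + g x) = n2 f + 2 * I (fun x => f x * g x) + n2 g.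
move=> lf lg; have [_ If] := lf; have [_ Ig] := lg; have Ifg := l2_ig_mul lf lg.
rewrite /n2 (_ : (fun x => (f x + g x) ^+ 2) =
 fun x => f x ^+ 2 + 2 * (f x * g x) + g x ^+ 2); last first.
 by apply/funext => x; ring.
rewrite ID //; last by apply: igD => //; exact: igZ.
by rewrite ID //; [rewrite IZ|exact: igZ].
Qed.

Lemma energy_add u w h H : sobolev Omega 2 u -> test_lim w h ->
 (fun x => h [:: o_0; o_0] x + h [:: o_1; o_1] x) = H ->
 l2 H /\ energy (fun x => u x + w x) = n2 (lap u) + 2 * I (fun x => lap u x * H x) + n2 H +
  I (\1_(pos (fun x => u x + w x)) : pl -> R).
move=> su tw EH; have [_ Hh _] := tw.
have lh : l2 H.
 by rewrite -EH; apply: l2D; [exact: (Hh [:: o_0; o_0] isT).1|exact: (Hh [:: o_1; o_1] isT).1].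
have ll := lap_l2 su.
have l2' := lap_l2 (sobolev_test_lim (leqnn 2) su tw).
have E0 : n2 (fun x => lap (fun x => u x + w x) x - (lap u x + H x)) = 0.
 by rewrite -EH; exact: lap_test_lim.
split=> //; rewrite /energy (n20_n2 l2' (l2D ll lh) E0).
by rewrite n2D.
Qed.

Lemma test_lim_test phi : test_function Omega phi -> test_lim phi (fun s => partials (rev s) phi).
move=> tp; split=> // [s _|]; last first.
 by exists (fun=> phi); split=> // s _; exact: cvg2_cst.
split; first exact: test_l2 (test_partials _ tp).
by move=> x; exact: test_out (test_partials _ tp).
Qed.

Lemma test_lapl phi : test_function Omega phi -> test_function Omega (lapl phi).
move=> tp; have := testD (test_partials [:: o_0; o_0] tp) (test_partials [:: o_1; o_1] tp).
by [].
Qed.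

Lemma lim_slope (A B : R) : (forall t : R, 0 < t -> 0 <= t * A + t ^+ 2 * B) -> 0 <= A.
move=> H; rewrite leNgt; apply/negP => A0.
have B1 : 0 < `|B| + 1 by smt.
(* The step at which the quadratic term is at most half as large as the linear one. *)
pose t := - A / (2 * (`|B| + 1)).
have t0 : 0 < t by rewrite divr_gt0 // ?mulr_gt0 // oppr_gt0.
have := H t t0; rewrite expr2 -mulrA -mulrDr pmulr_rge0 //.
have E : t * (`|B| + 1) = - A / 2 by rewrite /t; field; smt.
have : t * B <= t * (`|B| + 1).
 by rewrite ler_wpM2l ?(ltW t0) // (le_trans (ler_norm B)) // lerDl.
lra.
Qed.

(* Lowering u cannot increase the measure of its positivity set, so the
  biharmonic operator of a minimizer is nonpositive. *)
Lemma minimizer_superbiharmonic u0 u phi : minimizer Omega u0 u -> test_function Omega phi ->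
 (forall x, 0 <= phi x) -> 0 <= - I (fun x => rs u x * lapl (lapl phi) x).
move=> [adm Hmin] tp phi0; have [su _] := adm; have tl := test_lapl tp.
rewrite -(I_lap su tl); have ll := lap_l2 su; have lp := test_l2 tl.
rewrite -(pmulr_rge0 _ (ltr0Sn R 1)).
apply: (@lim_slope _ (n2 (lapl phi))) => t t0.
have tt : test_function Omega (fun x => (- t) * phi x) by smt.
have tw := test_lim_test tt.
have adm' := admissible_test_lim adm tw.
have /testP[sp _] := tp.
have EH : (fun x => partials (rev [:: o_0; o_0]) (fun x0 => - t * phi x0) x +
  partials (rev [:: o_1; o_1]) (fun x0 => - t * phi x0) x) = fun x => (- t) * lapl phi x.
 apply/funext => x; rewrite (partialsZ (- t) (rev [:: o_0; o_0]) sp).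
 by rewrite (partialsZ (- t) (rev [:: o_1; o_1]) sp) -mulrDr.
have [_ EA] := energy_add su tw EH.
have := Hmin _ adm'; rewrite (J_energy su) J_energy //; last by case: adm'.
rewrite EA lee_fin /energy.
rewrite (_ : (fun x => lap u x * _) = fun x => (- t) * (lap u x * lapl phi x)); last first.
 by apply/funext => x; lra.
have -> : n2 (fun x => (- t) * lapl phi x) = t ^+ 2 * n2 (lapl phi).
 by rewrite /n2 -IZ; [congr (I _); apply/funext => x; ring|case: lp].
rewrite IZ; last smt.
have : I (\1_(pos (fun x => u x + (- t) * phi x)) : pl -> R) <= I (\1_(pos u) : pl -> R).
 have [lu' _] := adm'.1; have [lu _] := su.
 apply: I_le; [exact: pos_ig|exact: pos_ig|move=> x; rewrite !indicE ler_nat].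
 case: (boolP (x \in pos _)) => [|_]; last by [].
 rewrite inE => -[Ox /= H]; rewrite mem_set //; split=> //=; apply: lt_le_trans H _.
 by rewrite gerDl mulNr oppr_le0 mulr_ge0 // ltW.
move: (n2 (lap u)) (n2 (lapl phi)) (I (fun x => lap u x * lapl phi x)) => A B C.
lra.
Qed.

End Variation.

(** * Mass of the bilaplacian near a point *)

Section Superbiharmonic.
Variable U : pl -> R.
Hypotheses (iU : ig U) (cU : forall x, Omega x -> {for x, continuous U}).
Variables (x0 : pl) (a : R).
Hypotheses (a0 : 0 < a) (DO : [set x | nsq (x - x0) <= 8 * a] `<=` Omega).
Implicit Types (rho delta e eta : R).

(** The pairing of [- Laplacian^2 U] with a test function. Its positivity and monotonicity stand in
    for the measure. *)
Definition TT phi : R := - I (fun y => U y * lapl (lapl phi) y).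

Hypothesis TT_ge0 : forall phi, test_function Omega phi -> (forall x, 0 <= phi x) -> 0 <= TT phi.

Lemma lapl_lin (c : R) phi psi : sm2 phi -> sm2 psi ->
 lapl (fun x => c * phi x + psi x) = fun x => c * lapl phi x + lapl psi x.
move=> sp sq; have sc : sm2 (fun x => c * phi x) by smt.
have H s : partials s (fun x => c * phi x + psi x) = fun x => c * partials s phi x + partials s psi x.
 by rewrite (partialsD s sc sq) (partialsZ c s sp).
apply/funext => x; rewrite /lapl !H; move: (partials _ _ _) (partials _ _ _) => A B.
by move: (partials _ _ _) (partials _ _ _) => C D; ring.
Qed.

Lemma sm2_lapl phi : sm2 phi -> sm2 (lapl phi).
by move=> sp; apply: smooth_add; smt. Qed.

Lemma TT_ig phi : test_function Omega phi -> ig (fun y => U y * lapl (lapl phi) y).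
move=> tp; have /testP[sl cl] := test_lapl (test_lapl tp).
rewrite (_ : (fun y => _) = fun y => lapl (lapl phi) y * U y); last by apply/funext => y; lra.
by apply: ig_mul_continuous => //; [exact: smooth_cont|exact: csupp_bsupp cl].
Qed.

Lemma TT_lin (c : R) phi psi : test_function Omega phi -> test_function Omega psi ->
 TT (fun x => c * phi x + psi x) = c * TT phi + TT psi.
move=> tp tq; have /testP[sp _] := tp; have /testP[sq _] := tq.
rewrite /TT lapl_lin // lapl_lin; [|exact: sm2_lapl..].
rewrite (_ : (fun y => _) = fun y => c * (U y * lapl (lapl phi) y) + U y * lapl (lapl psi) y); last first.
 by apply/funext => y; rewrite mulrDr mulrCA.
rewrite ID; [|exact/igZ/TT_ig|exact: TT_ig].
by rewrite IZ ?opprD ?mulrN //; exact: TT_ig.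
Qed.

Lemma testN phi : test_function Omega phi -> test_function Omega (fun x => - phi x).
by move=> /(testZ (-1)); under eq_fun do rewrite mulN1r. Qed.

Lemma TT_le phi psi : test_function Omega phi -> test_function Omega psi ->
 (forall x, phi x <= psi x) -> TT phi <= TT psi.
move=> tp tq H; have := TT_lin (-1) tp tq; rewrite mulN1r => E.
rewrite -subr_ge0 addrC -E; apply: TT_ge0.
 smt.
by move=> x; rewrite mulN1r addrC subr_ge0.
Qed.

Lemma TT_radial (h : R -> R) z : smoothR h ->
 TT (fun x => h (nsq (x - z))) = - I (fun y => U y * Lam (Lam h) (nsq (y - z))).
by move=> sh; rewrite /TT (lapl_radial z sh) (lapl_radial z (smoothR_Lam sh)). Qed.

Definition cutr (rho : R) x : R := cut (nsq (x - x0) / rho ^+ 2).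

Lemma nsq_bsupp_shift (h : R -> R) z (N : R) : (forall t, N < t -> h t = 0) ->
 bsupp (fun y : pl => h (nsq (y - z))).
by move=> H; exact: (@bsupp_shift (fun y => h (nsq y)) (- z) (bsupp_nsq H)). Qed.

Lemma cutr_test rho : 0 < rho -> rho ^+ 2 <= 8 * a -> test_function Omega (cutr rho).
move=> r0 ra; apply: (@test_radial _ (fun t => cut (t / rho ^+ 2)) x0 (rho ^+ 2)).
- exact/smoothR_div/smoothR_cut.
- by move=> t ht; rewrite cut0 // ler_pdivlMr ?exprn_gt0 // mul1r ltW.
- by move=> x /= hx; apply: DO; exact: le_trans hx ra.
Qed.

Lemma U_bounded : exists2 M : R, 0 <= M & forall x, nsq (x - x0) <= 8 * a -> `|U x| <= M.
have cK := @cdisk_compact x0 (8 * a).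
have cUK : compact (U @` [set x | nsq (x - x0) <= 8 * a]).
 apply: continuous_compact cK; apply: continuous_in_subspaceT => x.
 by rewrite inE => Kx; apply: cU; exact: DO.
have [M [_ HM]] := compact_bounded cUK; exists (`|M| + 1); first by smt.
move=> x Hx; apply: (HM (`|M| + 1)); last smt.
by rewrite (le_lt_trans (ler_norm _)) // ltrDl.
Qed.

Lemma ig_affine (c : R) z : 0 < c -> ig (fun y => U (c *: y + z)).
by move=> c0; exact: (ig_scale c0 (ig_translate z iU)). Qed.

Lemma ig_U_radial (h : R -> R) (N c : R) z : continuous h -> (forall t, N < t -> h t = 0) -> 0 < c ->
 ig (fun y => U (c *: y + z) * h (nsq y)).
move=> ch hN c0.
rewrite (_ : (fun y => _) = fun y => h (nsq y) * U (c *: y + z)); last by apply/funext => y; lra.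
apply: ig_mul_continuous; [|exact: bsupp_nsq hN|exact: ig_affine].
by move=> y; apply: (@continuous_comp _ _ _ (@nsq) h); [exact: cont_nsq|exact: ch].
Qed.

Lemma I_affine f (c : R) z : 0 < c -> ig f ->
 ig (fun y => f (c *: y + z)) /\ I f = c ^+ 2 * I (fun y => f (c *: y + z)).
move=> c0 If; have It := ig_translate z If; split; first exact: ig_scale c0 It.
rewrite (I_scale c0 It) (I_translate z If) mulVKf //.
by rewrite expf_neq0 // gt_eqF.
Qed.

(** An integral of [U / rho^2] over the annulus that carries [Th]; [TT_Gf] identifies its dyadic
    increments with the pairing against a truncated logarithm. *)
Definition HH (rho : R) : R := rho ^- 2 * I (fun y => U (rho *: y + x0) * Th (nsq y)).

Lemma HH_abs rho (M : R) : 0 < rho -> 0 <= M ->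
 (forall y, nsq y <= 1 -> `|rho ^- 2 * U (rho *: y + x0)| <= M) ->
 `|HH rho| <= M * I (fun y => `|Th (nsq y)|).
move=> r0 M0 H.
have cTh : continuous (@Th) := smooth_cont (@smoothR_Th).
have iTh : ig (fun y : pl => Th (nsq y)).
 apply: ig_continuous; last exact: bsupp_nsq (@Th_hi).
 by move=> y; apply: (@continuous_comp _ _ _ (@nsq) (@Th)); [exact: cont_nsq|exact: cTh].
have iUT := ig_U_radial x0 cTh (@Th_hi) r0.
have iT := ig_abs iTh.
rewrite /HH -(IZ _ iUT) -(IZ M iT).
apply: le_trans (I_abs (igZ _ iUT)) _.
apply: I_le; [exact/ig_abs/igZ|exact/igZ/ig_abs|].
move=> y; have [h|h] := leP (nsq y) 1.
 by rewrite mulrA normrM ler_wpM2r // H.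
by rewrite Th_hi // !mulr0 normr0 mulr0.
Qed.

Lemma HH_half rho : 0 < rho ->
 HH (rho / 2) = rho ^- 2 * (16 * I (fun y => U (rho *: y + x0) * Th (4 * nsq y))).
move=> r0; have h0 : 0 < 2^-1 :> R by [].
have cTh : continuous (fun t : R => Th (4 * t)).
 apply: smooth_cont (_ : smoothR _); apply: smooth_comp (@smoothR_Th) _.
 by apply: smooth_mul; smt.
have iUT : ig (fun y => U (rho *: y + x0) * Th (4 * nsq y)).
 apply: (@ig_U_radial (fun t => Th (4 * t)) 1 rho x0 cTh) => // t; exact: Th4_hi.
have := I_scale h0 iUT.
rewrite (_ : (fun x => _) = fun y => U ((rho / 2) *: y + x0) * Th (nsq y)); last first.
 apply/funext => y; rewrite scalerA nsqZ; congr (_ * Th _).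
 lra.
rewrite /HH => ->; set X := I _; field.
lra.
Qed.

Lemma TT_Gf rho : 0 < rho ->
 TT (fun x => - Gf (nsq (x - x0) / rho ^+ 2)) = HH rho - HH (rho / 2).
move=> r0; have r2 : 0 < rho ^+ 2 by smt.
have sG := @smoothR_Gf.
pose c : R := rho ^- 2.
have sd : smoothR (fun t : R => Gf (c * t)).
 by apply: smooth_comp sG _; apply: smooth_mul; smt.
have E (t : R) : Lam (Lam (fun t : R => - 1 * Gf (c * t))) t = - (c ^+ 2) * Lam (Lam (@Gf)) (c * t).
 by rewrite Lam2_dilate // mulN1r.
rewrite (_ : (fun x => - Gf _) = fun x => (fun t : R => - 1 * Gf (c * t)) (nsq (x - x0))); last first.
 by apply/funext => x; rewrite mulN1r /c mulrC.
rewrite (TT_radial x0 (smooth_mul (smooth_cst (fun _ : unit => 1 : R) (-1)) sd)).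
under eq_fun do rewrite E.
have cL : continuous (Lam (Lam (@Gf))) := smooth_cont (smoothR_Lam (smoothR_Lam sG)).
have iL := ig_U_radial x0 cL (@Lam2_Gf_hi) r0.
have iG : ig (fun y => U y * (- c ^+ 2 * Lam (Lam (@Gf)) (c * nsq (y - x0)))).
 rewrite (_ : (fun y => _) = fun y => - c ^+ 2 * Lam (Lam (@Gf)) (c * nsq (y - x0)) * U y); last first.
  by apply/funext => y; lra.
 apply: ig_mul_continuous => //.
  apply: smooth_cont (_ : sm2 _).
  apply: (@sm2_radial (fun t => - c ^+ 2 * Lam (Lam (@Gf)) (c * t))).
  apply: smooth_mul; first smt.
  apply: smooth_comp (smoothR_Lam (smoothR_Lam sG)) _.
  by apply: smooth_mul; smt.
 apply: (@nsq_bsupp_shift (fun t => - c ^+ 2 * Lam (Lam (@Gf)) (c * t)) x0 (rho ^+ 2)) => t ht.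
 by rewrite Lam2_Gf_hi ?mulr0 // /c mulrC ltr_pdivlMr // mul1r.
have [iGa EG] := I_affine x0 r0 iG.
rewrite EG (_ : (fun y => _) = fun y => - c ^+ 2 * (U (rho *: y + x0) * Lam (Lam (@Gf)) (nsq y))); last first.
 by apply/funext => y; rewrite addrK nsqZ /c mulKf ?gt_eqF // mulrCA.
rewrite (IZ _ iL) (_ : - _ = rho ^- 2 * I (fun y => U (rho *: y + x0) * Lam (Lam (@Gf)) (nsq y))); last first.
 by rewrite /c; move: (I _) => A; field; rewrite gt_eqF.
rewrite (HH_half r0) /HH -mulrBr; congr (_ * _).
have cTh : continuous (@Th) := smooth_cont (@smoothR_Th).
have cTh4 : continuous (fun t : R => Th (4 * t)).
 apply: smooth_cont (_ : smoothR _); apply: smooth_comp (@smoothR_Th) _.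
 by apply: smooth_mul; smt.
have i1 := ig_U_radial x0 cTh (@Th_hi) r0.
have i2 : ig (fun y => U (rho *: y + x0) * Th (4 * nsq y)).
 apply: (@ig_U_radial (fun t => Th (4 * t)) 1 rho x0 cTh4) => // t; exact: Th4_hi.
rewrite -IZ // -IB //; last exact: igZ.
by congr (I _); apply/funext => y; rewrite Lam2_Gf; ring.
Qed.

Lemma HH_step rho : 0 < rho -> rho ^+ 2 <= 8 * a ->
 HH (rho / 2) <= HH rho - ln 4 * TT (cutr (rho / 2)).
move=> r0 ra; have r2 : 0 < rho ^+ 2 by smt.
have th : test_function Omega (cutr (rho / 2)).
 apply: cutr_test; first by smt.
 lra.
have tG : test_function Omega (fun x => - Gf (nsq (x - x0) / rho ^+ 2)).
 apply: testN; apply: (@test_radial _ (fun t => Gf (t / rho ^+ 2)) x0 (rho ^+ 2)).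
 - exact/smoothR_div/smoothR_Gf.
 - by move=> t ht; rewrite Gf_hi // ler_pdivlMr // mul1r ltW.
 - by move=> x /= hx; apply: DO; exact: le_trans hx ra.
have t0 : test_function Omega (fun x => 0 * cutr (rho / 2) x) by smt.
have := TT_le (testZ (ln 4) th) tG.
have -> : TT (fun x => ln 4 * cutr (rho / 2) x) = ln 4 * TT (cutr (rho / 2)).
 have := TT_lin (ln 4) th t0.
 have := TT_lin 0 th t0; rewrite mul0r add0r.
 rewrite (_ : (fun x => 0 * _ + 0 * _) = fun x => 0 * cutr (rho / 2) x); last first.
  by apply/funext => x; lra.
 move=> _; rewrite (_ : (fun x => ln 4 * _ + 0 * _) = fun x => ln 4 * cutr (rho / 2) x); last first.
  by apply/funext => x; lra.
 move=> ->; suff -> : TT (fun x => 0 * cutr (rho / 2) x) = 0 by lra.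
 have E := TT_radial x0 (smooth_cst (fun _ : unit => 1 : R) 0).
 rewrite (_ : (fun x => 0 * _) = fun x => 0); last by apply/funext => x; lra.
 rewrite E Lam_cst Lam_cst; under eq_fun do rewrite mulr0.
 by rewrite I0 oppr0.
rewrite TT_Gf // => H; rewrite lerBrDr -lerBrDl; apply: H => x.
apply: le_trans (Gf_ge _); rewrite /cutr exprMn.
by rewrite (_ : nsq _ / (_ * _) = 4 * (nsq (x - x0) / rho ^+ 2)) //; lra.
Qed.

(* The measure - Laplacian^2 u has no atom at x0: an atom would make HH
  decrease by a fixed amount at each halving of the radius. *)
Lemma no_atom (C : R) : (forall e : R, 0 < e -> exists2 rho : R, 0 < rho < e &
  forall y, nsq y <= 1 -> `|rho ^- 2 * U (rho *: y + x0)| <= C) ->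
 forall eta : R, 0 < eta -> exists2 delta : R, 0 < delta & delta ^+ 2 <= 8 * a /\ TT (cutr delta) <= eta.
move=> HC eta eta0; have a8 : 0 < 8 * a by smt.
pose r0 : R := Num.sqrt (8 * a).
have r00 : 0 < r0 by rewrite sqrtr_gt0.
have r02 : r0 ^+ 2 = 8 * a by rewrite sqr_sqrtr // ltW.
clearbody r0.
apply: contrapT => Hn.
have Hd delta : 0 < delta -> delta <= r0 -> eta < TT (cutr delta).
 move=> d0 dr; rewrite ltNge; apply/negP => Hle; apply: Hn; exists delta => //.
 by split=> //; rewrite -r02 lerXn2r ?nnegrE ?(ltW d0) ?(ltW r00).
have l4 : 0 < ln 4 :> R by apply: ln_gt0; lra.
have le0 : 0 < ln 4 * eta by smt.
have step rho : 0 < rho -> rho <= r0 -> HH (rho / 2) <= HH rho - ln 4 * eta.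
 move=> rp rr; have := @HH_step rho rp.
 rewrite -r02 lerXn2r ?nnegrE ?(ltW rp) ?(ltW r00) // => /(_ isT) /le_trans; apply.
 by rewrite lerD2l lerN2 ler_pM2l // ltW // Hd; lra.
have steps j rho : 0 < rho -> rho <= r0 -> HH (rho / 2 ^+ j) <= HH rho - j%:R * (ln 4 * eta).
 elim: j rho => [|j IH] rho rp rr; first by rewrite expr0 divr1 mul0r subr0.
 have h1 : 0 < rho / 2 by smt.
 have h2 : rho / 2 <= r0 by lra.
 have -> : rho / 2 ^+ j.+1 = rho / 2 / 2 ^+ j by rewrite exprS invfM mulrA.
 rewrite -[j.+1]addn1 natrD mulrDl mul1r.
 exact: step_arith (IH _ h1 h2) (step rho rp rr).
have [M M0 HM] := U_bounded.
set B := I (fun y : pl => `|Th (nsq y)|).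
have B0 : 0 <= B by apply: I_ge0.
pose M1 := 4 / r0 ^+ 2 * M.
have M10 : 0 <= M1 by rewrite mulr_ge0 // divr_ge0 // exprn_ge0 // ltW.
have top rho : r0 / 2 <= rho -> rho <= r0 -> HH rho <= M1 * B.
 move=> h1 h2; have rp : 0 < rho by lra.
 apply: le_trans (ler_norm _) _; apply: HH_abs => // y y1.
 rewrite normrM; apply: ler_pM => //.
  rewrite ger0_norm ?invr_ge0 ?exprn_ge0 ?(ltW rp) //.
  rewrite (_ : 4 / r0 ^+ 2 = (r0 / 2) ^- 2); last by field; lra.
  by rewrite lef_pV2 ?posrE ?exprn_gt0 // ?lerXn2r ?nnegrE ?(ltW rp) //; lra.
 apply: HM; rewrite addrK nsqZ -r02.
 have : rho ^+ 2 <= r0 ^+ 2 by rewrite lerXn2r ?nnegrE ?(ltW rp) ?(ltW r00).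
 by move=> hr; rewrite (le_trans _ hr) // ler_piMr // sqr_ge0.
have C0 : 0 <= C.
 have [rho _ H] := HC 1 ltr01; apply: le_trans (H 0 _) => //.
 by rewrite nsq0.
(* N drops of size [ln 4 * eta] exceed the whole range [M1 * B + C * B] available to [HH]. A radius
   below [r0 / 2^N] forces at least N of them. *)
pose N := (Num.truncn ((M1 * B + C * B) / (ln 4 * eta))).+1.
have N1 : M1 * B + C * B < N%:R * (ln 4 * eta).
 rewrite -ltr_pdivrMr // /N; apply: truncnS_gt.
have p2 k : 0 < (2 : R) ^+ k by smt.
have [rho /andP[rp rN] Hrho] := HC (r0 / 2 ^+ N) (divr_gt0 r00 (p2 N)).
(* The last doubling that stays below [r0] lands in [[r0 / 2, r0]], where [HH] is bounded because U
   is. *)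
have ex : exists j, r0 < 2 ^+ j.+1 * rho.
 exists (Num.truncn (r0 / rho)); rewrite -ltr_pdivrMr //.
 apply: lt_le_trans (truncnS_gt _) _; rewrite -natrX ler_nat ltnW //.
 exact: ltn_expl.
case: (ex_minnP ex) => j Hj Hmin.
have jN : (N <= j)%N.
 rewrite leqNgt; apply/negP => jN; move: Hj; rewrite ltNge => /negP; apply.
 move: rN; rewrite ltr_pdivlMr // => /ltW; apply: le_trans; rewrite mulrC ler_pM2l //.
 by rewrite ler_eXn2l // ltr1n.
have jr : 2 ^+ j * rho <= r0.
 case: j Hmin {Hj jN} => [|j] Hmin.
  rewrite mul1r (le_trans (ltW rN)) // ler_pdivrMr // ler_peMr ?(ltW r00) //.
  by apply: exprn_ege1; rewrite ler1n.
 by rewrite leNgt; apply/negP => /Hmin; rewrite ltnn.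
have jr' : r0 / 2 <= 2 ^+ j * rho.
 by apply: half_le_of; rewrite mulrA -exprS.
have := steps j (2 ^+ j * rho) (mulr_gt0 (p2 j) rp) jr.
rewrite mulrAC mulfV ?gt_eqF // mul1r => Hst.
have := HH_abs rp C0 Hrho; rewrite ler_norml => /andP[Hlo _].
have := top _ jr' jr; have : N%:R * (ln 4 * eta) <= j%:R * (ln 4 * eta).
 by rewrite ler_wpM2r ?(ltW le0) // ler_nat.
move=> hNj htop; exact: no_atom_arith Hst Hlo N1 htop hNj.
Qed.

Hypothesis HC : exists C : R, forall e : R, 0 < e -> exists2 rho : R, 0 < rho < e &
  forall y, nsq y <= 1 -> `|rho ^- 2 * U (rho *: y + x0)| <= C.

(** * Finite differences of U along a line through the point *)

Section ThreePoints.

Lemma nsqD_le x y : nsq (x + y) <= 2 * nsq x + 2 * nsq y.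
rewrite /nsq (_ : (x + y).1 = x.1 + y.1) // (_ : (x + y).2 = x.2 + y.2) //.
by have := sqrD_le x.1 y.1; have := sqrD_le x.2 y.2; lra.
Qed.

Lemma nsqB_ge x y : 4 * nsq y <= nsq x -> nsq x / 4 <= nsq (x - y).
move=> H; have := nsqD_le (x - y) y; rewrite subrK.
lra.
Qed.

Lemma TT_Z (k : R) phi : test_function Omega phi -> TT (fun x => k * phi x) = k * TT phi.
move=> tp; have := TT_lin (-1) tp tp; rewrite mulN1r addNr.
rewrite (_ : (fun x => -1 * phi x + phi x) = fun _ => 0) => [T0|]; last first.
 by apply/funext => y; lra.
have := TT_lin k tp (testZ 0 tp).
rewrite (_ : (fun x => 0 * phi x) = fun _ => 0) ?T0 ?addr0; last by apply/funext => y; lra.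
by move=> <-; congr (TT _); apply/funext => y; lra.
Qed.

Lemma TT_sum n (c : 'I_n -> R) (phi : 'I_n -> pl -> R) : (forall j, test_function Omega (phi j)) ->
 test_function Omega (fun x => \sum_j c j * phi j x) /\
 TT (fun x => \sum_j c j * phi j x) = \sum_j c j * TT (phi j).
move=> tp; elim: n c phi tp => [|n IH] c phi tp.
 have E : (fun x => \sum_(j < 0) c j * phi j x) = fun _ => 0 by apply/funext => x; rewrite big_ord0.
 rewrite E big_ord0; split.
  apply/testP; split; first smt.
  by exists set0; split=> //; exact: compact0.
 have := TT_radial x0 (@smooth_cst R unit (fun=> 1) 0); rewrite Lam_cst Lam_cst => ->.
 by under eq_fun do rewrite mulr0; rewrite I0 oppr0.
have [t1 e1] := IH (fun j => c (lift ord0 j)) (fun j => phi (lift ord0 j)) (fun j => tp _).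
have E : (fun x => \sum_(j < n.+1) c j * phi j x) =
  fun x => c ord0 * phi ord0 x + \sum_(j < n) c (lift ord0 j) * phi (lift ord0 j) x.
 by apply/funext => x; rewrite big_ord_recl.
rewrite E big_ord_recl -e1; split; first by apply: testD => //; smt.
exact: (TT_lin (c ord0) (tp ord0) t1).
Qed.

(* Concentrating kernels: [e^-1 Kf (|y - z|^2 / e)] has integral [kc]. *)
Lemma Kf_approx z eta : Omega z -> 0 < eta -> exists2 e0 : R, 0 < e0 & forall e, 0 < e <= e0 ->
 `|I (fun y => U y * (e^-1 * Kf (nsq (y - z) / e))) - kc * U z| <= eta.
move=> Oz eta0.
have iK : ig (fun y : pl => Kf (nsq y)).
 by apply: ig_continuous; [exact: Kf_nsq_continuous|exact: bsupp_nsq (@Kf0)].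
set B := I (fun y : pl => `|Kf (nsq y)|).
have B0 : 0 <= B by apply: I_ge0.
have d0 : 0 < eta / (B + 1) by smt.
have /cvgrPdist_le /(_ _ d0) /nbhs_ballP[r /= r0 Hr] := cU Oz.
(* With [e <= r^2] the scale [s = sqrt e] is at most r, and [Kf (nsq y)] vanishes outside the unit
   ball, so [s y] stays within the radius of continuity. *)
exists (r ^+ 2); first by smt.
move=> e /andP[e0 er].
pose s := Num.sqrt e; have s0 : 0 < s by rewrite sqrtr_gt0.
have s2 : s ^+ 2 = e by rewrite sqr_sqrtr // ltW.
have sr : s <= r by rewrite -(ler_pXn2r (isT : (0 < 2)%N)) ?nnegrE ?(ltW s0) ?(ltW r0) // s2.
have cK : continuous (@Kf) := smooth_cont (@smoothR_Kf).
have iUK : ig (fun y => U (s *: y + z) * Kf (nsq y)).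
 apply: (@ig_U_radial _ 1 s z cK) => // t t1.
 by apply: Kf0; lra.
have iF : ig (fun y => U y * (e^-1 * Kf (nsq (y - z) / e))).
 rewrite (_ : (fun y => _) = fun y => e^-1 * Kf (nsq (y - z) / e) * U y); last first.
  by apply/funext => y; lra.
 apply: ig_mul_continuous => //.
  apply: smooth_cont (_ : sm2 _).
  apply: (@sm2_radial (fun t => e^-1 * Kf (t / e))).
  by apply: smooth_mul; [exact: smooth_cst|exact/smoothR_div/smoothR_Kf].
 apply: (@nsq_bsupp_shift (fun t => e^-1 * Kf (t / e)) z e) => t ht.
 rewrite Kf0 ?mulr0 //; apply: (@lt_trans _ _ 1); first by lra.
 by rewrite ltr_pdivlMr // mul1r.
have [_ ->] := I_affine z s0 iF.
have -> : (fun y => U (s *: y + z) * (e^-1 * Kf (nsq (s *: y + z - z) / e))) =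
  fun y => e^-1 * (U (s *: y + z) * Kf (nsq y)).
 apply/funext => y; rewrite mulrCA; congr (_ * (_ * Kf _)).
 by rewrite addrK nsqZ s2 mulrC mulKf // gt_eqF.
rewrite (IZ _ iUK) s2 mulVKf ?gt_eqF // /kc mulrC -(IZ _ iK).
rewrite -(IB iUK (igZ _ iK)).
have iKa := ig_abs iK.
have iD := igB iUK (igZ (U z) iK).
apply: le_trans (I_abs iD) _.
apply: (@le_trans _ _ (I (fun y : pl => eta / (B + 1) * `|Kf (nsq y)|))).
 apply: I_le; [exact: ig_abs|exact: igZ|move=> y].
 have [h|h] := leP (nsq y) 16^-1; last by rewrite Kf0 // !mulr0 subr0 normr0 mulr0.
 rewrite -mulrBl normrM ler_wpM2r //.
 rewrite distrC; apply: Hr; rewrite ball_planeE distrC addrK normrZ gtr0_norm //.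
 apply: lt_le_trans sr; rewrite -[ltRHS]mulr1 ltr_pM2l //.
 apply: norm_lt_nsq => //; rewrite expr1n; apply: le_lt_trans h _.
 lra.
rewrite (IZ _ iKa) -/B mulrAC ler_pdivrMr ?ltr_wpDl // ler_wpM2l ?(ltW eta0) //.
lra.
Qed.

Variables (n : nat) (c t : 'I_n -> R) (x : pl).
Hypotheses (c0 : \sum_j c j = 0) (c1 : \sum_j c j * t j = 0) (c2 : \sum_j c j * t j ^+ 2 = 0).

(** [tb] dominates all nodes and [X] dominates [tb * |x|]; both are at least 1, so that x = 0 needs
    no separate treatment. *)
Let tb : R := 1 + \sum_j `|t j|.
Let X : R := tb * enorm x + 1.
Let cs : R := \sum_j `|c j|.

Lemma tb_ge1 : 1 <= tb.
by rewrite lerDl sumr_ge0. Qed.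

Lemma t_tb j : `|t j| <= tb.
rewrite /tb (bigD1 j) //= addrA [1 + _]addrC -addrA lerDl.
by rewrite addr_ge0 // sumr_ge0.
Qed.

Lemma X_ge1 : 1 <= X.
by rewrite lerDr mulr_ge0 ?enorm_ge0 // (le_trans ler01) // tb_ge1. Qed.

Lemma cs_ge0 : 0 <= cs.
exact: sumr_ge0. Qed.

Lemma nsq_line rho (s : R) : 0 < rho -> `|s| <= rho * tb -> nsq (s *: x) <= rho ^+ 2 * X ^+ 2.
move=> r0 sr; rewrite nsqZ -sqr_enorm -!exprMn -(real_normK (num_real (s * enorm x))).
have N0 := @enorm_ge0 x; have t1 := tb_ge1.
rewrite lerXn2r ?nnegrE ?mulr_ge0 ?(ltW r0) ?(le_trans ler01 X_ge1) //.
rewrite normrM (ger0_norm N0); apply: (@le_trans _ _ (rho * tb * enorm x)).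
 by rewrite ler_wpM2r.
by rewrite -mulrA ler_wpM2l ?(ltW r0) // /X lerDl.
Qed.

Lemma t_rho rho j : 0 < rho -> `|rho * t j| <= rho * tb.
by move=> r0; rewrite normrM gtr0_norm // ler_wpM2l ?(ltW r0) // t_tb. Qed.

Definition zj rho j : pl := x0 + (rho * t j) *: x.

Lemma nsq_zj rho j y : nsq (y - zj rho j) = nsq (y - x0 - (rho * t j) *: x).
by rewrite /zj opprD addrA. Qed.

Lemma moments rho : [/\ \sum_j c j * (rho * t j) = 0 & \sum_j c j * (rho * t j) ^+ 2 = 0].
split.
 by under eq_bigr do rewrite mulrCA; rewrite -mulr_sumr c1 mulr0.
by under eq_bigr do rewrite exprMn mulrCA; rewrite -mulr_sumr c2 mulr0.
Qed.

Lemma far_bound (P : R -> R) (C m rho : R) y : smoothR P -> 0 <= C -> 0 < m -> 0 < rho ->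
 (forall s : R, m ^+ 2 <= s -> `|'D_1 ('D_1 P) s| * s <= C /\
   `|'D_1 ('D_1 ('D_1 P)) s| * s ^+ 2 <= C) ->
 4 * (rho ^+ 2 * X ^+ 2) <= nsq (y - x0) -> 4 * m ^+ 2 <= nsq (y - x0) ->
 `|\sum_j c j * P (nsq (y - zj rho j))| <= 20 * cs * C * X ^+ 3 * (rho ^+ 3 / m).
move=> sP C0 m0 r0 HP h1 h2; have [m1 m2] := moments rho.
under eq_bigr do rewrite nsq_zj.
apply: le_trans (third_diff_line sP C0 m0 c0 m1 m2 (fun j => t_rho j r0) HP _) _.
 move=> s sr; apply: le_trans (nsqB_ge _); first by lra.
 by apply: le_trans h1; rewrite ler_pM2l // nsq_line.
have N0 := @enorm_ge0 x; have t1 := tb_ge1; have t00 : 0 <= tb := le_trans ler01 t1.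
rewrite [X in X <= _](_ : _ = 20 * cs * C * (tb * enorm x) ^+ 3 * (rho ^+ 3 / m)); last first.
 by rewrite /cs; lra.
apply: ler_wpM2r; first by smt.
apply: ler_wpM2l; first by rewrite !mulr_ge0 // cs_ge0.
rewrite lerXn2r ?nnegrE ?mulr_ge0 ?(le_trans ler01 X_ge1) //.
by rewrite /X lerDl.
Qed.

(** The test function whose pairing reproduces, for small e, the finite difference of U at scale
    rho, while cancellation between the nodes keeps it of size [rho^2]. *)
Definition DD e rho y : R := \sum_j c j * Psi a e (nsq (y - zj rho j)).

(** Close to the nodes: [nsq (y - z)] is quadratic in the node and is annihilated too, so [s ln A]
    may be subtracted and [Ff_near] leaves [rho^2] without a logarithm. Further out the third
    difference gives [rho^3] over the distance, and beyond the localization nothing is left. *)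
Lemma DD_bound : exists C2 C3 : R, [/\ 0 <= C2, 0 <= C3 &
 forall rho e, 0 < rho -> 32 * (rho ^+ 2 * X ^+ 2) <= a -> 0 < e <= rho ^+ 2 -> forall y,
 [/\ `|DD e rho y| <= C2 * rho ^+ 2,
   forall delta, 0 < delta -> delta ^+ 2 <= 2 * nsq (y - x0) ->
    8 * (rho ^+ 2 * X ^+ 2) <= delta ^+ 2 -> `|DD e rho y| <= C3 * (rho ^+ 3 / delta) &
   4 * a < nsq (y - x0) -> DD e rho y = 0]].
have [C C0 HP] := Psi_bound a0.
pose K := 20 * cs * C * X ^+ 3.
have X1 := X_ge1; have X0 : 0 < X by lra.
have X30 : 0 <= X ^+ 3 by smt.
have K0 : 0 <= K by apply: mulr_ge0 => //; do 2 apply: mulr_ge0 => //; exact: cs_ge0.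
have l32 : 0 <= ln 32 :> R by apply: ln_ge0; lra.
have n0 : 0 <= cs * ((1 + ln 32) * (10 * X ^+ 2)).
 apply: mulr_ge0; first exact: cs_ge0.
 smt.
exists (K + cs * ((1 + ln 32) * (10 * X ^+ 2))), (3 * K); split.
- by rewrite addr_ge0.
- by rewrite mulr_ge0.
move=> rho e r0 rX /andP[e0 er] y.
have r20 : 0 < rho ^+ 2 by smt.
have rX2 : rho ^+ 2 <= rho ^+ 2 * X ^+ 2 by rewrite ler_peMr ?(ltW r20) // exprn_ege1.
have ea : 0 < e <= 4 * a by rewrite e0 /=; lra.
have far : 4 * (rho ^+ 2 * X ^+ 2) <= nsq (y - x0) ->
  `|DD e rho y| <= K * (rho ^+ 3 / (enorm (y - x0) / 2)) /\ rho <= enorm (y - x0) / 2.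
 move=> h; have E2 : (enorm (y - x0) / 2) ^+ 2 = nsq (y - x0) / 4.
  by rewrite -sqr_enorm; field.
 have mr : rho <= enorm (y - x0) / 2.
  rewrite -(ler_pXn2r (isT : (0 < 2)%N)) ?nnegrE ?(ltW r0) ?divr_ge0 ?enorm_ge0 // E2.
  lra.
 split=> //; apply: far_bound => //; first smt.
 - exact: lt_le_trans mr.
 - move=> s; rewrite E2 => hs; apply: HP => //.
  lra.
 - by rewrite E2 mulrC divfK.
have zle j : nsq (y - zj rho j) <= 2 * nsq (y - x0) + 2 * (rho ^+ 2 * X ^+ 2).
 rewrite nsq_zj; apply: le_trans (nsqD_le _ _) _; rewrite lerD2l ler_pM2l // nsqN.
 exact: nsq_line r0 (t_rho j r0).
have zge j : nsq (y - x0) <= 2 * nsq (y - zj rho j) + 2 * (rho ^+ 2 * X ^+ 2).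
 rewrite -[X in nsq X](subrK ((rho * t j) *: x)).
 apply: le_trans (nsqD_le _ _) _; rewrite -nsq_zj lerD2l ler_pM2l //.
 exact: nsq_line r0 (t_rho j r0).
have near : nsq (y - x0) < 4 * (rho ^+ 2 * X ^+ 2) ->
  `|DD e rho y| <= cs * ((1 + ln 32) * (10 * X ^+ 2)) * rho ^+ 2.
 move=> h; pose A := 10 * (rho ^+ 2 * X ^+ 2).
 have zA j : nsq (y - zj rho j) <= A.
  by have := zle j; move: h; rewrite /A; lra.
 have eA : 0 < e <= A.
  rewrite e0 /= /A; lra.
 have Aa : A < a / 2 by rewrite /A; lra.
 have [m1 m2] := moments rho.
 have mz : \sum_j c j * nsq (y - zj rho j) = 0.
  pose b := (y - x0).1 * x.1 + (y - x0).2 * x.2.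
  transitivity (\sum_j (nsq (y - x0) * c j - 2 * b * (c j * (rho * t j)) + nsq x * (c j * (rho * t j) ^+ 2))).
   apply: eq_bigr => j _; rewrite nsq_zj /b; move: (y - x0) => w; rewrite {1 2 3}/nsq.
   rewrite (_ : (w - (rho * t j) *: x).1 = w.1 - rho * t j * x.1) //.
   rewrite (_ : (w - (rho * t j) *: x).2 = w.2 - rho * t j * x.2) //.
   by ring.
  by rewrite big_split sumrB /= -!mulr_sumr c0 m1 m2 !mulr0 subr0 addr0.
 have -> : DD e rho y = \sum_j c j * (Ff e (nsq (y - zj rho j)) - nsq (y - zj rho j) * ln A).
  rewrite /DD (eq_bigr (fun j => c j * Ff e (nsq (y - zj rho j)))); last first.
   by move=> j _; rewrite Psi_lo //; exact: le_lt_trans Aa.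
  rewrite (_ : \sum_j c j * (_ - _) = \sum_j c j * Ff e (nsq (y - zj rho j)) -
   (\sum_j c j * nsq (y - zj rho j)) * ln A); first by rewrite mz mul0r subr0.
  by rewrite mulr_suml -sumrB; apply: eq_bigr => j _; rewrite mulrBr -(mulrA (c j) (nsq _)).
 apply: le_trans (ler_norm_sum _ _ _) _.
 rewrite (_ : _ * rho ^+ 2 = cs * ((1 + ln 32) * A)); last by rewrite /A; ring.
 rewrite /cs mulr_suml ler_sum // => j _; rewrite normrM ler_wpM2l // Ff_near //.
 by rewrite nsq_ge0 zA.
split.
- have [h|h] := ltP (nsq (y - x0)) (4 * (rho ^+ 2 * X ^+ 2)).
  apply: le_trans (near h) _; rewrite ler_wpM2r ?(ltW r20) // lerDr.
  exact: K0.
 have [h1 h2] := far h; apply: le_trans h1 _; rewrite mulrDl.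
 apply: (@le_trans _ _ (K * rho ^+ 2)); last by rewrite lerDl mulr_ge0 ?(ltW r20).
 rewrite ler_wpM2l // ler_pdivrMr; last exact: lt_le_trans h2.
 by rewrite exprSr ler_wpM2l // ltW.
- move=> delta d0 hd hX; have h : 4 * (rho ^+ 2 * X ^+ 2) <= nsq (y - x0).
  lra.
 have [h1 h2] := far h; apply: le_trans h1 _.
 rewrite (_ : 3 * K * (rho ^+ 3 / delta) = K * (rho ^+ 3 / (delta / 3))); last by field; rewrite gt_eqF.
 rewrite ler_wpM2l // ler_wpM2l ?exprn_ge0 ?(ltW r0) //.
 have m0 := lt_le_trans r0 h2; rewrite lef_pV2 ?posrE //; last by smt.
 rewrite -(ler_pXn2r (isT : (0 < 2)%N)) ?nnegrE ?divr_ge0 ?enorm_ge0 ?(ltW d0) //.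
 rewrite !exprMn sqr_enorm; move: hd (sqr_ge0 delta); move: (delta ^+ 2) (nsq _) => p q.
 lra.
- move=> h; rewrite /DD big1 // => j _; rewrite Psi_supp ?mulr0 //.
 by have := zge j; lra.
Qed.

(** The remainder is one fixed smooth profile vanishing near the nodes, so its third difference is
    of order [rho^3], with a constant free of e. *)
Lemma RR_bound : exists2 CR : R, 0 <= CR & forall rho, 0 < rho -> 32 * (rho ^+ 2 * X ^+ 2) <= a ->
 forall y, `|\sum_j c j * Rr a (4 * a) (nsq (y - zj rho j))| <= CR * rho ^+ 3.
pose P := Rr a (4 * a); have sP : smoothR P := smoothR_Rr _ _.
have a4 : 0 < 4 * a by smt.
have a44 : 0 < 4 * a <= 4 * a by lra.
have s2 := smoothR_D (smoothR_D sP); have s3 := smoothR_D s2.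
have [M2 M20 H2] := @cont_bounded_seg (fun s => 'D_1 ('D_1 P) s * s) 0 a
 (smooth_cont (smooth_mul s2 (@smoothR_id))).
have [M3 M30 H3] := @cont_bounded_seg (fun s => 'D_1 ('D_1 ('D_1 P)) s * s ^+ 2) 0 a
 (smooth_cont (smooth_mul s3 (smooth_exp 2 (@smoothR_id)))).
have Z (s : R) : a < s -> P s = 0 by move=> hs; exact: Rr_hi.
have oB := @open_gtR a.
have z1 (s : R) : a < s -> 'D_1 P s = 0.
 by move=> As; rewrite (@derive_eq_open _ (fun _ => 0) _ oB Z s As); case: (der_cst 0 s).
have z2 (s : R) : a < s -> 'D_1 ('D_1 P) s = 0.
 by move=> As; rewrite (@derive_eq_open _ (fun _ => 0) _ oB z1 s As); case: (der_cst 0 s).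
have z3 (s : R) : a < s -> 'D_1 ('D_1 ('D_1 P)) s = 0.
 by move=> As; rewrite (@derive_eq_open _ (fun _ => 0) _ oB z2 s As); case: (der_cst 0 s).
pose m := Num.sqrt (a / 32).
have a32 : 0 < a / 32 by smt.
have m0 : 0 < m by rewrite sqrtr_gt0.
have m2 : m ^+ 2 = a / 32 by rewrite sqr_sqrtr // ltW.
have HP (s : R) : m ^+ 2 <= s -> `|'D_1 ('D_1 P) s| * s <= M2 + M3 /\
  `|'D_1 ('D_1 ('D_1 P)) s| * s ^+ 2 <= M2 + M3.
 rewrite m2 => hs; have s0 : 0 <= s := le_trans (ltW a32) hs.
 have [h|h] := leP s a; last by rewrite z2 // z3 // normr0 !mul0r addr_ge0.
 have sa : 0 <= s <= a by lra.
 have := H2 s sa; have := H3 s sa.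
 have e2 (A : R) : `|A * s| = `|A| * s by rewrite normrM (ger0_norm s0).
 have e3 (A : R) : `|A * s ^+ 2| = `|A| * s ^+ 2 by rewrite normrM (ger0_norm (sqr_ge0 s)).
 rewrite e3 e2 => b3 b2.
 by split; [apply: le_trans b2 _; rewrite lerDl|apply: le_trans b3 _; rewrite lerDr].
have X30 : 0 <= X ^+ 3 by rewrite exprn_ge0 // (le_trans ler01 X_ge1).
have K0 : 0 <= 20 * cs * (M2 + M3) * X ^+ 3 / m.
 apply: divr_ge0; last smt.
 apply: mulr_ge0 => //; apply: mulr_ge0; last smt.
 by apply: mulr_ge0 => //; exact: cs_ge0.
exists (20 * cs * (M2 + M3) * X ^+ 3 / m) => //.
move=> rho r0 rX y.
have [h|h] := ltP (nsq (y - x0)) (a / 8).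
 rewrite big1 ?normr0.
  smt.
 move=> j _; rewrite Rr_lo ?mulr0 //.
 have : nsq (y - zj rho j) <= 2 * nsq (y - x0) + 2 * (rho ^+ 2 * X ^+ 2).
  rewrite nsq_zj; apply: le_trans (nsqD_le _ _) _; rewrite lerD2l ler_pM2l // nsqN.
  exact: nsq_line r0 (t_rho j r0).
 lra.
rewrite (_ : _ * rho ^+ 3 = 20 * cs * (M2 + M3) * X ^+ 3 * (rho ^+ 3 / m)); last by field; lra.
apply: far_bound => //; first smt.
- by move: h rX; lra.
- by rewrite m2; lra.
Qed.

Lemma zj_O rho j : 0 < rho -> 32 * (rho ^+ 2 * X ^+ 2) <= a -> Omega (zj rho j).
move=> r0 rX; apply: DO => /=.
rewrite /zj addrC addKr; apply: le_trans (nsq_line r0 (t_rho j r0)) _.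
have := mulr_ge0 (sqr_ge0 rho) (sqr_ge0 X); lra.
Qed.

Lemma Psi_test e rho j : 0 < rho -> 32 * (rho ^+ 2 * X ^+ 2) <= a ->
 test_function Omega (fun y => Psi a e (nsq (y - zj rho j))).
move=> r0 rX; apply: (@test_radial _ (Psi a e) _ a (@smoothR_Psi a e)).
 by move=> s hs; rewrite Psi_supp // ltW.
move=> y /= hy; apply: DO => /=.
rewrite -[X in nsq X](subrK ((rho * t j) *: x)); apply: le_trans (nsqD_le _ _) _; rewrite -nsq_zj.
have := nsq_line r0 (t_rho j r0); move: hy a0 rX; lra.
Qed.

Lemma ig_U_rad (h : R -> R) (N : R) z : smoothR h -> (forall s, N < s -> h s = 0) ->
 ig (fun y => U y * h (nsq (y - z))).
move=> sh hN; rewrite (_ : (fun y => _) = fun y => h (nsq (y - z)) * U y); last first.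
 by apply/funext => y; lra.
apply: ig_mul_continuous => //; last exact: nsq_bsupp_shift hN.
exact: smooth_cont (sm2_radial z sh).
Qed.

Lemma TT_DD e rho : 0 < rho -> 32 * (rho ^+ 2 * X ^+ 2) <= a -> 0 < e <= rho ^+ 2 ->
 test_function Omega (DD e rho) /\
 TT (DD e rho) = - (\sum_j c j * I (fun y => U y * (e^-1 * Kf (nsq (y - zj rho j) / e))) +
  I (fun y => U y * \sum_j c j * Rr a (4 * a) (nsq (y - zj rho j)))).
move=> r0 rX /andP[e0 er].
have [td ->] := TT_sum c (fun j => Psi_test e j r0 rX); split=> //.
have r20 : 0 < rho ^+ 2 by smt.
have rX2 : rho ^+ 2 <= rho ^+ 2 * X ^+ 2 by rewrite ler_peMr ?(ltW r20) // exprn_ege1 // X_ge1.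
have ea : 0 < e <= 4 * a by rewrite e0 /=; lra.
have a44 : 0 < 4 * a <= 4 * a by lra.
have iK j : ig (fun y => U y * (e^-1 * Kf (nsq (y - zj rho j) / e))).
 apply: (@ig_U_rad (fun s => e^-1 * Kf (s / e)) e).
  by apply: smooth_mul; [exact: smooth_cst|exact/smoothR_div/smoothR_Kf].
 move=> s hs; rewrite Kf0 ?mulr0 //; apply: (@lt_trans _ _ 1); first by lra.
 by rewrite ltr_pdivlMr // mul1r.
have iR j : ig (fun y => U y * Rr a (4 * a) (nsq (y - zj rho j))).
 by apply: (@ig_U_rad _ a); [exact: smoothR_Rr|move=> s hs; exact: Rr_hi].
have -> : I (fun y => U y * \sum_j c j * Rr a (4 * a) (nsq (y - zj rho j))) =
  \sum_j c j * I (fun y => U y * Rr a (4 * a) (nsq (y - zj rho j))).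
 have gen (m : nat) (d : 'I_m -> R) (F : 'I_m -> pl -> R) : (forall j, ig (fun y => U y * F j y)) ->
   ig (fun y => U y * \sum_j d j * F j y) /\
   I (fun y => U y * \sum_j d j * F j y) = \sum_j d j * I (fun y => U y * F j y).
  elim: m d F => [|m IH] d F iF.
   rewrite big_ord0 (_ : (fun y => _) = fun _ => 0) ?I0; first by split=> //; exact: ig0.
   by apply/funext => y; rewrite big_ord0 mulr0.
  have [i1 e1] := IH (fun j => d (lift ord0 j)) (fun j => F (lift ord0 j)) (fun j => iF _).
  rewrite big_ord_recl -e1 (_ : (fun y => _) = fun y => d ord0 * (U y * F ord0 y) +
    U y * \sum_(j < m) d (lift ord0 j) * F (lift ord0 j) y); last first.
   by apply/funext => y; rewrite big_ord_recl mulrDr mulrCA.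
  split; first by apply: igD => //; exact/igZ/iF.
  by rewrite ID //; [rewrite IZ //; exact: iF|exact/igZ/iF].
 exact: (gen _ c _ iR).2.
rewrite -big_split -sumrN; apply: eq_bigr => j _ /=.
rewrite (TT_radial (zj rho j) (@smoothR_Psi a e)) mulrN -mulrDr -ID //.
congr (- (_ * I _)); apply/funext => y; rewrite -mulrDr; congr (_ * _).
by rewrite -(Rr_indep a0 ea a44) /Rr [RHS]addrC subrK.
Qed.

(** The difference is paired through [DD], which lies below a sum of two cutoffs. Inside radius
    delta it is of size [rho^2], against a mass made small by [no_atom]; outside it is of size
    [rho^3 / delta], against a fixed mass, which is negligible once rho is small. *)
Lemma three_points eta : 0 < eta -> exists2 r1 : R, 0 < r1 & forall rho, 0 < rho < r1 ->
 `|\sum_j c j * (rho ^- 2 * U (zj rho j))| <= eta.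
move=> eta0.
have [C2 [C3 [C20 C30 HD]]] := DD_bound; have [CR CR0 HR] := RR_bound.
have k0 := kc_gt0; have cs0 := cs_ge0.
(* Half of the allowance [kc * eta] goes to the near mass; [C2 + 1] avoids a division by zero. *)
have d10 : 0 < kc * eta / (2 * (C2 + 1)).
 smt.
have [C HCC] := HC.
have [delta dl0 [da Sd]] := no_atom HCC d10.
(* [cutr b] equals 1 where [nsq (y - x0) <= 4 * a], the region that carries [DD]. *)
pose b := Num.sqrt (8 * a).
have a8 : 0 < 8 * a by smt.
have b0 : 0 < b by rewrite sqrtr_gt0.
have b2 : b ^+ 2 = 8 * a by rewrite sqr_sqrtr // ltW.
have td : test_function Omega (cutr delta) by apply: cutr_test.
have tb' : test_function Omega (cutr b) by apply: cutr_test => //; rewrite b2.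
have cp r y : 0 <= cutr r y by exact: cut_ge0.
have S0 := TT_ge0 tb' (cp b).
set SB := TT (cutr b) in S0.
set IU := I (fun y => `|U y|).
have IU0 : 0 <= IU by apply: I_ge0.
(* Collects the coefficients of [rho^3]: kernel approximation, localization remainder and far
   mass. *)
pose G := cs + CR * IU + C3 / delta * SB.
have G0 : 0 <= G.
 by rewrite !addr_ge0 // mulr_ge0 // divr_ge0 // ltW.
have X1 := X_ge1; have X0 : 0 < X by exact: lt_le_trans X1.
have q1 : 0 < Num.sqrt (a / 32) / X by rewrite divr_gt0 // sqrtr_gt0 divr_gt0.
have q2 : 0 < delta / (3 * X) by smt.
have q3 : 0 < kc * eta / (2 * (G + 1)).
 smt.
(* The three bounds keep the nodes inside the localization, keep them well within the disc of radius
   delta, and make the terms of order [rho^3] at most half of the allowance. *)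
exists (Num.min (Num.sqrt (a / 32) / X) (Num.min (delta / (3 * X)) (kc * eta / (2 * (G + 1))))).
 by rewrite !lt_min q1 q2 q3.
move=> rho /andP[r0]; rewrite !lt_min => /and3P[h1 h2 h3].
have r20 : 0 < rho ^+ 2 by smt.
have rX : 32 * (rho ^+ 2 * X ^+ 2) <= a.
 rewrite -exprMn -ler_pdivlMl //.
 rewrite [leRHS](_ : _ = Num.sqrt (a / 32) ^+ 2); last by rewrite sqr_sqrtr ?(ltW (divr_gt0 _ _)) // mulrC.
 by rewrite lerXn2r ?nnegrE ?mulr_ge0 ?sqrtr_ge0 ?(ltW r0) ?(ltW X0) // -ler_pdivlMr // ltW.
have rd : 8 * (rho ^+ 2 * X ^+ 2) <= delta ^+ 2.
 have : (rho * X) ^+ 2 <= (delta / 3) ^+ 2.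
  rewrite lerXn2r ?nnegrE ?mulr_ge0 ?(ltW r0) ?(ltW X0) ?(ltW dl0) //.
  by rewrite -ler_pdivlMr // -mulrA -invfM ltW.
 by rewrite !exprMn exprVn; exact: nine_le (sqr_ge0 delta).
have [e e0 HK] : exists2 e : R, 0 < e <= rho ^+ 2 & forall j,
  `|I (fun y => U y * (e^-1 * Kf (nsq (y - zj rho j) / e))) - kc * U (zj rho j)| <= rho ^+ 3.
 have r3 : 0 < rho ^+ 3 by smt.
 have /choice[f Hf] : forall j : 'I_n, exists e1 : R, 0 < e1 /\ forall e, 0 < e <= e1 ->
  `|I (fun y => U y * (e^-1 * Kf (nsq (y - zj rho j) / e))) - kc * U (zj rho j)| <= rho ^+ 3.
  by move=> j; have [e1 ? ?] := Kf_approx (zj_O j r0 rX) r3; exists e1.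
 (* One e for all nodes: the inverse of a sum of inverses lies below each of them. *)
 pose S := rho ^- 2 + \sum_j (f j)^-1.
 have fV j : 0 <= (f j)^-1 by rewrite invr_ge0 ltW //; case: (Hf j).
 have S1 : rho ^- 2 <= S by rewrite lerDl sumr_ge0.
 have Sp : 0 < S by apply: lt_le_trans S1; smt.
 have Sj j : (f j)^-1 <= S.
  rewrite /S (bigD1 j) //= addrCA lerDl addr_ge0 ?sumr_ge0 // invr_ge0 ltW //.
 exists S^-1; first by rewrite invr_gt0 Sp /= -[leRHS]invrK lef_pV2 ?posrE // invr_gt0.
 move=> j; have [fj Hj] := Hf j; apply: Hj; rewrite invr_gt0 Sp /=.
 by rewrite -[leRHS]invrK lef_pV2 ?posrE // invr_gt0.
have [tD ED] := TT_DD r0 rX e0.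
pose B y := C2 * rho ^+ 2 * cutr delta y + C3 * (rho ^+ 3 / delta) * cutr b y.
have tB : test_function Omega B by apply: testD; smt.
have EB : TT B = C2 * rho ^+ 2 * TT (cutr delta) + C3 * (rho ^+ 3 / delta) * SB.
 rewrite /B (TT_lin _ td (testZ _ tb')); congr (_ + _).
 exact: TT_Z.
have DB y : `|DD e rho y| <= B y.
 have [b1 b2' b3] := HD rho e r0 rX e0 y.
 have p1 : 0 <= C2 * rho ^+ 2 by smt.
 have p2 : 0 <= C3 * (rho ^+ 3 / delta) by smt.
 have [h|h] := leP (2 * nsq (y - x0)) (delta ^+ 2).
  apply: le_trans b1 _; rewrite /B {1}/cutr cut1 ?mulr1.
   by rewrite lerDl mulr_ge0.
  by rewrite ler_pdivrMr ?exprn_gt0 //; exact: double_le.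
 have [h'|h'] := leP (nsq (y - x0)) (4 * a); last by rewrite b3 // normr0 addr_ge0 // mulr_ge0.
 apply: le_trans (b2' delta dl0 (ltW h) rd) _; rewrite /B {2}/cutr cut1 ?mulr1.
  by rewrite lerDr mulr_ge0.
 by rewrite ler_pdivrMr ?exprn_gt0 // b2; exact: quad_le.
have TD : `|TT (DD e rho)| <= TT B.
 rewrite ler_norml; apply/andP; split; last first.
  by apply: TT_le => // y; apply: le_trans (ler_norm _) (DB y).
 rewrite lerNl.
 have tDn := testN tD.
 have -> : - TT (DD e rho) = TT (fun y => - DD e rho y).
  rewrite -mulN1r -(TT_Z _ tD); congr (TT _).
  by apply/funext => w; rewrite mulN1r.
 by apply: TT_le => // y; apply: le_trans (ler_norm _) _; rewrite normrN.
have RB : `|I (fun y => U y * \sum_j c j * Rr a (4 * a) (nsq (y - zj rho j)))| <= CR * rho ^+ 3 * IU.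
 have iUa := ig_abs iU.
 have cR : continuous (fun y => \sum_j c j * Rr a (4 * a) (nsq (y - zj rho j))).
  apply: smooth_cont (_ : sm2 _); apply: smooth_sum => j.
  smt.
 have iUR : ig (fun y => U y * \sum_j c j * Rr a (4 * a) (nsq (y - zj rho j))).
  rewrite (_ : (fun y => _) = fun y => (\sum_j c j * Rr a (4 * a) (nsq (y - zj rho j))) * U y); last first.
   by apply/funext => y; rewrite mulrC.
  apply: (ig_mul_bounded (cont_measurable cR) _ iU).
  exact: (HR rho r0 rX).
 apply: le_trans (I_abs iUR) _; rewrite /IU -(IZ _ iUa).
 apply: I_le; [exact: ig_abs|exact: igZ|move=> y].
 by rewrite normrM mulrC ler_wpM2r // HR.
have main : kc * `|\sum_j c j * U (zj rho j)| <= cs * rho ^+ 3 + (TT B + CR * rho ^+ 3 * IU).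
 rewrite -{1}(gtr0_norm k0) -normrM mulr_sumr.
 rewrite (_ : \sum_j kc * (c j * U (zj rho j)) =
  \sum_j c j * (kc * U (zj rho j) - I (fun y => U y * (e^-1 * Kf (nsq (y - zj rho j) / e)))) +
  \sum_j c j * I (fun y => U y * (e^-1 * Kf (nsq (y - zj rho j) / e)))); last first.
  rewrite -big_split; apply: eq_bigr => j _ /=; rewrite -mulrDr subrK.
  ring.
 apply: le_trans (ler_normD _ _) _; apply: lerD.
  apply: le_trans (ler_norm_sum _ _ _) _; rewrite /cs mulr_suml ler_sum // => j _.
  by rewrite normrM ler_wpM2l // distrC.
 have -> : \sum_j c j * I (fun y => U y * (e^-1 * Kf (nsq (y - zj rho j) / e))) =
  - (TT (DD e rho) + I (fun y => U y * \sum_j c j * Rr a (4 * a) (nsq (y - zj rho j)))).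
  by rewrite ED opprD opprK addrK.
 by rewrite normrN; apply: le_trans (ler_normD _ _) _; apply: lerD.
rewrite (_ : \sum_j c j * (rho ^- 2 * U (zj rho j)) = rho ^- 2 * \sum_j c j * U (zj rho j)); last first.
 by rewrite mulr_sumr; apply: eq_bigr => j _; rewrite mulrCA.
rewrite normrM ger0_norm ?invr_ge0 ?(ltW r20) // mulrC ler_pdivrMr //.
rewrite -(ler_pM2l k0); apply: le_trans main _; rewrite EB.
have f1 : C2 * TT (cutr delta) <= kc * eta / 2.
 apply: (@le_trans _ _ ((C2 + 1) * (kc * eta / (2 * (C2 + 1))))).
  have : C2 * TT (cutr delta) <= C2 * (kc * eta / (2 * (C2 + 1))) by rewrite ler_wpM2l.
  move=> /le_trans; apply; rewrite ler_wpM2r ?(ltW d10) // lerDl //.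
 by rewrite le_eqVlt; apply/orP; left; apply/eqP; field; rewrite gt_eqF // ltr_wpDl.
have f2 : G * rho <= kc * eta / 2.
 apply: (@le_trans _ _ ((G + 1) * (kc * eta / (2 * (G + 1))))).
  apply: ler_pM => //; [exact: ltW|by rewrite lerDl|exact: ltW].
 by rewrite le_eqVlt; apply/orP; left; apply/eqP; field; rewrite gt_eqF // ltr_wpDl.
apply: (@le_trans _ _ ((C2 * TT (cutr delta) + G * rho) * rho ^+ 2)).
 rewrite le_eqVlt; apply/orP; left; apply/eqP; rewrite /G; move: (TT _) => A.
 ring.
rewrite [leRHS]mulrA ler_wpM2r ?(ltW r20) //.
exact: halves_le.
Qed.

End ThreePoints.

(** * Homogeneity of two-phase blow-ups *)

Section Conclusion.
Hypothesis U0 : U x0 = 0.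
Hypothesis gU : forall (x : pl) (e : R), 0 < e -> exists2 r : R, 0 < r & forall rho : R, 0 < rho < r ->
 `|U (x0 + rho *: x) - U (x0 - rho *: x)| <= e * rho.
Variables (r_ : nat -> R) (v : pl -> R).
Hypotheses (r_gt0 : forall k, 0 < r_ k) (r_cvg : r_ k @[k --> \oo] --> (0 : R)).
Hypothesis v_cvg : forall x, (r_ k) ^- 2 * U (x0 + r_ k *: x) @[k --> \oo] --> v x.

Let q (rho : R) x := rho ^- 2 * U (x0 + rho *: x).

Lemma cvg_le_eta (F : R -> R) (l : R) : (F (r_ k) @[k --> \oo] --> l) ->
 (forall eta : R, 0 < eta -> exists2 r1 : R, 0 < r1 & forall rho : R, 0 < rho < r1 -> `|F rho| <= eta) -> l = 0.
move=> cF H; apply/eqP; rewrite -normr_le0; apply/ler_addgt0Pr => e e0; rewrite add0r.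
have e2 : 0 < e / 2 by smt.
have [r1 r10 H1] := H _ e2.
move/cvgrPdist_le : cF => /(_ _ e2) c1; move/cvgrPdist_lt : r_cvg => /(_ _ r10) c2.
have [k [h1 h2]] := filter_ex (filterI c1 c2).
rewrite sub0r normrN gtr0_norm // in h2.
have h3 : `|F (r_ k)| <= e / 2 by apply: H1; rewrite r_gt0 h2.
rewrite -(subrK (F (r_ k)) l); apply: le_trans (ler_normD _ _) _.
lra.
Qed.

Let zj0 (rho : R) x : U (x0 + (rho * 0) *: x) = 0.
by rewrite mulr0 scale0r addr0. Qed.

Lemma even_part (t : R) x : v (t *: x) + v (- (t *: x)) = t ^+ 2 * (v x + v (- x)).
apply/eqP; rewrite -subr_eq0; apply/eqP.
apply: (@cvg_le_eta (fun rho => q rho (t *: x) + q rho (- (t *: x)) - t ^+ 2 * (q rho x + q rho (- x)))).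
 apply: cvgB; first by apply: cvgD; exact: v_cvg.
 by apply: cvgM; [exact: cvg_cst|apply: cvgD; exact: v_cvg].
(* The node 0 carries the value [U x0 = 0]; its weight serves to cancel the zeroth moment. *)
pose c (j : 'I_5) : R := nth 0 [:: 1; 1; - t ^+ 2; - t ^+ 2; 2 * t ^+ 2 - 2] j.
pose p (j : 'I_5) : R := nth 0 [:: t; - t; 1; - 1; 0] j.
move=> eta eta0; have [|||r1 r10 H] := @three_points 5 c p x _ _ _ eta eta0.
- by rewrite !big_ord_recl big_ord0 /c /=; ring.
- by rewrite !big_ord_recl big_ord0 /c /p /=; ring.
- by rewrite !big_ord_recl big_ord0 /c /p /=; ring.
exists r1 => // rho hr; apply: le_trans (H rho hr).
rewrite le_eqVlt; apply/orP; left; apply/eqP; congr (`|_|).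
rewrite !big_ord_recl big_ord0 /c /zj /p /= zj0 /q !scalerA.
rewrite mulr1 mulrN mulrN1 !scaleNr !scalerN !scalerA.
lra.
Qed.

(** The antisymmetric increment b satisfies [b(rho) - 2 b(rho / 2) = o(rho^2)]. A linear b would
    satisfy this as well; [gU] excludes it at 0, and telescoping over dyadic radii gives
    [b = o(rho^2)]. *)
Lemma odd_part x : v x = v (- x).
apply/eqP; rewrite -subr_eq0; apply/eqP.
apply: (@cvg_le_eta (fun rho => q rho x - q rho (- x))).
 by apply: cvgB; exact: v_cvg.
pose c (j : 'I_4) : R := nth 0 [:: 1; - 1; - 2; 2] j.
pose p (j : 'I_4) : R := nth 0 [:: 1; - 1; 2^-1; - 2^-1] j.
move=> eta eta0; have e2 : 0 < eta / 2 by smt.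
have [|||r1 r10 H] := @three_points 4 c p x _ _ _ (eta / 2) e2.
- by rewrite !big_ord_recl big_ord0 /c /=; ring.
- by rewrite !big_ord_recl big_ord0 /c /p /=; field.
- by rewrite !big_ord_recl big_ord0 /c /p /=; field.
exists r1 => // rho hr; pose b (rho : R) := U (x0 + rho *: x) - U (x0 - rho *: x).
have Hb (r : R) : 0 < r < r1 -> `|b r - 2 * b (r / 2)| <= eta / 2 * r ^+ 2.
 move=> hr'; have r0 : 0 < r by lra.
 have := H r hr'; rewrite !big_ord_recl big_ord0 /c /zj /p /=.
 rewrite mulr1 mulrN1 mulrN !scaleNr addr0.
 rewrite (_ : _ + _ = r ^- 2 * (b r - 2 * b (r / 2))); last first.
  by rewrite /b; lra.
 by rewrite normrM ger0_norm ?invr_ge0 ?sqr_ge0 // mulrC ler_pdivrMr // exprn_gt0.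
have /(_ rho hr) := dyadic_bound (ltW e2) Hb (gU x).
have r0 : 0 < rho by lra.
have -> : q rho x - q rho (- x) = rho ^- 2 * b rho by rewrite /q scalerN -mulrBr.
rewrite normrM ger0_norm ?invr_ge0 ?sqr_ge0 // [2 * _]mulrC divfK // => Hf.
by rewrite mulrC ler_pdivrMr ?exprn_gt0.
Qed.

Lemma superbiharmonic_blowup (t : R) x : v (t *: x) = t ^+ 2 * v x.
have := even_part t x; rewrite -!odd_part -!mulr2n mulrnAr => /eqP.
lra.
Qed.

End Conclusion.

End Superbiharmonic.

#[local] Hint Resolve test_lapl sm2_lapl TT_ig testN cutr_test ig_affine I_affine : plane.

#[local] Hint Resolve Psi_test TT_DD : plane.

(** * Symmetry of second derivatives *)

Section Schwarz.

Lemma ord2P (i : 'I_2) : i = o_0 \/ i = o_1.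
by case: i => -[|[|//]] p; [left|right]; exact: val_inj. Qed.

Lemma der_coord_off (z y : pl) i j : i != j ->
 is_derive y (e_ i) (fun x => coord2 j (x - z)) 0.
move=> ij; have E (m : 'I_2) : m <> o_0 -> m = o_1 by have [->|->] := ord2P m.
have H : is_derive (y - z) (e_ i) (fun x => coord2 j x) 0.
 rewrite /basis2 /coord2; case: (j =P o_0) => [j0|j0]; case: ifP => [/eqP i0|i0].
 - by rewrite i0 j0 eqxx in ij.
 - exact: der_fst.
 - exact: der_snd.
 - exfalso; move/negP: ij; apply; apply/eqP; rewrite (E j j0).
  by apply: E => i1; rewrite i1 eqxx in i0.
exact: der_shift_plane H.
Qed.

Lemma radial_mixed (h : R -> R) i j x : smoothR h -> i != j ->
 partials [:: i; j] (fun y => h (nsq y)) x = 'D_1 ('D_1 h) (nsq x) * (2 * coord2 i x) * (2 * coord2 j x).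
move=> sh ij; rewrite [partials _ _ _]/=.
have n0 (k : R -> R) : (fun y : pl => k (nsq y)) = fun y => k (nsq (y - 0)).
 by apply/funext => y; rewrite subr0.
rewrite (n0 h) (_ : 'D_(e_ j) (fun y => h (nsq (y - 0))) =
 fun y => 'D_1 h (nsq (y - 0)) * (2 * coord2 j (y - 0))); last first.
 by apply/funext => y; exact: derive_radial.
have H1 := der_comp (der_nsq_shift 0 x i) (smoothR_der (nsq (x - 0)) (smoothR_D sh)).
have H2 : is_derive x (e_ i) (fun y => 2 * coord2 j (y - 0)) 0.
 have := der_mul (is_derive_cst (2 : R) x (e_ i)) (der_coord_off 0 x ij).
 by rewrite mul0r add0r mulr0.
have [_ ->] := der_mul H1 H2.
by rewrite mulr0 addr0 subr0.
Qed.

Lemma moll_schwarz n x : partials [:: o_0; o_1] (@moll n) x = partials [:: o_1; o_0] (@moll n) x.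
pose h (t : R) := mollc^-1 * n.+1%:R ^+ 2 * cut (n.+1%:R ^+ 2 * t).
have sh : smoothR h by apply: smooth_mul; smt.
have -> : @moll n = fun y => h (nsq y) by apply/funext => y; rewrite /moll nsqZ.
rewrite !radial_mixed //; lra.
Qed.

Lemma bsupp_flip psi x : bsupp psi -> bsupp (fun y => psi (x - y)).
move=> [N HN]; exists (N + `|x|) => y Hy; apply: HN.
have : `|x - (x - y)| <= `|x| + `|x - y| by exact: ler_normB.
rewrite opprB addrC subrK => H; rewrite -(ltrD2l `|x|); apply: lt_le_trans H.
lra.
Qed.

Lemma conv_partials f s n x : sm2 f -> bsupp f ->
 conv (partials s f) (moll n) x = conv f (partials (rev s) (moll n)) x.
move=> sf bf; rewrite /conv; have sm := @moll_sm2 n.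
have sg := sm2_flip x sm.
have bg := bsupp_flip x (@moll_bsupp n).
have := I_partials (rev s) sf sg bg; rewrite revK => E.
have sn : (-1) ^+ size s * (-1) ^+ size s = 1 :> R by rewrite -expr2 sqrr_sign.
have E2 : (fun y => f y * partials (rev s) (fun y0 => moll n (x - y0)) y) =
  fun y => (-1) ^+ size s * (f y * partials (rev s) (moll n) (x - y)).
 by apply/funext => y; rewrite partials_flip // size_rev mulrCA.
have i2 : ig (fun y => f y * partials (rev s) (moll n) (x - y)).
 apply: conv_ig; first exact: ig_continuous (smooth_cont sf) bf.
  exact/smooth_cont/sm2_partials.
 smt.
move: E; rewrite E2 (IZ _ i2) size_rev => E.
by apply: (mulfI (x := (-1) ^+ size s)); rewrite ?signr_eq0.
Qed.

(** Convolution moves both derivatives onto the mollifier, where radiality makes the mixed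
    derivatives symmetric. Hence every mollification of the difference vanishes and, by continuity,
    so does the difference. *)
Lemma schwarz f : sm2 f -> bsupp f ->
 'D_(e_ o_0) ('D_(e_ o_1) f) = 'D_(e_ o_1) ('D_(e_ o_0) f).
move=> sf bf; pose a : seq 'I_2 := [:: o_0; o_1]; pose b : seq 'I_2 := [:: o_1; o_0].
suff H : partials a f = partials b f by exact: H.
apply/funext => x; apply/eqP; rewrite -subr_eq0 -normr_le0; apply/ler_addgt0Pr => e e0; rewrite add0r.
have i s : ig (partials s f).
 by apply: ig_continuous; [exact/smooth_cont/sm2_partials|exact: bsupp_partials].
pose g y := partials a f y - partials b f y.
have cg : continuous g.
 by move=> y; apply: cvgB; exact: (smooth_cont (sm2_partials _ sf)).
have ig_ : ig g by exact: igB.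
have c0 n : conv g (moll n) x = 0.
 have cb y s : ig (fun z => partials s f z * moll n (y - z)).
  by apply: conv_ig; [exact: i|exact/smooth_cont/moll_sm2|exact: moll_bsupp].
 rewrite /conv /g (_ : (fun y => _) = fun y => partials a f y * moll n (x - y) - partials b f y * moll n (x - y)); last first.
  by apply/funext => y; rewrite mulrBl.
 rewrite (IB (cb x a) (cb x b)); apply/eqP; rewrite subr_eq0; apply/eqP.
 apply: etrans (conv_partials a n x sf bf) _; apply: etrans _ (esym (conv_partials b n x sf bf)).
 have E : partials (rev a) (@moll n) = partials (rev b) (moll n).
  by apply/funext => y; exact: esym (moll_schwarz n y).
 by rewrite E.
have /cvgrPdist_le /(_ _ e0) /nbhs_ballP[r /= r0 Hr] := cg x.
have [n Hn] : exists n : nat, n.+1%:R^-1 < r.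
 exists (Num.truncn r^-1); rewrite invf_plt ?posrE //; exact: truncnS_gt.
have := @conv_approx g n x e ig_; rewrite c0 sub0r normrN; apply.
move=> z zn; rewrite distrC; apply: Hr; rewrite ball_planeE opprD addrCA subrr addr0 normrN.
exact: le_lt_trans zn Hn.
Qed.

End Schwarz.

(** * The dilation and rotation fields *)

Section Euler.
Variable x0 : pl.
Implicit Types (h : pl -> R) (k : R -> R).
Local Notation D0 f := ('D_(e_ o_0) f).
Local Notation D1 f := ('D_(e_ o_1) f).

Definition q1 x : R := (x - x0).1.
Definition q2 x : R := (x - x0).2.
Definition sq x : R := nsq (x - x0).
Definition Eu f x : R := q1 x * D0 f x + q2 x * D1 f x.
Definition Ro f x : R := q1 x * D1 f x - q2 x * D0 f x.

Lemma sqE x : sq x = q1 x ^+ 2 + q2 x ^+ 2.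
by []. Qed.

Lemma sm2_q1 : sm2 q1.
exact: (sm2_shift (- x0) (@sm2_fst)). Qed.

Lemma sm2_q2 : sm2 q2.
exact: (sm2_shift (- x0) (@sm2_snd)). Qed.

Lemma sm2_sq : sm2 sq.
exact: (sm2_shift (- x0) (@sm2_nsq)). Qed.

Lemma sm2_rad k : smoothR k -> sm2 (fun x => k (sq x)).
by move=> sk; exact: sm2_radial. Qed.

Lemma der_q1 x v : is_derive x v q1 v.1.
exact: (der_shift_plane (z := - x0) (der_fst (x - x0) v)). Qed.

Lemma der_q2 x v : is_derive x v q2 v.2.
exact: (der_shift_plane (z := - x0) (der_snd (x - x0) v)). Qed.

Lemma sm2_Eu f : sm2 f -> sm2 (Eu f).
by move=> sf; apply: smooth_add; apply: smooth_mul;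
 [exact: sm2_q1|exact: smooth_D|exact: sm2_q2|exact: smooth_D].
Qed.

Lemma sm2_Ro f : sm2 f -> sm2 (Ro f).
by move=> sf; apply: smooth_sub; apply: smooth_mul;
 [exact: sm2_q1|exact: smooth_D|exact: sm2_q2|exact: smooth_D].
Qed.

Lemma bsupp_D f i : sm2 f -> bsupp f -> bsupp ('D_(e_ i) f).
by move=> sf bf; exact: (@bsupp_partials _ [:: i]). Qed.

Lemma bsupp_Eu f : sm2 f -> bsupp f -> bsupp (Eu f).
by move=> sf bf; apply: bsupp_add; apply: bsuppMr; exact: bsupp_D. Qed.

Lemma bsupp_Ro f : sm2 f -> bsupp f -> bsupp (Ro f).
move=> sf bf; apply: bsupp_add; first by apply: bsuppMr; exact: bsupp_D.
apply: (@bsuppW (fun x => q2 x * D0 f x)); first by apply: bsuppMr; exact: bsupp_D.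
by move=> x ->; lra.
Qed.

Lemma deriveM2 f g i x : sm2 f -> sm2 g ->
 'D_(e_ i) (fun y => f y * g y) x = 'D_(e_ i) f x * g x + f x * 'D_(e_ i) g x.
by move=> sf sg; case: (der_mul (smooth_der i x sf) (smooth_der i x sg)).
Qed.

Lemma deriveD2 f g i x : sm2 f -> sm2 g ->
 'D_(e_ i) (fun y => f y + g y) x = 'D_(e_ i) f x + 'D_(e_ i) g x.
by move=> sf sg; case: (der_add (smooth_der i x sf) (smooth_der i x sg)).
Qed.

Lemma deriveB2 f g i x : sm2 f -> sm2 g ->
 'D_(e_ i) (fun y => f y - g y) x = 'D_(e_ i) f x - 'D_(e_ i) g x.
by move=> sf sg; case: (der_add (smooth_der i x sf) (der_opp (smooth_der i x sg))).
Qed.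

Lemma derive_q1 i x : 'D_(e_ i) q1 x = (e_ i).1.
by case: (der_q1 x (e_ i)). Qed.

Lemma derive_q2 i x : 'D_(e_ i) q2 x = (e_ i).2.
by case: (der_q2 x (e_ i)). Qed.

Lemma EuM f g x : sm2 f -> sm2 g -> Eu (fun y => f y * g y) x = Eu f x * g x + f x * Eu g x.
move=> sf sg; rewrite /Eu !deriveM2 //.
by move: (D0 f x) (D1 f x) (D0 g x) (D1 g x) => a b c d; ring.
Qed.

Lemma RoM f g x : sm2 f -> sm2 g -> Ro (fun y => f y * g y) x = Ro f x * g x + f x * Ro g x.
move=> sf sg; rewrite /Ro !deriveM2 //.
by move: (D0 f x) (D1 f x) (D0 g x) (D1 g x) => a b c d; ring.
Qed.

Lemma Eu_rad k x : smoothR k -> Eu (fun y => k (sq y)) x = 2 * sq x * 'D_1 k (sq x).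
move=> sk; rewrite /Eu (derive_radial x0 x o_0 sk) (derive_radial x0 x o_1 sk).
rewrite /coord2 /= -/(sq x) [in RHS]sqE -/(q1 x) -/(q2 x).
lra.
Qed.

Lemma Ro_rad k x : smoothR k -> Ro (fun y => k (sq y)) x = 0.
move=> sk; rewrite /Ro (derive_radial x0 x o_0 sk) (derive_radial x0 x o_1 sk).
lra.
Qed.

Lemma ig_sm f : sm2 f -> bsupp f -> ig f.
by move=> sf; exact: ig_continuous (smooth_cont sf). Qed.

Lemma I_D0 f i : sm2 f -> bsupp f -> I ('D_(e_ i) f) = 0.
move=> sf bf; apply: I_derive0 => //; last exact/smooth_cont/smooth_D.
by move=> x; exact: smooth_derivable.
Qed.

Lemma I_Eu f : sm2 f -> bsupp f -> I (fun x => Eu f x + 2 * f x) = 0.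
move=> sf bf.
have s1 : sm2 (fun x => q1 x * f x) := smooth_mul sm2_q1 sf.
have s2 : sm2 (fun x => q2 x * f x) := smooth_mul sm2_q2 sf.
have b1 : bsupp (fun x => q1 x * f x) := bsuppMr _ bf.
have b2 : bsupp (fun x => q2 x * f x) := bsuppMr _ bf.
rewrite (_ : (fun x => _) = fun x => D0 (fun x => q1 x * f x) x + D1 (fun x => q2 x * f x) x); last first.
 apply/funext => x; rewrite !deriveM2 //; [|exact: sm2_q2|exact: sm2_q1].
 rewrite derive_q1 derive_q2 /basis2 /= /Eu.
 by move: (D0 f x) (D1 f x) => a b; ring.
rewrite ID; first by rewrite !I_D0 // addr0.
- by apply: ig_sm; [exact: smooth_D|exact: bsupp_D].
- by apply: ig_sm; [exact: smooth_D|exact: bsupp_D].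
Qed.

Lemma I_Ro f : sm2 f -> bsupp f -> I (Ro f) = 0.
move=> sf bf.
have s1 : sm2 (fun x => q1 x * f x) := smooth_mul sm2_q1 sf.
have s2 : sm2 (fun x => q2 x * f x) := smooth_mul sm2_q2 sf.
have b1 : bsupp (fun x => q1 x * f x) := bsuppMr _ bf.
have b2 : bsupp (fun x => q2 x * f x) := bsuppMr _ bf.
rewrite (_ : Ro f = fun x => D1 (fun x => q1 x * f x) x - D0 (fun x => q2 x * f x) x); last first.
 apply/funext => x; rewrite !deriveM2 //; [|exact: sm2_q2|exact: sm2_q1].
 rewrite derive_q1 derive_q2 /basis2 /= /Ro.
 by move: (D0 f x) (D1 f x) => a b; ring.
rewrite IB; first by rewrite !I_D0 // subr0.
- by apply: ig_sm; [exact: smooth_D|exact: bsupp_D].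
- by apply: ig_sm; [exact: smooth_D|exact: bsupp_D].
Qed.

Lemma Eu_Ro f : sm2 f -> bsupp f -> Eu (Ro f) = Ro (Eu f).
move=> sf bf; apply/funext => x.
have sD i : sm2 ('D_(e_ i) f) := smooth_D i sf.
have s11 : sm2 (fun y => q1 y * D1 f y) := smooth_mul sm2_q1 (sD _).
have s10 : sm2 (fun y => q1 y * D0 f y) := smooth_mul sm2_q1 (sD _).
have s20 : sm2 (fun y => q2 y * D0 f y) := smooth_mul sm2_q2 (sD _).
have s21 : sm2 (fun y => q2 y * D1 f y) := smooth_mul sm2_q2 (sD _).
have dR i : 'D_(e_ i) (Ro f) x = (e_ i).1 * D1 f x + q1 x * 'D_(e_ i) (D1 f) x -
  ((e_ i).2 * D0 f x + q2 x * 'D_(e_ i) (D0 f) x).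
 by rewrite (deriveB2 i x s11 s20) (deriveM2 i x sm2_q1 (sD _)) (deriveM2 i x sm2_q2 (sD _)) derive_q1 derive_q2.
have dE i : 'D_(e_ i) (Eu f) x = (e_ i).1 * D0 f x + q1 x * 'D_(e_ i) (D0 f) x +
  ((e_ i).2 * D1 f x + q2 x * 'D_(e_ i) (D1 f) x).
 by rewrite (deriveD2 i x s10 s21) (deriveM2 i x sm2_q1 (sD _)) (deriveM2 i x sm2_q2 (sD _)) derive_q1 derive_q2.
have S : D0 (D1 f) x = D1 (D0 f) x := congr1 (fun h : pl -> R => h x) (schwarz sf bf).
rewrite [LHS]/Eu [RHS]/Ro !dR !dE S /basis2 /=.
move: (D0 (D0 f) x) (D1 (D0 f) x) (D1 (D1 f) x) (D0 f x) (D1 f x) => a b c d e; ring.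
Qed.

Definition TE f x : R := Eu f x - 2 * f x.
(** The coefficient of order zero left when T is moved by parts across the weight [k(|x - x0|^2)]:
    the radial derivative of k, plus 2 for the divergence of the dilation field and 2 for each of
    the two factors. It annihilates [t^-3]. *)
Definition ks k (t : R) : R := 2 * t * 'D_1 k t + 6 * k t.

Lemma sm2_TE f : sm2 f -> sm2 (TE f).
by move=> sf; apply: smooth_sub; [exact: sm2_Eu|apply: smooth_mul => //; exact: smooth_cst].
Qed.

Lemma bsupp_TE f : sm2 f -> bsupp f -> bsupp (TE f).
move=> sf bf; apply: bsupp_add; first exact: bsupp_Eu.
by apply: (@bsuppW f) => // x ->; lra.
Qed.

Lemma smoothR_ks k : smoothR k -> smoothR (ks k).
move=> sk; apply: smooth_add; apply: smooth_mul => //; try exact: smooth_cst.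
 by apply: smooth_mul; smt.
smt.
Qed.

(* Integration by parts for TE, in the weight that makes |x - x0|^2
  homogeneous functions invisible. *)
Lemma I_TE k f g : smoothR k -> sm2 f -> sm2 g -> bsupp f ->
 I (fun x => ks k (sq x) * (f x * g x) + k (sq x) * (TE f x * g x) + k (sq x) * (f x * TE g x)) = 0.
move=> sk sf sg bf; have sr := sm2_rad sk; have sfg : sm2 (fun x => f x * g x) := smooth_mul sf sg.
have := I_Eu (smooth_mul sr sfg : sm2 (fun x => k (sq x) * (f x * g x))) (bsuppMr _ (bsuppMl _ bf)).
move=> <-; congr (I _); apply/funext => x.
rewrite (EuM x sr sfg) (EuM x sf sg) (Eu_rad x sk) /ks /TE.
lra.
Qed.

Lemma I_RoM k f g : smoothR k -> sm2 f -> sm2 g -> bsupp f ->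
 I (fun x => k (sq x) * (Ro f x * g x) + k (sq x) * (f x * Ro g x)) = 0.
move=> sk sf sg bf; have sr := sm2_rad sk; have sfg : sm2 (fun x => f x * g x) := smooth_mul sf sg.
have := I_Ro (smooth_mul sr sfg : sm2 (fun x => k (sq x) * (f x * g x))) (bsuppMr _ (bsuppMl _ bf)).
move=> <-; congr (I _); apply/funext => x.
rewrite (RoM x sr sfg) (RoM x sf sg) (Ro_rad x sk).
lra.
Qed.

Lemma TE_Ro f : sm2 f -> bsupp f -> TE (Ro f) = Ro (TE f).
move=> sf bf; apply/funext => x.
have s2f : sm2 (fun y => 2 * f y) := smooth_mul (smooth_cst _ _) sf.
rewrite /TE (congr1 (fun h => h x) (Eu_Ro sf bf)) {3}/Ro.
rewrite !(deriveB2 _ x (sm2_Eu sf) s2f).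
have dz i : 'D_(e_ i) (fun y => 2 * f y) x = 2 * 'D_(e_ i) f x.
 by rewrite (deriveM2 i x (smooth_cst _ _) sf) derive_cst mul0r add0r.
rewrite !dz /Ro.
by move: (D0 (Eu f) x) (D1 (Eu f) x) (D0 f x) (D1 f x) => a b c d; ring.
Qed.

(** The polar form of the Laplacian, [(r d_r)^2 + d_theta^2], with [r d_r = T + 2]. *)
Lemma lapl_polar f x : sm2 f ->
 sq x * lapl f x = TE (TE f) x + 4 * TE f x + 4 * f x + Ro (Ro f) x.
move=> sf.
have sD i : sm2 ('D_(e_ i) f) := smooth_D i sf.
have s11 : sm2 (fun y => q1 y * D1 f y) := smooth_mul sm2_q1 (sD _).
have s10 : sm2 (fun y => q1 y * D0 f y) := smooth_mul sm2_q1 (sD _).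
have s20 : sm2 (fun y => q2 y * D0 f y) := smooth_mul sm2_q2 (sD _).
have s21 : sm2 (fun y => q2 y * D1 f y) := smooth_mul sm2_q2 (sD _).
have s2f : sm2 (fun y => 2 * f y) := smooth_mul (smooth_cst _ _) sf.
have dR i : 'D_(e_ i) (Ro f) x = (e_ i).1 * D1 f x + q1 x * 'D_(e_ i) (D1 f) x -
  ((e_ i).2 * D0 f x + q2 x * 'D_(e_ i) (D0 f) x).
 by rewrite (deriveB2 i x s11 s20) (deriveM2 i x sm2_q1 (sD _)) (deriveM2 i x sm2_q2 (sD _)) derive_q1 derive_q2.
have dz i : 'D_(e_ i) (fun y => 2 * f y) x = 2 * 'D_(e_ i) f x.
 by rewrite (deriveM2 i x (smooth_cst _ _) sf) derive_cst mul0r add0r.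
have dT i : 'D_(e_ i) (TE f) x = (e_ i).1 * D0 f x + q1 x * 'D_(e_ i) (D0 f) x +
  ((e_ i).2 * D1 f x + q2 x * 'D_(e_ i) (D1 f) x) - 2 * 'D_(e_ i) f x.
 rewrite (deriveB2 i x (sm2_Eu sf) s2f) dz.
 by rewrite (deriveD2 i x s10 s21) (deriveM2 i x sm2_q1 (sD _)) (deriveM2 i x sm2_q2 (sD _)) derive_q1 derive_q2.
rewrite {1}/TE {1}/Eu {1}/Ro !dT !dR /TE /Eu sqE /lapl /basis2 /=.
move: (D0 (D0 f) x) (D1 (D0 f) x) (D0 (D1 f) x) (D1 (D1 f) x) (D0 f x) (D1 f x) => a b c d e g.
by ring.
Qed.

Lemma TE2E f x : sm2 f ->
 TE (TE f) x = q1 x * q1 x * D0 (D0 f) x + q1 x * q2 x * (D0 (D1 f) x + D1 (D0 f) x) +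
  q2 x * q2 x * D1 (D1 f) x - 3 * Eu f x + 4 * f x.
move=> sf.
have sD i : sm2 ('D_(e_ i) f) := smooth_D i sf.
have s10 : sm2 (fun y => q1 y * D0 f y) := smooth_mul sm2_q1 (sD _).
have s21 : sm2 (fun y => q2 y * D1 f y) := smooth_mul sm2_q2 (sD _).
have s2f : sm2 (fun y => 2 * f y) := smooth_mul (smooth_cst _ _) sf.
have dz i : 'D_(e_ i) (fun y => 2 * f y) x = 2 * 'D_(e_ i) f x.
 by rewrite (deriveM2 i x (smooth_cst _ _) sf) derive_cst mul0r add0r.
have dT i : 'D_(e_ i) (TE f) x = (e_ i).1 * D0 f x + q1 x * 'D_(e_ i) (D0 f) x +
  ((e_ i).2 * D1 f x + q2 x * 'D_(e_ i) (D1 f) x) - 2 * 'D_(e_ i) f x.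
 rewrite (deriveB2 i x (sm2_Eu sf) s2f) dz.
 by rewrite (deriveD2 i x s10 s21) (deriveM2 i x sm2_q1 (sD _)) (deriveM2 i x sm2_q2 (sD _)) derive_q1 derive_q2.
rewrite {1}/TE {1}/Eu !dT /TE /Eu /basis2 /=.
move: (D0 (D0 f) x) (D1 (D0 f) x) (D0 (D1 f) x) (D1 (D1 f) x) (D0 f x) (D1 f x) => a b c d e g.
by ring.
Qed.

End Euler.

#[local] Hint Resolve bsupp_flip sm2_q1 sm2_q2 sm2_sq sm2_rad sm2_Eu sm2_Ro bsupp_D bsupp_Eu bsupp_Ro ig_sm sm2_TE bsupp_TE smoothR_ks : plane.

(** * A Weiss-type identity *)

Section Weiss.
Variable x0 : pl.
Implicit Types (h U : pl -> R) (k : R -> R).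
Local Notation sq := (sq x0).
Local Notation TE := (TE x0).
Local Notation Ro := (Ro x0).

(** Integrability is carried along with the vanishing integral so that such identities can be added
    and scaled. *)
Definition zint f : Prop := ig f /\ I f = 0.

Lemma zintD f g : zint f -> zint g -> zint (fun x => f x + g x).
by move=> [i1 e1] [i2 e2]; split; [exact: igD|rewrite ID // e1 e2 addr0]. Qed.

Lemma zintZ (c : R) f : zint f -> zint (fun x => c * f x).
by move=> [i1 e1]; split; [exact: igZ|rewrite IZ // e1 mulr0]. Qed.

Lemma zint_TE k f g : smoothR k -> sm2 f -> sm2 g -> bsupp f ->
 zint (fun x => ks k (sq x) * (f x * g x) + k (sq x) * (TE f x * g x) + k (sq x) * (f x * TE g x)).
move=> sk sf sg bf; split; last exact: I_TE.
apply: ig_sm.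
 smt.
smt.
Qed.

Lemma zint_Ro k f g : smoothR k -> sm2 f -> sm2 g -> bsupp f ->
 zint (fun x => k (sq x) * (Ro f x * g x) + k (sq x) * (f x * Ro g x)).
move=> sk sf sg bf; split; last exact: I_RoM.
apply: ig_sm.
 smt.
smt.
Qed.

(** The terms weighted by [ks k] or [ks (ks k)], which vanish wherever k is [t^-3]. *)
Definition wrem k U x : R := - (5 / 2) * (ks k (sq x) * TE U x ^+ 2) + 2 * (ks (ks k) (sq x) * U x ^+ 2)
 - 2 * (ks k (sq x) * U x ^+ 2) - 2^-1 * (ks (ks k) (sq x) * Ro U x ^+ 2) + 2^-1 * (ks k (sq x) * Ro U x ^+ 2).

(* A Weiss-type identity: up to terms carrying derivatives of the weight, the
  domain variation of the bilaplacian energy along the dilation field is a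
  sum of squares measuring the failure of 2-homogeneity. *)
Lemma weiss_identity k U : smoothR k -> sm2 U -> bsupp U ->
 zint (fun x => k (sq x) * (sq x * lapl U x * (TE (TE U) x + TE U x)) -
  (k (sq x) * TE (TE U) x ^+ 2 + k (sq x) * TE (Ro U) x ^+ 2 + wrem k U x)).
move=> sk sU bU; have sk1 := smoothR_ks sk.
have sA := sm2_TE x0 sU; have bA := bsupp_TE x0 sU bU.
have sA' := sm2_TE x0 sA; have bA' := bsupp_TE x0 sA bA.
have sy := sm2_Ro x0 sU; have by_ := bsupp_Ro x0 sU bU.
have sy1 := sm2_TE x0 sy.
have c1 := TE_Ro x0 sU bU; have c2 := TE_Ro x0 sA bA.
have za := zint_TE sk sA sA bA.
have zb := zint_TE sk sU sA bU.
have zc := zint_TE sk1 sU sU bU.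
have zd := zint_TE sk sU sU bU.
have ze := zint_TE sk sy sy1 by_.
have zf := zint_TE sk1 sy sy by_.
have zg := zint_TE sk sy sy by_.
have zh := zint_Ro sk sy sA' by_.
have zi := zint_Ro sk sy sA by_.
(* Multiples of the vanishing integrals chosen so that every mixed product absent from the identity
   cancels. *)
have := zintD (zintZ (5 / 2) za) (zintD (zintZ 4 zb) (zintD (zintZ (-2) zc) (zintD (zintZ 2 zd)
 (zintD (zintZ (-1) ze) (zintD (zintZ 2^-1 zf) (zintD (zintZ (- 2^-1) zg) (zintD zh zi))))))).
congr (zint _); apply/funext => x.
have e1 : Ro (TE U) x = TE (Ro U) x := esym (congr1 (fun h : pl -> R => h x) c1).
have e2 : Ro (TE (TE U)) x = TE (TE (Ro U)) x.
 by rewrite -(congr1 (fun h : pl -> R => h x) c2) -c1.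
rewrite e1 e2 (lapl_polar x0 x sU) /wrem.
move: (TE (TE (Ro U)) x) (Ro (Ro U) x) (TE (TE U) x) (TE (Ro U) x) (TE U x) (Ro U x) (U x) => a b c d e f g.
lra.
Qed.

End Weiss.

(** * Localizing Sobolev functions *)

Section Localization.
Implicit Types (u w chi : pl -> R) (s : seq 'I_2) (F G h : seq 'I_2 -> pl -> R).

Lemma compact_inner (K : set pl) : compact K -> K `<=` Omega -> exists m, K `<=` inner m.
move=> /compact_near_coveringP cK KO.
have := cK nat \oo (fun n x => inner n x) _.
case=> [x Kx|N _ HN]; last by exists N => x Kx; exact: (HN N (leqnn N)).
have /nbhs_ballP[e /= e0 He] := oO (KO x Kx).
have e2 : 0 < e / 2 by smt.
exists ([set y | `|x - y| < e / 2], [set n | (Num.truncn (e / 2)^-1 <= n)%N]).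
 split; last by exists (Num.truncn (e / 2)^-1).
 by apply: (@near_plane x _ _ e2) => y /=; rewrite distrC.
move=> [y n] /= [xy nN] z zy; apply: He; rewrite ball_planeE.
have : `|x - z| <= `|x - y| + `|y - z| by rewrite (le_trans _ (ler_normD _ _)) // addrA subrK.
move=> /le_lt_trans; apply; rewrite (splitr e) ltrD // distrC; apply: lt_le_trans zy _.
rewrite -[leRHS]invrK lef_pV2 ?posrE ?invr_gt0 //.
by apply: ltW; apply: lt_le_trans (truncnS_gt _) _; rewrite ler_nat ltnS.
Qed.

Lemma cvg2_near (F G : nat -> pl -> R) f m : (forall n, (m < n)%N -> F n = G n) ->
 cvg2 F f -> cvg2 G f.
move=> E; apply: cvg_trans; apply: near_eq_cvg; near=> n.
by rewrite E //; near: n; exact: nbhs_infty_gt.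
Unshelve. all: by end_near. Qed.

(** The Leibniz rule on words of length at most 2, for a family F of candidate derivatives in place
    of the derivatives of a function. *)
Definition leib psi F s x : R :=
 match s with
 | [::] => psi x * F [::] x
 | [:: i] => 'D_(e_ i) psi x * F [::] x + psi x * F [:: i] x
 | [:: i; j] => partials [:: i; j] psi x * F [::] x + 'D_(e_ j) psi x * F [:: i] x +
   ('D_(e_ i) psi x * F [:: j] x + psi x * F [:: i; j] x)
 | _ => 0
 end.

Lemma partials_leib psi f s x : sm2 psi -> sm2 f -> (size s <= 2)%N ->
 partials s (fun y => psi y * f y) x = leib psi (fun t => partials t f) s x.
move=> sp sf; case: s => [//|i [|j [|//]]] _; first exact: deriveM2.
rewrite [LHS]/= (_ : 'D_(e_ j) (fun y => psi y * f y) =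
 fun y => 'D_(e_ j) psi y * f y + psi y * 'D_(e_ j) f y); last first.
 by apply/funext => y; exact: deriveM2.
have s1 := smooth_D j sp; have s2 := smooth_D j sf.
by rewrite (deriveD2 i x (smooth_mul s1 sf) (smooth_mul sp s2)) (deriveM2 i x s1 sf) (deriveM2 i x sp s2).
Qed.

Lemma leib_eq psi F G s x : (forall t, (size t <= 2)%N -> F t x = G t x) -> leib psi F s x = leib psi G s x.
by move=> E; case: s => [|i [|j [|//]]]; rewrite /leib !E. Qed.

Lemma leib0 psi F s x : (forall t, partials t psi x = 0) -> leib psi F s x = 0.
move=> z; have z0 : psi x = 0 := z [::].
have z1 i : 'D_(e_ i) psi x = 0 := z [:: i].
case: s => [|i [|j [|//]]]; rewrite /leib ?z1 ?z0.
- by rewrite mul0r.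
- by rewrite !mul0r addr0.
- by rewrite (z [:: i; j]) !mul0r !addr0.
Qed.

Lemma partials_out (K : set pl) psi t x : closed K -> (forall y, ~ K y -> psi y = 0) ->
 ~ K x -> partials t psi x = 0.
move=> cK H; have oK : open (~` K) := closed_openC cK.
elim: t x => [|i t IH] //= x nKx.
rewrite (@near_eq_derive _ _ _ _ (fun=> 0)) ?derive_cst //.
by have := oK x nKx; apply: filterS => y; exact: IH.
Qed.

Variable u : pl -> R.
Hypothesis su : sobolev Omega 2 u.

Definition gd s : pl -> R := if s is [::] then rs u else rs (wderiv Omega s u).

Lemma gd_l2 s : (size s <= 2)%N -> l2 (gd s).
have [lu Hu] := su; case: s => [|i s] sz; first exact/(L2P).
by apply/(L2P); exact: (wderivP (Hu (i :: s) sz)).1.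
Qed.

Lemma gd_out s x : ~ Omega x -> gd s x = 0.
by case: s => [|i s] Ox; rewrite /gd rs_out. Qed.

Lemma gd_bsupp s : bsupp (gd s).
exact: bsupp_O (@gd_out s). Qed.

Lemma gd_conv s m n x : (size s <= 2)%N -> inner m x -> (m < n)%N ->
 conv (rs u) (partials s (moll n)) x = conv (gd s) (moll n) x.
have [lu Hu] := su; have lu' := (L2P u).1 lu.
case: s => [//|i s] sz ix mn.
exact: (conv_weak lu' (wderivP (Hu (i :: s) sz)).2 ix mn).
Qed.

Definition mollu n : pl -> R := conv (rs u) (moll n).

Lemma mollu_sm2 n : sm2 (mollu n).
have [lu _] := su; apply: conv_sm2; [|exact: moll_sm2|exact: moll_bsupp].
exact: l2_ig ((L2P u).1 lu) (bsupp_rs u).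
Qed.

Lemma cvg2_leib psi (F : nat -> seq 'I_2 -> pl -> R) G s : test_function Omega psi ->
 (size s <= 2)%N ->
 (forall n t, (size t <= 2)%N -> l2 (F n t)) -> (forall t, (size t <= 2)%N -> l2 (G t)) ->
 (forall t, (size t <= 2)%N -> cvg2 (fun n => F n t) (G t)) ->
 l2 (leib psi G s) /\ cvg2 (fun n => leib psi (F n) s) (leib psi G s).
move=> tp sz lF lG cF.
have term t t' : (size t' <= 2)%N -> l2 (fun x => partials t psi x * G t' x) /\
  (forall n, l2 (fun x => partials t psi x * F n t' x)) /\
  cvg2 (fun n x => partials t psi x * F n t' x) (fun x => partials t psi x * G t' x).
 move=> t2; have /testP[st ct] := test_partials t tp.
 have cc := smooth_cont st.
 have [M _ HM] := bsupp_bounded cc (csupp_bsupp ct).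
 have mc := cont_measurable cc.
 split; first exact: l2_mul_bounded mc HM (lG _ t2).
 split; first by move=> n; exact: l2_mul_bounded mc HM (lF n _ t2).
 exact: cvg2M mc HM (fun n => lF n _ t2) (lG _ t2) (cF _ t2).
have add (A B : nat -> pl -> R) a b : l2 a /\ (forall n, l2 (A n)) /\ cvg2 A a ->
  l2 b /\ (forall n, l2 (B n)) /\ cvg2 B b ->
  l2 (fun x => a x + b x) /\ (forall n, l2 (fun x => A n x + B n x)) /\
  cvg2 (fun n x => A n x + B n x) (fun x => a x + b x).
 move=> [la [lA cA]] [lb [lB cB]]; split; first smt.
 by split; [move=> n; exact: l2D|exact: cvg2D].
case: s sz => [_|i [_|j [_|//]]].
- by have [la [_ ca]] := term [::] [::] isT.
- by have [la [_ ca]] := add _ _ _ _ (term [:: i] [::] isT) (term [::] [:: i] isT).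
- by have [la [_ ca]] := add _ _ _ _ (add _ _ _ _ (term [:: i; j] [::] isT) (term [:: j] [:: i] isT))
  (add _ _ _ _ (term [:: i] [:: j] isT) (term [::] [:: i; j] isT)).
Qed.

Lemma leib_out psi F s x : test_function Omega psi -> ~ Omega x -> leib psi F s x = 0.
move=> tp Ox; apply: leib0 => t; exact: test_out (test_partials t tp) Ox.
Qed.

(** The approximants are the mollifications of u times the cutoff. On the support of the cutoff a
    fine enough mollification commutes with weak derivatives; off it all terms vanish. *)
Lemma test_lim_mul psi : test_function Omega psi ->
 test_lim (fun x => psi x * rs u x) (fun s => leib psi gd (rev s)).
move=> tp; have /testP[sp [K [cK KO HK]]] := tp.
have [m Hm] := compact_inner cK KO.
have lc n s : (size s <= 2)%N -> l2 (conv (gd s) (moll n)).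
 by move=> s2; exact: (conv_young n (gd_l2 s2) (gd_bsupp s)).1.
have cc s : (size s <= 2)%N -> cvg2 (fun n => conv (gd s) (moll n)) (gd s).
 by move=> s2; exact: moll_cvg (gd_l2 s2) (gd_bsupp s).
have CL s (sz : (size s <= 2)%N) := cvg2_leib tp sz lc gd_l2 cc.
split=> //.
- move=> s s2; have sr : (size (rev s) <= 2)%N by rewrite size_rev.
 by split; [exact: (CL _ sr).1|move=> x; exact: leib_out].
exists (fun n x => psi x * mollu n x); split.
 move=> n; have := testM tp (mollu_sm2 n).
 by rewrite (_ : (fun x => mollu n x * psi x) = fun x => psi x * mollu n x) //; apply/funext => x; lra.
move=> s s2; have sr : (size (rev s) <= 2)%N by rewrite size_rev.
apply: (@cvg2_near _ _ _ m _ (CL _ sr).2) => n mn; apply/funext => x; rewrite (partials_leib x sp (mollu_sm2 n) sr).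
have [lu _] := su; have iu := l2_ig ((L2P u).1 lu) (bsupp_rs u).
have E t : partials t (mollu n) x = conv (rs u) (partials t (moll n)) x.
 by rewrite /mollu (partials_conv _ iu (@moll_sm2 n) (@moll_bsupp n)).
have [Kx|Kx] := pselect (K x).
 by apply: leib_eq => t t2; rewrite E (gd_conv t2 (Hm x Kx) mn).
have clK : closed K by apply: compact_closed => //; smt.
by rewrite !leib0 // => t; exact: partials_out clK HK Kx.
Qed.

(** Such limits integrate by parts against every smooth function of bounded support, so
    mollification commutes with differentiation on the whole plane and not only well inside
    [Omega]. *)
Lemma test_lim_conv w h s n : test_lim w h -> (size s <= 2)%N -> ig w -> bsupp w ->
 partials s (conv w (moll n)) = conv (h s) (moll n).
move=> tw s2 iw bw; have sm := @moll_sm2 n; have bm := @moll_bsupp n.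
rewrite (partials_conv _ iw sm bm); apply/funext => x.
have sg := sm2_flip x sm; have bg := bsupp_flip x bm.
have := test_lim_parts tw s2 sg bg.
rewrite (_ : (fun y => w y * _) = fun y => (-1) ^+ size s * (w y * partials s (moll n) (x - y))); last first.
 by apply/funext => y; rewrite partials_flip // mulrCA.
rewrite IZ; last first.
 by apply: conv_ig => //; [exact/smooth_cont/sm2_partials|exact: bsupp_partials].
by move=> H; apply: (mulfI (x := (-1) ^+ size s)); rewrite ?signr_eq0.
Qed.

Lemma test_lim_leib V (F : seq 'I_2 -> pl -> R) psi : test_function Omega psi ->
 test_lim V (fun s => F (rev s)) ->
 test_lim (fun x => psi x * V x) (fun s => leib psi F (rev s)).
move=> tp [FV lF [phi [tphi cp]]].
have /testP[sp _] := tp.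
have lF' r : (size r <= 2)%N -> l2 (F r) by move=> r2; have := (lF (rev r)); rewrite size_rev revK => /(_ r2)[].
have lphi n r : (size r <= 2)%N -> l2 (partials r (phi n)).
 by move=> _; exact: test_l2 (test_partials r (tphi n)).
have cF r : (size r <= 2)%N -> cvg2 (fun n => partials r (phi n)) (F r).
 by move=> r2; have := cp (rev r); rewrite size_rev revK => /(_ r2).
have CL s (sz : (size s <= 2)%N) := cvg2_leib tp sz lphi lF' cF.
split.
- by apply/funext => x /=; rewrite -FV.
- move=> s s2; have sr : (size (rev s) <= 2)%N by rewrite size_rev.
 by split; [exact: (CL _ sr).1|move=> x; exact: leib_out].
exists (fun n x => psi x * phi n x); split.
 smt.
move=> s s2; have sr : (size (rev s) <= 2)%N by rewrite size_rev.
have /= [_] := CL _ sr; apply: cvg_trans; apply: near_eq_cvg; near=> n; congr n2; apply/funext => x; congr (_ - _).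
by have /testP[sn _] := tphi n; rewrite (partials_leib x sp sn sr).
Unshelve. all: by end_near. Qed.

End Localization.

#[local] Hint Resolve gd_l2 gd_bsupp mollu_sm2 cvg2_leib : plane.

(** * A chain rule from Taylor's formula *)

Section ChainRule.
Implicit Types (a : pl -> R).

Lemma der_quadratic f x (v : pl) (K : R) : f x = 0 ->
 (forall y, `|f y| <= K * `|y - x| ^+ 2) -> is_derive x v f 0.
move=> f0 H; apply/der_line.
set p := fun h : R => f (h *: v + x).
have p0 : p 0 = 0 by rewrite /p scale0r add0r.
pose C : R := K * `|v| ^+ 2.
have B (h : R) : `|p h| <= C * h ^+ 2.
 rewrite (le_trans (H _)) // addrK normrZ /C -mulrA.
 by rewrite exprMn real_normK ?num_real // (mulrC (h ^+ 2)).
have C0 : 0 <= C.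
 by have := B 1; rewrite expr1n mulr1; apply: le_trans.
clearbody C p.
have L : (fun h : R => h^-1 *: ((p \o shift 0) (h *: 1) - p 0)) @ 0^' --> (0 : R).
 apply/cvgr0Pnorm_le => e e0; near=> h.
 have h0 : h != 0 by near: h; exact: nbhs_dnbhs_neq.
 rewrite /= p0 subr0 addr0 [h *: 1]mulr1 normrZ normfV.
 rewrite ler_pdivrMl ?normr_gt0 // (le_trans (B h)) //.
 rewrite -[h ^+ 2]real_normK ?num_real // expr2 mulrA mulrC ler_wpM2l //.
 have hh : `|h| <= e / (C + 1).
  near: h; apply: dnbhs0_le; rewrite divr_gt0 // ltr_pwDr //.
 rewrite (le_trans (ler_wpM2l C0 hh)) // mulrCA -[leRHS]mulr1 ler_wpM2l ?(ltW e0) //.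
 by rewrite ler_pdivrMr ?mul1r ?ltr_pwDr // lerDl.
by apply: DeriveDef; [apply/cvg_ex; exists 0|exact: cvg_lim].
Unshelve. all: by end_near. Qed.

Lemma seg_bound_shift (p w : R -> R) (M a b : R) : (forall x : R, is_derive x 1 p (w x)) ->
 (forall t : R, `|t - b| <= `|a - b| -> `|w t| <= M) -> `|p a - p b| <= M * `|a - b|.
move=> Dp wM.
have D (t : R) : is_derive t 1 (fun h : R => p (h + b)) (w (t + b)).
 rewrite -[w _]mulr1.
 have A : is_derive t 1 (fun h : R => h + b) 1.
  by rewrite -[X in is_derive _ _ _ X]addr0; exact: der_add (der_id t) (der_cst b t).
 exact: der_comp A (Dp (t + b)).
have := @seg_bound _ _ M `|a - b| D _ (a - b) (lexx _).
rewrite subrK add0r; apply=> t ta; apply: wM; by rewrite addrK.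
Qed.

Lemma taylor1 f : sm2 f -> bsupp f -> exists2 K : R, 0 <= K & forall x y,
 `|f y - f x - ('D_(e_ o_0) f x * (y.1 - x.1) + 'D_(e_ o_1) f x * (y.2 - x.2))| <= K * `|y - x| ^+ 2.
move=> sf bf.
have [_ [L0 L00 H0]] := sm2_lipb (smooth_D o_0 sf) (bsupp_D o_0 sf bf).
have [_ [L1 L10 H1]] := sm2_lipb (smooth_D o_1 sf) (bsupp_D o_1 sf bf).
exists (L0 + L1) => [|x y]; first smt.
have n1 : `|y.1 - x.1| <= `|y - x| := norm1_le (y - x).
have n2 : `|y.2 - x.2| <= `|y - x| := norm2_le (y - x).
pose g (s : R) := f (s, y.2) - 'D_(e_ o_0) f x * s.
pose k (s : R) := f (x.1, s) - 'D_(e_ o_1) f x * s.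
have Dg (s : R) : is_derive s 1 g ('D_(e_ o_0) f (s, y.2) - 'D_(e_ o_0) f x).
 apply: der_add; first by apply: (@der_restr0 f y); exact: smooth_der.
 apply: der_opp; rewrite -[X in is_derive _ _ _ X]mulr1.
 by apply: der_scale; smt.
have Dk (s : R) : is_derive s 1 k ('D_(e_ o_1) f (x.1, s) - 'D_(e_ o_1) f x).
 apply: der_add; first by apply: (@der_restr1 f x); exact: smooth_der.
 apply: der_opp; rewrite -[X in is_derive _ _ _ X]mulr1.
 by apply: der_scale; smt.
have Bg : `|g y.1 - g x.1| <= L0 * `|y - x| * `|y.1 - x.1|.
 apply: (seg_bound_shift Dg) => t tx; rewrite (le_trans (H0 _ _)) // ler_wpM2l //.
 by rewrite norm_planeE /= ge_max n2 andbT (le_trans tx).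
have Bk : `|k y.2 - k x.2| <= L1 * `|y - x| * `|y.2 - x.2|.
 apply: (seg_bound_shift Dk) => t tx; rewrite (le_trans (H1 _ _)) // ler_wpM2l //.
 by rewrite norm_planeE /= subrr normr0 ge_max normr_ge0 /= (le_trans tx).
have -> : f y - f x - ('D_(e_ o_0) f x * (y.1 - x.1) + 'D_(e_ o_1) f x * (y.2 - x.2)) =
  (g y.1 - g x.1) + (k y.2 - k x.2).
 rewrite /g /k -!surjective_pairing; move: ('D_(e_ o_0) f x) ('D_(e_ o_1) f x) => A B; ring.
rewrite (le_trans (ler_normD _ _)) // mulrDl expr2 !mulrA lerD //.
 by rewrite (le_trans Bg) // ler_wpM2l // mulr_ge0.
by rewrite (le_trans Bk) // ler_wpM2l // mulr_ge0.
Qed.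

(** Smoothness is encoded by partial derivatives, so a Taylor estimate with quadratic error plays
    the role of the differential; the Lipschitz bound on [Phi] keeps the error quadratic. *)
Lemma der_plane_comp f (Phi : pl -> pl) x (v : pl) (L d1 d2 : R) :
 sm2 f -> bsupp f -> (forall y, `|Phi y - Phi x| <= L * `|y - x|) ->
 is_derive x v (fun y => (Phi y).1) d1 -> is_derive x v (fun y => (Phi y).2) d2 ->
 is_derive x v (fun y => f (Phi y))
  ('D_(e_ o_0) f (Phi x) * d1 + 'D_(e_ o_1) f (Phi x) * d2).
move=> sf bf HL D1 D2; have [K K0 HK] := taylor1 sf bf.
pose A := 'D_(e_ o_0) f (Phi x); pose B := 'D_(e_ o_1) f (Phi x).
have HKx y := HK (Phi x) (Phi y).
rewrite -/A -/B in HKx *; clearbody A B.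
pose lin y := f (Phi x) + (A * ((Phi y).1 - (Phi x).1) + B * ((Phi y).2 - (Phi x).2)).
have Dl : is_derive x v lin (A * d1 + B * d2).
 have scal (c : R) (g : pl -> R) (dg : R) : is_derive x v g dg -> is_derive x v (fun y => c * g y) (c * dg).
  by move=> H; have := der_mul (is_derive_cst c x v) H; rewrite mul0r add0r.
 have sub (c : R) (g : pl -> R) (dg : R) : is_derive x v g dg -> is_derive x v (fun y => g y - c) dg.
  move=> H; rewrite -[X in is_derive _ _ _ X]subr0.
  exact: der_add H (der_opp (is_derive_cst c x v)).
 rewrite -[X in is_derive _ _ _ X]add0r.
 exact: der_add (is_derive_cst _ x v) (der_add (scal _ _ _ (sub _ _ _ D1)) (scal _ _ _ (sub _ _ _ D2))).
have Dr : is_derive x v (fun y => f (Phi y) - lin y) 0.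
 apply: (@der_quadratic _ _ _ (K * L ^+ 2)).
  by rewrite /lin !subrr !mulr0 !addr0 subrr.
 move=> y; rewrite /lin opprD addrA (le_trans (HKx y)) // -mulrA ler_wpM2l // -exprMn.
 by rewrite lerXn2r ?nnegrE ?(le_trans (normr_ge0 _) (HL y)).
have := der_add Dl Dr; rewrite addr0.
by rewrite (_ : (fun y => lin y + (f (Phi y) - lin y)) = fun y => f (Phi y)) //; apply/funext => y; lra.
Qed.

End ChainRule.

(** * Shears along a coordinate *)

Section Shear.
Implicit Types (t : R).
Variable a : pl -> R.
Hypotheses (sa : sm2 a) (ba : bsupp a).
Variable i : 'I_2.
Local Notation D j f := ('D_(e_ j) f).

(** A deformation moving a single coordinate, so that substitution on lines applies to it; it fixes
    the points where [a] vanishes. *)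
Definition shear t x : pl := x + (t * a x) *: e_ i.

Lemma shear_id t x : a x = 0 -> shear t x = x.
by move=> a0; rewrite /shear a0 mulr0 scale0r addr0. Qed.

Lemma norm_basis2 j : `|e_ j| = 1.
by rewrite norm_planeE /basis2; case: ifP => _ /=; rewrite normr0 normr1; [rewrite max_l|rewrite max_r]. Qed.

Lemma shear_dist t x : `|shear t x - x| = `|t| * `|a x|.
by rewrite /shear addrC addKr normrZ norm_basis2 mulr1 normrM. Qed.

Lemma shear_lip : exists2 L : R, 0 <= L & forall t x y, `|shear t x - shear t y| <= (1 + `|t| * L) * `|x - y|.
have [_ [L L0 HL]] := sm2_lipb sa ba; exists L => // t x y.
have -> : shear t x - shear t y = (x - y) + (t * (a x - a y)) *: e_ i.
 by rewrite /shear opprD addrACA mulrBr scalerBl.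
rewrite (le_trans (ler_normD _ _)) // normrZ norm_basis2 mulr1 normrM mulrDl mul1r lerD2l -mulrA ler_wpM2l //.
Qed.

Lemma basis2_1 j : (e_ j).1 = (j == o_0)%:R.
by rewrite /basis2; case: ifP. Qed.

Lemma basis2_2 j : (e_ j).2 = (j != o_0)%:R.
by rewrite /basis2; case: ifP. Qed.

Lemma der_shear f j t x : sm2 f -> bsupp f ->
 is_derive x (e_ j) (fun y => f (shear t y)) (D j f (shear t x) + t * D j a x * D i f (shear t x)).
move=> sf bf; have [L L0 HL] := shear_lip.
have sh1 : is_derive x (e_ j) (fun y => (shear t y).1) ((j == o_0)%:R + t * D j a x * (i == o_0)%:R).
 rewrite (_ : (fun y => (shear t y).1) = fun y => y.1 + (t * (i == o_0)%:R) * a y); last first.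
  by apply/funext => y; rewrite /= basis2_1 [_ *: _]mulrAC.
 apply: der_add; first by rewrite -basis2_1; exact: der_fst.
 have := der_mul (is_derive_cst (t * (i == o_0)%:R) x (e_ j)) (smooth_der j x sa).
 by rewrite mul0r add0r mulrAC.
have sh2 : is_derive x (e_ j) (fun y => (shear t y).2) ((j != o_0)%:R + t * D j a x * (i != o_0)%:R).
 rewrite (_ : (fun y => (shear t y).2) = fun y => y.2 + (t * (i != o_0)%:R) * a y); last first.
  by apply/funext => y; rewrite /= basis2_2 [_ *: _]mulrAC.
 apply: der_add; first by rewrite -basis2_2; exact: der_snd.
 have := der_mul (is_derive_cst (t * (i != o_0)%:R) x (e_ j)) (smooth_der j x sa).
 by rewrite mul0r add0r mulrAC.
have := der_plane_comp sf bf (fun y => HL t y x) sh1 sh2.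
have pk (F : 'I_2 -> R) k : F o_0 * (k == o_0)%:R + F o_1 * (k != o_0)%:R = F k.
 by case: (ord2P k) => ->; rewrite /= ?eqxx /= ?mulr1 ?mulr0 ?addr0 ?add0r.
rewrite -(pk (fun k => D k f (shear t x)) j) -(pk (fun k => D k f (shear t x)) i).
move: (D o_0 f (shear t x)) (D o_1 f (shear t x)) (D j a x) => A B C.
move: ((j == o_0)%:R) ((j != o_0)%:R) ((i == o_0)%:R) ((i != o_0)%:R) => j1 j2 i1 i2.
by rewrite (_ : A * (j1 + t * C * i1) + B * (j2 + t * C * i2) = A * j1 + B * j2 + t * C * (A * i1 + B * i2)) //; ring.
Qed.

Lemma derive_shear f j t : sm2 f -> bsupp f ->
 D j (fun y => f (shear t y)) = fun x => D j f (shear t x) + t * D j a x * D i f (shear t x).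
by move=> sf bf; apply/funext => x; have [_ ->] := der_shear j t x sf bf. Qed.

Lemma shear_continuous t : continuous (shear t).
move=> x; apply: cvgD; first smt.
apply: cvgZ; last exact: cvg_cst.
by apply: cvgM; [exact: cvg_cst|exact: smooth_cont sa x].
Qed.

Lemma sm2_shear f t : sm2 f -> bsupp f -> sm2 (fun y => f (shear t y)).
move=> sf bf n; elim: n f sf bf => [|n IH] f sf bf.
 by move=> x; apply: continuous_comp; [exact: shear_continuous|exact: smooth_cont].
have cf g : sm2 g -> continuous (fun y => g (shear t y)).
 by move=> sg x; apply: continuous_comp; [exact: shear_continuous|exact: smooth_cont].
split; first exact: cf.
move=> j; split; first by move=> x; have [] := der_shear j t x sf bf.
rewrite (derive_shear j t sf bf).
apply: Cn_add; first exact: (IH _ (smooth_D j sf) (bsupp_D j sf bf)).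
apply: Cn_mul; last exact: (IH _ (smooth_D i sf) (bsupp_D i sf bf)).
by apply: Cn_mul; [exact: Cn_cst|exact: (smooth_D j sa n)].
Qed.

Lemma shear_surj0 t (M : R) (p : R -> R) c : continuous p -> (forall s, `|p s| <= M) ->
 exists s, s + t * p s = c.
move=> cp HM; pose N : R := `|t| * M.
have N0 : 0 <= N by rewrite mulr_ge0 // (le_trans _ (HM 0)).
have B s : `|t * p s| <= N by rewrite normrM ler_wpM2l.
clearbody N.
have ab : c - N <= c + N by lra.
have cf : {within `[c - N, c + N], continuous (fun s => s + t * p s)}.
 apply: continuous_subspaceT => s; apply: cvgD; first smt.
 by apply: cvgM; [exact: cvg_cst|exact: cp].
have [|s _ E] := @IVT R (fun s => s + t * p s) (c - N) (c + N) c ab cf; last by exists s.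
have := B (c - N); have := B (c + N); rewrite !ler_norml => /andP[h1 h2] /andP[h3 h4].
by rewrite ge_min le_max; lra.
Qed.

(** The bound 1/2 keeps the Jacobian [1 + t d_i a] positive; boundedness of [a] and the intermediate
    value theorem give surjectivity on each line. *)
Lemma subst_shear t : (forall x, `|t * D i a x| <= 2^-1) ->
 subst_ok (shear t) (fun x => 1 + t * D i a x).
move=> Ht; have ca := smooth_cont sa; have cD := smooth_cont (smooth_D i sa).
have [M _ HM] := bsupp_bounded ca ba.
have cw : continuous (fun x : pl => 1 + t * D i a x).
 smt.
have w0 x : 0 < 1 + t * D i a x by have := Ht x; rewrite ler_norml; lra.
have tD x : is_derive x (e_ i) (fun y => t * a y) (t * D i a x).
 by have := der_mul (is_derive_cst t x (e_ i)) (smooth_der i x sa); rewrite mul0r add0r.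
have line0 (x2 : R) : continuous (fun s : R => a (s, x2)).
 by move=> s; have [+ _] := @der_restr0 a (s, x2) s _ (smooth_der o_0 (s, x2) sa);
  move=> /derivable1_diffP/differentiable_continuous.
have line1 (x1 : R) : continuous (fun s : R => a (x1, s)).
 by move=> s; have [+ _] := @der_restr1 a (x1, s) s _ (smooth_der o_1 (x1, s) sa);
  move=> /derivable1_diffP/differentiable_continuous.
move: cw w0 tD; rewrite /shear; case: (ord2P i) => -> cw w0 tD.
 rewrite (_ : (fun x => _ + _) = fun x => (x.1 + t * a x, x.2)); last first.
  by apply/funext => x; congr (_, _); rewrite /= ?[_ *: 1]mulr1 ?scaler0 ?addr0.
 apply: subst_ok_fst => //.
 - by move=> x; apply: der_add => //; exact: der_fst.
 - move=> x; apply: cvgD; first exact: cont_fst_plane.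
  by apply: cvgM; [exact: cvg_cst|exact: ca].
 - by move=> x c; apply: (@shear_surj0 t M (fun s => a (s, x.2))).
rewrite (_ : (fun x => _ + _) = fun x => (x.1, x.2 + t * a x)); last first.
 by apply/funext => x; congr (_, _); rewrite /= ?[_ *: 1]mulr1 ?scaler0 ?addr0.
apply: subst_ok_snd => //.
- by move=> x; apply: der_add => //; exact: der_snd.
- move=> x; apply: cvgD; first exact: cont_snd_plane.
 by apply: cvgM; [exact: cvg_cst|exact: ca].
- by move=> x c; apply: (@shear_surj0 t M (fun s => a (x.1, s))).
Qed.

(** The displacement has length [|t a(x)|], too short for a Lipschitz [a] to come down from a
    nonzero value to 0. *)
Lemma shear_supp t x (L : R) : (forall x y, `|a x - a y| <= L * `|x - y|) -> `|t| * L <= 2^-1 ->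
 a (shear t x) = 0 -> a x = 0.
move=> HL tL a0; have := HL x (shear t x); rewrite a0 subr0 distrC shear_dist mulrA (mulrC L) => H.
have : `|a x| <= 2^-1 * `|a x| by apply: (le_trans H); rewrite ler_wpM2r.
by move=> H2; apply/normr0_eq0/eqP; rewrite eq_le normr_ge0 andbT; lra.
Qed.

End Shear.

#[local] Hint Resolve shear_continuous sm2_shear : plane.

(** * Limits under small shears *)

Section ShearLimits.
Implicit Types (c q : pl -> R) (t : R).
Variable a : pl -> R.
Hypotheses (sa : sm2 a) (ba : bsupp a).
Variable i : 'I_2.
Local Notation D j f := ('D_(e_ j) f).
Local Notation Phi := (shear a i).

Lemma near0_le (d : R) : 0 < d -> \forall t \near (0 : R), `|t| <= d.
by move=> d0; apply/nbhs_ballP; exists d => // t; rewrite /ball /= sub0r normrN => /ltW.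
Qed.

Lemma small_mul (d N t : R) : 0 < d -> 0 <= N -> `|t| <= d / (N + 1) -> `|t| * N <= d.
move=> d0 N0 tN; have N1 : 0 < N + 1 by smt.
rewrite (le_trans (ler_wpM2r N0 tN)) // -mulrA ger_pMr // mulrC ler_pdivrMr // mul1r.
lra.
Qed.

Definition good t : Prop := (forall x, `|t * D i a x| <= 2^-1) /\
 (forall x, a (Phi t x) = 0 -> a x = 0).

Lemma near_good : \forall t \near (0 : R), good t.
have [M M0 HM] := bsupp_bounded (smooth_cont (smooth_D i sa)) (bsupp_D i sa ba).
have [_ [L L0 HL]] := sm2_lipb sa ba.
have sm (N : R) : 0 <= N -> \forall t \near (0 : R), `|t| * N <= 2^-1.
 move=> N0; near=> t.
 apply: small_mul => //.
 by near: t; apply: near0_le; rewrite divr_gt0 ?invr_gt0 // ltr_pwDr.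
near=> t; split.
 move=> x; rewrite normrM (le_trans (ler_wpM2l (normr_ge0 _) (HM x))) //.
 by near: t; apply: sm; exact: ltW.
by move=> x; apply: (shear_supp HL); near: t; exact: sm.
Unshelve. all: by end_near. Qed.

Lemma measurable_shear f t : measurable_fun setT f -> good t -> measurable_fun setT (fun x => f (Phi t x)).
move=> mf [gt _]; have [mPhi _ _ _] := subst_shear sa ba gt.
exact: measurableT_comp mf mPhi.
Qed.

Lemma shear_weight t x : good t -> 1 <= 2 * (1 + t * D i a x).
by move=> [gt _]; have := gt x; rewrite ler_norml; lra. Qed.

Lemma ig_shear f t : ig f -> good t -> ig (fun x => f (Phi t x)).
move=> iF gt; have S := subst_shear sa ba gt.1.
have := igZ 2 (ig_abs (subst_ig S iF)) => /ig_le; apply.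
 exact: measurable_shear (ig_measurable iF) gt.
move=> x; have := shear_weight x gt; rewrite normrM; move: (1 + _) => w w2.
have w0 : 0 <= w by lra.
by rewrite (ger0_norm w0) mulrA -[leLHS]mul1r ler_wpM2r.
Qed.

(** The Jacobian is at least 1/2. *)
Lemma I_shear_le f t : ig f -> (forall x, 0 <= f x) -> good t -> I (fun x => f (Phi t x)) <= 2 * I f.
move=> iF f0 gt; have S := subst_shear sa ba gt.1.
rewrite -(subst_I S iF) -IZ; last exact: subst_ig.
apply: I_le; [exact: ig_shear|exact/igZ/subst_ig|move=> x].
have := shear_weight x gt; move: (1 + _) => w w2.
by rewrite mulrA -[leLHS]mul1r ler_wpM2r.
Qed.

Lemma l2_shear f t : l2 f -> good t -> l2 (fun x => f (Phi t x)).
by move=> [mf if2] gt; split; [exact: measurable_shear|exact: (ig_shear if2)]. Qed.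

Lemma n2_shear_le f t : l2 f -> good t -> n2 (fun x => f (Phi t x)) <= 2 * n2 f.
by move=> [mf if2] gt; apply: (I_shear_le if2) => // x; smt. Qed.

Lemma cvg2_shear (F : nat -> pl -> R) f t : (forall n, l2 (F n)) -> l2 f -> cvg2 F f -> good t ->
 cvg2 (fun n x => F n (Phi t x)) (fun x => f (Phi t x)).
move=> lF lf cF gt.
apply: (@squeeze_cvgr _ _ _ _ (fun=> 0) (fun n => 2 * n2 (fun x => F n x - f x))); last 2 first.
- exact: cvg_cst.
- rewrite -[X in _ --> X](mulr0 2); apply: cvgM; [exact: cvg_cst|exact: cF].
near=> n; rewrite n2_ge0 /=; exact: (n2_shear_le (l2B (lF n) lf)).
Unshelve. all: by end_near. Qed.

Definition cvgI (f : R -> pl -> R) g : Prop :=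
 [/\ ig g, \forall t \near (0 : R), ig (f t) & I (f t) @[t --> (0 : R)] --> I g].

Lemma cvgI_add (f1 f2 : R -> pl -> R) g1 g2 : cvgI f1 g1 -> cvgI f2 g2 ->
 cvgI (fun t x => f1 t x + f2 t x) (fun x => g1 x + g2 x).
move=> [i1 n1 c1] [i2 n2 c2]; split; first exact: igD.
 by near=> t; apply: igD; near: t.
rewrite ID //; apply: cvg_trans (cvgD c1 c2); apply: near_eq_cvg; near=> t.
by rewrite /= ID //; near: t.
Unshelve. all: by end_near. Qed.

Lemma cvgI_Z (k : R) (f : R -> pl -> R) g : cvgI f g -> cvgI (fun t x => k * f t x) (fun x => k * g x).
move=> [i1 n1 c1]; split; first exact: igZ.
 by near=> t; apply: igZ; near: t.
rewrite IZ //; apply: cvg_trans (cvgM (cvg_cst k) c1); apply: near_eq_cvg; near=> t.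
by rewrite /= IZ //; near: t.
Unshelve. all: by end_near. Qed.

(** As q is merely integrable, it is replaced by a Lipschitz function, whose values the shear moves
    by O(t); the replacement costs at most twice its L^1 error after shearing. *)
Lemma cvgI_shear c q : continuous c -> bsupp c -> ig q -> bsupp q ->
 cvgI (fun t x => c x * q (Phi t x)) (fun x => c x * q x).
move=> cc bc iq bq; have [M M0 HM] := bsupp_bounded cc bc.
have mc := cont_measurable cc.
have iM f : ig f -> ig (fun x => c x * f x) by move=> iF; smt.
have IM f : ig f -> `|I (fun x => c x * f x)| <= M * I (fun x => `|f x|).
 move=> iF; rewrite (le_trans (I_abs (iM _ iF))) // -IZ; last exact: ig_abs.
 apply: I_le; [exact: ig_abs (iM _ iF)|exact/igZ/ig_abs|move=> x].
 by rewrite normrM ler_wpM2r.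
split; first exact: iM.
 by near=> t; apply: iM; apply: ig_shear => //; near: t; exact: near_good.
apply/cvgrPdist_le => e e0.
(* This yields shares e/6 and e/3 for the two replacements and leaves e/2 for the Lipschitz
   function. *)
have e4 : 0 < e / (6 * M) by smt.
have [_ /(_ _ e4) [f [lf Hf]]] := near1_ig iq bq.
have [bf [L L0 HL]] := lf.
have [Ma Ma0 HMa] := bsupp_bounded (smooth_cont sa) ba.
pose N : R := L * Ma * I (fun x => `|c x|).
have ic : ig c := ig_continuous cc bc.
have N0 : 0 <= N by rewrite /N mulr_ge0 ?mulr_ge0 ?(ltW Ma0) //; apply: I_ge0.
near=> t.
have gt : good t by near: t; exact: near_good.
have tN : `|t| * N <= e / 2.
 apply: small_mul => //; first by smt.
 by near: t; apply: near0_le; rewrite !divr_gt0 // ltr_pwDr.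
have iF : ig f := lipb_ig lf.
have iqf : ig (fun x => q x - f x) := igB iq iF.
have E : I (fun x => c x * q x) - I (fun x => c x * q (Phi t x)) =
  I (fun x => c x * (q x - f x)) - I (fun x => c x * (q (Phi t x) - f (Phi t x))) -
  I (fun x => c x * (f (Phi t x) - f x)).
 have j1 := iM _ iq; have j2 := iM _ iF; have j3 := iM _ (ig_shear iq gt).
 have j4 := iM _ (ig_shear iF gt).
 have EB (g1 g2 : pl -> R) : (fun x => c x * (g1 x - g2 x)) = fun x => c x * g1 x - c x * g2 x.
  by apply/funext => x; rewrite mulrBr.
 rewrite (EB q f) (EB (fun x => q (Phi t x)) (fun x => f (Phi t x))) (EB (fun x => f (Phi t x)) f).
 rewrite (IB j1 j2) (IB j3 j4) (IB j4 j2).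
 by move: (I _) (I _) (I _) (I _) => A1 A2 A3 A4; ring.
rewrite E.
have B1 : `|I (fun x => c x * (q x - f x))| <= e / 6.
 rewrite (le_trans (IM _ iqf)) // (le_trans (ler_wpM2l (ltW M0) Hf)) //.
 by rewrite le_eqVlt; apply/orP; left; apply/eqP; field; rewrite gt_eqF.
have B2 : `|I (fun x => c x * (q (Phi t x) - f (Phi t x)))| <= e / 3.
 rewrite (le_trans (IM _ (ig_shear iqf gt))) //.
 have := I_shear_le (ig_abs iqf) (fun x => normr_ge0 _) gt => H.
 have H2 : I (fun x => `|q (Phi t x) - f (Phi t x)|) <= 2 * (e / (6 * M)).
  by rewrite (le_trans H) // ler_wpM2l.
 rewrite (le_trans (ler_wpM2l (ltW M0) H2)) //.
 by rewrite le_eqVlt; apply/orP; left; apply/eqP; field; rewrite gt_eqF.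
have B3 : `|I (fun x => c x * (f (Phi t x) - f x))| <= e / 2.
 have iff := igB (ig_shear iF gt) iF.
 rewrite (le_trans (I_abs (iM _ iff))) // (le_trans _ tN) //.
 rewrite /N mulrA -IZ; last exact: ig_abs.
 apply: I_le; [exact: ig_abs (iM _ iff)|exact/igZ/ig_abs|move=> x].
 rewrite normrM mulrC ler_wpM2r // (le_trans (HL _ _)) // shear_dist mulrCA.
 by rewrite ler_wpM2l // ler_wpM2l.
rewrite (le_trans (ler_normB _ _)) // (le_trans (lerD (ler_normB _ _) (lexx _))) //.
rewrite (le_trans (lerD (lerD B1 B2) B3)) //.
by rewrite le_eqVlt; apply/orP; left; apply/eqP; field.
Unshelve. all: by end_near. Qed.

Definition bdd2 (f : R -> pl -> R) : Prop :=
 exists2 C : R, 0 <= C & \forall t \near (0 : R), l2 (f t) /\ n2 (f t) <= C.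

Lemma bdd2_add (f g : R -> pl -> R) : bdd2 f -> bdd2 g -> bdd2 (fun t x => f t x + g t x).
move=> [C C0 H1] [C' C0' H2]; exists (2 * C + 2 * C'); first by smt.
near=> t.
have [l1 b1] : l2 (f t) /\ n2 (f t) <= C by near: t.
have [l2' b2] : l2 (g t) /\ n2 (g t) <= C' by near: t.
split; first exact: l2D.
by rewrite (le_trans (n2D_le l1 l2')) // lerD // ler_wpM2l.
Unshelve. all: by end_near. Qed.

Lemma bdd2_shear c f : continuous c -> bsupp c -> l2 f -> bdd2 (fun t x => c x * f (Phi t x)).
move=> cc bc lf; have [M M0 HM] := bsupp_bounded cc bc.
have mc := cont_measurable cc.
exists (M ^+ 2 * (2 * n2 f)); first by rewrite mulr_ge0 ?sqr_ge0 // mulr_ge0 // n2_ge0.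
near=> t; have gt : good t by near: t; exact: near_good.
have lft := l2_shear lf gt.
split; first exact: l2_mul_bounded mc HM lft.
rewrite (le_trans _ (ler_wpM2l (sqr_ge0 M) (n2_shear_le lf gt))) // /n2 -IZ; last exact: lft.2.
apply: I_le; [exact: (l2_mul_bounded mc HM lft).2|exact: igZ lft.2|move=> x].
by rewrite exprMn ler_wpM2r ?sqr_ge0 // -[leLHS]real_normK ?num_real // lerXn2r ?nnegrE // ltW.
Unshelve. all: by end_near. Qed.

Lemma bdd2_shear1 f : l2 f -> bdd2 (fun t x => f (Phi t x)).
move=> lf; exists (2 * n2 f); first by rewrite mulr_ge0 // n2_ge0.
near=> t; have gt : good t by near: t; exact: near_good.
by split; [exact: l2_shear|exact: n2_shear_le].
Unshelve. all: by end_near. Qed.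

End ShearLimits.

(** * Vanishing of first variations *)

Section FirstVariation.

(** Dividing by t from the right and from the left gives opposite inequalities for the limit
    slope. *)
Lemma first_variation0 (S : R -> R) (S0 C : R) : S t @[t --> (0 : R)] --> S0 ->
 (\forall t \near (0 : R), 0 <= t * S t + t ^+ 2 * C) -> S0 = 0.
move=> cS H.
have cB : S t + t * C @[t --> (0 : R)] --> S0.
 have c0 : t * C @[t --> (0 : R)] --> 0 * C by apply: cvgM; [exact: cvg_id|exact: cvg_cst].
 rewrite -[X in _ --> X]addr0 -[X in _ --> _ + X](mul0r C); exact: cvgD cS c0.
apply/eqP; rewrite eq_le; apply/andP; split.
- have cL : S t + t * C @[t --> (0 : R)^'-] --> S0 by apply: cvg_at_left_filter; exact: cB.
 apply: (cvgr_to_le cL); near=> t.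
 have t0 : t < 0 by near: t; exact: nbhs_left_lt.
 have : 0 <= t * S t + t ^+ 2 * C by near: t; apply: cvg_within; exact: H.
 by rewrite expr2 -mulrA -mulrDr nmulr_rge0.
- have cR : S t + t * C @[t --> (0 : R)^'+] --> S0 by apply: cvg_at_right_filter; exact: cB.
 apply: (cvgr_to_ge cR); near=> t.
 have t0 : 0 < t by near: t; exact: nbhs_right_gt.
 have : 0 <= t * S t + t ^+ 2 * C by near: t; apply: cvg_within; exact: H.
 by rewrite expr2 -mulrA -mulrDr pmulr_rge0.
Unshelve. all: by end_near. Qed.

Lemma n2_perturb (f g : pl -> R) (t : R) : l2 f -> l2 g ->
 n2 (fun x => f x + t ^+ 2 * g x) <= n2 f + t ^+ 2 * (n2 f + (1 + t ^+ 2) * n2 g).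
move=> lf lg; have ltg := l2Z (t ^+ 2) lg.
rewrite (n2D lf ltg).
have -> : (fun x => f x * (t ^+ 2 * g x)) = fun x => t ^+ 2 * (f x * g x) by apply/funext => x; lra.
rewrite (IZ _ (l2_ig_mul lf lg)).
have -> : n2 (fun x => t ^+ 2 * g x) = t ^+ 2 * t ^+ 2 * n2 g.
 by rewrite /n2 -(IZ _ lg.2); congr I; apply/funext => x; lra.
have B : 2 * I (fun x => f x * g x) <= n2 f + n2 g.
 have := n2_ge0 (fun x => f x + - g x); rewrite (n2D lf (l2N lg)) n2N.
 have -> : (fun x => f x * - g x) = fun x => - (f x * g x) by apply/funext => x; lra.
 rewrite (IN (l2_ig_mul lf lg)); lra.
have t2 := sqr_ge0 t.
move: (n2 f) (n2 g) (I _) B t2 => p q r; move: (t ^+ 2) => T B T0.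
have := ler_wpM2l T0 B; lra.
Qed.

End FirstVariation.

(** * Pulling back derivatives by a shear *)

Section InnerVariation.
Local Notation D j f := ('D_(e_ j) f).
Implicit Types (c a : pl -> R) (t : R) (s : seq 'I_2) (F G : seq 'I_2 -> pl -> R).

Lemma cvg2N (F : nat -> pl -> R) f : cvg2 F f -> cvg2 (fun n x => - F n x) (fun x => - f x).
apply: cvg_trans; apply: near_eq_cvg; near=> n; rewrite /= -n2N; congr n2.
by apply/funext => x; rewrite opprB opprK addrC.
Unshelve. all: by end_near. Qed.

(** The chain rule up to second order for composition with the shear, on candidate derivatives F.
    Mixed words keep their order because the weak second derivatives come without symmetry. *)
Definition pb a i t F s x : R :=
 match s with
 | [::] => F [::] (shear a i t x)
 | [:: j] => F [:: j] (shear a i t x) + (t * D j a x) * F [:: i] (shear a i t x)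
 | [:: j; k] => (F [:: j; k] (shear a i t x) + (t * D j a x) * F [:: i; k] (shear a i t x)) +
   ((t * partials [:: j; k] a x) * F [:: i] (shear a i t x) +
   (t * D k a x) * (F [:: j; i] (shear a i t x) + (t * D j a x) * F [:: i; i] (shear a i t x)))
 | _ => 0
 end.

Section Pullback.
Variable a : pl -> R.
Hypotheses (sa : sm2 a) (ba : bsupp a).
Variable i : 'I_2.
Local Notation Phi := (shear a i).

Lemma partials_pb t f s x : sm2 f -> bsupp f -> (size s <= 2)%N ->
 partials s (fun y => f (Phi t y)) x = pb a i t (fun r => partials r f) s x.
move=> sf bf; case: s => [//|j [|k [|//]]] _; first exact: (congr1 (fun h => h x) (derive_shear sa ba i j t sf bf)).
rewrite [LHS]/= (derive_shear sa ba i k t sf bf).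
have sj := smooth_D k sf; have bj := bsupp_D k sf bf.
have si := smooth_D i sf; have bi := bsupp_D i sf bf.
have s1 := sm2_shear sa ba i t sj bj; have s2 := sm2_shear sa ba i t si bi.
have sk : sm2 (fun x => t * D k a x) by apply: smooth_mul; [exact: smooth_cst|exact: smooth_D].
rewrite (deriveD2 j x s1 (smooth_mul sk s2)) (deriveM2 j x sk s2).
rewrite (deriveM2 j x (smooth_cst _ t) (smooth_D k sa)).
have -> : D j (fun=> t) x = 0 by exact: derive_cst.
rewrite mul0r add0r.
have E1 := congr1 (fun h => h x) (derive_shear sa ba i j t sj bj).
have E2 := congr1 (fun h => h x) (derive_shear sa ba i j t si bi).
by rewrite /= in E1 E2; rewrite E1 E2.
Qed.

Lemma l2_cvg2_pb (F : nat -> seq 'I_2 -> pl -> R) G s t : good a i t -> (size s <= 2)%N ->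
 (forall n r, (size r <= 2)%N -> l2 (F n r)) -> (forall r, (size r <= 2)%N -> l2 (G r)) ->
 (forall r, (size r <= 2)%N -> cvg2 (fun n => F n r) (G r)) ->
 [/\ l2 (pb a i t G s), forall n, l2 (pb a i t (F n) s) & cvg2 (fun n => pb a i t (F n) s) (pb a i t G s)].
move=> gt sz lF lG cF.
pose P (A : nat -> pl -> R) b := l2 b /\ (forall n, l2 (A n)) /\ cvg2 A b.
have sh r : (size r <= 2)%N -> P (fun n x => F n r (Phi t x)) (fun x => G r (Phi t x)).
 move=> r2; split; first exact: (l2_shear sa ba (lG _ r2) gt).
 split; first by move=> n; exact: (l2_shear sa ba (lF n _ r2) gt).
 exact: (cvg2_shear sa ba (fun n => lF n _ r2) (lG _ r2) (cF _ r2) gt).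
have mul r A b : P A b -> r != [::] -> P (fun n x => (t * partials r a x) * A n x) (fun x => (t * partials r a x) * b x).
 move=> [lb [lA cA]] r0.
 have cc : continuous (fun x => t * partials r a x).
  by apply: smooth_cont; apply: smooth_mul; [exact: smooth_cst|exact: sm2_partials].
 have bc : bsupp (fun x => t * partials r a x).
  smt.
 have [M _ HM] := bsupp_bounded cc bc.
 have mc := cont_measurable cc.
 split; first exact: l2_mul_bounded mc HM lb.
 split; first by move=> n; exact: l2_mul_bounded mc HM (lA n).
 exact: cvg2M mc HM lA lb cA.
have add A B b c : P A b -> P B c -> P (fun n x => A n x + B n x) (fun x => b x + c x).
 move=> [la [lA cA]] [lb [lB cB]]; split; first smt.
 by split; [move=> n; exact: l2D|exact: cvg2D].
suff [lb [lp cb]] : P (fun n => pb a i t (F n) s) (pb a i t G s) by split.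
case: s sz => [_|j [_|k [_|//]]]; first exact: sh.
- exact: (add _ _ _ _ (sh [:: j] isT) (mul [:: j] _ _ (sh [:: i] isT) isT)).
- have A1 := add _ _ _ _ (sh [:: j; k] isT) (mul [:: j] _ _ (sh [:: i; k] isT) isT).
 have A2 := add _ _ _ _ (sh [:: j; i] isT) (mul [:: j] _ _ (sh [:: i; i] isT) isT).
 exact: (add _ _ _ _ A1 (add _ _ _ _ (mul [:: j; k] _ _ (sh [:: i] isT) isT) (mul [:: k] _ _ A2 isT))).
Qed.

Lemma pb_id t F s x : (size s <= 2)%N -> (forall r, partials r a x = 0) -> pb a i t F s x = F s x.
move=> s2 z; have a0 : a x = 0 := z [::].
have z1 j : D j a x = 0 := z [:: j].
have Px : Phi t x = x := shear_id i t a0.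
case: s s2 => [|j [|k [|//]]] _; rewrite /pb Px ?z1 //; first by lra.
by rewrite (z [:: j; k]) !mulr0 !mul0r !addr0.
Qed.

Variable K : set pl.
Hypotheses (cK : compact K) (KO : K `<=` Omega) (aK : forall x, ~ K x -> a x = 0).

Lemma test_shear phi t : good a i t -> test_function Omega phi ->
 test_function Omega (fun x => phi (Phi t x)).
move=> gt /testP[sp [K' [cK' K'O pK']]]; apply/testP.
have bp : bsupp phi by apply: (@csupp_bsupp Omega); exists K'.
split; first smt.
exists (K' `|` K); split; first by apply: compactU.
 by move=> x [/K'O|/KO].
move=> x /not_orP[nK' nK]; rewrite shear_id ?aK //; exact: pK'.
Qed.

(** The approximants of V composed with the shear are again test functions, the shear being the
    identity off K, and they converge because small shears are bounded on L^2. *)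
Lemma test_lim_shear V F t : good a i t -> test_lim V (fun s => F (rev s)) ->
 test_lim (fun x => V (Phi t x) - V x) (fun s x => pb a i t F (rev s) x - F (rev s) x).
move=> gt [FV lF [phi [tp cp]]].
have lF' r : (size r <= 2)%N -> l2 (F r) by move=> r2; have := (lF (rev r)); rewrite size_rev revK => /(_ r2)[].
have ta : test_function Omega a by apply/testP; split=> //; exists K.
have sphi n : sm2 (phi n) by have /testP[] := tp n.
have bphi n : bsupp (phi n) by have /testP[_ /csupp_bsupp] := tp n.
have lphi n r : (size r <= 2)%N -> l2 (partials r (phi n)).
 by move=> _; exact: test_l2 (test_partials r (tp n)).
have cF r : (size r <= 2)%N -> cvg2 (fun n => partials r (phi n)) (F r).
 by move=> r2; have := cp (rev r); rewrite size_rev revK => /(_ r2).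
have H s (s2 : (size s <= 2)%N) := l2_cvg2_pb gt s2 lphi lF' cF.
split.
- by apply/funext => x /=; rewrite -FV.
- move=> s s2; have sr : (size (rev s) <= 2)%N by rewrite size_rev.
 split; first by apply: l2B; [have [] := H _ sr|exact: lF'].
 move=> x Ox; rewrite pb_id ?subrr // => r; exact: test_out (test_partials r ta) Ox.
exists (fun n x => phi n (Phi t x) + (-1) * phi n x); split.
 by move=> n; apply: testD; [exact: test_shear|exact: testZ].
move=> s s2; have sr : (size (rev s) <= 2)%N by rewrite size_rev.
have [lp lpn cp'] := H _ sr.
have := cvg2D lpn lp (fun n => l2N (lphi n _ sr)) (l2N (lF' _ sr)) cp' (cvg2N (cF _ sr)).
apply: cvg_trans; apply: near_eq_cvg; near=> n; congr n2; apply/funext => x; congr (_ - _).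
rewrite (partialsD _ (sm2_shear sa ba i t (sphi n) (bphi n)) (smooth_mul (smooth_cst _ (-1)) (sphi n))).
by rewrite (partialsZ (-1) _ (sphi n)) (partials_pb _ _ (sphi n) (bphi n) sr) mulN1r.
Unshelve. all: by end_near. Qed.

End Pullback.
End InnerVariation.

(** * Radial vector fields *)

Section RadialFields.
Variable x0 : pl.
Implicit Types (k Z : R -> R).
Local Notation D j f := ('D_(e_ j) f).
Local Notation q1 := (q1 x0).
Local Notation q2 := (q2 x0).
Local Notation sq := (sq x0).

Lemma laplM f g x : sm2 f -> sm2 g -> lapl (fun y => f y * g y) x =
 lapl f x * g x + 2 * (D o_0 f x * D o_0 g x + D o_1 f x * D o_1 g x) + f x * lapl g x.
move=> sf sg; rewrite /lapl (partials_leib x sf sg (s := [:: o_0; o_0]) isT) (partials_leib x sf sg (s := [:: o_1; o_1]) isT).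
rewrite /leib [partials [::] g x]/= [partials [:: o_0] g x]/= [partials [:: o_1] g x]/=.
move: (partials _ f x) (partials _ f x) (partials _ g x) (partials _ g x) => A1 A2 A3 A4.
move: (D o_0 f x) (D o_1 f x) (D o_0 g x) (D o_1 g x) (f x) (g x) => A5 A6 A7 A8 A9 A10; ring.
Qed.

Lemma derive_rad Z i x : smoothR Z -> D i (fun y => Z (sq y)) x = 'D_1 Z (sq x) * (2 * coord2 i (x - x0)).
exact: derive_radial. Qed.

Definition qc i x : R := coord2 i (x - x0).

Lemma partials1_rad Z i x : smoothR Z ->
 partials [:: i] (fun y => Z (sq y)) x = 'D_1 Z (sq x) * (2 * qc i x).
by move=> sZ; rewrite -(derive_rad i x sZ). Qed.

Lemma sm2_qc i : sm2 (qc i).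
by rewrite /qc; case: (ord2P i) => ->; smt. Qed.

Lemma derive_qc i j x : D j (qc i) x = (i == j)%:R.
have [<-|ij] := eqVneq i j; first by have [_] := der_coord x0 x i.
by rewrite eq_sym in ij; have [_ ->] := @der_coord_off x0 x j i ij; smt.
Qed.

Lemma lapl_qc i x : lapl (qc i) x = 0.
have E j : partials [:: j; j] (qc i) x = 0.
 rewrite [LHS]/= (_ : D j (qc i) = fun _ => (i == j)%:R); last by apply/funext => y; exact: derive_qc.
 exact: derive_cst.
by rewrite /lapl !E addr0.
Qed.

(** One component of a dilation field localized by a radial weight; the two components are varied
    separately. *)
Definition rad Z i x : R := Z (sq x) * qc i x.

Lemma sm2_rad_field Z i : smoothR Z -> sm2 (rad Z i).
by move=> sZ; apply: smooth_mul; [exact: sm2_rad|exact: sm2_qc]. Qed.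

Lemma derive_rad_field Z i j x : smoothR Z ->
 D j (rad Z i) x = 2 * 'D_1 Z (sq x) * qc j x * qc i x + Z (sq x) * (i == j)%:R.
move=> sZ; rewrite /rad (deriveM2 j x (sm2_rad x0 sZ) (sm2_qc i)) derive_qc (derive_rad j x sZ) -/(qc j x).
lra.
Qed.

Lemma lapl_rad_field Z i x : smoothR Z ->
 lapl (rad Z i) x = (4 * sq x * 'D_1 ('D_1 Z) (sq x) + 8 * 'D_1 Z (sq x)) * qc i x.
move=> sZ; rewrite /rad (laplM x (sm2_rad x0 sZ) (sm2_qc i)) lapl_qc !derive_qc !(derive_rad _ x sZ).
rewrite (congr1 (fun h => h x) (lapl_radial x0 sZ)) /Lam -/(sq x) -!/(qc _ x).
rewrite mulr0 addr0.
by case: (ord2P i) => ->; rewrite ?eqxx /=;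
 move: (qc o_0 x) (qc o_1 x) (sq x) ('D_1 ('D_1 Z) _) ('D_1 Z _) => A1 A2 A4 A5 A6; ring.
Qed.

Lemma derive_ks2 k t : smoothR k -> 'D_1 (fun t : R => k t * t ^+ 2) t = 'D_1 k t * t ^+ 2 + k t * (2 * t).
move=> sk; have H := der_mul (smoothR_der t sk) (der_mul (der_id t) (der_id t)).
have [_] := H; rewrite (_ : (fun y : R => k y * (y * y)) = fun t : R => k t * t ^+ 2); last by apply/funext => y; smt.
lra.
Qed.

Lemma smoothR_ks2 k : smoothR k -> smoothR (fun t : R => k t * t ^+ 2).
by move=> sk; smt. Qed.

Lemma derive2_ks2 k t : smoothR k -> 'D_1 ('D_1 (fun t : R => k t * t ^+ 2)) t =
 'D_1 ('D_1 k) t * t ^+ 2 + 4 * t * 'D_1 k t + 2 * k t.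
move=> sk; have sk' := smoothR_D sk.
have -> : 'D_1 (fun t : R => k t * t ^+ 2) = fun t => 'D_1 k t * (t * t) + k t * (2 * t).
 by apply/funext => s; rewrite (derive_ks2 s sk) expr2.
have H1 := der_mul (smoothR_der t sk') (der_mul (der_id t) (der_id t)).
have H2 := der_mul (smoothR_der t sk) (der_scale 2 (der_id t)).
have [_ ->] := der_add H1 H2.
lra.
Qed.

Lemma derive_ks k t : smoothR k -> 'D_1 (ks k) t = 2 * t * 'D_1 ('D_1 k) t + 8 * 'D_1 k t.
move=> sk; have sk' := smoothR_D sk.
have H1 := der_mul (der_scale 2 (der_id t)) (smoothR_der t sk').
have H2 := der_scale 6 (smoothR_der t sk).
have [_ E] := der_add H1 H2; rewrite /ks E.
ring.
Qed.

End RadialFields.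
#[local] Hint Resolve sm2_qc sm2_rad_field smoothR_ks2 : plane.

(** * Local L^2 convergence *)

Section Sequences.
Implicit Types (c a b : pl -> R) (A B : nat -> pl -> R).

Definition s2 A a : Prop := [/\ l2 a, forall n, l2 (A n) & cvg2 A a].

Lemma s2D A B a b : s2 A a -> s2 B b -> s2 (fun n x => A n x + B n x) (fun x => a x + b x).
by move=> [la lA cA] [lb lB cB]; split; [exact: l2D|move=> n; exact: l2D|exact: cvg2D].
Qed.

Lemma s2M c (M : R) A a : measurable_fun setT c -> (forall x, `|c x| <= M) -> s2 A a ->
 s2 (fun n x => c x * A n x) (fun x => c x * a x).
move=> mc HM [la lA cA]; split; first exact: l2_mul_bounded mc HM la.
 by move=> n; exact: l2_mul_bounded mc HM (lA n).
exact: cvg2M mc HM lA la cA.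
Qed.

Definition sI A a : Prop := [/\ ig a, forall n, ig (A n) & I (A n) @[n --> \oo] --> I a].

Lemma sI_D A B a b : sI A a -> sI B b -> sI (fun n x => A n x + B n x) (fun x => a x + b x).
move=> [ia iA cA] [ib iB cB]; split; [exact: igD|by move=> n; exact: igD|].
rewrite ID //; under eq_fun do rewrite ID //; exact: cvgD.
Qed.

Lemma sI_Z (k : R) A a : sI A a -> sI (fun n x => k * A n x) (fun x => k * a x).
move=> [ia iA cA]; split; [exact: igZ|by move=> n; exact: igZ|].
rewrite IZ //; under eq_fun do rewrite IZ //; apply: cvgM => //; exact: cvg_cst.
Qed.

Lemma sI_mul A B a b : s2 A a -> s2 B b -> sI (fun n x => A n x * B n x) (fun x => a x * b x).
move=> [la lA cA] [lb lB cB]; split; [exact: l2_ig_mul|by move=> n; exact: l2_ig_mul|].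
have E n : I (fun x => A n x * B n x) = I (fun x => (A n x - a x) * (B n x - b x)) +
  (I (fun x => B n x * a x) + I (fun x => A n x * b x) - I (fun x => a x * b x)).
 have i1 := l2_ig_mul (l2B (lA n) la) (l2B (lB n) lb).
 have i2 := l2_ig_mul (lB n) la; have i3 := l2_ig_mul (lA n) lb; have i4 := l2_ig_mul la lb.
 rewrite -(ID i2 i3) -(IB (igD i2 i3) i4) -(ID i1 (igB (igD i2 i3) i4)).
 by congr I; apply/funext => x; ring.
under eq_fun do rewrite E.
have Eab : I (fun x => b x * a x) = I (fun x => a x * b x).
 by congr I; apply/funext => x; lra.
have C2 : I (fun x => B n x * a x) + I (fun x => A n x * b x) - I (fun x => a x * b x) @[n --> \oo] -->
  I (fun x => b x * a x) + I (fun x => a x * b x) - I (fun x => a x * b x).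
 by apply: cvgB; [apply: cvgD; exact: cvg2_I|exact: cvg_cst].
suff C1 : I (fun x => (A n x - a x) * (B n x - b x)) @[n --> \oo] --> (0 : R).
 have L : I (fun x => a x * b x) = 0 + (I (fun x => b x * a x) + I (fun x => a x * b x) - I (fun x => a x * b x)).
  lra.
 apply: (cvg_trans (cvgD C1 C2)); rewrite -L; smt.
apply/cvgr0Pnorm_le => e e0.
have A1 : \forall n \near \oo, n2 (fun x => A n x - a x) <= e.
 by have /cvgr0Pnorm_le /(_ _ e0) := cA; apply: filterS => n; rewrite ger0_norm ?n2_ge0.
have B1 : \forall n \near \oo, n2 (fun x => B n x - b x) <= e.
 by have /cvgr0Pnorm_le /(_ _ e0) := cB; apply: filterS => n; rewrite ger0_norm ?n2_ge0.
near=> n; rewrite (le_trans (I_mul_le (l2B (lA n) la) (l2B (lB n) lb))) //.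
have -> : e = Num.sqrt e * Num.sqrt e by rewrite -expr2 sqr_sqrtr // ltW.
by apply: ler_pM => //; rewrite ler_wsqrtr //; near: n.
Unshelve. all: by end_near. Qed.

(** Lets one weight serve two factors: [c A B] is the product of [c A] and [eta B]. *)
Lemma bsupp_mul_one c : bsupp c -> exists eta : pl -> R, [/\ continuous eta, bsupp eta &
 forall x, c x * eta x = c x].
(* For [|x| <= N] one has [nsq x <= 2 N^2], at most half of P, so the cutoff is 1 there. *)
move=> [N HN]; pose P : R := 4 * (N ^+ 2 + 1).
have P0 : 0 < P by rewrite mulr_gt0 // ltr_pwDr // sqr_ge0.
have se : sm2 (fun x : pl => cut (P^-1 * nsq x)).
 by apply: (smooth_comp (smoothR_cutZ P^-1)); smt.
exists (fun x => cut (P^-1 * nsq x)); split.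
- exact: smooth_cont.
- apply: (bsupp_nsq (h := fun t => cut (P^-1 * t)) (N := P)) => t Pt.
 by apply: cut0; rewrite mulrC ler_pdivlMr // mul1r ltW.
move=> x; have [xN|/HN ->] := leP `|x| N; last by lra.
rewrite cut1 ?mulr1 // mulrC ler_pdivrMr //.
have N2 : `|x| ^+ 2 <= N ^+ 2 by rewrite lerXn2r ?nnegrE // (le_trans (normr_ge0 x)).
rewrite (le_trans (nsq_le_norm x)) // /P mulrA; lra.
Qed.

(** The coefficients of T are unbounded polynomials; testing with multipliers of bounded support
    makes the convergence stable under multiplication by them. *)
Definition ls2 A a : Prop := forall c, continuous c -> bsupp c ->
 s2 (fun n x => c x * A n x) (fun x => c x * a x).

Lemma ls2_s2 A a : s2 A a -> ls2 A a.
move=> H c cc bc; have [M _ HM] := bsupp_bounded cc bc.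
exact: s2M (cont_measurable cc) HM H.
Qed.

Lemma ls2D A B a b : ls2 A a -> ls2 B b -> ls2 (fun n x => A n x + B n x) (fun x => a x + b x).
move=> HA HB c cc bc; have := s2D (HA c cc bc) (HB c cc bc).
rewrite (_ : (fun n x => _ + _) = fun n x => c x * (A n x + B n x)); last first.
 by apply/funext => n; apply/funext => x; lra.
by rewrite (_ : (fun x => _ + _) = fun x => c x * (a x + b x)) //; apply/funext => x; lra.
Qed.

Lemma ls2M (q : pl -> R) A a : continuous q -> ls2 A a -> ls2 (fun n x => q x * A n x) (fun x => q x * a x).
move=> cq HA c cc bc; have := HA (fun x => c x * q x) _ _.
have E f : (fun x => c x * q x * f x) = fun x => c x * (q x * f x) by apply/funext => x; lra.
rewrite (_ : (fun n x => c x * q x * A n x) = fun n x => c x * (q x * A n x)); last first.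
 by apply/funext => n; rewrite E.
rewrite E; apply; first by move=> x; apply: cvgM; [exact: cc|exact: cq].
smt.
Qed.

Lemma sI_w c A B a b : continuous c -> bsupp c -> ls2 A a -> ls2 B b ->
 sI (fun n x => c x * (A n x * B n x)) (fun x => c x * (a x * b x)).
move=> cc bc HA HB; have [eta [ce be E]] := bsupp_mul_one bc.
have := sI_mul (HA c cc bc) (HB eta ce be).
have EE f g : (fun x => c x * f x * (eta x * g x)) = fun x => c x * (f x * g x).
 by apply/funext => x; rewrite -[in RHS]E; ring.
rewrite EE (_ : (fun n x => _ * _) = fun n x => c x * (A n x * B n x)) //.
by apply/funext => n; rewrite EE.
Qed.

End Sequences.

Section KsSupport.

Lemma ks_supp (k : R -> R) (N : R) : (forall t, N < t -> k t = 0) -> forall t, N < t -> ks k t = 0.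
move=> H t Nt; rewrite /ks H // mulr0 addr0 (_ : 'D_1 k t = 0) ?mulr0 //.
have := @derive_eq_open k (fun=> 0) _ (open_gtR (a := N)) H t Nt.
by move=> ->; exact: derive_cst.
Qed.

End KsSupport.

(** * Mollifications of a function with Lipschitz gradient *)

Section MollifierBounds.
Implicit Types (W : pl -> R).

Lemma conv_translate W psi x (h : pl) : ig W -> continuous psi -> bsupp psi ->
 conv W psi (x + h) = conv (fun y => W (y + h)) psi x.
move=> iW cp bp; rewrite /conv -(I_translate h (conv_ig (x + h) iW cp bp)).
by congr I; apply/funext => y; congr (_ * psi _); rewrite opprD addrACA subrr addr0.
Qed.

Lemma conv_bound W n x (M : R) : ig W -> (forall y, `|y - x| <= n.+1%:R^-1 -> `|W y| <= M) ->
 `|conv W (moll n) x| <= M.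
move=> iW H; have cm := smooth_cont (@moll_sm2 n); have bm := @moll_bsupp n.
have i1 := conv_ig x iW cm bm.
have E : (fun y => moll n (x - y)) = fun y => moll n (y + - x).
 by apply/funext => y; rewrite -moll_even opprB.
have i2 : ig (fun y => moll n (x - y)) by rewrite E; smt.
have I1 : I (fun y => moll n (x - y)) = 1 by rewrite E (I_translate _ (@moll_ig n)) I_moll.
rewrite (le_trans (I_abs i1)) // -[M]mulr1 -I1 -IZ //.
apply: I_le; [exact: ig_abs|exact: igZ|move=> y].
have m0 := moll_ge0 n (x - y); rewrite normrM (ger0_norm m0).
have [yx|yx] := leP `|y - x| n.+1%:R^-1; first by rewrite ler_wpM2r // H.
by rewrite moll_supp ?mulr0 // distrC.
Qed.

Lemma conv_diff_bound W n x (h : pl) (M : R) : ig W ->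
 (forall y, `|y - x| <= n.+1%:R^-1 -> `|W (y + h) - W y| <= M) ->
 `|conv W (moll n) (x + h) - conv W (moll n) x| <= M.
move=> iW H; have cm := smooth_cont (@moll_sm2 n); have bm := @moll_bsupp n.
have iWh := ig_translate h iW.
rewrite (conv_translate x h iW cm bm) -(conv_lin n x iWh iW).
by apply: conv_bound => //; exact: igB.
Qed.

Variable W : pl -> R.
Variable g : 'I_2 -> pl -> R.
(** The assumptions hold on the ball of radius [3 * r]: room for a point within r, a mollification
    radius of at most r and the increments of difference quotients. *)
Variables (x0 : pl) (r L : R).
Hypotheses (iW : ig W) (r0 : 0 < r) (L0 : 0 <= L).
Hypothesis dW : forall i y, `|y - x0| <= 3 * r -> is_derive y (e_ i) W (g i y).
Hypothesis gL : forall i y z, `|y - x0| <= 3 * r -> `|z - x0| <= 3 * r -> `|g i y - g i z| <= L * `|y - z|.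
Hypotheses (W0 : W x0 = 0) (g0 : forall i, g i x0 = 0).

Lemma g_le i y : `|y - x0| <= 3 * r -> `|g i y| <= L * `|y - x0|.
by move=> yr; have := gL i yr (z := x0); rewrite subrr normr0 g0 subr0; apply; smt. Qed.

(** The partial derivatives are integrated along an L-shaped path of two coordinate segments. *)
Lemma W_le y : `|y - x0| <= 3 * r -> `|W y| <= 2 * L * `|y - x0| ^+ 2.
move=> yr; pose z : pl := (x0.1, y.2).
have nb (s : R) : `|s| <= `|y.1 - x0.1| -> `|(s *: e_ o_0 + z) - x0| <= `|y - x0|.
 move=> sy; rewrite !norm_planeE /= [s *: 1]mulr1 [s *: 0]mulr0 add0r addrK.
 by rewrite ge_max !le_max sy lexx orbT.
have nb2 (s : R) : `|s| <= `|y.2 - x0.2| -> `|(s *: e_ o_1 + x0) - x0| <= `|y - x0|.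
 by move=> sy; rewrite addrK normrZ norm_basis2 mulr1 (le_trans sy) // (norm2_le (y - x0)).
have B1 : `|W ((y.1 - x0.1) *: e_ o_0 + z) - W (0 *: e_ o_0 + z)| <= L * `|y - x0| * `|y.1 - x0.1|.
 apply: (@seg_bound_loc (fun s => W (s *: e_ o_0 + z)) (fun s => g o_0 (s *: e_ o_0 + z))) => t /nb ty.
  by apply: der_along_at; apply: dW; lra.
 by rewrite (le_trans (g_le _ (le_trans ty yr))) // ler_wpM2l.
have B2 : `|W ((y.2 - x0.2) *: e_ o_1 + x0) - W (0 *: e_ o_1 + x0)| <= L * `|y - x0| * `|y.2 - x0.2|.
 apply: (@seg_bound_loc (fun s => W (s *: e_ o_1 + x0)) (fun s => g o_1 (s *: e_ o_1 + x0))) => t /nb2 ty.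
  by apply: der_along_at; apply: dW; lra.
 by rewrite (le_trans (g_le _ (le_trans ty yr))) // ler_wpM2l.
have E1 : (y.1 - x0.1) *: e_ o_0 + z = y.
 by rewrite [RHS]surjective_pairing; congr (_, _); rewrite /= ?[_ *: 1]mulr1 ?[_ *: 0]mulr0 ?add0r ?subrK.
have E2 : (y.2 - x0.2) *: e_ o_1 + x0 = z.
 by rewrite /z; congr (_, _); rewrite /= ?[_ *: 1]mulr1 ?[_ *: 0]mulr0 ?add0r ?subrK.
rewrite E1 scale0r add0r in B1; rewrite E2 scale0r add0r W0 subr0 in B2.
have -> : W y = (W y - W z) + W z by lra.
rewrite (le_trans (ler_normD _ _)) //.
have n1 : `|y.1 - x0.1| <= `|y - x0| := norm1_le (y - x0).
have n2 : `|y.2 - x0.2| <= `|y - x0| := norm2_le (y - x0).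
have LN : 0 <= L * `|y - x0| by smt.
have := lerD (le_trans B1 (ler_wpM2l LN n1)) (le_trans B2 (ler_wpM2l LN n2)).
lra.
Qed.

Lemma W_lip y z (N : R) : `|y - x0| <= N -> `|z - x0| <= N -> N <= r ->
 `|W y - W z| <= 6 * L * N * `|y - z|.
move=> yN zN Nr; pose w : pl := (z.1, y.2).
have N0 : 0 <= N := le_trans (normr_ge0 _) yN.
have N3 : 3 * N <= 3 * r by lra.
have seg (a b c : R) : `|a - c| <= N -> `|b - c| <= N -> forall s, `|s| <= `|a - b| -> `|s + b - c| <= 3 * N.
 move=> ac bc s sab; rewrite -addrA (le_trans (ler_normD _ _)) //.
 have : `|a - b| <= `|a - c| + `|b - c| by rewrite (distrC b) (le_trans _ (ler_normD _ _)) // addrA subrK.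
 lra.
have y1 := le_trans (norm1_le (y - x0)) yN; have y2 := le_trans (norm2_le (y - x0)) yN.
have z1 := le_trans (norm1_le (z - x0)) zN; have z2 := le_trans (norm2_le (z - x0)) zN.
have NN : N <= 3 * N by lra.
have nb1 (s : R) : `|s| <= `|y.1 - z.1| -> `|(s *: e_ o_0 + w) - x0| <= 3 * N.
 move=> sy; rewrite norm_planeE /= [s *: 1]mulr1 [s *: 0]mulr0 add0r.
 by rewrite ge_max (le_trans y2 NN) andbT; exact: seg y1 z1 s sy.
have nb2 (s : R) : `|s| <= `|y.2 - z.2| -> `|(s *: e_ o_1 + z) - x0| <= 3 * N.
 move=> sy; rewrite norm_planeE /basis2 /= [s *: 1]mulr1 [s *: 0]mulr0 add0r.
 by rewrite ge_max (le_trans z1 NN) /=; exact: seg y2 z2 s sy.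
have gb i t : `|t - x0| <= 3 * N -> `|g i t| <= 3 * L * N.
 move=> tN; rewrite (le_trans (g_le i (le_trans tN N3))) // -mulrA mulrCA ler_wpM2l //.
have B1 : `|W ((y.1 - z.1) *: e_ o_0 + w) - W (0 *: e_ o_0 + w)| <= 3 * L * N * `|y.1 - z.1|.
 apply: (@seg_bound_loc (fun s => W (s *: e_ o_0 + w)) (fun s => g o_0 (s *: e_ o_0 + w))) => t /nb1 ty.
  by apply: der_along_at; apply: dW; exact: le_trans ty N3.
 exact: gb.
have B2 : `|W ((y.2 - z.2) *: e_ o_1 + z) - W (0 *: e_ o_1 + z)| <= 3 * L * N * `|y.2 - z.2|.
 apply: (@seg_bound_loc (fun s => W (s *: e_ o_1 + z)) (fun s => g o_1 (s *: e_ o_1 + z))) => t /nb2 ty.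
  by apply: der_along_at; apply: dW; exact: le_trans ty N3.
 exact: gb.
have E1 : (y.1 - z.1) *: e_ o_0 + w = y.
 by rewrite [RHS]surjective_pairing; congr (_, _); rewrite /= ?[_ *: 1]mulr1 ?[_ *: 0]mulr0 ?add0r ?subrK.
have E2 : (y.2 - z.2) *: e_ o_1 + z = w.
 by rewrite /w; congr (_, _); rewrite /= ?[_ *: 1]mulr1 ?[_ *: 0]mulr0 ?add0r ?subrK.
rewrite E1 scale0r add0r in B1; rewrite E2 scale0r add0r in B2.
have -> : W y - W z = (W y - W w) + (W w - W z) by ring.
rewrite (le_trans (ler_normD _ _)) //.
have n1 : `|y.1 - z.1| <= `|y - z| := norm1_le (y - z).
have n2 : `|y.2 - z.2| <= `|y - z| := norm2_le (y - z).
have LN : 0 <= 3 * L * N by smt.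
have := lerD (le_trans B1 (ler_wpM2l LN n1)) (le_trans B2 (ler_wpM2l LN n2)).
by move/le_trans; apply; rewrite le_eqVlt; apply/orP; left; apply/eqP; move: (`|y - z|) => M; ring.
Qed.

Lemma norm_scale_basis2 (h : R) i : `|h *: e_ i| = `|h|.
by rewrite normrZ norm_basis2 mulr1. Qed.

Let U n := conv W (moll n).

Lemma U_sm2 n : sm2 (U n).
exact: conv_sm2 iW (@moll_sm2 n) (@moll_bsupp n). Qed.

Lemma dist_step x y (h : pl) (a b c : R) : `|x - x0| <= a -> `|y - x| <= b -> `|h| <= c ->
 `|h + y - x0| <= a + b + c.
move=> xa yb hc; have -> : h + y - x0 = (x - x0) + (y - x) + h.
 ring.
by rewrite (le_trans (ler_normD _ _)) // lerD // (le_trans (ler_normD _ _)) // lerD.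
Qed.

Lemma moll_grad_bound n i x : `|x - x0| <= r -> n.+1%:R^-1 <= r ->
 `|'D_(e_ i) (U n) x| <= L * (`|x - x0| + 2 * n.+1%:R^-1).
move=> xr nr; have n0 : 0 < n.+1%:R^-1 :> R by smt.
apply: (derive_le (smooth_der i x (U_sm2 n)) n0) => h hn.
rewrite [_ + x]addrC /U; apply: conv_diff_bound => // y yx.
have d3 : `|x - x0| + 2 * n.+1%:R^-1 <= 3 * r by move: (n.+1%:R^-1) (`|x - x0|) xr nr => p q; lra.
have nb (t : R) : `|t| <= `|h| -> `|t *: e_ i + y - x0| <= `|x - x0| + 2 * n.+1%:R^-1.
 move=> th; have := dist_step (lexx `|x - x0|) yx (h := t *: e_ i) (c := n.+1%:R^-1).
 rewrite norm_scale_basis2 => /(_ (le_trans th (ltW hn))) /le_trans; apply.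
 by rewrite -addrA lerD2l mulr2n mulrDl mul1r.
have := @seg_bound_loc (fun s => W (s *: e_ i + y)) (fun s => g i (s *: e_ i + y))
 (L * (`|x - x0| + 2 * n.+1%:R^-1)) h.
rewrite scale0r add0r [y + _]addrC; apply => t /nb ty.
 by apply: der_along_at; apply: dW; exact: le_trans ty d3.
by rewrite (le_trans (g_le _ (le_trans ty d3))) // ler_wpM2l.
Qed.

(** A second-order difference quotient of W is controlled by the Lipschitz constant of the gradient,
    and averaging preserves the bound. *)
Lemma moll_hess_bound n i j x : `|x - x0| <= r -> n.+1%:R^-1 <= r ->
 `|'D_(e_ i) ('D_(e_ j) (U n)) x| <= L.
move=> xr nr; have r2 : 0 < r / 2 by smt.
have sD := smooth_D j (U_sm2 n).
apply: (derive_le (smooth_der i x sD) r2) => h hr.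
pose ei := h *: e_ i.
have Df : is_derive x (e_ j) (fun y => U n (y + ei) - U n y) ('D_(e_ j) (U n) (ei + x) - 'D_(e_ j) (U n) x).
 rewrite [ei + x]addrC; apply: der_add; last by apply: der_opp; exact: smooth_der (U_sm2 n).
 by apply: der_shift_plane; exact: smooth_der (U_sm2 n).
have iWi := ig_translate ei iW.
have EU y : U n (y + ei) - U n y = conv (fun z => W (z + ei) - W z) (moll n) y.
 rewrite /U (conv_translate y ei iW (smooth_cont (@moll_sm2 n)) (@moll_bsupp n)).
 by rewrite (conv_lin n y iWi iW).
rewrite (_ : (fun y => U n (y + ei) - U n y) = conv (fun z => W (z + ei) - W z) (moll n)) in Df; last exact/funext/EU.
apply: (derive_le Df r2) => k kr.
pose ej := k *: e_ j.
rewrite [k *: e_ j + x]addrC.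
apply: conv_diff_bound; first exact: igB.
move=> y yx.
have nb (t : R) : `|t| <= `|k| -> `|t *: e_ j + y - x0| <= 3 * r /\ `|t *: e_ j + y + ei - x0| <= 3 * r.
 move=> tk; have tr := le_trans tk (ltW kr).
 have h1 := dist_step xr yx (h := t *: e_ j) (c := r / 2).
 have h2 := dist_step xr yx (h := t *: e_ j + ei) (c := r / 2 + r / 2).
 have {}h2 : `|t *: e_ j + ei + y - x0| <= r + n.+1%:R^-1 + (r / 2 + r / 2).
  by apply: h2; rewrite (le_trans (ler_normD _ _)) // lerD // norm_scale_basis2 // ltW.
 have {}h1 : `|t *: e_ j + y - x0| <= r + n.+1%:R^-1 + r / 2 by apply: h1; rewrite norm_scale_basis2.
 rewrite [t *: e_ j + ei + y]addrAC in h2; split; [apply: (le_trans h1)|apply: (le_trans h2)];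
  by move: (n.+1%:R^-1) nr => p; lra.
have := @seg_bound_loc (fun s => W (s *: e_ j + y + ei) - W (s *: e_ j + y))
 (fun s => g j (s *: e_ j + y + ei) - g j (s *: e_ j + y)) (L * `|h|) k.
rewrite scale0r add0r -/ej [ej + y]addrC; apply => t /nb [t1 t2].
 apply: der_add; last by apply: der_opp; apply: der_along_at; exact: dW.
 rewrite (_ : (fun s : R => W (s *: e_ j + y + ei)) = fun s : R => W (s *: e_ j + (y + ei))).
  by apply: der_along_at; rewrite addrA; exact: dW.
 by apply/funext => s; rewrite addrA.
rewrite (le_trans (gL j t2 t1)) // ler_wpM2l // [_ + ei]addrC addrK norm_scale_basis2 //.
Qed.

End MollifierBounds.
#[local] Hint Resolve U_sm2 : plane.

(** * The truncated weight *)

Section ScaleInvariantWeight.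
Implicit Types (a b t eta : R) (k : R -> R).

Lemma ks_dilate k (c d t : R) : smoothR k -> ks (fun t => c * k (d * t)) t = c * ks k (d * t).
move=> sk; rewrite /ks.
have [_ ->] := der_scale c (der_dilate (smoothR_der (d * t) sk)).
lra.
Qed.

Lemma ksB k k' t : smoothR k -> smoothR k' -> ks (fun t => k t - k' t) t = ks k t - ks k' t.
move=> sk sk'; rewrite /ks.
have [_ ->] := der_add (smoothR_der t sk) (der_opp (smoothR_der t sk')).
lra.
Qed.

(** [t^-3] smoothly cut to 0 near the origin, with [pp] in place of t to keep the inverse smooth.
    From 1 on it is exactly [t^-3], which [ks] annihilates. *)
Definition K0 t : R := (pp t)^-1 ^+ 3 * (1 - cut t).

Lemma smoothR_K0 : smoothR K0.
apply: smooth_mul.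
 by apply: smooth_exp; apply: smooth_inv; [exact: smoothR_pp|move=> t; rewrite gt_eqF // pp_gt0].
smt.
Qed.

Lemma K0_lo t : t <= 2^-1 -> K0 t = 0.
by move=> t2; rewrite /K0 cut1 // subrr mulr0. Qed.

Lemma K0E t : 0 < t -> K0 t = t^-1 ^+ 3 * (1 - cut t).
move=> t0; have [t2|t2] := leP t 2^-1; first by rewrite K0_lo // cut1 // subrr mulr0.
by rewrite /K0 pp_id // ltW // (le_lt_trans _ t2) // lef_pV2 ?posrE // ler_nat.
Qed.

Lemma ks_K0 t : 1 < t -> ks K0 t = 0.
move=> t1; have t0 : 0 < t by lra.
have E : 'D_1 K0 t = - 3 * t^-1 ^+ 4.
 rewrite (@derive_eq_open K0 (fun s => s^-1 * (s^-1 * s^-1)) _ (open_gtR (a := 1)) _ t t1).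
  have H := der_invR t0.
  have [_ ->] := der_mul H (der_mul H H).
  lra.
 move=> s /= s1; rewrite K0E ?(lt_trans ltr01 s1) // cut0 ?(ltW s1) // subr0 mulr1.
 smt.
by rewrite /ks E K0E // cut0 ?(ltW t1) // subr0 mulr1; field; lra.
Qed.

Definition kz a t : R := a^-1 ^+ 3 * K0 (a^-1 * t).

Lemma smoothR_kz a : smoothR (kz a).
apply: smooth_mul; first smt.
apply: (smooth_comp smoothR_K0 (f := fun t : R => a^-1 * t)).
smt.
Qed.

Lemma kzE a t : 0 < a -> 0 < t -> kz a t = t^-1 ^+ 3 * (1 - cut (a^-1 * t)).
move=> a0 t0; rewrite /kz K0E ?mulr_gt0 ?invr_gt0 // mulrA; congr (_ * _).
by field; lra.
Qed.

Lemma kz_npos a t : 0 < a -> t <= 0 -> kz a t = 0.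
move=> a0 t0; rewrite /kz K0_lo ?mulr0 // (le_trans (y := 0)) // pmulr_rle0 // invr_gt0 //.
Qed.

(** [t^-3] between the scales a and b. Its image under [ks] is one fixed profile rescaled to a,
    minus the same profile rescaled to b. *)
Definition kab a b t : R := kz a t - kz b t.

Lemma smoothR_kab a b : smoothR (kab a b).
by apply: smooth_sub; exact: smoothR_kz. Qed.

Lemma kabE a b t : 0 < a -> 0 < b -> 0 < t -> kab a b t = t^-1 ^+ 3 * (cut (b^-1 * t) - cut (a^-1 * t)).
by move=> a0 b0 t0; rewrite /kab !kzE // -mulrBr; lra. Qed.

Lemma kab_ge0 a b t : 0 < a -> a <= b -> 0 <= kab a b t.
move=> a0 ab; have b0 : 0 < b by lra.
have [t0|t0] := leP t 0; first by rewrite /kab !kz_npos // subrr.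
rewrite kabE //; apply: mulr_ge0; first by smt.
by rewrite subr_ge0 cut_ni // ler_wpM2r ?(ltW t0) // lef_pV2.
Qed.

Lemma kab_hi a b t : 0 < a -> a <= b -> b < t -> kab a b t = 0.
move=> a0 ab bt; have b0 : 0 < b by lra.
have t0 : 0 < t by lra.
rewrite kabE // !cut0 ?subrr ?mulr0 // mulrC ler_pdivlMr ?mul1r // ltW //.
lra.
Qed.

Lemma kab_mid a b t : 0 < a -> a <= t -> t <= b / 2 -> kab a b t = t^-1 ^+ 3.
move=> a0 at' tb; have t0 : 0 < t by lra.
have b0 : 0 < b by have := lt_le_trans t0 tb; lra.
have h1 : 1 <= a^-1 * t by rewrite mulrC ler_pdivlMr ?mul1r.
have h2 : b^-1 * t <= 2^-1 by rewrite mulrC ler_pdivrMr // mulrC.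
by rewrite kabE // (cut0 h1) (cut1 h2) subr0 mulr1.
Qed.

Lemma ks_kab a b t : ks (kab a b) t = a^-1 ^+ 3 * ks K0 (a^-1 * t) - b^-1 ^+ 3 * ks K0 (b^-1 * t).
rewrite /kab (ksB t (@smoothR_kz a) (@smoothR_kz b)).
by rewrite /kz (ks_dilate _ _ t smoothR_K0) (ks_dilate _ _ t smoothR_K0).
Qed.

Lemma ks_ks_kab a b t : ks (ks (kab a b)) t =
 a^-1 ^+ 3 * ks (ks K0) (a^-1 * t) - b^-1 ^+ 3 * ks (ks K0) (b^-1 * t).
have s1 := smoothR_ks smoothR_K0.
have sd c : smoothR (fun t => c^-1 ^+ 3 * ks K0 (c^-1 * t)).
 apply: smooth_mul; first smt.
 apply: (smooth_comp s1 (f := fun t : R => c^-1 * t)).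
 smt.
rewrite (_ : ks (kab a b) = fun t => a^-1 ^+ 3 * ks K0 (a^-1 * t) - b^-1 ^+ 3 * ks K0 (b^-1 * t)).
 by rewrite (ksB t (sd a) (sd b)) (ks_dilate _ _ t s1) (ks_dilate _ _ t s1).
by apply/funext => s; exact: ks_kab.
Qed.

Variable x0 : pl.
Local Notation sq := (sq x0).

(** In the plane, [|x|^-6] against [|x|^4 dx] is invariant under dilations, so eta disappears from
    the integral. *)
Lemma scaled_weight (h : R -> R) eta : smoothR h -> (forall t, 1 < t -> h t = 0) -> 0 < eta ->
 ig (fun x => `|(eta ^+ 2)^-1 ^+ 3 * h ((eta ^+ 2)^-1 * sq x)| * sq x ^+ 2) /\
 I (fun x => `|(eta ^+ 2)^-1 ^+ 3 * h ((eta ^+ 2)^-1 * sq x)| * sq x ^+ 2) =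
 I (fun y : pl => `|h (nsq y)| * nsq y ^+ 2).
move=> sh hz e0.
have ch : continuous (fun x : pl => h ((eta ^+ 2)^-1 * sq x)).
 apply: smooth_cont; apply: (smooth_comp sh); apply: smooth_mul; [exact: smooth_cst|exact: sm2_sq].
have e2 : 0 < eta ^+ 2 by smt.
have bh : bsupp (fun x => h ((eta ^+ 2)^-1 * sq x)).
 apply: (@nsq_bsupp_shift (fun t => h ((eta ^+ 2)^-1 * t)) x0 (eta ^+ 2)) => t te.
 by apply: hz; rewrite mulrC ltr_pdivlMr // mul1r.
have i1 : ig (fun x => `|(eta ^+ 2)^-1 ^+ 3 * h ((eta ^+ 2)^-1 * sq x)| * sq x ^+ 2).
 apply: ig_continuous.
  move=> x; apply: cvgM; last exact: (smooth_cont (smooth_exp 2 (sm2_sq x0))).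
  by apply: cvg_norm; apply: cvgM; [exact: cvg_cst|exact: ch].
 by apply: bsuppW bh _ => x ->; rewrite mulr0 normr0 mul0r.
split=> //; have [_ ->] := I_affine x0 e0 i1.
have E y : sq (eta *: y + x0) = eta ^+ 2 * nsq y by rewrite /sq addrK nsqZ.
have e0' : eta != 0 by lra.
rewrite -IZ; last by have [] := I_affine x0 e0 i1.
congr I; apply/funext => y; rewrite E mulKf ?gt_eqF // normrM ger0_norm; last by smt.
by move: (nsq y) (`|h _|) => A1 A2; field.
Qed.

(** The factor 2 accounts for the two ends of the truncated weight. *)
Definition wconst : R := 2 * (I (fun y : pl => `|ks K0 (nsq y)| * nsq y ^+ 2) +
 I (fun y : pl => `|ks (ks K0) (nsq y)| * nsq y ^+ 2)).

Lemma kab_weight eta b : 0 < eta -> 0 < b ->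
 I (fun x => (`|ks (kab (eta ^+ 2) (b ^+ 2)) (sq x)| + `|ks (ks (kab (eta ^+ 2) (b ^+ 2))) (sq x)|) * sq x ^+ 2) <= wconst.
move=> e0 b0; have s1 := smoothR_ks smoothR_K0; have s2 := smoothR_ks s1.
have z1 : forall t, 1 < t -> ks K0 t = 0 := ks_K0.
have z2 : forall t, 1 < t -> ks (ks K0) t = 0 := ks_supp z1.
have [i1 I1] := scaled_weight s1 z1 e0; have [i2 I2] := scaled_weight s1 z1 b0.
have [i3 I3] := scaled_weight s2 z2 e0; have [i4 I4] := scaled_weight s2 z2 b0.
have iS := igD (igD i1 i2) (igD i3 i4).
have -> : wconst = I (fun x => (`|(eta ^+ 2)^-1 ^+ 3 * ks K0 ((eta ^+ 2)^-1 * sq x)| * sq x ^+ 2 +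
  `|(b ^+ 2)^-1 ^+ 3 * ks K0 ((b ^+ 2)^-1 * sq x)| * sq x ^+ 2) +
  (`|(eta ^+ 2)^-1 ^+ 3 * ks (ks K0) ((eta ^+ 2)^-1 * sq x)| * sq x ^+ 2 +
  `|(b ^+ 2)^-1 ^+ 3 * ks (ks K0) ((b ^+ 2)^-1 * sq x)| * sq x ^+ 2)).
 by rewrite (ID (igD i1 i2) (igD i3 i4)) (ID i1 i2) (ID i3 i4) I1 I2 I3 I4 /wconst; ring.
apply: I_le => //.
 apply: ig_continuous.
  move=> x; apply: cvgM; last exact: (smooth_cont (smooth_exp 2 (sm2_sq x0))).
  have sk := smoothR_kab (eta ^+ 2) (b ^+ 2).
  apply: cvgD; apply: cvg_norm; apply: (smooth_cont (sm2_rad x0 _)); [exact: smoothR_ks|].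
  smt.
 apply: bsuppMl; pose N := eta ^+ 2 + b ^+ 2.
 have zk (h : R -> R) (c t : R) : (forall t, 1 < t -> h t = 0) -> 0 < c -> c ^+ 2 < t -> h ((c ^+ 2)^-1 * t) = 0.
  by move=> hz c0 ct; apply: hz; rewrite mulrC ltr_pdivlMr ?mul1r // exprn_gt0.
 have N1 : eta ^+ 2 <= N by rewrite lerDl sqr_ge0.
 have N2 : b ^+ 2 <= N by rewrite lerDr sqr_ge0.
 apply: (@nsq_bsupp_shift (fun t => `|ks (kab (eta ^+ 2) (b ^+ 2)) t| + `|ks (ks (kab (eta ^+ 2) (b ^+ 2))) t|) x0 N) => t tN.
 have t1 := le_lt_trans N1 tN; have t2 := le_lt_trans N2 tN.
 by rewrite ks_kab ks_ks_kab !zk // !mulr0 subrr normr0 addr0.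
move=> x; rewrite ks_kab ks_ks_kab -!mulrDl ler_wpM2r ?sqr_ge0 // lerD // ler_normB //.
Qed.

End ScaleInvariantWeight.
#[local] Hint Resolve smoothR_K0 smoothR_kz smoothR_kab : plane.

Section Constants.

Lemma bound_const_ge0 (L : R) : 0 <= 800 * (12 * L ^+ 2 + 1).
by have := sqr_ge0 L; lra. Qed.

Lemma ls2_one : ls2 (fun (_ : nat) (_ : pl) => 1 : R) (fun _ : pl => 1 : R).
move=> c cc bc; have := l2_continuous cc bc.
rewrite (_ : (fun x => c x * 1) = c); last by apply/funext => x; lra.
by move=> lc; split=> //; exact: cvg2_cst.
Qed.

End Constants.

(** * The adjoint of T *)

Section DualField.
Variable x0 : pl.
Implicit Types (rho : R).

(** The formal adjoint of T: that of [Eu] is [- Eu - 2], the 2 being the divergence of the dilation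
    field in the plane. *)
Definition TS f x : R := - (Eu x0 f x + 4 * f x).

Lemma sm2_TS f : sm2 f -> sm2 (TS f).
move=> sf; apply: smooth_opp; apply: smooth_add; first smt.
smt.
Qed.

Lemma bsupp_TS f : sm2 f -> bsupp f -> bsupp (TS f).
move=> sf bf; apply: bsuppW (bsupp_add (bsupp_Eu x0 sf bf) (bsuppMr (fun=> 4) bf)) _ => x E.
by rewrite /TS E oppr0.
Qed.

Lemma I_TS f g : sm2 f -> sm2 g -> bsupp g -> I (fun x => TE x0 f x * g x) = I (fun x => f x * TS g x).
move=> sf sg bg; have sfg := smooth_mul sf sg; have bfg : bsupp (fun x => f x * g x) by smt.
have := I_Eu x0 sfg bfg.
have i1 : ig (fun x => TE x0 f x * g x).
 by apply: ig_sm; smt.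
have i2 : ig (fun x => f x * TS g x).
 by apply: ig_sm; [apply: smooth_mul => //; exact: sm2_TS|apply: bsuppMr; exact: bsupp_TS].
rewrite (_ : (fun x => _ + _) = fun x => TE x0 f x * g x - f x * TS g x); last first.
 by apply/funext => x; rewrite (EuM x0 x sf sg) /TE /TS; lra.
by rewrite (IB i1 i2) => /eqP; lra.
Qed.

End DualField.

(** * Dilations of test functions *)

Section Dilation.
Implicit Types (rho : R).

Definition dil (x0 : pl) rho f x : R := f (rho *: (x - x0)).

Lemma der_dil x0 rho f (v : pl) x d : is_derive (rho *: (x - x0)) v f d ->
 is_derive x v (dil x0 rho f) (rho * d).
move=> /der_line H; apply/der_line.
rewrite /dil (_ : (fun h : R => _) = fun h : R => f ((rho * h) *: v + rho *: (x - x0))); last first.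
 by apply/funext => h; rewrite -addrA scalerDr scalerA.
by apply: (der_dilate (f := fun h : R => f (h *: v + rho *: (x - x0)))); rewrite mulr0.
Qed.

Lemma sm2_dil x0 rho f : sm2 f -> sm2 (dil x0 rho f).
move=> sf n; elim: n f sf => [|n IH] f sf.
 move=> x; apply: (@continuous_comp _ _ _ (fun x : pl => rho *: (x - x0)) f); last exact: smooth_cont.
 by apply: cvgZ; [exact: cvg_cst|apply: cvgB; [exact: cvg_id|exact: cvg_cst]].
split.
 move=> x; apply: (@continuous_comp _ _ _ (fun x : pl => rho *: (x - x0)) f); last exact: smooth_cont.
 by apply: cvgZ; [exact: cvg_cst|apply: cvgB; [exact: cvg_id|exact: cvg_cst]].
move=> i; have D x := der_dil (smooth_der i (rho *: (x - x0)) sf).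
split; first by move=> x; smt.
rewrite (_ : (fun x => 'D_(e_ i) (dil x0 rho f) x) = fun x => rho * dil x0 rho ('D_(e_ i) f) x).
 by apply: Cn_mul; [exact: Cn_cst|apply: IH; exact: smooth_D].
by apply/funext => x; have [_ ->] := D x.
Qed.

Lemma bsupp_dil x0 rho f : 0 < rho -> bsupp f -> bsupp (dil x0 rho f).
move=> r0 [N HN]; exists (rho^-1 * N + `|x0|) => x Nx; apply: HN.
rewrite normrZ gtr0_norm // -ltr_pdivrMl // (lt_le_trans _ (lerB_dist _ _)) // ltrBrDr //.
Qed.

Lemma Eu_dil x0 rho f x : sm2 f -> Eu x0 (dil x0 rho f) x = dil x0 rho (Eu 0 f) x.
move=> sf; have D i := der_dil (smooth_der i (rho *: (x - x0)) sf).
rewrite /Eu /dil /q1 /q2 subr0; have [_ E0] := D o_0; have [_ E1] := D o_1.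
rewrite -/(dil x0 rho f) E0 E1 /=.
move: ('D_(e_ o_0) f _) ('D_(e_ o_1) f _) => A0 A1.
have gen (p q B0 B1 : R) : p * (rho * B0) + q * (rho * B1) = rho * p * B0 + rho * q * B1 by ring.
exact: gen.
Qed.

Lemma TS_dil x0 rho f : sm2 f -> TS x0 (dil x0 rho f) = dil x0 rho (TS 0 f).
by move=> sf; apply/funext => x; rewrite /TS (Eu_dil x0 rho x sf). Qed.

End Dilation.
#[local] Hint Resolve sm2_TS bsupp_TS sm2_dil bsupp_dil : plane.

(** * Variations of one-phase minimizers *)

Section OnePhase.
Local Notation D j f := ('D_(e_ j) f).
Implicit Types (c : pl -> R) (t : R) (s : seq 'I_2).
(** V is a localization of u, equal to it on B, and [F s] is its derivative along the word s. The
    words are reversed in [tV] to match the convention of [test_lim]. *)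
Variables (u0 u V : pl -> R) (F : seq 'I_2 -> pl -> R) (B : set pl).
Hypotheses (mu : one_phase_minimizer Omega u0 u) (tV : test_lim V (fun s => F (rev s))) (BO : B `<=` Omega).
Hypothesis VB : forall x, B x -> V x = u x.

Definition Lp x : R := F [:: o_0; o_0] x + F [:: o_1; o_1] x.
Definition chip x : R := \1_(pos u) x.

Hypothesis LB : forall x, B x -> lap u x = Lp x.

Lemma F_l2 s : (size s <= 2)%N -> l2 (F s).
by have [_ + _] := tV => /(_ (rev s)); rewrite size_rev revK => H /H[]. Qed.

Lemma F_bsupp s : (size s <= 2)%N -> bsupp (F s).
by have [_ + _] := tV => /(_ (rev s)); rewrite size_rev revK => H /H[_ /(bsupp_O)]. Qed.

Lemma Lp_l2 : l2 Lp.
by apply: l2D; apply: F_l2. Qed.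

Lemma Lp_bsupp : bsupp Lp.
by apply: bsupp_add; apply: F_bsupp. Qed.

Lemma chip_ig : ig chip.
by have [[su _] _ _] := mu; exact: (pos_ig su.1). Qed.

Lemma chip_bsupp : bsupp chip.
apply: bsupp_O => x Ox; by rewrite /chip indicE memNset // => -[].
Qed.

(** The Laplacian of u may be traded for that of V: they agree on B, and the perturbation H vanishes
    off B. *)
Lemma one_phase_variation w h H : test_lim w h ->
 (fun x => h [:: o_0; o_0] x + h [:: o_1; o_1] x) = H ->
 (forall x, Omega x -> 0 <= u x + w x) -> (forall x, ~ B x -> H x = 0) ->
 0 <= n2 (fun x => Lp x + H x) - n2 Lp +
  (I (\1_(pos (fun x => u x + w x)) : pl -> R) - I chip).
move=> tw EH uw HB; have [adm _ mini] := mu; have [su _] := adm.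
have adw := admissible_test_lim adm tw.
have := mini _ adw uw; rewrite (J_energy su) (J_energy adw.1) lee_fin.
have [lH ->] := energy_add su tw EH.
rewrite (n2D Lp_l2 lH) /energy.
have -> : (fun x => lap u x * H x) = fun x => Lp x * H x.
 apply/funext => x; have [Bx|Bx] := pselect (B x); first by rewrite LB.
 by rewrite HB // !mulr0.
lra.
Qed.

Section Inner.
Variable a : pl -> R.
Hypothesis sa : sm2 a.
Variable i : 'I_2.
Variable K : set pl.
Hypotheses (cK : compact K) (KB : K `<=` B) (aK : forall x, ~ K x -> a x = 0).
Local Notation Phi := (shear a i).
Let ba : bsupp a.
by apply: (@csupp_bsupp B); exists K. Qed.
Let clK : closed K.
by apply: compact_closed => //; smt. Qed.

Definition Sy j x : R := F [:: i; j] x + F [:: j; i] x.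
Let E1 t x : R := (D o_0 a x * Sy o_0 (Phi t x) + D o_1 a x * Sy o_1 (Phi t x)) +
 lapl a x * F [:: i] (Phi t x).
Let E2 t x : R := (D o_0 a x * D o_0 a x + D o_1 a x * D o_1 a x) * F [:: i; i] (Phi t x).

Let cD j : continuous (D j a). Proof. exact: smooth_cont (smooth_D j sa). Qed.
Let bD j : bsupp (D j a). Proof. exact: bsupp_D j sa ba. Qed.
Let cL : continuous (lapl a).
by apply: smooth_cont; apply: sm2_lapl. Qed.
Let bL : bsupp (lapl a).
by apply: bsupp_add; smt. Qed.

Lemma Sy_l2 j : l2 (Sy j).
by apply: l2D; apply: F_l2. Qed.

Lemma pb_lapl t x : pb a i t F [:: o_0; o_0] x + pb a i t F [:: o_1; o_1] x =
 (Lp (Phi t x) + t * E1 t x) + t ^+ 2 * E2 t x.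
rewrite /pb /Lp /E1 /E2 /Sy /lapl.
move: (F [:: o_0; o_0] _) (F [:: o_1; o_1] _) (F [:: i; o_0] _) (F [:: i; o_1] _) (F [:: o_0; i] _)
 (F [:: o_1; i] _) (F [:: i] _) (F [:: i; i] _) => f0 f1 f2 f3 f4 f5 f6 f7.
move: (partials _ a x) (partials _ a x) (D o_0 a x) (D o_1 a x) => a0 a1 a2 a3; ring.
Qed.

Let moved t x : good a i t -> a x != 0 -> [/\ B x, B (Phi t x), Omega x & Omega (Phi t x)].
move=> [_ gt] ax.
have Kx : K x by apply: contrapT => /aK E; lra.
have KP : K (Phi t x) by apply: contrapT => /aK /gt E; lra.
by split; smt.
Qed.

(** Adding [V o Phi - V] to u amounts to composing u with the shear, because points that move stay
    in B, where u and V agree. Competitors therefore stay nonnegative. *)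
Let comp_u t x : good a i t -> u x + (V (Phi t x) - V x) = u (Phi t x) /\ (Omega x <-> Omega (Phi t x)).
move=> gt; have [ax|ax] := eqVneq (a x) 0; first by rewrite shear_id // subrr addr0.
have [b1 b2 o1 o2] := moved gt ax; split; last smt.
by rewrite !VB // addrC subrK.
Qed.

Lemma inner_energy t : good a i t ->
 [/\ l2 (fun x => Lp (Phi t x)), l2 (E1 t), l2 (E2 t) &
 0 <= n2 (fun x => (Lp (Phi t x) + t * E1 t x) + t ^+ 2 * E2 t x) - n2 Lp + (I (fun x => chip (Phi t x)) - I chip)].
move=> gt; have lsh f : l2 f -> l2 (fun x => f (Phi t x)) by move=> lf; exact: (l2_shear sa ba lf gt).
have lm f g : continuous f -> bsupp f -> l2 g -> l2 (fun x => f x * g (Phi t x)).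
 move=> cf bf lg; have [M _ HM] := bsupp_bounded cf bf.
 exact: l2_mul_bounded (cont_measurable cf) HM (lsh _ lg).
split.
- exact: lsh Lp_l2.
- apply: l2D; last by apply: lm => //; exact: F_l2.
 by apply: l2D; apply: lm => //; exact: Sy_l2.
- apply: lm; last exact: F_l2.
  smt.
 smt.
have KO : K `<=` Omega by move=> x /KB/BO.
have tw := test_lim_shear sa ba cK KO aK gt tV.
pose H x : R := pb a i t F [:: o_0; o_0] x + pb a i t F [:: o_1; o_1] x - Lp x.
have := @one_phase_variation _ _ H tw.
rewrite (_ : (fun x => Lp x + H x) = fun x => (Lp (Phi t x) + t * E1 t x) + t ^+ 2 * E2 t x); last first.
 by apply/funext => x; rewrite /H pb_lapl addrC subrK.
rewrite (_ : \1_(pos _) = fun x => chip (Phi t x)).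
 apply.
 - by apply/funext => x; rewrite /H /Lp /rev /catrev; cbv beta; move: (pb _ _ _ _ _ x) (pb _ _ _ _ _ x) (F _ x) (F _ x) => ? ? ? ?; ring.
 - move=> x Ox; have [-> [/(_ Ox) O2 _]] := comp_u x gt.
  by have [_ p _] := mu; exact: p.
 - move=> x nB; have nK : ~ K x by move=> /KB.
  by rewrite /H /Lp !pb_id ?subrr // => r; exact: partials_out clK aK nK.
apply/funext => x; rewrite /chip !indicE; congr (_%:R); congr nat_of_bool.
have [E O] := comp_u x gt; apply/idP/idP; rewrite !inE /pos /= E.
- by move=> [/O].
- by move=> [/O].
Qed.

(** Substitution by the shear turns the change of the energy density into the term with [- d_i a];
    the rest is the part of order t of the Laplacian of the composition. Both signs of t are
    allowed, so the slope vanishes. *)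
Lemma inner_variation :
 zint (fun x => - 1 * (D i a x * (Lp x ^+ 2 + chip x)) + 2 * ((D o_0 a x * (Lp x * Sy o_0 x) +
  D o_1 a x * (Lp x * Sy o_1 x)) + lapl a x * (Lp x * F [:: i] x))).
have ig2 f g : l2 f -> l2 g -> ig (fun x => f x * g x) by smt.
have iq0 : ig (fun x => Lp x ^+ 2 + chip x) by apply: igD; [exact: Lp_l2.2|exact: chip_ig].
have bq0 : bsupp (fun x => Lp x ^+ 2 + chip x).
 apply: bsupp_add chip_bsupp; apply: bsuppW Lp_bsupp _ => x ->; lra.
have iqS j : ig (fun x => Lp x * Sy j x) by apply: ig2; [exact: Lp_l2|exact: Sy_l2].
have bqS j : bsupp (fun x => Lp x * Sy j x) by apply: bsuppMl; exact: Lp_bsupp.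
have iqF : ig (fun x => Lp x * F [:: i] x) by apply: ig2; [exact: Lp_l2|exact: F_l2].
have bqF : bsupp (fun x => Lp x * F [:: i] x) by apply: bsuppMl; exact: Lp_bsupp.
have C0 := cvgI_Z (-1) (cvgI_shear sa ba i (@cD i) (bD i) iq0 bq0).
have CS j := cvgI_shear sa ba i (@cD j) (bD j) (iqS j) (bqS j).
have CF := cvgI_shear sa ba i cL bL iqF bqF.
have C1 := cvgI_Z 2 (cvgI_add (cvgI_add (CS o_0) (CS o_1)) CF).
have [igS nS cS] := cvgI_add C0 C1; split=> //.
have lS j := Sy_l2 j.
have [c0 c00 n0] := bdd2_shear1 sa ba i Lp_l2.
have [c1 c10 n1] : bdd2 E1.
 apply: bdd2_add; last by apply: bdd2_shear => //; exact: F_l2.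
 by apply: bdd2_add; apply: bdd2_shear => //; smt.
have [c2 c20 n2'] : bdd2 E2.
 apply: bdd2_shear => //; last exact: F_l2.
  smt.
 smt.
(* The constant is the one delivered by [variation_arith] from the three uniform L^2 bounds. *)
apply: (first_variation0 (C := 2 * c0 + 3 * c1 + 2 * c2) cS).
have [_ nC0 _] := C0; have [_ nC1 _] := C1.
near=> t.
have gt : good a i t by near: t; exact: near_good.
have [lX lE1 lE2] := inner_energy gt.
have [_ b0] : l2 (fun x => Lp (Phi t x)) /\ n2 (fun x => Lp (Phi t x)) <= c0 by near: t.
have [_ b1] : l2 (E1 t) /\ n2 (E1 t) <= c1 by near: t.
have [_ b2] : l2 (E2 t) /\ n2 (E2 t) <= c2 by near: t.
have t1 : t ^+ 2 <= 1.
 have : `|t| <= 1 by near: t; exact: near0_le.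
 by rewrite -[t ^+ 2]real_normK ?num_real // expr_le1.
have i0 : ig (fun x => -1 * (D i a x * (Lp (Phi t x) ^+ 2 + chip (Phi t x)))) by near: t; exact: nC0.
have i1 := nC1.
have {}i1 : ig (fun x => 2 * ((D o_0 a x * (Lp (Phi t x) * Sy o_0 (Phi t x)) +
  D o_1 a x * (Lp (Phi t x) * Sy o_1 (Phi t x))) + lapl a x * (Lp (Phi t x) * F [:: i] (Phi t x)))).
 by near: t; exact: nC1.
have S := subst_shear sa ba gt.1.
have T (q : pl -> R) : ig q -> I (fun x => q (Phi t x)) - I q = - t * I (fun x => D i a x * q (Phi t x)).
 move=> iq; have iqs := ig_shear sa ba iq gt.
 have := subst_I S iq.
 have [M _ HM] := bsupp_bounded (@cD i) (bD i).
 have iM : ig (fun x => D i a x * q (Phi t x)).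
  exact: ig_mul_bounded (cont_measurable (@cD i)) HM iqs.
 rewrite (_ : (fun x => _ * _) = fun x => q (Phi t x) + t * (D i a x * q (Phi t x))); last first.
  by apply/funext => x; move: (D i a x) (q _) => A1 A2; ring.
 rewrite (ID iqs (igZ t iM)) (IZ t iM); move: (I q) => A0 <-.
 by move: (I _) (I _) => A1 A2; ring.
have T0 := T _ iq0.
rewrite (ID i0 i1) (IZ (-1)); last first.
 have := igZ (-1) i0; rewrite (_ : (fun x => _) = fun x => D i a x * (Lp (Phi t x) ^+ 2 + chip (Phi t x))) //.
 by apply/funext => x; rewrite mulrA mulN1r opprK mul1r.
have EX : (fun x => 2 * ((D o_0 a x * (Lp (Phi t x) * Sy o_0 (Phi t x)) +
  D o_1 a x * (Lp (Phi t x) * Sy o_1 (Phi t x))) + lapl a x * (Lp (Phi t x) * F [:: i] (Phi t x)))) =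
  fun x => 2 * (Lp (Phi t x) * E1 t x).
 apply/funext => x; rewrite /E1; move: (D o_0 a x) (D o_1 a x) (lapl a x) (Lp _) (Sy _ _) (Sy _ _) (F _ _) => A1 A2 A3 A4 A5 A6 A7.
 ring.
have iXE := ig2 _ _ lX lE1.
rewrite EX (IZ 2 iXE).
have lt1 := l2Z t lE1; have lXE := l2D lX lt1.
move=> H; have P := n2_perturb t lXE lE2.
have Q1 := n2D_le lX lt1.
have Z1 : n2 (fun x => t * E1 t x) = t ^+ 2 * n2 (E1 t).
 by rewrite /n2 -(IZ _ lE1.2); congr I; apply/funext => x; rewrite exprMn.
have Q2 := n2D lX lt1.
have Z2 : I (fun x => Lp (Phi t x) * (t * E1 t x)) = t * I (fun x => Lp (Phi t x) * E1 t x).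
 by rewrite -(IZ _ iXE); congr I; apply/funext => x; rewrite mulrCA.
have T1 : I (fun x => Lp (Phi t x) ^+ 2 + chip (Phi t x)) = n2 (fun x => Lp (Phi t x)) + I (fun x => chip (Phi t x)).
 by rewrite ID //; [exact: lX.2|exact: (ig_shear sa ba chip_ig gt)].
have T2 : I (fun x => Lp x ^+ 2 + chip x) = n2 Lp + I chip by rewrite ID //; [exact: Lp_l2.2|exact: chip_ig].
rewrite T1 T2 in T0; rewrite Z1 in Q1; rewrite Z1 Z2 in Q2.
have t0 := sqr_ge0 t.
have := n2_ge0 (E1 t); have := n2_ge0 (E2 t); have := n2_ge0 (fun x => Lp (Phi t x)).
move: T0 H P Q1 Q2 b0 b1 b2 t1 t0.
move: (I (fun x => D i a x * _)) (I (fun x => chip _)) (I chip) (n2 Lp) (I (fun x => Lp _ * _)).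
move: (n2 (fun x => Lp (Phi t x) + t * E1 t x + _)) (n2 (fun x => Lp (Phi t x) + _)) (n2 (fun x => Lp (Phi t x))) (n2 (E1 t)) (n2 (E2 t)).
move: (t ^+ 2) c00 c10 c20 => T2' ? ? ?; exact: variation_arith.
Unshelve. all: by end_near. Qed.

End Inner.

(** For small t the factor [1 + t psi] is positive: the competitor is nonnegative with the same
    positivity set, so the phase term drops out. *)
Lemma outer_variation psi (K : set pl) : sm2 psi -> compact K -> K `<=` B ->
 (forall x, ~ K x -> psi x = 0) ->
 zint (fun x => Lp x * (lapl psi x * V x + 2 * (D o_0 psi x * F [:: o_0] x + D o_1 psi x * F [:: o_1] x)
  + psi x * Lp x)).
move=> sp cK KB pK.
have clK : closed K by apply: compact_closed => //; smt.
have tp : test_function Omega psi by apply/testP; split=> //; exists K; split=> // x /KB/BO.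
have bp : bsupp psi by have /testP[_ /csupp_bsupp] := tp.
have FV : F [::] = V by have [] := tV.
pose H x := lapl psi x * V x + 2 * (D o_0 psi x * F [:: o_0] x + D o_1 psi x * F [:: o_1] x) + psi x * Lp x.
have EH t x : leib (fun y => t * psi y) F [:: o_0; o_0] x + leib (fun y => t * psi y) F [:: o_1; o_1] x = t * H x.
 have e1 j := congr1 (fun h => h x) (partialsZ t [:: j] sp).
 have e2 j := congr1 (fun h => h x) (partialsZ t [:: j; j] sp).
 rewrite /leib -![D _ (fun y => t * psi y) x]/(partials [:: _] (fun y => t * psi y) x) !e1 !e2 /H FV /lapl /Lp [partials [:: o_0] psi x]/= [partials [:: o_1] psi x]/=.
 move: (partials _ psi x) (partials _ psi x) (D o_0 psi x) (D o_1 psi x) (V x) (psi x) => a1 a2 a3 a4 a5 a6.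
 lra.
have [M M0 HM] := bsupp_bounded (smooth_cont sp) bp.
have lL := Lp_l2.
have H0 x : ~ B x -> H x = 0.
 move=> nB; have nK : ~ K x by move=> /KB.
 have z r := partials_out r clK pK nK.
 have z0 : psi x = 0 := z [::]; have z1 j : D j psi x = 0 := z [:: j].
 have hl : lapl psi x = 0 by rewrite /lapl !z addr0.
 by rewrite /H hl z0 !z1; ring.
have lH : l2 H.
 have := (test_lim_leib tp tV); have [_ L _] := test_lim_leib tp tV => _.
 have := l2D (L [:: o_0; o_0] isT).1 (L [:: o_1; o_1] isT).1.
 rewrite (_ : (fun x => _ + _) = H) //; apply/funext => x; rewrite /rev /catrev.
 have p1 : (fun y => 1 * psi y) = psi by apply/funext => y; lra.
 by have := EH 1 x; rewrite p1 mul1r.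
split; first smt.
suff : 2 * I (fun x => Lp x * H x) = 0 by move/eqP; lra.
apply: (first_variation0 (S := fun=> 2 * I (fun x => Lp x * H x)) (C := n2 H)); first exact: cvg_cst.
near=> t.
have tM x : `|t * psi x| < 1.
 rewrite normrM (le_lt_trans (ler_wpM2l (normr_ge0 _) (HM x))) //.
 apply: (@le_lt_trans _ _ 2^-1); last by rewrite invf_lt1 // ltr1n.
 apply: small_mul => //; first smt.
 by near: t; apply: near0_le; rewrite divr_gt0 ?invr_gt0 // ltr_pwDr // ltW.
have tpt : test_function Omega (fun x => t * psi x) by smt.
have tw := test_lim_leib tpt tV.
have comp x : Omega x -> u x + t * psi x * V x = (1 + t * psi x) * u x.
 move=> Ox; have [Kx|Kx] := pselect (K x); first by rewrite VB ?mulrDl ?mul1r //; exact: KB.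
 by rewrite pK // mulr0 mul0r !addr0 mul1r.
have w0 x : 0 < 1 + t * psi x by have := tM x; rewrite ltr_norml; lra.
have := @one_phase_variation _ _ (fun x => t * H x) tw.
have -> : (\1_(pos (fun x => u x + t * psi x * V x)) : pl -> R) = chip.
 apply/funext => x; rewrite /chip !indicE; congr (_%:R); congr nat_of_bool.
 apply/idP/idP; rewrite !inE /pos /= => -[Ox]; rewrite comp //.
  by rewrite pmulr_rgt0.
 by move=> ux; split=> //; smt.
rewrite subrr addr0.
have lt := l2Z t lH.
rewrite (n2D lL lt).
have -> : I (fun x => Lp x * (t * H x)) = t * I (fun x => Lp x * H x).
 by rewrite -(IZ _ (l2_ig_mul lL lH)); congr I; apply/funext => x; rewrite mulrCA.
have -> : n2 (fun x => t * H x) = t ^+ 2 * n2 H.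
 by rewrite /n2 -(IZ _ lH.2); congr I; apply/funext => x; rewrite exprMn.
rewrite (_ : n2 Lp + 2 * (t * I (fun x => Lp x * H x)) + t ^+ 2 * n2 H - n2 Lp =
 t * (2 * I (fun x => Lp x * H x)) + t ^+ 2 * n2 H); last first.
 by move: (n2 _) (n2 _) (I _) => A1 A2 A3; ring.
apply.
- by apply/funext => x; rewrite -EH.
- move=> x Ox; rewrite comp //; apply: mulr_ge0; first exact: ltW.
 by have [_ p _] := mu; exact: p.
- by move=> x /H0 ->; rewrite mulr0.
Unshelve. all: by end_near. Qed.

#[local] Hint Resolve F_l2 F_bsupp Lp_l2 Lp_bsupp chip_ig chip_bsupp Sy_l2 : plane.

Variable x0 : pl.

Local Notation q1 := (q1 x0).
Local Notation q2 := (q2 x0).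
Local Notation sq := (sq x0).

(** [AA] and [AB] are T V and T T V, expressed through the weak derivatives. *)
Definition AA x : R := q1 x * F [:: o_0] x + q2 x * F [:: o_1] x - 2 * F [::] x.
Definition AB x : R := q1 x * q1 x * F [:: o_0; o_0] x +
 q1 x * q2 x * (F [:: o_0; o_1] x + F [:: o_1; o_0] x) + q2 x * q2 x * F [:: o_1; o_1] x -
 3 * (q1 x * F [:: o_0] x + q2 x * F [:: o_1] x) + 4 * F [::] x.

(** Inner variations along both components of [Z (x - x0)] with [Z = k t^2], plus an outer variation
    by [- 2 Z u], move u in the direction [Z T u]. Apart from weights [ks k] and [ks (ks k)], what
    remains is [- 8 k] times the product occurring in the Weiss identity. *)
Lemma radial_variation (k : R -> R) (K : set pl) : smoothR k -> compact K -> K `<=` B ->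
 (forall x, ~ K x -> k (sq x) = 0) ->
 zint (fun x => - (ks k (sq x) * sq x ^+ 2 * (Lp x ^+ 2 + chip x)) +
  2 * (sq x * Lp x * ((2 * ks k (sq x) - 4 * k (sq x)) * AB x + (ks (ks k) (sq x) - 4 * k (sq x)) * AA x))).
move=> sk cK KB kK; pose Z (t : R) := k t * t ^+ 2.
have sZ : smoothR Z := smoothR_ks2 sk.
have rK i x : ~ K x -> rad x0 Z i x = 0 by move=> /kK E; rewrite /rad /Z E !mul0r.
have pK x : ~ K x -> - 2 * Z (sq x) = 0 by move=> /kK E; rewrite /Z E mul0r mulr0.
have sr : sm2 (fun x => Z (sq x)) by smt.
have sp : sm2 (fun x => - 2 * Z (sq x)) by apply: smooth_mul => //; smt.
have V0 := inner_variation (sm2_rad_field x0 o_0 sZ) o_0 cK KB (rK o_0).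
have V1 := inner_variation (sm2_rad_field x0 o_1 sZ) o_1 cK KB (rK o_1).
have V2 := outer_variation sp cK KB pK.
have := zintD (zintD V0 V1) (zintZ 2 V2).
set f := (X in zint X -> _); set g := (X in _ -> zint X); suff -> : f = g by [].
rewrite /f /g {f g}; apply/funext => x.
have FV : F [::] x = V x by have [/(congr1 (fun h => h x))] := tV.
rewrite !(derive_rad_field _ _ _ _ sZ) !(lapl_rad_field _ _ _ sZ).
have -> : lapl (fun x => -2 * Z (sq x)) x = -2 * Lam Z (sq x).
 rewrite /lapl !(partialsZ (-2) _ sr) -mulrDr; congr (_ * _).
 exact: (congr1 (fun h => h x) (lapl_radial x0 sZ)).
have E j : D j (fun x => -2 * Z (sq x)) x = -2 * ('D_1 Z (sq x) * (2 * qc x0 j x)).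
 apply: etrans (congr1 (fun h => h x) (partialsZ (-2) [:: j] sr)) _; congr (_ * _).
 exact: (@partials1_rad x0 Z j x sZ).
rewrite !E /Lam (derive2_ks2 _ sk) (derive_ks2 _ sk) /Z /Sy /Lp -FV.
rewrite [ks (ks k)]/ks (derive_ks _ sk) /ks /AA /AB !eqxx.
have -> : (o_0 == o_1 :> 'I_2) = false by [].
have -> : (o_1 == o_0 :> 'I_2) = false by [].
have -> : true%:R = 1 :> R by [].
have -> : false%:R = 0 :> R by [].
have -> : qc x0 o_0 x = q1 x by [].
have -> : qc x0 o_1 x = q2 x by [].
move: (chip x) (F [::] x) (F [:: o_0] x) (F [:: o_1] x) (F [:: o_0; o_0] x) (F [:: o_0; o_1] x)
 (F [:: o_1; o_0] x) (F [:: o_1; o_1] x) => c f f0 f1 f00 f01 f10 f11.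
rewrite (sqE x0 x).
move: (q1 x) (q2 x) (k _) ('D_1 k _) ('D_1 ('D_1 k) _) => p q k0 k1 k2.
by ring.
Qed.

Definition Un n : pl -> R := conv V (moll n).

Lemma V_l2 : l2 V.
by have [<- _ _] := tV; exact: (F_l2 (s := [::])). Qed.

Lemma V_bsupp : bsupp V.
by have [<- _ _] := tV; exact: (F_bsupp (s := [::])). Qed.

Lemma V_ig : ig V.
exact: l2_ig V_l2 V_bsupp. Qed.

Lemma Un_sm2 n : sm2 (Un n).
exact: conv_sm2 V_ig (@moll_sm2 n) (@moll_bsupp n). Qed.

Lemma Un_bsupp n : bsupp (Un n).
have [N HN] := V_bsupp; exists (N + n.+1%:R^-1) => x Nx.
rewrite /Un /conv (_ : (fun y => _) = fun=> 0) ?I0 //; apply/funext => y.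
have [yN|/HN ->] := leP `|y| N; last by lra.
rewrite moll_supp ?mulr0 //; have : `|x| <= `|x - y| + `|y| by rewrite (le_trans _ (ler_normD _ _)) // subrK.
move: (`|x|) (`|y|) (`|x - y|) (n.+1%:R^-1) Nx yN => p q r s h1 h2 h3; lra.
Qed.

Lemma Un_s2 s : (size s <= 2)%N -> s2 (fun n => partials s (Un n)) (F (rev s)).
move=> s2'; have sr : (size (rev s) <= 2)%N by rewrite size_rev.
have lF := F_l2 sr; have bF := F_bsupp sr.
have E n : partials s (Un n) = conv (F (rev s)) (moll n).
 by rewrite /Un (test_lim_conv n tV s2' V_ig V_bsupp).
split=> //; first by move=> n; rewrite E; exact: (conv_young n lF bF).1.
rewrite /cvg2; under eq_fun do rewrite E; exact: moll_cvg lF bF.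
Qed.

Lemma q1_continuous : continuous q1.
exact: smooth_cont (sm2_q1 x0). Qed.

Lemma q2_continuous : continuous q2.
exact: smooth_cont (sm2_q2 x0). Qed.

Definition RoF x : R := q1 x * F [:: o_1] x - q2 x * F [:: o_0] x.

Let lU s : (size s <= 2)%N -> ls2 (fun n => partials s (Un n)) (F (rev s)).
by move=> ?; apply: ls2_s2; exact: Un_s2. Qed.

Let lN A a : ls2 A a -> forall k : R, ls2 (fun n x => k * A n x) (fun x => k * a x).
by move=> H k; apply: (ls2M (q := fun=> k)) H => x; exact: cvg_cst. Qed.

Lemma ls2_V : ls2 Un V.
by have [<- _ _] := tV; exact: (lU (s := [::])). Qed.

Lemma ls2_F i : ls2 (fun n => 'D_(e_ i) (Un n)) (F [:: i]).
exact: (lU (s := [:: i])). Qed.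

Lemma ls2_Lp : ls2 (fun n => lapl (Un n)) Lp.
exact: (ls2D (lU (s := [:: o_0; o_0]) isT) (lU (s := [:: o_1; o_1]) isT)). Qed.

Let ls2_Eu : ls2 (fun n => Eu x0 (Un n)) (fun x => q1 x * F [:: o_0] x + q2 x * F [:: o_1] x).
exact: ls2D (ls2M q1_continuous (@ls2_F _)) (ls2M q2_continuous (@ls2_F _)). Qed.

Lemma ls2_AA : ls2 (fun n => TE x0 (Un n)) AA.
have [FV _ _] := tV.
have := ls2D ls2_Eu (lN ls2_V (-2)).
rewrite (_ : (fun n x => _ + _) = fun n => TE x0 (Un n)); last first.
 by apply/funext => n; apply/funext => x; rewrite /TE mulNr.
by rewrite (_ : (fun x => _ + _) = AA) //; apply/funext => x; rewrite /AA -FV mulNr.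
Qed.

Lemma ls2_Ro : ls2 (fun n => Ro x0 (Un n)) RoF.
have := ls2D (ls2M q1_continuous (@ls2_F o_1)) (lN (ls2M q2_continuous (@ls2_F o_0)) (-1)).
rewrite (_ : (fun n x => _ + _) = fun n => Ro x0 (Un n)); last first.
 by apply/funext => n; apply/funext => x; rewrite /Ro mulN1r.
by rewrite (_ : (fun x => _ + _) = RoF) //; apply/funext => x; rewrite /RoF mulN1r.
Qed.

Lemma ls2_AB : ls2 (fun n => TE x0 (TE x0 (Un n))) AB.
have [FV _ _] := tV.
have cm f g : continuous f -> continuous g -> continuous (fun x => f x * g x : R).
 by move=> cf cg x; apply: cvgM; [exact: cf|exact: cg].
have c11 := cm _ _ q1_continuous q1_continuous; have c12 := cm _ _ q1_continuous q2_continuous.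
have c22 := cm _ _ q2_continuous q2_continuous.
have H2 i j := lU (s := [:: i; j]) isT.
have := ls2D (ls2D (ls2D (ls2D (ls2M c11 (H2 o_0 o_0)) (ls2M c12 (ls2D (H2 o_0 o_1) (H2 o_1 o_0))))
 (ls2M c22 (H2 o_1 o_1))) (lN ls2_Eu (-3))) (lN ls2_V 4).
rewrite (_ : (fun n x => _ + _) = fun n => TE x0 (TE x0 (Un n))); last first.
 by apply/funext => n; apply/funext => x; rewrite (TE2E x0 x (Un_sm2 n)) mulNr.
rewrite (_ : (fun x => _ + _) = AB) //; apply/funext => x; rewrite /AB -FV /rev /catrev mulNr.
lra.
Qed.

Definition wremF (k : R -> R) x : R := - (5 / 2) * (ks k (sq x) * AA x ^+ 2) + 2 * (ks (ks k) (sq x) * V x ^+ 2)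
 - 2 * (ks k (sq x) * V x ^+ 2) - 2^-1 * (ks (ks k) (sq x) * RoF x ^+ 2) + 2^-1 * (ks k (sq x) * RoF x ^+ 2).

Lemma rad_weight (k : R -> R) (N : R) : smoothR k -> (forall t, N < t -> k t = 0) ->
 continuous (fun x => k (sq x)) /\ bsupp (fun x => k (sq x)).
move=> sk kN; split; first exact: smooth_cont (sm2_rad x0 sk).
exact: nsq_bsupp_shift kN.
Qed.

(** The identity holds for the mollifications. The nonnegative square of [TE (Ro U)] is dropped by
    its sign, and the inequality for the remaining terms passes to the limit. *)
Lemma weiss_limit (k : R -> R) (N : R) : smoothR k -> (forall t, 0 <= k t) -> (forall t, N < t -> k t = 0) ->
 ig (fun x => k (sq x) * (sq x * Lp x * (AB x + AA x)) - (k (sq x) * AB x ^+ 2 + wremF k x)) /\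
 0 <= I (fun x => k (sq x) * (sq x * Lp x * (AB x + AA x)) - (k (sq x) * AB x ^+ 2 + wremF k x)).
move=> sk k0 kN.
have [ck bk] := rad_weight sk kN.
have [ck1 bk1] := rad_weight (smoothR_ks sk) (ks_supp kN).
have [ck2 bk2] := rad_weight (smoothR_ks (smoothR_ks sk)) (ks_supp (ks_supp kN)).
have cs : continuous sq := smooth_cont (sm2_sq x0).
have w c (cc : continuous c) (bc : bsupp c) A a : ls2 A a ->
  sI (fun n x => c x * (A n x ^+ 2)) (fun x => c x * (a x ^+ 2)) := fun H => sI_w cc bc H H.
have T1 := sI_w ck bk (ls2M cs ls2_Lp) (ls2D ls2_AB ls2_AA).
have T2 := sI_Z (-1) (w _ ck bk _ _ ls2_AB).
have T3 := sI_Z (5 / 2) (w _ ck1 bk1 _ _ ls2_AA).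
have T4 := sI_Z (-2) (w _ ck2 bk2 _ _ ls2_V).
have T5 := sI_Z 2 (w _ ck1 bk1 _ _ ls2_V).
have T6 := sI_Z 2^-1 (w _ ck2 bk2 _ _ ls2_Ro).
have T7 := sI_Z (- 2^-1) (w _ ck1 bk1 _ _ ls2_Ro).
have [ig0 ign cvg] := sI_D (sI_D (sI_D (sI_D (sI_D (sI_D T1 T2) T3) T4) T5) T6) T7.
set f := (X in _ /\ 0 <= I X); set g := (X in ig X) in ig0.
have E : g = f by apply/funext => x; rewrite /g /f /wremF; ring.
rewrite -/g E in cvg ig0; split=> //.
apply: (cvgr_to_ge cvg); near=> n.
have [iw Iw] := weiss_identity x0 sk (Un_sm2 n) (Un_bsupp n).
have iy : ig (fun x => k (sq x) * TE x0 (Ro x0 (Un n)) x ^+ 2).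
 have s2' := sm2_TE x0 (sm2_Ro x0 (Un_sm2 n)).
 apply: ig_sm; first by apply: smooth_mul; smt.
 exact: bsuppMl.
have Iy : 0 <= I (fun x => k (sq x) * TE x0 (Ro x0 (Un n)) x ^+ 2).
 by apply: I_ge0 => x; smt.
set W := (X in ig X) in iw.
suff H : forall f1 : pl -> R, f1 = (fun x => W x + k (sq x) * TE x0 (Ro x0 (Un n)) x ^+ 2) -> 0 <= I f1.
 apply: H; apply/funext => x; rewrite /W /wrem; ring.
by move=> f1 ->; rewrite (ID iw iy) Iw add0r.
Unshelve. all: by end_near. Qed.

#[local] Hint Resolve V_l2 V_bsupp V_ig Un_sm2 Un_bsupp q1_continuous q2_continuous : plane.

Variable g : 'I_2 -> pl -> R.
Variables r L : R.
Hypotheses (r0 : 0 < r) (L0 : 0 <= L) (dV : forall i y, `|y - x0| <= 3 * r -> is_derive y (e_ i) V (g i y)).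
Hypothesis gL : forall i y z, `|y - x0| <= 3 * r -> `|z - x0| <= 3 * r -> `|g i y - g i z| <= L * `|y - z|.
Hypotheses (V0 : V x0 = 0) (g0 : forall i, g i x0 = 0) (DB : [set x | nsq (x - x0) <= r ^+ 2] `<=` B).

Let iV : ig V := V_ig.

(** Weights living in the disc where the C^{1,1} bounds on V are available. *)
Definition weight c : Prop := [/\ continuous c, bsupp c, forall x, 0 <= c x &
 forall x, r ^+ 2 < sq x -> c x = 0].

Lemma weightM c f : weight c -> continuous f -> (forall x, 0 <= f x) -> weight (fun x => c x * f x).
move=> [cc bc c0 cz] cf f0; split.
- by move=> x; apply: cvgM; [exact: cc|exact: cf].
- exact: bsuppMl.
- by move=> x; smt.
- by move=> x /cz ->; lra.
Qed.

Lemma weight_ig c : weight c -> ig c.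
by move=> [cc bc _ _]; smt. Qed.

Lemma weight_norm c x : weight c -> c x != 0 -> `|x - x0| <= r.
move=> [_ _ _ cz] cx; have sr : sq x <= r ^+ 2.
 by rewrite leNgt; apply/negP => /cz E; lra.
have := le_trans (norm_le_nsq (x - x0)) sr.
by rewrite lerXn2r_ge0 // ltW || (rewrite ler_sqr ?nnegrE //; exact: ltW).
Qed.

Lemma near_invn : \forall n \near \oo, n.+1%:R^-1 <= r.
have /cvgr0Pnorm_le /(_ _ r0) := @invn_cvg0; apply: filterS => n.
by rewrite ger0_norm // invr_ge0.
Qed.

(** Pointwise bounds on mollifications, up to an error of order 1/n, survive the L^2 limit as bounds
    on weighted integrals, the form in which weak derivatives can be handled. *)
Lemma weight_limit c (A : nat -> pl -> R) a (M : pl -> R) (N : R) : weight c -> continuous M ->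
 (forall n x, `|x - x0| <= r -> n.+1%:R^-1 <= r -> A n x ^+ 2 <= M x + N * n.+1%:R^-1) ->
 ls2 A a -> I (fun x => c x * a x ^+ 2) <= I (fun x => c x * M x).
move=> wc cM H lA; have [cc bc c0 cz] := wc.
have [_ _ cvg] := sI_w cc bc lA lA.
have ic := weight_ig wc.
have icM : ig (fun x => c x * M x).
 by apply: ig_continuous; [move=> x; apply: cvgM; [exact: cc|exact: cM]|exact: bsuppMl].
have cvg2 : I (fun x => c x * M x) + N * I c * n.+1%:R^-1 @[n --> \oo] --> I (fun x => c x * M x).
 rewrite -[X in _ --> X]addr0; apply: cvgD; first exact: cvg_cst.
 rewrite -(mulr0 (N * I c)); apply: cvgM; [exact: cvg_cst|exact: invn_cvg0].
apply: (ler_cvg_to cvg cvg2); near=> n.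
have nr : n.+1%:R^-1 <= r by near: n; exact: near_invn.
have [_ igA _] := sI_w cc bc lA lA.
have -> : N * I c * n.+1%:R^-1 = (N * n.+1%:R^-1) * I c by rewrite mulrAC.
rewrite -(IZ _ ic) -(ID icM (igZ _ ic)).
apply: I_le; [exact: igA|exact: igD icM (igZ _ ic)|move=> x].
have [->|cx] := eqVneq (c x) 0; first by rewrite !mul0r mulr0 addr0.
rewrite [_ * n.+1%:R^-1 * _]mulrC -mulrDr -expr2 ler_wpM2l //.
by apply: H => //; exact: weight_norm wc cx.
Unshelve. all: by end_near. Qed.

Lemma hess_weight c i j : weight c -> I (fun x => c x * F [:: i; j] x ^+ 2) <= L ^+ 2 * I c.
move=> wc; have ic := weight_ig wc.
have -> : L ^+ 2 * I c = I (fun x => c x * L ^+ 2).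
 by rewrite -IZ //; congr I; apply/funext => x; lra.
apply: (@weight_limit _ (fun n => partials [:: j; i] (Un n)) _ (fun=> L ^+ 2) 0) => //.
- by move=> x; exact: cvg_cst.
- move=> n x xr nr; rewrite mul0r addr0 -[leLHS]real_normK ?num_real // lerXn2r ?nnegrE //.
 exact: (moll_hess_bound iV r0 L0 dV gL j i xr nr).
- by apply: ls2_s2; exact: (Un_s2 (s := [:: j; i])).
Qed.

Lemma grad_weight c i : weight c -> I (fun x => c x * F [:: i] x ^+ 2) <= 2 * L ^+ 2 * I (fun x => c x * sq x).
move=> wc; have [cc bc c0 _] := wc.
have cs : continuous sq := smooth_cont (sm2_sq x0).
have s0 x : 0 <= sq x by exact: nsq_ge0.
have ics := weight_ig (weightM wc cs s0).
have -> : 2 * L ^+ 2 * I (fun x => c x * sq x) = I (fun x => c x * (2 * L ^+ 2 * sq x)).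
 by rewrite -IZ //; congr I; apply/funext => x; lra.
apply: (@weight_limit _ (fun n => 'D_(e_ i) (Un n)) _ (fun x => 2 * L ^+ 2 * sq x) (8 * L ^+ 2)) => //.
- by move=> x; apply: cvgM; [exact: cvg_cst|exact: cs].
- move=> n x xr nr.
 have H := moll_grad_bound iV r0 L0 dV gL g0 i xr nr.
 rewrite -[leLHS]real_normK ?num_real //.
 have e0 : 0 <= n.+1%:R^-1 :> R by smt.
 have e1 : n.+1%:R^-1 <= 1 :> R by rewrite invf_le1 // ler1n.
 have ns : `|x - x0| ^+ 2 <= sq x := norm_le_nsq (x - x0).
 have H2 : `|'D_(e_ i) (Un n) x| ^+ 2 <= (L * (`|x - x0| + 2 * n.+1%:R^-1)) ^+ 2.
  by rewrite lerXn2r ?nnegrE // (le_trans (normr_ge0 _) H).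
 rewrite (le_trans H2) // exprMn (_ : 2 * L ^+ 2 * sq x + 8 * L ^+ 2 * n.+1%:R^-1 = L ^+ 2 * (2 * sq x + 8 * n.+1%:R^-1)); last by ring.
 rewrite ler_wpM2l ?sqr_ge0 // (le_trans (sqD2 _ _)) //.
 have e2 : n.+1%:R^-1 ^+ 2 <= n.+1%:R^-1 :> R by rewrite expr2 ler_piMr.
 rewrite exprMn; move: (n.+1%:R^-1) (n.+1%:R^-1 ^+ 2) (sq x) (`|x - x0| ^+ 2) ns e2 => a1 a2 a3 a4 ns e2; lra.
- exact: (ls2_F i).
Qed.

Lemma val_weight c : weight c -> I (fun x => c x * V x ^+ 2) <= 4 * L ^+ 2 * I (fun x => c x * sq x ^+ 2).
move=> wc; have [cc bc c0 _] := wc.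
have cs2 : continuous (fun x => sq x ^+ 2) := smooth_cont (smooth_exp 2 (sm2_sq x0)).
have ics := weight_ig (weightM wc cs2 (fun x => sqr_ge0 _)).
rewrite -IZ //; apply: I_le; [|exact: igZ|].
 have [] := sI_w cc bc ls2_V ls2_V; exact.
move=> x; have [->|cx] := eqVneq (c x) 0; first by lra.
have xr := weight_norm wc cx.
have x3 : `|x - x0| <= 3 * r by rewrite (le_trans xr) // ler_peMl // ?ler1n // ltW.
rewrite [leRHS]mulrCA ler_wpM2l // -[leLHS]real_normK ?num_real //.
have H := W_le r0 L0 dV gL V0 g0 x3.
have ns : `|x - x0| ^+ 2 <= sq x := norm_le_nsq (x - x0).
have H2 : `|V x| <= 2 * L * sq x by rewrite (le_trans H) // ler_wpM2l // mulr_ge0.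
rewrite (_ : 4 * L ^+ 2 * sq x ^+ 2 = (2 * L * sq x) ^+ 2); last by ring.
by rewrite lerXn2r ?nnegrE // (le_trans (normr_ge0 _) H2).
Qed.

(** A dilation-invariant energy density: each derivative is paired with the power of the distance
    that matches quadratic growth. *)
Definition Ew x : R := sq x ^+ 2 * (F [:: o_0; o_0] x ^+ 2 + F [:: o_0; o_1] x ^+ 2 +
  (F [:: o_1; o_0] x ^+ 2 + F [:: o_1; o_1] x ^+ 2)) +
 sq x * (F [:: o_0] x ^+ 2 + F [:: o_1] x ^+ 2) + V x ^+ 2 + sq x ^+ 2 * chip x.

(** 12 = 4 + 4 + 4: four squared second derivatives bounded by [L^2], two squared first derivatives
    by [2 L^2 sq], and the squared value by [4 L^2 sq^2]. The indicator contributes the 1. *)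
Lemma Ew_weight c : weight c -> ig (fun x => c x * Ew x) /\
 I (fun x => c x * Ew x) <= (12 * L ^+ 2 + 1) * I (fun x => c x * sq x ^+ 2).
move=> wc; have [cc bc c0 _] := wc.
have cs : continuous sq := smooth_cont (sm2_sq x0).
have s0 x : 0 <= sq x by exact: nsq_ge0.
have cs2 : continuous (fun x => sq x ^+ 2) := smooth_cont (smooth_exp 2 (sm2_sq x0)).
have w1 := weightM wc cs s0; have w2 := weightM wc cs2 (fun x => sqr_ge0 _).
have [cc1 bc1 _ _] := w1; have [cc2 bc2 _ _] := w2.
have iF c' s : (size s <= 2)%N -> weight c' -> ig (fun x => c' x * F s x ^+ 2).
 move=> s2 [cc' bc' _ _]; have [M _ HM] := bsupp_bounded cc' bc'.
 exact: ig_mul_bounded (cont_measurable cc') HM (F_l2 s2).2.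
have ichi : ig (fun x => (c x * sq x ^+ 2) * chip x).
 have [M _ HM] := bsupp_bounded cc2 bc2.
 by apply: ig_mul_bounded (cont_measurable cc2) HM chip_ig.
have [_ lV _] := tV; have FV : F [::] = V by have [] := tV.
have iV2 : ig (fun x => c x * V x ^+ 2) by rewrite -FV; exact: iF.
have h i j := iF _ [:: i; j] isT w2; have d i := iF _ [:: i] isT w1.
have E : (fun x => c x * Ew x) = fun x =>
  ((c x * sq x ^+ 2) * F [:: o_0; o_0] x ^+ 2 + (c x * sq x ^+ 2) * F [:: o_0; o_1] x ^+ 2) +
  ((c x * sq x ^+ 2) * F [:: o_1; o_0] x ^+ 2 + (c x * sq x ^+ 2) * F [:: o_1; o_1] x ^+ 2) +
  ((c x * sq x) * F [:: o_0] x ^+ 2 + (c x * sq x) * F [:: o_1] x ^+ 2) + c x * V x ^+ 2 +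
  (c x * sq x ^+ 2) * chip x.
 by apply/funext => x; rewrite /Ew; ring.
have i1 := igD (h o_0 o_0) (h o_0 o_1); have i2 := igD (h o_1 o_0) (h o_1 o_1).
have i3 := igD i1 i2; have i4 := igD (d o_0) (d o_1); have i5 := igD i3 i4; have i6 := igD i5 iV2.
split; first by rewrite E; exact: igD.
rewrite E (ID i6 ichi) (ID i5 iV2) (ID i3 i4) (ID i1 i2) (ID (h _ _) (h _ _)) (ID (h _ _) (h _ _)) (ID (d _) (d _)).
have hw i j := hess_weight i j w2; have dw i := grad_weight i w1; have vw := val_weight wc.
have es : (fun x => c x * sq x * sq x) = fun x => c x * sq x ^+ 2 by apply/funext => x; lra.
have cw : I (fun x => c x * sq x ^+ 2 * chip x) <= I (fun x => c x * sq x ^+ 2).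
 apply: I_le => //; first smt.
 move=> x; rewrite ler_piMr ?mulr_ge0 ?sqr_ge0 // /chip indicE; by case: (_ \in _); smt.
have := dw o_0; have := dw o_1; rewrite es => d1 d2.
have := hw o_0 o_0; have := hw o_0 o_1; have := hw o_1 o_0; have := hw o_1 o_1.
move: d1 d2 vw cw; move: (L ^+ 2) (I (fun x => c x * sq x ^+ 2)).
by move: (I _) (I _) (I _) (I _) (I _) (I _) (I _) (I _) => a1 a2 a3 a4 a5 a6 a7 a8 l J *; lra.
Qed.

(** Eight times the Weiss inequality plus the radial variation: the products weighted by k cancel,
    [8 k (T T V)^2] remains, and the rest is estimated by [variation_remainder_le]. *)
Lemma energy_bound (k : R -> R) : smoothR k -> (forall t, 0 <= k t) -> (forall t, r ^+ 2 < t -> k t = 0) ->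
 ig (fun x => k (sq x) * AB x ^+ 2) /\
 8 * I (fun x => k (sq x) * AB x ^+ 2) <=
 800 * (12 * L ^+ 2 + 1) * I (fun x => (`|ks k (sq x)| + `|ks (ks k) (sq x)|) * sq x ^+ 2).
move=> sk k0 kz.
have [ck bk] := rad_weight sk kz.
have [ck1 bk1] := rad_weight (smoothR_ks sk) (ks_supp kz).
have [ck2 bk2] := rad_weight (smoothR_ks (smoothR_ks sk)) (ks_supp (ks_supp kz)).
have wc : weight (fun x => `|ks k (sq x)| + `|ks (ks k) (sq x)|).
 split.
 - by move=> x; apply: cvgD; apply: cvg_norm; [exact: ck1|exact: ck2].
 - by apply: bsupp_add; [apply: bsuppW bk1 _|apply: bsuppW bk2 _] => x ->; rewrite normr0.
 - by move=> x; smt.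
 - by move=> x sr; rewrite (ks_supp kz) // (ks_supp (ks_supp kz)) // normr0 addr0.
have [_ igAB _] := sI_w ck bk ls2_AB ls2_AB.
have [iAB _ _] := sI_w ck bk ls2_AB ls2_AB.
have {}iAB : ig (fun x => k (sq x) * AB x ^+ 2) by exact: iAB.
split=> //.
have [iE IE] := Ew_weight wc.
have [iW IW] := weiss_limit sk k0 kz.
have cK : compact [set x | nsq (x - x0) <= r ^+ 2] := @cdisk_compact x0 (r ^+ 2).
have kK x : ~ [set x | nsq (x - x0) <= r ^+ 2] x -> k (sq x) = 0.
 by move=> /= /negP; rewrite -ltNge => /kz.
have [iR IR] := radial_variation sk cK DB kK.
rewrite -mulrA; apply: (le_trans _ (ler_wpM2l (ler0n R 800) IE)).
rewrite -(IZ _ iE) -(IZ _ iAB).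
have iW8 := igZ 8 iW.
set Rd := (X in ig X) in iR.
apply: (@le_trans _ _ (I (fun x => 8 * (k (sq x) * AB x ^+ 2)) + (I (fun x => 8 * (k (sq x) * (sq x * Lp x * (AB x + AA x)) - (k (sq x) * AB x ^+ 2 + wremF k x))) + I Rd))).
 by rewrite lerDl IR addr0 (IZ _ iW) mulr_ge0.
rewrite -(ID iW8 iR) -(ID (igZ 8 iAB) (igD iW8 iR)).
apply: I_le; [exact: igD (igZ 8 iAB) (igD iW8 iR)|exact: igZ|move=> x]; rewrite /Rd.
have chi0 : 0 <= chip x by smt.
have := @variation_remainder_le (q1 x) (q2 x) (V x) (F [:: o_0] x) (F [:: o_1] x) (F [:: o_0; o_0] x)
 (F [:: o_0; o_1] x) (F [:: o_1; o_0] x) (F [:: o_1; o_1] x) (chip x) (sq x) (Ew x) _ _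
 (AA x) (AB x) (Lp x) _ _ (sqE x0 x) erefl erefl erefl chi0 _ _ erefl erefl erefl (ks k (sq x)) (ks (ks k) (sq x)).
have FV : V x = F [::] x by have [<-] := tV.
move=> /(_ _ _); rewrite /wremF /RoF FV => /(_ erefl erefl).
lra.
Qed.

Definition Je (a b : R) : R := I (fun x => kab (a ^+ 2) (b ^+ 2) (sq x) * AB x ^+ 2).

Lemma Je_bound (a : R) : 0 < a -> a <= r -> ig (fun x => kab (a ^+ 2) (r ^+ 2) (sq x) * AB x ^+ 2) /\
 8 * Je a r <= 800 * (12 * L ^+ 2 + 1) * wconst.
move=> a0 ar; have a2 : 0 < a ^+ 2 by smt.
have ar2 : a ^+ 2 <= r ^+ 2 by rewrite lerXn2r ?nnegrE // ltW.
have [i1 H] := energy_bound (smoothR_kab (a ^+ 2) (r ^+ 2))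
 (fun t => kab_ge0 t a2 ar2) (fun t => kab_hi a2 ar2).
split=> //; apply: (le_trans H); apply: ler_wpM2l; last exact: kab_weight.
exact: bound_const_ge0.
Qed.

(** [Je a b = Je a r - Je b r], and the values [Je a r] are bounded: b is taken where [Je b r] is
    within e of their supremum. *)
Lemma Je_decay (e : R) : 0 < e -> exists2 b : R, 0 < b <= r & forall a : R, 0 < a <= b ->
 ig (fun x => kab (a ^+ 2) (b ^+ 2) (sq x) * AB x ^+ 2) /\ Je a b <= e.
move=> e0; pose E := [set Je a r | a in [set a : R | 0 < a <= r]].
have sE : has_sup E.
 split; first by exists (Je r r); exists r => //=; rewrite r0 lexx.
 exists (800 * (12 * L ^+ 2 + 1) * wconst / 8) => _ [a /andP[a0 ar] <-].
 by rewrite ler_pdivlMr // mulrC; exact: (Je_bound a0 ar).2.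
have [_ [b /andP[b0 br] <-] Hb] := sup_adherent e0 sE.
exists b; first by rewrite b0.
move=> a /andP[a0 ab]; have ar := le_trans ab br.
have [i1 _] := Je_bound a0 ar; have [i2 _] := Je_bound b0 br.
have E12 : (fun x => kab (a ^+ 2) (b ^+ 2) (sq x) * AB x ^+ 2) =
  fun x => kab (a ^+ 2) (r ^+ 2) (sq x) * AB x ^+ 2 - kab (b ^+ 2) (r ^+ 2) (sq x) * AB x ^+ 2.
 by apply/funext => x; rewrite /kab; lra.
split; first by rewrite E12; exact: igB.
rewrite /Je E12 (IB i1 i2).
have : Je a r <= sup E by apply: ub_le_sup; [exact: sE.2|exists a => //=; rewrite a0].
rewrite -/(Je a r) -/(Je b r); move: (Je a r) (Je b r) (sup E) Hb => *; lra.
Qed.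

Definition annular phi : Prop := exists2 ab : R * R, 0 < ab.1 & 0 < ab.2 /\
 forall x, ~~ (ab.1 ^+ 2 <= nsq x <= ab.2 ^+ 2) -> phi x = 0.

Lemma annular_bsupp phi : annular phi -> bsupp phi.
move=> [[a b] a0 /= [b0 H]]; exists b => x bx; apply: H; rewrite negb_and -!ltNge; apply/orP; right.
by rewrite (lt_le_trans _ (norm_le_nsq x)) // ltr_pXn2r // nnegrE // ltW.
Qed.

Lemma weak_AB phi : sm2 phi -> bsupp phi ->
 I (fun x => AB x * phi x) = I (fun x => V x * TS x0 (TS x0 phi) x).
move=> sp bp; have s1 := sm2_TS x0 sp; have b1 := bsupp_TS x0 sp bp.
have s2 := sm2_TS x0 s1; have b2 := bsupp_TS x0 s1 b1.
have [_ _ c1] := sI_w (smooth_cont sp) bp ls2_AB (@ls2_one).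
have [_ _ c2] := sI_w (smooth_cont s2) b2 ls2_V (@ls2_one).
have E n : I (fun x => phi x * (TE x0 (TE x0 (Un n)) x * 1)) = I (fun x => TS x0 (TS x0 phi) x * (Un n x * 1)).
 have sU := Un_sm2 n.
 have := I_TS x0 (sm2_TE x0 sU) sp bp; rewrite (I_TS x0 sU s1 b1) => H.
 transitivity (I (fun x => TE x0 (TE x0 (Un n)) x * phi x)); first by congr I; apply/funext => x; ring.
 by rewrite H; congr I; apply/funext => x; ring.
have c1' : I (fun x => TS x0 (TS x0 phi) x * (Un n x * 1)) @[n --> \oo] --> I (fun x => phi x * (AB x * 1)).
 by under eq_fun do rewrite -E; exact: c1.
have := cvg_unique (@norm_hausdorff _ _) c1' c2 => H.
transitivity (I (fun x => phi x * (AB x * 1))); first by congr I; apply/funext => x; ring.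
by rewrite H; congr I; apply/funext => x; ring.
Qed.

(** Young's inequality with parameter [lam]; the weight K is required to reach [rho4 * lam] only
    where f is nonzero. *)
Lemma young_pointwise (A f lam K rho4 : R) : 0 < lam -> 0 <= rho4 -> (f != 0 -> rho4 * lam <= K) -> 0 <= K ->
 `|rho4 * (A * f)| <= K * A ^+ 2 + rho4 * (f ^+ 2 / (4 * lam)).
move=> l0 r40 H K0; have [->|/H rK] := eqVneq f 0.
 by rewrite expr0n /= mul0r !mulr0 addr0 normr0 mulr_ge0 ?sqr_ge0.
apply: (@le_trans _ _ (rho4 * lam * A ^+ 2 + rho4 * (f ^+ 2 / (4 * lam)))); last by rewrite lerD2r ler_wpM2r ?sqr_ge0.
rewrite normrM ger0_norm // -mulrA -mulrDr ler_wpM2l //.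
rewrite -subr_ge0 (_ : _ - _ = (lam * `|A| - `|f| / 2) ^+ 2 / lam).
 smt.
rewrite normrM -(real_normK (num_real A)) -(real_normK (num_real f)).
by field; rewrite gt_eqF.
Qed.

(** The rescaled test function lives where the truncated weight is exactly [|x - x0|^-6]. Young's
    inequality splits the pairing into a multiple of [Je], small by [Je_decay], and
    [n2 phi / (4 lam)], small by the choice of lam. *)
Lemma annular_decay phi (e : R) : sm2 phi -> annular phi -> 0 < e ->
 exists2 b : R, 0 < b & forall rho : R, 0 < rho <= b ->
 `|rho ^- 4 * I (fun y => AB y * dil x0 rho^-1 phi y)| <= e.
move=> sp ap e0; have bp := annular_bsupp ap; have [[a b] /= a0 [b0 Hab]] := ap.
have lp := l2_continuous (smooth_cont sp) bp.
pose lam : R := n2 phi / (2 * e) + 1.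
have lam0 : 0 < lam by rewrite ltr_pwDr // mulr_ge0 ?n2_ge0 // invr_ge0 mulr_ge0 // ltW.
have lamE : n2 phi / (4 * lam) <= e / 2.
 have : n2 phi <= 2 * e * lam.
  rewrite /lam mulrDr mulr1 mulrC divfK ?gt_eqF ?mulr_gt0 // lerDl; smt.
 by rewrite ler_pdivrMr ?mulr_gt0 //; lra.
pose e1 : R := e / (2 * lam * b ^+ 6).
have b6 : 0 < b ^+ 6 by smt.
have e10 : 0 < e1 by rewrite divr_gt0 // !mulr_gt0.
have [d /andP[d0 dr] Hd] := Je_decay e10.
(* [d / (2 * b)] places the rescaled annulus where the outer cutoff is 1; [d / a] keeps the inner
   radius [a * rho] at most d. *)
pose m : R := Num.min (d / (2 * b)) (d / a).
have m0 : 0 < m by rewrite lt_min !divr_gt0 // mulr_gt0.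
exists m => // rho /andP[rho0]; rewrite le_min => /andP[rb ra].
have ard : a * rho <= d by rewrite mulrC -ler_pdivlMr.
have ar0 : 0 < a * rho by smt.
have [iJ HJ] := Hd (a * rho) (introT andP (conj ar0 ard)).
have ard2 : (a * rho) ^+ 2 <= d ^+ 2 by rewrite lerXn2r ?nnegrE // ltW.
have rho1 : 0 < rho^-1 by smt.
have sd := sm2_dil x0 rho^-1 sp; have bd := bsupp_dil x0 rho1 bp.
have ld := l2_continuous (smooth_cont sd) bd.
have lAB : ig (fun y => AB y * dil x0 rho^-1 phi y).
 have [] := sI_w (smooth_cont sd) bd ls2_AB (@ls2_one).
 by rewrite (_ : (fun x => _ * _) = fun y => AB y * dil x0 rho^-1 phi y) //; apply/funext => x; ring.
have r4 : 0 <= rho ^- 4 by smt.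
have n2d : n2 (dil x0 rho^-1 phi) = rho ^+ 2 * n2 phi.
 have [_] := I_affine x0 rho0 ld.2; rewrite /n2 => ->; congr (_ * I _).
 by apply/funext => y; rewrite /dil addrK scalerA mulVf ?gt_eqF // scale1r.
rewrite -(IZ _ lAB) (le_trans (I_abs (igZ _ lAB))) //.
pose lr : R := lam * rho ^- 2.
have lr0 : 0 < lr by rewrite mulr_gt0 // invr_gt0 exprn_gt0.
have iR : ig (fun y => rho ^- 4 * (dil x0 rho^-1 phi y ^+ 2 / (4 * lr))).
 have := igZ (rho ^- 4 / (4 * lr)) ld.2; rewrite (_ : (fun y => _ * _) = fun y => rho ^- 4 * (dil x0 rho^-1 phi y ^+ 2 / (4 * lr))) //.
 have gen (A B1 C : R) : A / B1 * C = A * (C / B1) by lra.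
 by apply/funext => y; exact: gen.
have iL := igZ (lam * b ^+ 6) iJ.
apply: (@le_trans _ _ (I (fun y => lam * b ^+ 6 * (kab ((a * rho) ^+ 2) (d ^+ 2) (sq y) * AB y ^+ 2) + rho ^- 4 * (dil x0 rho^-1 phi y ^+ 2 / (4 * lr))))).
 apply: I_le; [exact: ig_abs (igZ _ lAB)|exact: igD|move=> y].
 rewrite [lam * b ^+ 6 * _]mulrA; apply: young_pointwise => //; last first.
  apply: mulr_ge0; first smt.
  by apply: kab_ge0 => //; smt.
 move=> dn0.
 have /andP[q1' q2'] : a ^+ 2 <= nsq (rho^-1 *: (y - x0)) <= b ^+ 2.
  by apply: contraNT dn0 => /Hab E; rewrite /dil E.
 have rr : 0 < rho ^+ 2 by smt.
 have sE : sq y = rho ^+ 2 * nsq (rho^-1 *: (y - x0)).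
  by rewrite nsqZ exprVn mulVKf ?gt_eqF.
 have sl : (a * rho) ^+ 2 <= sq y by rewrite sE exprMn mulrC ler_wpM2l // ltW.
 have sh : sq y <= rho ^+ 2 * b ^+ 2 by rewrite sE ler_wpM2l // ltW.
 have sd2 : sq y <= d ^+ 2 / 2.
  apply: (le_trans sh).
  have h : rho * b <= d / 2 by have := ler_wpM2r (ltW b0) rb; rewrite (_ : d / (2 * b) * b = d / 2) //; field; rewrite gt_eqF.
  have h2 : (rho * b) ^+ 2 <= (d / 2) ^+ 2 by rewrite lerXn2r ?nnegrE // ?mulr_ge0 ?divr_ge0 // ltW.
  rewrite -exprMn (le_trans h2) // exprMn ler_wpM2l ?sqr_ge0 //.
  by rewrite expr2 ler_piMr ?invr_ge0 // invf_le1 // ler1n.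
 have s0 : 0 < sq y by apply: lt_le_trans sl; smt.
 rewrite kab_mid ?exprn_gt0 // exprVn.
 have c3 : sq y ^+ 3 <= rho ^+ 6 * b ^+ 6.
  rewrite (_ : rho ^+ 6 * b ^+ 6 = (rho ^+ 2 * b ^+ 2) ^+ 3); last by ring.
  by rewrite lerXn2r ?nnegrE ?mulr_ge0 ?sqr_ge0 // ltW.
 have s3 : 0 < sq y ^+ 3 by smt.
 rewrite ler_pdivlMr // /lr (_ : rho ^- 4 * (lam * rho ^- 2) = lam / rho ^+ 6); last by field; rewrite gt_eqF.
 rewrite -mulrA ler_wpM2l ?(ltW lam0) // ler_pdivrMl ?exprn_gt0 //.
rewrite (ID iL iR) (IZ _ iJ).
have -> : I (fun y => rho ^- 4 * (dil x0 rho^-1 phi y ^+ 2 / (4 * lr))) = n2 phi / (4 * lam).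
 rewrite (_ : (fun y => _ * _) = fun y => rho ^- 4 / (4 * lr) * dil x0 rho^-1 phi y ^+ 2); last first.
  by apply/funext => y; lra.
 rewrite (IZ _ ld.2) -/(n2 (dil x0 rho^-1 phi)) n2d /lr.
 by move: (n2 phi) => N; field; lra.
rewrite [leRHS](splitr e) lerD //.
have c0 : 0 <= lam * b ^+ 6 := mulr_ge0 (ltW lam0) (ltW b6).
rewrite (le_trans (ler_wpM2l c0 HJ)) // /e1.
by rewrite le_eqVlt; apply/orP; left; apply/eqP; field; rewrite !gt_eqF.
Qed.

(** With both operators moved to the test function, this is the equation T T v = 0 for blow-ups, in
    weak form away from 0. *)
Lemma blowup_weak phi (e : R) : sm2 phi -> annular phi -> 0 < e ->
 exists2 b : R, 0 < b & forall rho : R, 0 < rho <= b ->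
 `|I (fun y => (rho ^- 2 * V (rho *: y + x0)) * TS 0 (TS 0 phi) y)| <= e.
move=> sp ap e0; have [b b0 Hb] := annular_decay sp ap e0.
exists b => // rho rr; have := Hb rho rr; have /andP[rho0 _] := rr.
have bp := annular_bsupp ap.
have rho1 : 0 < rho^-1 by smt.
rewrite (weak_AB (sm2_dil x0 rho^-1 sp) (bsupp_dil x0 rho1 bp)).
rewrite (TS_dil x0 rho^-1 sp) (TS_dil x0 rho^-1 (sm2_TS 0 sp)).
have s2 := sm2_TS 0 (sm2_TS 0 sp); have b2 := bsupp_TS 0 (sm2_TS 0 sp) (bsupp_TS 0 sp bp).
have i1 : ig (fun x => V x * dil x0 rho^-1 (TS 0 (TS 0 phi)) x).
 have cd := smooth_cont (sm2_dil x0 rho^-1 s2); have bd := bsupp_dil x0 rho1 b2.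
 have := ig_mul_continuous cd bd iV; rewrite (_ : (fun x => _ * _) = fun x => V x * dil x0 rho^-1 (TS 0 (TS 0 phi)) x) //.
 by apply/funext => x; lra.
have [i2 ->] := I_affine x0 rho0 i1.
rewrite mulrA (_ : rho ^- 4 * rho ^+ 2 = rho ^- 2); last by field; lra.
rewrite -(IZ _ i2); apply: le_trans; rewrite le_eqVlt; apply/orP; left; apply/eqP; congr (`|I _|).
apply/funext => y; rewrite /dil addrK scalerA mulVf ?gt_eqF // scale1r mulrA //.
Qed.

End OnePhase.

(** * From T T v = 0 to homogeneity *)

Section Homogeneity.
Implicit Types (t lam : R).

Lemma der_quadratic_near (p : R -> R) (t0 K e : R) : 0 < e -> 0 <= K -> p t0 = 0 ->
 (forall t, `|t - t0| < e -> `|p t| <= K * `|t - t0| ^+ 2) -> is_derive t0 1 p 0.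
move=> e0 K0 p0 H.
have L : (fun h : R => h^-1 *: ((p \o shift t0) (h *: 1) - p t0)) @ 0^' --> (0 : R).
 apply/cvgr0Pnorm_le => d d0; near=> h.
 have h0 : h != 0 by near: h; exact: nbhs_dnbhs_neq.
 rewrite /= p0 subr0 [h *: 1]mulr1 normrZ normfV ler_pdivrMl ?normr_gt0 //.
 have hE : `|h + t0 - t0| = `|h| by rewrite addrK.
 have he : `|h + t0 - t0| < e by rewrite hE; near: h; exact: dnbhs0_lt.
 rewrite (le_trans (H _ he)) // hE expr2 mulrA mulrC ler_wpM2l // mulrC.
 apply: small_mul => //; near: h; apply: dnbhs0_le; by rewrite divr_gt0 // ltr_pwDr.
by apply: DeriveDef; [apply/cvg_ex; exists 0; exact: L|exact: cvg_lim].
Unshelve. all: by end_near. Qed.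

Lemma affine_bounded (b c J : R) : (forall s, `|b - c * s| <= J) -> c = 0.
move=> H; apply/eqP; apply: contraT => c0; have := H ((2 * J + 1) / c); have := H 0.
rewrite mulr0 subr0 mulrC divfK // !ler_norml; lra.
Qed.

Lemma annulus_closed (a b : R) : closed [set x : pl | a <= nsq x <= b].
rewrite (_ : [set x | _] = (@nsq) @^-1` `[a, b]%classic).
 by apply: closed_comp; [move=> x _; exact: cont_nsq|exact: interval_closed].
smt.
Qed.

Lemma annular_TS phi : annular phi -> annular (TS 0 phi).
move=> [[a b] /= a0 [b0 H]]; exists (a, b) => //=; split=> // x nx.
have cK := @annulus_closed (a ^+ 2) (b ^+ 2).
have z s : partials s phi x = 0.
 by apply: (partials_out s cK) => [y /negP /H //|]; exact/negP.
have zD i : 'D_(e_ i) phi x = 0 := z [:: i].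
by rewrite /TS /Eu !zD (z [::] : phi x = 0) !mulr0 !addr0 oppr0.
Qed.

Lemma annular_dil lam phi : 0 < lam -> annular phi -> annular (dil 0 lam phi).
move=> l0 [[a b] /= a0 [b0 H]]; exists (lam^-1 * a, lam^-1 * b) => /=; first by smt.
split; first by smt.
move=> x nx; rewrite /dil; apply: H; apply: contra nx.
have l2 : 0 < lam ^+ 2 by smt.
by rewrite subr0 nsqZ !exprMn !exprVn ler_pdivrMl // ler_pdivlMl.
Qed.

Variable v : pl -> R.
Variable C : R.
Hypotheses (C0 : 0 <= C) (vC : forall x, `|v x| <= C * nsq x) (cv : continuous v).
Hypothesis weak : forall phi, sm2 phi -> annular phi -> I (fun y => v y * TS 0 (TS 0 phi) y) = 0.

Lemma dil_continuous lam f : continuous f -> continuous (dil 0 lam f).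
move=> cf x; apply: (@continuous_comp _ _ _ (fun x : pl => lam *: (x - 0)) f); last exact: cf.
by apply: cvgZ; [exact: cvg_cst|apply: cvgB; [exact: cvg_id|exact: cvg_cst]].
Qed.

Definition Pv phi lam : R := I (fun x => v x * dil 0 lam phi x).

Lemma Pv_ig phi lam : continuous phi -> bsupp phi -> 0 < lam -> ig (fun x => v x * dil 0 lam phi x).
move=> cp bp l0; apply: ig_continuous; last by apply: bsuppMr; smt.
by move=> x; apply: cvgM; [exact: cv|exact: dil_continuous].
Qed.

(** v is merely continuous, so the dilation parameter is differentiated in the test function,
    through its Taylor expansion. *)
Lemma Pv_derive phi lam : sm2 phi -> bsupp phi -> 0 < lam ->
 is_derive lam 1 (Pv phi) (lam^-1 * Pv (Eu 0 phi) lam).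
move=> sp bp l0; have [K K0 HK] := taylor1 sp bp; have [N HN] := bp.
have cp := smooth_cont sp.
have l2 : 0 < lam / 2 by smt.
pose N1 : R := `|N| / (lam / 2).
have N10 : 0 <= N1 by rewrite divr_ge0 // ltW.
pose M : R := 4 * (N1 ^+ 2 + 1).
have M0 : 0 < M by rewrite mulr_gt0 // ltr_pwDr // sqr_ge0.
(* Dominates the Taylor remainder for all parameters above [lam / 2]: the cutoff is 1 wherever one
   of the dilated test functions may be nonzero. *)
pose E x := `|v x| * nsq x * cut (M^-1 * nsq x).
have iE : ig E.
 apply: ig_continuous.
  move=> x; apply: cvgM.
   by apply: cvgM; [apply: cvg_norm; exact: cv|exact: cont_nsq].
  apply: (smooth_cont (e := e_) (f := fun x => cut (M^-1 * nsq x))).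
  by apply: (smooth_comp (smoothR_cutZ M^-1)); smt.
 apply: bsuppMr; apply: (bsupp_nsq (h := fun t => cut (M^-1 * t)) (N := M)) => t tM.
 by apply: cut0; rewrite mulrC ler_pdivlMr // mul1r ltW.
have sE := sm2_Eu 0 sp; have bE := bsupp_Eu 0 sp bp.
have i0 := Pv_ig cp bp l0; have i1 := Pv_ig (smooth_cont sE) bE l0.
pose d := lam^-1 * Pv (Eu 0 phi) lam.
pose rem (m : R) := Pv phi m - (Pv phi lam + d * (m - lam)).
have R0 : is_derive lam 1 rem 0.
 have KE : 0 <= K * I E.
  by apply: mulr_ge0 => //; apply: I_ge0 => x; rewrite mulr_ge0 ?cut_ge0 // mulr_ge0 // nsq_ge0.
 have rem0 : rem lam = 0 by rewrite /rem subrr mulr0 addr0 subrr.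
 apply: (der_quadratic_near l2 KE rem0) => m ml.
 have m2 : lam / 2 < m.
  by move: ml; rewrite ltr_norml => /andP[h _]; lra.
 have m0 : 0 < m := lt_trans l2 m2.
 have im := Pv_ig cp bp m0.
 have -> : rem m = I (fun x => v x * (dil 0 m phi x - dil 0 lam phi x - lam^-1 * dil 0 lam (Eu 0 phi) x * (m - lam))).
  rewrite /rem /d /Pv; have i3 := igZ (lam^-1 * (m - lam)) i1.
  transitivity (I (fun x => v x * dil 0 m phi x) - (I (fun x => v x * dil 0 lam phi x) + I (fun x => lam^-1 * (m - lam) * (v x * dil 0 lam (Eu 0 phi) x)))).
   by rewrite (IZ _ i1) mulrAC.
  rewrite -(ID i0 i3) -(IB im (igD i0 i3)); congr I; apply/funext => x.
  lra.
 have ir : ig (fun x => v x * (dil 0 m phi x - dil 0 lam phi x - lam^-1 * dil 0 lam (Eu 0 phi) x * (m - lam))).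
  have i3 := igB im (igD i0 (igZ (lam^-1 * (m - lam)) i1)).
  move: i3; rewrite (_ : (fun x => _ - _) = fun x => v x * (dil 0 m phi x - dil 0 lam phi x - lam^-1 * dil 0 lam (Eu 0 phi) x * (m - lam))) //.
  by apply/funext => x; lra.
 rewrite (le_trans (I_abs ir)) // mulrAC -(IZ _ iE).
 apply: I_le; [exact: ig_abs|exact: igZ|move=> x].
 rewrite normrM /E.
 have dE : dil 0 lam (Eu 0 phi) x = lam * (x.1 * 'D_(e_ o_0) phi (lam *: x) + x.2 * 'D_(e_ o_1) phi (lam *: x)).
  rewrite /dil /Eu /q1 /q2 !subr0 /=.
  have gen (p q B0 B1 : R) : lam * p * B0 + lam * q * B1 = lam * (p * B0 + q * B1) by ring.
  exact: gen.
 have [xN|xN] := leP `|x| N1; last first.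
  have big (m' : R) : lam / 2 < m' -> N < `|m' *: x|.
   move=> m'2; have m'0 : 0 < m' := lt_trans l2 m'2.
   rewrite normrZ gtr0_norm //; rewrite /N1 ltr_pdivrMr // in xN.
   rewrite (le_lt_trans (ler_norm N)) // (lt_le_trans xN) // mulrC ler_wpM2r // ltW //.
  have ll : lam / 2 < lam by rewrite ltr_pdivrMr // mulr_natr mulr2n ltrDl.
  have z1 : dil 0 m phi x = 0 by rewrite /dil subr0; smt.
  have z2 : dil 0 lam phi x = 0 by rewrite /dil subr0; smt.
  have z3 i : 'D_(e_ i) phi (lam *: x) = 0 by apply: (derive_bsupp _ HN); exact: big.
  rewrite dE z1 z2 !z3 !mulr0 addr0 !mulr0 mul0r subrr subr0 normr0 mulr0.
  apply: mulr_ge0; first by apply: mulr_ge0 => //; smt.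
  by apply: mulr_ge0; [apply: mulr_ge0 => //; exact: nsq_ge0|exact: cut_ge0].
 have cc : cut (M^-1 * nsq x) = 1.
  apply: cut1; rewrite mulrC ler_pdivrMr // (le_trans (nsq_le_norm x)) //.
  have : `|x| ^+ 2 <= N1 ^+ 2 by rewrite lerXn2r ?nnegrE.
  by rewrite /M; move: (`|x| ^+ 2) (N1 ^+ 2) => *; lra.
 rewrite cc mulr1 mulrCA ler_wpM2l //.
 have := HK (lam *: x) (m *: x).
 have -> : phi (m *: x) - phi (lam *: x) - ('D_(e_ o_0) phi (lam *: x) * ((m *: x).1 - (lam *: x).1) +
   'D_(e_ o_1) phi (lam *: x) * ((m *: x).2 - (lam *: x).2)) =
   dil 0 m phi x - dil 0 lam phi x - lam^-1 * dil 0 lam (Eu 0 phi) x * (m - lam).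
  rewrite dE /dil !subr0 mulKf ?gt_eqF //; congr (_ - _); rewrite /=.
  have gen (p q B0 B1 : R) : B0 * (m * p - lam * p) + B1 * (m * q - lam * q) = (p * B0 + q * B1) * (m - lam) by ring.
  exact: gen.
 move/le_trans; apply; rewrite -scalerBl normrZ exprMn -[leRHS]mulrA ler_wpM2l // ler_wpM2l ?sqr_ge0 //.
 exact: norm_le_nsq.
have lin : is_derive lam 1 (fun m : R => Pv phi lam + d * (m - lam)) d.
 have lin1 := der_scale d (der_add (der_id lam) (der_opp (der_cst lam lam))).
 by have := der_add (der_cst (Pv phi lam) lam) lin1; rewrite add0r subr0 mulr1.
have := der_add R0 lin; rewrite add0r.
by rewrite (_ : (fun m => rem m + _) = Pv phi) //; apply/funext => m; rewrite /rem subrK.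
Qed.

(** The pairing of phi with the rescaling [e^(2 tau) v(e^(- tau) y)], which a 2-homogeneous v leaves
    constant; the exponent 4 includes the Jacobian of the dilation. *)
Definition Gv phi (tau : R) : R := expR tau ^+ 4 * Pv phi (expR tau).

Lemma Gv_derive phi (tau : R) : sm2 phi -> bsupp phi -> is_derive tau 1 (Gv phi) (- Gv (TS 0 phi) tau).
move=> sp bp; have l0 : 0 < expR tau by exact: expR_gt0.
have D1 := der_comp (is_derive_expR tau) (Pv_derive sp bp l0).
have De := is_derive_expR tau.
have D2 := der_mul (der_mul De De) (der_mul De De).
have := der_mul D2 D1.
have ll : expR tau != 0 by lra.
have EP : Pv (TS 0 phi) (expR tau) = - (Pv (Eu 0 phi) (expR tau) + 4 * Pv phi (expR tau)).
 have i1 := Pv_ig (smooth_cont (sm2_Eu 0 sp)) (bsupp_Eu 0 sp bp) l0.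
 have i2 := Pv_ig (smooth_cont sp) bp l0.
 rewrite /Pv -(IZ _ i2) -(ID i1 (igZ 4 i2)) -(IN (igD i1 (igZ 4 i2))); congr I; apply/funext => x.
 by rewrite /TS /dil; lra.
rewrite (_ : (fun y : R => _ * Pv phi (expR y)) = Gv phi); last first.
 by apply/funext => y; rewrite /Gv !exprS expr0 mulr1 !mulrA.
set A := (X in is_derive _ _ _ X); rewrite (_ : A = - Gv (TS 0 phi) tau) //.
rewrite /A /Gv EP; move: (Pv (Eu 0 phi) _) (Pv phi _) ll; move: (expR tau) => l p q ll; field; exact: ll.
Qed.

Lemma Gv_bounded phi tau : continuous phi -> bsupp phi -> `|Gv phi tau| <= C * I (fun x => nsq x * `|phi x|).
move=> cp bp; have l0 : 0 < expR tau by exact: expR_gt0.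
rewrite /Gv; move: (expR tau) l0 => l l0; have i1 := Pv_ig cp bp l0.
have cf : continuous (fun x : pl => nsq x * `|phi x|).
 by move=> x; apply: cvgM; [exact: cont_nsq|apply: cvg_norm; exact: cp].
have bf : bsupp (fun x : pl => nsq x * `|phi x|) by apply: bsuppW bp _ => x ->; rewrite normr0 mulr0.
have iF := ig_continuous cf bf; have iFl := ig_scale l0 iF.
have l4 : 0 <= l ^+ 4 by smt.
have ll : l != 0 by lra.
rewrite normrM ger0_norm // (le_trans (ler_wpM2l l4 (I_abs i1))) //.
have -> : C * I (fun x => nsq x * `|phi x|) = l ^+ 4 * (C * l ^- 2 * I (fun x => nsq (l *: x) * `|phi (l *: x)|)).
 by rewrite (I_scale l0 iF); move: (I _) => J; field.
rewrite ler_wpM2l // -(IZ _ iFl); apply: I_le; [exact: ig_abs|exact: igZ|move=> x].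
rewrite normrM /dil subr0 nsqZ mulrA ler_wpM2r // (le_trans (vC x)) //.
by rewrite -mulrA mulKf // expf_eq0.
Qed.

(** The second derivative in tau vanishes by the weak equation, and a bounded affine function is
    constant. Boundedness is the step that excludes solutions such as [|x|^2 ln |x|]. *)
Lemma Gv_const phi tau : sm2 phi -> annular phi -> Gv phi tau = Gv phi 0.
move=> sp ap; have bp := annular_bsupp ap.
have s1 := sm2_TS 0 sp; have a1 := annular_TS ap; have b1 := annular_bsupp a1.
have Z (s : R) : Gv (TS 0 (TS 0 phi)) s = 0.
 rewrite /Gv; have l0 : 0 < expR s by exact: expR_gt0.
 rewrite /Pv -(TS_dil 0 (expR s) s1) -(TS_dil 0 (expR s) sp) weak ?mulr0 //; first smt.
 exact: annular_dil.
have C1 (s : R) : Gv (TS 0 phi) s = Gv (TS 0 phi) 0.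
 have D (s' : R) : is_derive s' 1 (Gv (TS 0 phi)) 0 by have := Gv_derive s' s1 b1; rewrite Z oppr0.
 have := @mvt_bound _ (fun=> 0) 0 s 0 D; rewrite mul0r => H.
 by apply/eqP; rewrite -subr_eq0 -normr_le0; apply: H => x; rewrite normr0.
set c := Gv (TS 0 phi) 0 in C1.
have G1 (s : R) : Gv phi s = Gv phi 0 - c * s.
 have D (s' : R) : is_derive s' 1 (fun s => Gv phi s + c * s) 0.
  have := der_add (Gv_derive s' sp bp) (der_scale c (der_id s')).
  by rewrite C1 mulr1 addNr.
 have := @mvt_bound _ (fun=> 0) 0 s 0 D; rewrite mul0r mulr0 addr0 => H.
 apply/eqP; rewrite eq_sym subr_eq eq_sym -subr_eq0 -normr_le0; apply: H => x; by rewrite normr0.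
have c0 : c = 0.
 apply: (@affine_bounded (Gv phi 0) c (C * I (fun x => nsq x * `|phi x|))) => s.
 by rewrite -G1; exact: Gv_bounded (smooth_cont sp) bp.
by rewrite G1 c0 mul0r subr0.
Qed.

Lemma homogeneous_weak phi t : sm2 phi -> annular phi -> 0 < t ->
 I (fun x => (v (t *: x) - t ^+ 2 * v x) * phi x) = 0.
move=> sp ap t0; have bp := annular_bsupp ap; have cp := smooth_cont sp.
have tV : 0 < t^-1 by smt.
have := Gv_const (ln t^-1) sp ap; rewrite /Gv lnK ?posrE // expR0 expr1n mul1r.
have i1 := Pv_ig cp bp tV; have i0 := Pv_ig cp bp ltr01.
have E0 : Pv phi 1 = I (fun x => v x * phi x).
 by congr I; apply/funext => x; rewrite /dil subr0 scale1r.
have e0 : (fun x => v x * dil 0 1 phi x) = fun x => v x * phi x.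
 by apply/funext => x; rewrite /dil subr0 scale1r.
rewrite e0 in i0.
have it := ig_scale t0 i1; have := I_scale t0 i1.
have et : (fun x => v (t *: x) * dil 0 t^-1 phi (t *: x)) = fun x => v (t *: x) * phi x.
 by apply/funext => x; rewrite /dil subr0 scalerA mulVf ?gt_eqF // scale1r.
rewrite et in it *; rewrite E0 -/(Pv phi t^-1) => S H.
have -> : (fun x => (v (t *: x) - t ^+ 2 * v x) * phi x) = fun x => v (t *: x) * phi x - t ^+ 2 * (v x * phi x).
 by apply/funext => x; rewrite mulrBl mulrA.
rewrite (IB it (igZ _ i0)) (IZ _ i0) S -H exprVn.
by move: (Pv phi _) => P; field; rewrite gt_eqF.
Qed.

(** A failure at x would be detected by a bump centred at x of radius at most [|x| / 2], which stays
    away from the origin. *)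
Lemma weak_homogeneous t x : 0 < t -> v (t *: x) = t ^+ 2 * v x.
move=> t0; have v0 : v 0 = 0.
 by apply/eqP; rewrite -normr_le0 (le_trans (vC 0)) // nsq0 mulr0.
have [->|xn0] := eqVneq x 0; first by rewrite scaler0 v0 mulr0.
pose w y := v (t *: y) - t ^+ 2 * v y.
suff wx : w x = 0 by apply/eqP; rewrite -subr_eq0; apply/eqP.
apply: contrapT => /eqP wx.
have cw : continuous w.
 move=> y; apply: cvgB; last by apply: cvgM; [exact: cvg_cst|exact: cv].
 apply: (@continuous_comp _ _ _ (fun y : pl => t *: y) v); last exact: cv.
 by apply: cvgZ; [exact: cvg_cst|exact: cvg_id].
have wx2 : 0 < w x * w x by rewrite -expr2 exprn_even_gt0.
have cW : continuous (fun y => w x * w y) by move=> y; apply: cvgM; [exact: cvg_cst|exact: cw].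
have /nbhs_ballP[e /= e0 He] : nbhs x [set y | 0 < w x * w y] by exact: (cvgr_gt _ (cW x) _ wx2).
have xn : 0 < `|x| by rewrite normr_gt0.
pose d : R := Num.min e (`|x| / 2).
have d0 : 0 < d by rewrite lt_min e0 divr_gt0.
have d2 : 0 < d ^+ 2 by smt.
pose phi y := cut ((d ^+ 2)^-1 * nsq (y - x)).
have sp : sm2 phi by exact: (sm2_radial x (smoothR_cutZ (d ^+ 2)^-1)).
have pn y : phi y != 0 -> `|y - x| < d.
 move=> py; apply: norm_lt_nsq; first smt.
 rewrite ltNge; apply: contra py => h; rewrite /phi cut0 // mulrC ler_pdivlMr // mul1r //.
have ap : annular phi.
 (* The outer radius pays for the passage from the sup norm to [nsq]:
    [2 * (2 |x|)^2 <= (3 |x|)^2]. *)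
 exists (`|x| / 2, 3 * `|x|) => /=; first by smt.
 split; first by smt.
 move=> y; apply: contraNeq => /pn; rewrite lt_min => /andP[_ yx].
 have n1 := norm_le_nsq y; have n2 := nsq_le_norm y.
 have t1 : `|x| <= `|y - x| + `|y| by rewrite distrC (le_trans _ (ler_normD _ _)) // subrK.
 have t2 : `|y| <= `|y - x| + `|x| by rewrite (le_trans _ (ler_normD _ _)) // subrK.
 have x1 : `|x| / 2 <= `|y| by move: (`|x|) (`|y|) (`|y - x|) yx t1 => *; lra.
 have x2 : `|y| <= 2 * `|x| by move: (`|x|) (`|y|) (`|y - x|) yx t2 xn => *; lra.
 rewrite (le_trans _ n1) /=; last by rewrite lerXn2r ?nnegrE // divr_ge0.
 rewrite (le_trans n2) //.
 have : `|y| ^+ 2 <= (2 * `|x|) ^+ 2 by rewrite lerXn2r ?nnegrE // mulr_ge0.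
 lra.
have bp := annular_bsupp ap; have cp := smooth_cont sp.
have c1 : continuous (fun y => w x * w y * phi y) by move=> y; apply: cvgM; [exact: cW|exact: cp].
have := @I_gt0 (fun y => w x * w y * phi y) x c1 (bsuppMr _ bp) _ _.
have px : phi x = 1 by rewrite /phi subrr nsq0 mulr0 cut1.
rewrite px mulr1 => /(_ _ wx2) H.
have : 0 < I (fun y => w x * w y * phi y).
 apply: H => y; have [->|py] := eqVneq (phi y) 0; first by lra.
 rewrite mulr_ge0 ?cut_ge0 // ltW //; apply: He; rewrite ball_planeE distrC.
 by have := pn y py; rewrite lt_min => /andP[].
rewrite (_ : (fun y => _) = fun y => w x * (w y * phi y)); last by apply/funext => y; lra.
rewrite IZ; last by apply: ig_continuous; [move=> y; apply: cvgM; [exact: cw|exact: cp]|exact: bsuppMr].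
by rewrite (homogeneous_weak sp ap t0) mulr0 ltxx.
Qed.

End Homogeneity.

#[local] Hint Resolve annular_TS annular_dil dil_continuous Pv_ig : plane.

End Domain.

Implicit Types (x y z : pl) (f g phi psi : pl -> R).

(** * Blow-ups of minimizers *)

Section TwoPhase.

Lemma minimizer_blowup (Omega : set pl) (u0 u : pl -> R) (x0 : pl) (v : pl -> R) :
 open Omega -> bounded_set Omega -> Omega x0 -> (forall x, Omega x -> differentiable u x) ->
 u x0 = 0 -> grad u x0 = 0 -> minimizer Omega u0 u -> blowup_limit u x0 v -> homogeneous2 v.
move=> oO bO Ox du ux gx mu /blowup_uniform[r_ [r_0 r_c uni]].
have [a a0 Ha] := disc_in_open oO Ox.
have a80 : 0 < a / 8 by smt.
have DO : [set x | nsq (x - x0) <= 8 * (a / 8)] `<=` Omega.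
 by rewrite (_ : 8 * (a / 8) = a) //; field.
have [[[lu _] _] _] := mu.
have iU := l2_ig ((L2P oO u).1 lu) (bsupp_rs bO u).
have rsE x : Omega x -> rs Omega u x = u x by exact: rs_in.
have cU x : Omega x -> {for x, continuous (rs Omega u)}.
 move=> Oz; have := differentiable_continuous (du x Oz); rewrite /prop_for /continuous_at (rsE x Oz).
 apply: cvg_trans; apply: near_eq_cvg; have : nbhs x Omega by exact: oO.
 by apply: filterS => y /rsE.
have U0 : rs Omega u x0 = 0 by rewrite rsE.
have inO (rho : R) y : nsq y <= 1 -> rho ^+ 2 <= a -> Omega (x0 + rho *: y).
 move=> y1 ra; apply: Ha => /=; rewrite addrC addKr nsqZ.
 by rewrite (le_trans _ ra) // ler_piMr ?sqr_ge0.
have nr (d : R) : 0 < d -> \forall k \near \oo, r_ k < d.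
 move=> d0; have /cvgr0Pnorm_lt /(_ _ d0) := r_c; apply: filterS => k.
 by rewrite gtr0_norm.
have nra : \forall k \near \oo, r_ k ^+ 2 <= a.
 have := nr (Num.min 1 a); rewrite lt_min ltr01 a0 => /(_ isT); apply: filterS => k.
 rewrite lt_min => /andP[k1 ka]; rewrite (le_trans _ (ltW ka)) // expr2 ler_piMl ?ltW //.
have n1 y : nsq y <= 1 -> `|y| <= 1.
 move=> y1; have := le_trans (norm_le_nsq y) y1.
 by rewrite expr_le1.
(* Uniform convergence on the unit disc compares every late rescaling with the one at a fixed index
   K, which is bounded because u is; the 2 is the sum of the two distances to v. *)
have HC : exists C : R, forall e : R, 0 < e -> exists2 rho : R, 0 < rho < e &
  forall y : pl, nsq y <= 1 -> `|rho ^- 2 * rs Omega u (rho *: y + x0)| <= C.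
 have [M M0 HM] := U_bounded (a := a / 8) cU DO.
 have [K [HK1 HK2]] := filter_ex (filterI (uni 1 1 ltr01) nra).
 exists ((r_ K) ^- 2 * M + 2) => e e0.
 have [k [[Hk1 Hk2] Hk3]] := filter_ex (filterI (filterI (uni 1 1 ltr01) nra) (nr e e0)).
 exists (r_ k); first by rewrite r_0.
 move=> y y1; have yn := n1 y y1.
 have := Hk1 y yn; have := HK1 y yn.
 have EK : u (x0 + r_ K *: y) = rs Omega u (x0 + r_ K *: y) by rewrite rsE //; exact: inO.
 rewrite [_ + x0]addrC rsE; last smt.
 have BK : `|(r_ K) ^- 2 * u (x0 + r_ K *: y)| <= (r_ K) ^- 2 * M.
  have rK : 0 <= (r_ K) ^- 2 by smt.
  rewrite normrM (ger0_norm rK) ler_wpM2l // EK; apply: HM.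
  rewrite addrC addKr nsqZ (_ : 8 * (a / 8) = a); last by field.
  by rewrite (le_trans _ HK2) // ler_piMr ?sqr_ge0.
 move: (v y) ((r_ k) ^- 2 * _) ((r_ K) ^- 2 * u _) ((r_ K) ^- 2 * M) BK => p q s t.
 by rewrite !ltr_norml !ler_norml; lra.
have gU (x : pl) (e : R) : 0 < e -> exists2 r : R, 0 < r & forall rho : R, 0 < rho < r ->
  `|rs Omega u (x0 + rho *: x) - rs Omega u (x0 - rho *: x)| <= e * rho.
 move=> e0; have e2 : 0 < e / 2 by smt.
 have [d d0 Hd] := small_increment (derive_all_zero (du x0 Ox) gx x) ux e2.
 have nx : 0 < nsq x + 1 by rewrite ltr_pwDr // nsq_ge0.
 pose m : R := Num.min d (Num.min 1 (a / (nsq x + 1))).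
 have m0 : 0 < m by rewrite !lt_min d0 ltr01 divr_gt0.
 exists m => // rho /andP[rho0]; rewrite !lt_min => /andP[rd /andP[r1 ra]].
 have rn : `|rho| < d by rewrite gtr0_norm.
 have rn' : `|- rho| < d by rewrite normrN.
 have inO2 (s : R) : s ^+ 2 = rho ^+ 2 -> Omega (x0 + s *: x).
  move=> s2; apply: Ha => /=; rewrite addrC addKr nsqZ s2.
  have h : rho * (nsq x + 1) <= a by rewrite -ler_pdivlMr // ltW.
  apply: (le_trans _ h); rewrite expr2 -mulrA ler_wpM2l ?(ltW rho0) //.
  have nq := nsq_ge0 x.
  by rewrite (@le_trans _ _ (nsq x)) ?lerDl // ler_piMl // ltW.
 have := Hd rho rn; have := Hd (- rho) rn'.
 have A1 := rsE _ (inO2 rho erefl); have A2 := rsE _ (inO2 (- rho) (sqrrN rho)).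
 rewrite scaleNr in A2 *; rewrite A1 A2 (normrN rho) (gtr0_norm rho0).
 move: (u _) (u _) => p q; rewrite !ler_norml (_ : e / 2 * rho = (e * rho) / 2); last by ring.
 by move: (e * rho) => w; lra.
have TTp phi : test_function Omega phi -> (forall x, 0 <= phi x) -> 0 <= TT (rs Omega u) phi.
 by move=> tp p0; exact: (minimizer_superbiharmonic oO bO mu tp p0).
have vc x : (r_ k) ^- 2 * rs Omega u (x0 + r_ k *: x) @[k --> \oo] --> v x.
 have := @blowup_pointwise u x0 v r_ uni x; apply: cvg_trans; apply: near_eq_cvg.
 by have := near_scaled x oO Ox r_c; apply: filterS => k /rsE ->.
move=> t x t0.
exact: (superbiharmonic_blowup iU cU a80 DO TTp HC U0 gU r_0 r_c vc).
Qed.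

End TwoPhase.

(** * Blow-ups of one-phase minimizers *)

Section OnePhase.

Lemma partials_near_cst (f : pl -> R) (c : R) (O : set pl) s : open O ->
 (forall y, O y -> f y = c) -> s != [::] -> forall y, O y -> partials s f y = 0.
move=> oO H; case: s => // i s _.
have D (h : pl -> R) (c' : R) j : (forall y, O y -> h y = c') -> forall y, O y -> 'D_(e_ j) h y = 0.
 move=> Hh y Oy; rewrite (@near_eq_derive _ _ _ h (fun=> c')) ?derive_cst //.
 by have := oO y Oy; apply: filterS => z; exact: Hh.
elim: s i => [|j s IH] i y Oy; first exact: D H y Oy.
exact: (D _ 0 i (IH j)).
Qed.

Lemma leib1 (psi : pl -> R) F i j x : psi x = 1 -> (forall t, t != [::] -> partials t psi x = 0) ->
 leib psi F [:: i; j] x = F [:: i; j] x.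
move=> p1 z; have zi k : 'D_(e_ k) psi x = 0 := z [:: k] isT.
by rewrite /leib !zi (z [:: i; j]) // p1 !mul0r !add0r mul1r.
Qed.

Lemma enorm_le (x : pl) : enorm x <= 2 * `|x|.
have n0 : 0 <= 2 * `|x| by smt.
rewrite -(ler_pXn2r (n := 2)) ?nnegrE ?enorm_ge0 // sqr_enorm (le_trans (nsq_le_norm x)) //.
rewrite exprMn ler_wpM2r ?sqr_ge0 // -natrX ler_nat //.
Qed.

Lemma norm_le_enorm (x : pl) : `|x| <= enorm x.
by rewrite -(ler_pXn2r (n := 2)) ?nnegrE ?enorm_ge0 // sqr_enorm norm_le_nsq. Qed.

Lemma one_phase_blowup (Omega : set pl) (u0 u : pl -> R) (x0 : pl) (v : pl -> R) :
 open Omega -> bounded_set Omega -> Omega x0 -> C11 Omega u ->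
 u x0 = 0 -> grad u x0 = 0 -> one_phase_minimizer Omega u0 u -> blowup_limit u x0 v -> homogeneous2 v.
move=> oO bO Ox [du [C HC]] ux gx mu /blowup_uniform[r_ [r_0 r_c uni]].
have [su _] : admissible Omega u0 u by have [] := mu.
have [a a0 Ha] := disc_in_open oO Ox.
(* Since [r <= 1], this gives [40 r^2 <= a]. The sup-ball of radius [3 r] satisfies [nsq <= 18 r^2]
   and so lies in the set [nsq < 20 r^2], on which the cutoff at [40 r^2] equals 1. *)
pose r : R := Num.min 1 (a / 40).
have r0 : 0 < r by rewrite lt_min ltr01 divr_gt0.
have r2 : 40 * r ^+ 2 <= a.
 have r1 : r <= 1 by rewrite ge_min lexx.
 have ra : r <= a / 40 by rewrite ge_min lexx orbT.
 have rr : r ^+ 2 <= r by rewrite expr2 ler_piMl // ltW.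
 lra.
have rp : 0 < 40 * r ^+ 2 by smt.
clearbody r.
pose kap (t : R) := cut ((40 * r ^+ 2)^-1 * t).
pose psi x := kap (nsq (x - x0)).
have tp : test_function Omega psi.
 apply: (test_radial (h := kap) (N := 40 * r ^+ 2)); first exact: smoothR_cutZ.
  by move=> t tN; rewrite /kap cut0 // mulrC ler_pdivlMr // mul1r ltW.
 by move=> x /= xN; apply: Ha; exact: le_trans xN r2.
pose O := [set x | nsq (x - x0) < 20 * r ^+ 2].
have oOO : open O.
 have cs : continuous (fun x => nsq (x - x0)) := smooth_cont (sm2_sq x0).
 rewrite (_ : O = (fun x => nsq (x - x0)) @^-1` [set t | t < 20 * r ^+ 2]) //.
 by apply: open_comp; smt.
have OO : O `<=` Omega.
 by move=> x /= xO; apply: Ha => /=; rewrite (le_trans (ltW xO)) // (le_trans _ r2) // ler_wpM2r ?sqr_ge0 // ler_nat.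
have psi1 x : O x -> psi x = 1.
 move=> /= xO; rewrite /psi /kap cut1 // mulrC ler_pdivrMr // (le_trans (ltW xO)) //.
 lra.
pose V x := psi x * rs Omega u x.
pose F := leib psi (gd Omega u).
have tV : test_lim Omega V (fun s => F (rev s)) := test_lim_mul oO bO su tp.
pose B := [set x | nsq (x - x0) <= r ^+ 2].
have BOO : B `<=` O.
 by move=> x /= xB; rewrite /O /= (le_lt_trans xB) // ltr_pMl ?exprn_gt0 // ltr1n.
have BO : B `<=` Omega by move=> x /BOO/OO.
have VO x : O x -> V x = u x by move=> xO; rewrite /V psi1 // mul1r rs_in //; exact: OO.
have VB x : B x -> V x = u x by smt.
have LB x : B x -> lap Omega u x = Lp F x.
 move=> /BOO xO; have z s : s != [::] -> partials s psi x = 0.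
  by move=> s0; apply: (partials_near_cst oOO psi1).
 rewrite lapE; have := leib1 (gd Omega u) _ _ (psi1 x xO) z => E1.
 by rewrite /Lp {1 2}/F !E1.
have nO y : `|y - x0| <= 3 * r -> O y.
 move=> yr; rewrite /O /= (le_lt_trans (nsq_le_norm _)) //.
 have h : `|y - x0| ^+ 2 <= (3 * r) ^+ 2 by rewrite lerXn2r ?nnegrE // mulr_ge0 // ltW.
 lra.
pose g i y := 'D_(e_ i) u y.
have dV i y : `|y - x0| <= 3 * r -> is_derive y (e_ i) V (g i y).
 move=> /nO Oy; have nV : \forall z \near y, u z = V z.
  by have := oOO y Oy; apply: filterS => z /VO.
 apply: DeriveDef; first by apply: near_eq_derivable nV _; apply: diff_derivable; exact: du (OO _ Oy).
 by rewrite /g (near_eq_derive _ nV).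
(* The factor 2 converts the Euclidean Lipschitz bound into one for the sup norm. *)
pose L : R := 2 * `|C|.
have L0 : 0 <= L by rewrite mulr_ge0.
have gL i y z : `|y - x0| <= 3 * r -> `|z - x0| <= 3 * r -> `|g i y - g i z| <= L * `|y - z|.
 move=> /nO/OO Oy /nO/OO Oz; have := HC y z Oy Oz; rewrite powRr1 ?enorm_ge0 // => H.
 have H2 : `|grad u y - grad u z| <= L * `|y - z|.
  rewrite (le_trans (norm_le_enorm _)) // (le_trans H) //.
  rewrite (le_trans (ler_wpM2r (enorm_ge0 _) (ler_norm C))) //.
  rewrite (le_trans (ler_wpM2l (normr_ge0 C) (enorm_le _))) //.
  by rewrite /L mulrA (mulrC `|C|).
 rewrite (le_trans _ H2) //; case: (ord2P i) => ->.
  exact: (norm1_le (grad u y - grad u z)).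
 exact: (norm2_le (grad u y - grad u z)).
have V0 : V x0 = 0.
 by rewrite VO //; apply: nO; rewrite subrr normr0 mulr_ge0 // ltW.
have g0 i : g i x0 = 0 by case: gx => g1 g2; case: (ord2P i) => ->.
have iV := V_ig bO tV.
have near_r N : 0 <= N -> \forall k \near \oo, r_ k * N <= r.
 move=> N0; have d0 : 0 < r / (N + 1) by smt.
 have /cvgr0Pnorm_le /(_ _ d0) := r_c; apply: filterS => k kr.
 by have := small_mul r0 N0 kr; rewrite gtr0_norm.
have scaled k y : `|x0 + r_ k *: y - x0| = r_ k * `|y|.
 by rewrite addrC addKr normrZ gtr0_norm.
have rr3 : r <= 3 * r by rewrite ler_peMl ?ler1n // ltW.
have nearV y : \forall k \near \oo, V (x0 + r_ k *: y) = u (x0 + r_ k *: y).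
 have := near_r _ (normr_ge0 y); apply: filterS => k kr; apply: VO; apply: nO.
 by rewrite scaled (le_trans kr).
have vc y : (r_ k) ^- 2 * V (x0 + r_ k *: y) @[k --> \oo] --> v y.
 have := @blowup_pointwise u x0 v r_ uni y; apply: cvg_trans; apply: near_eq_cvg.
 by have := nearV y; apply: filterS => k ->.
have qb k y : r_ k * `|y| <= r -> `|(r_ k) ^- 2 * V (x0 + r_ k *: y)| <= 2 * L * nsq y.
 move=> kr; have xr : `|x0 + r_ k *: y - x0| <= 3 * r by rewrite scaled (le_trans kr).
 have := W_le r0 L0 dV gL V0 g0 xr; rewrite scaled exprMn => H.
 have rk : 0 < r_ k ^+ 2 by smt.
 rewrite normrM ger0_norm; last by smt.
 rewrite ler_pdivrMl // (le_trans H) // mulrCA ler_wpM2l ?(ltW rk) // ler_wpM2l ?norm_le_nsq //.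
 smt.
(* The quadratic bound on V is invariant under the blow-up scaling and passes to the limit; so does
   the local Lipschitz bound that follows, which makes v continuous. *)
have vC y : `|v y| <= 2 * L * nsq y.
 apply: (cvgr_to_le (cvg_norm (vc y))).
 by have := near_r _ (normr_ge0 y); apply: filterS => k; exact: qb.
have vL N y z : `|y| <= N -> `|z| <= N -> `|v y - v z| <= 6 * L * N * `|y - z|.
 move=> yN zN; have N0 := le_trans (normr_ge0 _) yN.
 apply: (cvgr_to_le (cvg_norm (cvgB (vc y) (vc z)))).
 have := near_r N N0; apply: filterS => k kr.
 have rk : 0 < r_ k ^+ 2 by smt.
 have y1 : `|x0 + r_ k *: y - x0| <= r_ k * N by rewrite scaled ler_wpM2l // ltW.
 have z1 : `|x0 + r_ k *: z - x0| <= r_ k * N by rewrite scaled ler_wpM2l // ltW.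
 have := W_lip r0 L0 dV gL g0 y1 z1 kr.
 rewrite (_ : x0 + r_ k *: y - (x0 + r_ k *: z) = r_ k *: (y - z)); last first.
  ring.
 rewrite normrZ gtr0_norm // => H.
 rewrite -mulrBr normrM ger0_norm; last by smt.
 rewrite ler_pdivrMl // (le_trans H) // le_eqVlt; apply/orP; left; apply/eqP.
 ring.
have cv : continuous v.
 move=> y; apply/cvgrPdist_le => e e0; pose N : R := `|y| + 1.
 have N0 : 0 <= N by rewrite addr_ge0.
 have LN : 0 <= 6 * L * N by smt.
 have d0 : 0 < Num.min 1 (e / (6 * L * N + 1)) by rewrite lt_min ltr01 divr_gt0 // ltr_pwDr.
 apply: (near_plane d0) => z; rewrite lt_min => /andP[z1 z2].
 have yN : `|y| <= N by rewrite lerDl.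
 have zN : `|z| <= N.
  by rewrite (le_trans _ (lerD (lexx `|y|) (ltW z1))) // -lerBlDl (le_trans (lerB_dist _ _)) // distrC.
 rewrite (le_trans (vL N y z yN zN)) // mulrC -[`|y - z|]normr_id.
 by apply: small_mul => //; rewrite normr_id ltW.
have weak phi : sm2 phi -> annular phi -> I (fun y => v y * TS 0 (TS 0 phi) y) = 0.
 move=> sp ap; have bp := annular_bsupp ap.
 have s2 := sm2_TS 0 (sm2_TS 0 sp); have b2 := bsupp_TS 0 (sm2_TS 0 sp) (bsupp_TS 0 sp bp).
 move: (TS 0 (TS 0 phi)) s2 b2 (fun e e0 => blowup_weak oO bO mu tV BO VB LB r0 L0 dV gL V0 g0 (fun x h => h) sp ap (e := e) e0) => chi sc bc Hw.
 have [N HN] := bc; have cc := smooth_cont sc.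
 (* Discarding the first K indices places the rescaled support inside the ball of radius r for every
    index, as the domination must hold for all of them. *)
 have [K HK] : exists K, forall k, r_ (k + K)%N * `|N| <= r.
  by have [K _ HK] := near_r _ (normr_ge0 N); exists K => k; apply: HK; rewrite /= leq_addl.
 pose f k y := (r_ (k + K)%N) ^- 2 * V (r_ (k + K)%N *: y + x0) * chi y.
 have cG : continuous (fun y : pl => 2 * L * nsq y * `|chi y|).
  move=> y; apply: cvgM; last by apply: cvg_norm; exact: cc.
  by apply: cvgM; [exact: cvg_cst|exact: cont_nsq].
 have iG : ig (fun y : pl => 2 * L * nsq y * `|chi y|).
  by apply: ig_continuous cG _; apply: bsuppW bc _ => y ->; rewrite normr0 mulr0.
 have fi k : ig (f k).
  have i1 := igZ ((r_ (k + K)%N) ^- 2) (ig_scale (r_0 (k + K)%N) (ig_translate x0 iV)).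
  have := ig_mul_continuous cc bc i1; rewrite (_ : (fun y => _ * _) = f k) //.
  by apply/funext => y; rewrite /f mulrC.
 have fb k y : `|f k y| <= 2 * L * nsq y * `|chi y|.
  have [yN|/HN c0] := leP `|y| N; last by rewrite /f c0 !mulr0 normr0 mulr0.
  rewrite /f normrM ler_wpM2r // [_ + x0]addrC; apply: qb.
  exact: le_trans (ler_wpM2l (ltW (r_0 _)) (le_trans yN (ler_norm N))) (HK k).
 have fc y : f k y @[k --> \oo] --> v y * chi y.
  apply: cvgM; last exact: cvg_cst.
  have := vc y; rewrite -(cvg_shiftn K); apply: cvg_trans; apply: near_eq_cvg; near=> k.
  by rewrite addrC.
 have [_ Ic] := I_cvg_dominated (fun k => ig_measurable (fi k)) iG fb fc.
 apply/eqP; rewrite -normr_le0; apply/ler_addgt0Pl => e e0; rewrite addr0.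
 apply: (cvgr_to_le (cvg_norm Ic)).
 have [b b0 Hb] := Hw e e0.
 have /cvgr0Pnorm_le /(_ _ b0) [K' _ HK'] := r_c.
 exists K' => // k /= kK; apply: Hb; rewrite r_0 /=.
 by have := HK' (k + K)%N; rewrite gtr0_norm //; apply; rewrite /= (leq_trans kK) // leq_addr.
move=> t x t0; exact: (weak_homogeneous vC cv weak).
Unshelve. all: by end_near. Qed.

End OnePhase.

End Plane.

Theorem theorem1p13 (R : realType) (Omega : set (plane R))
    (u0 u : plane R -> R) (x0 : plane R) (r : R)
    (hOmega : smooth_bounded_domain Omega)
    (hu0 : sobolev Omega 2 u0)
    (hx0 : Omega x0)
    (hr : 0 < r)
    (hBr : closure (eball x0 r) `<=` Omega)
    (hreg : forall alpha : R, 0 < alpha -> alpha < 1 ->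
      C1alpha_loc Omega alpha u)
    (hfb : free_boundary Omega u x0)
    (hsing : grad u x0 = 0)
    (hu : (minimizer Omega u0 u /\
           exists delta : R, 0 < delta /\
             forall rho : R, 0 < rho -> rho <= r ->
               ~ rank2_flat Omega u delta rho x0) \/
          [/\ one_phase_minimizer Omega u0 u, C11 Omega u &
              (mu2 R).-negligible (free_boundary Omega u)]) :
  forall v : plane R -> R, blowup_limit u x0 v ->
    homogeneous2 v \/ (forall x : plane R, v x = 0).
Proof.
(* The zero function is homogeneous as well, so the first alternative covers both. *)
move=> v bv; left.
have [oO _ _ bO _] := hOmega.
have h2 : 2^-1 < 1 :> R by lra.
have [du _] : C1alpha_loc Omega (2^-1) u by apply: hreg => //; rewrite invr_gt0.
have ux := free_boundary_zero oO hx0 (differentiable_continuous (du x0 hx0)) hfb.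
case: hu => [[mu _]|[mu cu _]].
- exact: minimizer_blowup oO bO hx0 du ux hsing mu bv.
- exact: one_phase_blowup oO bO hx0 cu ux hsing mu bv.
Qed.
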